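(* Let $u$ be the solution of the delay subdiffusion problem and suppose that, with $u_{k\tau}$ denoting the restriction of $u$ to $t\in((k-1)\tau,k\tau]$ and $u_\tau=u_{1\tau}$, $$|\partial_t u_{k\tau}|\le C(1+t^{\alpha-1}),\ k=1,\dots,K;\qquad |\partial_t^2u_\tau|\le C(1+t^{\alpha-2});\qquad |\partial_t^2u_{k\tau}|\le C(1+(t-\tau)^{\alpha-1}),\ k=2,\dots,K.$$ Assume further that $u\in L^\infty(-\tau,K\tau;H^2(\Omega))$, $\partial_tu\in L^1(-\tau,K\tau;H^2(\Omega))$, and that $u_h^n$, $-2N\le n\le0$, is a suitable approximation of $\varphi(x,t_n)$ such that $\|u_h^n-\varphi(\cdot,t_n)\|\lesssim h^2$. Let $u_h^n\in X_h$, $1\le n\le 2KN$, be the numerical solution on the symmetric graded time mesh with $r>1$ of $$(D^\alpha u_h^n,v_h)+B(u_h^n,v_h)=(bJ^{1-\alpha}u_h^{n-2N},v_h)+(G^n,v_h)\quad\forall v_h\in X_h.$$ Then, for $1\le n\le2KN$, $$\|u^n-u_h^n\|\lesssim h^2+N^{-\min\{1,\alpha r\}}.$$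
   Context: Problem: $0<\alpha<1$, $\tau>0$, $K\in\mathbb N^+$, $p>0$, $a\le 0$, $b\ne 0$ constants, $\Omega=(0,L)$, $\Omega_T=(0,L)\times(0,K\tau]$, and $$\partial_t u(x,t)=\partial_t^{1-\alpha}\big(p\Delta u+au(x,t)\big)+bu(x,t-\tau)+f(x,t),\quad (x,t)\in\Omega_T,$$ with $u=\varphi$ on $\Omega\times[-\tau,0]$ and $u=0$ on $\partial\Omega$ for $t\in[-\tau,K\tau]$; $f$, $\varphi$ continuous. It is used in the transformed form ${}_0^C\mathrm D_t^\alpha u=p\Delta u+au+{}_0I_t^{1-\alpha}[bu(x,t-\tau)]+G$ with $G={}_0I_t^{1-\alpha}f$. Here $\omega_\beta(t)=t^{\beta-1}/\Gamma(\beta)$, ${}_0I_t^{\beta}v(t)=\int_0^t\omega_\beta(t-s)v(s)\,ds$, $\partial_t^{1-\alpha}v=\partial_t\,{}_0I_t^\alpha v$, ${}_0^C\mathrm D_t^\alpha u(x,t)=\int_0^t\omega_{1-\alpha}(t-s)\partial_su(x,s)\,ds$. The solution is understood to be continuous in time, with the time derivatives appearing in the bounds existing on each delay interval; the bounds are uniform in $x$. Symmetric graded mesh: for an integer $N\ge 2$, $t_{-2N}=-\tau$ and, for $i=0,1,\dots,K$, $$t_n=\begin{cases}\frac{\tau}{2}\left(\frac{n-2(i-1)N}{N}\right)^r+(i-1)\tau,& 2(i-1)N+1\le n<(2i-1)N,\\ -\frac{\tau}{2}\left(\frac{2iN-n}{N}\right)^r+i\tau,&(2i-1)N\le n\le 2iN.\end{cases}$$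 Put $\rho_n=t_n-t_{n-1}$, $u^n=u(\cdot,t_n)$, $\nabla_tv^n=v^n-v^{n-1}$, $G^n=G(\cdot,t_n)$, $$a^{(n)}_{n-k}=\frac{\omega_{2-\alpha}(t_n-t_{k-1})-\omega_{2-\alpha}(t_n-t_k)}{\rho_k},\qquad D^\alpha v^n=\sum_{k=1}^na^{(n)}_{n-k}\nabla_tv^k,\qquad J^{1-\alpha}v^{n-2N}=\sum_{k=1}^n\rho_k\,a^{(n)}_{n-k}v^{k-2N}.$$ $X_h\subset H_0^1(\Omega)$ is the continuous piecewise linear finite element space on a quasi-uniform mesh of $\Omega$ with maximal diameter $h$; $u_h^n\in X_h$ for $-2N\le n\le 0$ as well; $(u,v)=\int_\Omega uv\,dx$, $\|u\|=(u,u)^{1/2}$, $B(u,v)=p\left(\frac{du}{dx},\frac{dv}{dx}\right)-(au,v)$. $A\lesssim B$ means $A\le CB$ with a constant $C>0$ independent of $N$, $h$ and $n$. *)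

(* Defs.v *)
From HB Require Import structures.
From mathcomp Require Export all_boot all_order all_algebra.
From mathcomp Require Export all_classical all_reals all_analysis.
Export Order.TTheory GRing.Theory Num.Theory.
Export numFieldNormedType.Exports.

#[export] Set Implicit Arguments.
#[export] Unset Strict Implicit.
#[export] Unset Printing Implicit Defensive.

Global Open Scope classical_set_scope.
Global Open Scope ring_scope.

(* A function of space and time is curried, space first: [u x t]. The real-   *)
(* valued integral [\int[mu]_(x in D) f x] is total but meaningful only when  *)
(* [f] is integrable on [D].                                                  *)

(* -------------------------- Fractional calculus --------------------------- *)

Definition Gamma (R : realType) (b : R) : R :=
  \int[lebesgue_measure]_(s in `]0, +oo[) (s `^ (b - 1) * expR (- s)).

Definition omega (R : realType) (b t : R) : R := t `^ (b - 1) / Gamma b.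

Definition frac_int (R : realType) (b : R) (v : R -> R) (t : R) : R :=
  \int[lebesgue_measure]_(s in `]0, t[) (omega b (t - s) * v s).

Definition frac_integrable (R : realType) (b : R) (v : R -> R) (t : R) : Prop :=
  lebesgue_measure.-integrable `]0, t[
    (fun s : R => (omega b (t - s) * v s)%:E).

(* Derivative at [t] of the restriction of [g] to [A]; it is one-sided at an  *)
(* end point of [A].                                                          *)
Definition derivable_in (R : realType) (A : set R) (g : R -> R) (t : R) : Prop :=
  cvg ((fun s => (g s - g t) / (s - t)) @ within A t^').

Definition derive_in (R : realType) (A : set R) (g : R -> R) (t : R) : R :=
  lim ((fun s => (g s - g t) / (s - t)) @ within A t^').

(* The [k]-th delay interval, of which the right end point is a member: the   *)
(* time derivatives of u at k tau are those of its restriction to it, since   *)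
(* they may be discontinuous across the multiples of the delay.               *)
Definition delay_itv (R : realType) (tau : R) (k : nat) : set R :=
  `](k%:R - 1) * tau, k%:R * tau].

(* ------------------------- Function spaces on ]a, b[ ---------------------- *)

Definition L2dot (R : realType) (L : R) (v w : R -> R) : R :=
  \int[lebesgue_measure]_(x in `]0, L[) (v x * w x).

Definition L2norm (R : realType) (L : R) (v : R -> R) : R :=
  Num.sqrt (L2dot L v v).

Definition in_L2 (R : realType) (L : R) (v : R -> R) : Prop :=
  measurable_fun (`]0, L[ : set R) v /\
  lebesgue_measure.-integrable `]0, L[ (fun x : R => (v x ^+ 2)%:E).

(* Compactly supported in ]a, b[. Testing with C^1 functions gives the same   *)
(* weak derivatives as testing with C^oo ones.                                *)
Definition test_function (R : realType) (a b : R) (psi : R -> R) : Prop :=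
  [/\ forall x : R, derivable psi x 1,
      continuous (derive1 psi) &
      exists c d : R, [/\ a < c, c <= d, d < b &
        forall x : R, x \notin `[c, d] -> psi x = 0]].

Definition weak_deriv (R : realType) (a b : R) (v w : R -> R) : Prop :=
  forall psi : R -> R, test_function a b psi ->
    \int[lebesgue_measure]_(x in `]a, b[) (v x * derive1 psi x) =
    - \int[lebesgue_measure]_(x in `]a, b[) (w x * psi x).

(* [v] is in H^2(0, L) with weak derivatives [v1] and [v2].                   *)
Definition in_H2 (R : realType) (L : R) (v v1 v2 : R -> R) : Prop :=
  [/\ in_L2 L v, in_L2 L v1, in_L2 L v2,
      weak_deriv 0 L v v1 & weak_deriv 0 L v1 v2].

Definition H2norm (R : realType) (L : R) (v v1 v2 : R -> R) : R :=
  Num.sqrt (L2norm L v ^+ 2 + L2norm L v1 ^+ 2 + L2norm L v2 ^+ 2).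

(* [v] is in the Bochner space L^oo(c, d; H^2(0, L)). As H^2 is separable,    *)
(* strong measurability amounts to joint measurability of [v].                *)
Definition in_Linfty_H2 (R : realType) (L c d : R) (v : R -> R -> R) : Prop :=
  measurable_fun ((`]0, L[ : set R) `*` (`]c, d[ : set R))
    (fun z : R * R => v z.1 z.2) /\
  exists (v1 v2 : R -> R -> R) (M : R),
    {ae lebesgue_measure, forall t : R, t \in `]c, d[ ->
       in_H2 L (v^~ t) (v1^~ t) (v2^~ t) /\
       H2norm L (v^~ t) (v1^~ t) (v2^~ t) <= M}.

Definition in_L1_H2 (R : realType) (L c d : R) (v : R -> R -> R) : Prop :=
  measurable_fun ((`]0, L[ : set R) `*` (`]c, d[ : set R))
    (fun z : R * R => v z.1 z.2) /\
  exists v1 v2 : R -> R -> R,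
    {ae lebesgue_measure, forall t : R, t \in `]c, d[ ->
       in_H2 L (v^~ t) (v1^~ t) (v2^~ t)} /\
    lebesgue_measure.-integrable `]c, d[
      (fun t : R => (H2norm L (v^~ t) (v1^~ t) (v2^~ t))%:E).

(* The weak time derivative of [u] on ]c, d[ is in L^1(c, d; H^2(0, L)).      *)
Definition dt_in_L1_H2 (R : realType) (L c d : R) (u : R -> R -> R) : Prop :=
  exists g : R -> R -> R, in_L1_H2 L c d g /\
    {ae lebesgue_measure, forall x : R, x \in `]0, L[ ->
       weak_deriv c d (u x) (g x)}.

(* ---------------------------- Continuous problem -------------------------- *)

Definition elliptic (R : realType) (p a : R) (u : R -> R -> R) (x t : R) : R :=
  p * derive1n 2 (u^~ t) x + a * u x t.

(* Continuity in [x] up to the boundary is what gives the boundary values     *)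
(* their meaning.                                                             *)
Definition is_solution (R : realType) (alpha tau : R) (K : nat) (p a b L : R)
    (f phi u : R -> R -> R) : Prop :=
  [/\ forall x : R, x \in `[0, L] ->
        {within `[- tau, K%:R * tau], continuous (u x)},
      forall t : R, t \in `[- tau, K%:R * tau] ->
        {within `[0, L], continuous (u^~ t)},
      forall x t : R, x \in `]0, L[ -> t \in `[- tau, 0] -> u x t = phi x t,
      forall t : R, t \in `[- tau, K%:R * tau] -> u 0 t = 0 /\ u L t = 0 &
      forall (k : nat) (x t : R), (1 <= k <= K)%N ->
        x \in `]0, L[ -> t \in delay_itv tau k ->
        [/\ derivable (u^~ t) x 1 /\ derivable (derive1 (u^~ t)) x 1,
            frac_integrable alpha (elliptic p a u x) t,
            derivable_in (delay_itv tau k) (u x) t,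
            derivable_in (delay_itv tau k)
              (frac_int alpha (elliptic p a u x)) t &
            derive_in (delay_itv tau k) (u x) t =
              derive_in (delay_itv tau k)
                (frac_int alpha (elliptic p a u x)) t
              + b * u x (t - tau) + f x t]].

Definition dt_bounds (R : realType) (alpha tau : R) (K : nat) (L : R)
    (u : R -> R -> R) : Prop :=
  exists C : R, forall (k : nat) (x t : R), (1 <= k <= K)%N ->
    x \in `]0, L[ -> t \in delay_itv tau k ->
    let I := delay_itv tau k in
    [/\ derivable_in I (u x) t,
        derivable_in I (derive_in I (u x)) t,
        `|derive_in I (u x) t| <= C * (1 + t `^ (alpha - 1)) &
        `|derive_in I (derive_in I (u x)) t| <=
          C * (1 + if k == 1%N then t `^ (alpha - 2)
                   else (t - tau) `^ (alpha - 1))].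

(* ------------------------------ Discretization ---------------------------- *)

(* [n] lies in the [i]-th block 2(i-1)N+1 <= n <= 2iN for the [i] below.      *)
Definition graded_mesh (R : realType) (tau r : R) (N : nat) (n : int) : R :=
  let NZ : int := N%:Z in
  let i : int := ((n - 1) %/ (2 * NZ))%Z + 1 in
  if n < (2 * i - 1) * NZ
  then tau / 2 * ((n - 2 * (i - 1) * NZ)%:~R / N%:R) `^ r + (i - 1)%:~R * tau
  else - (tau / 2) * ((2 * i * NZ - n)%:~R / N%:R) `^ r + i%:~R * tau.

(* The coefficient written a^{(n)}_{n-k}.                                     *)
Definition L1coef (R : realType) (alpha : R) (t : int -> R) (n k : int) : R :=
  (omega (2 - alpha) (t n - t (k - 1)) - omega (2 - alpha) (t n - t k))
  / (t k - t (k - 1)).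

Definition Dalpha (R : realType) (alpha : R) (t : int -> R)
    (v : int -> R -> R) (n : nat) (x : R) : R :=
  \sum_(1 <= k < n.+1) L1coef alpha t n%:Z k%:Z * (v k%:Z x - v (k%:Z - 1) x).

(* J^{1-alpha} v^{n-2N}.                                                      *)
Definition Jdelay (R : realType) (alpha : R) (t : int -> R) (N : nat)
    (v : int -> R -> R) (n : nat) (x : R) : R :=
  \sum_(1 <= k < n.+1) (t k%:Z - t (k%:Z - 1)) * L1coef alpha t n%:Z k%:Z
                       * v (k%:Z - 2 * N%:Z) x.

(* Spatial mesh 0 = X 0 < X 1 < ... < X M = L.                                *)
Definition spatial_mesh (R : realType) (L : R) (M : nat) (X : nat -> R) : Prop :=
  [/\ X 0%N = 0, X M = L & forall j : nat, (j < M)%N -> X j < X j.+1].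

Definition mesh_diam (R : realType) (M : nat) (X : nat -> R) : R :=
  \big[Num.max/0]_(j < M) (X j.+1 - X j).

Definition quasi_uniform (R : realType) (kappa : R) (M : nat) (X : nat -> R) :
    Prop :=
  forall j : nat, (j < M)%N -> mesh_diam M X <= kappa * (X j.+1 - X j).

(* The space X_h; the values of its members outside [0, L] are irrelevant.    *)
Definition fe_space (R : realType) (L : R) (M : nat) (X : nat -> R)
    (v : R -> R) : Prop :=
  [/\ {within `[0, L], continuous v}, v 0 = 0, v L = 0 &
      forall j : nat, (j < M)%N -> exists c d : R,
        forall x : R, x \in `[X j, X j.+1] -> v x = c + d * x].

(* [derive1] is the derivative of a member of X_h away from the nodes.        *)
Definition Bform (R : realType) (L p a : R) (v w : R -> R) : R :=
  p * L2dot L (derive1 v) (derive1 w) - L2dot L (fun x => a * v x) w.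

Definition fe_scheme (R : realType) (alpha : R) (K : nat) (p a b L : R)
    (f : R -> R -> R) (t : int -> R) (N M : nat) (X : nat -> R)
    (uh : int -> R -> R) : Prop :=
  forall n : nat, (1 <= n <= 2 * K * N)%N ->
  forall vh : R -> R, fe_space L M X vh ->
    L2dot L (Dalpha alpha t uh n) vh + Bform L p a (uh n%:Z) vh =
    L2dot L (fun x => b * Jdelay alpha t N uh n x) vh
    + L2dot L (fun x => frac_int (1 - alpha) (f x) (t n%:Z)) vh.

(* Main.v *)
(** Let [Pi] be nodal interpolation and write u^n - u_h^n = eta^n + theta^n with eta = u - Pi u.

    Duality gives |v - Pi v| <= 2 h^2 S as soon as |(v, Z'')| <= S |Z| for all C^2 functions Z with
    compact support. Applied to u(t) and to the increments of u in time, this bounds eta(t) by h^2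
    and sum_k |eta^k - eta^(k-1)| by h^2 times the integral of the H^2 norm of the time derivative.

    The equation is paired with bounded functions v: the fractional integral of s -> (p u'' + a u, v)(s)
    is then an absolutely continuous function, so that a further fractional integration and a
    differentiation recover (p u'' + a u, v)(t) at every t > 0 from the equation. In one dimension the
    bilinear form does not distinguish u from Pi u, which gives an exact error identity for theta.

    For nu = (u, v) the truncation error of the L1 formula at t_n is at most
    A t_n^(-alpha) N^(-min(1, alpha r)) + sum_k a_(n-k) E_k with sum_k E_k = O(1/N). On the cells
    k <= min(n, N)/2 the mean value of nu' is subtracted, and the oscillation of the kernel telescopes;
    the next ones use the grading of the mesh; beyond the first half delay nu' has bounded variation.

    As the coefficients of the L1 formula are monotone and a_(n-1) is at least
    t_n^(-alpha) / Gamma(1 - alpha), a residual sum_k a_(n-k) E_k + F t_n^(-alpha) yields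
    |theta^n| <= |theta^0| + sum_k E_k + Gamma(1 - alpha) F. The delay term contributes
    E_k = |b| rho_k |u^(k-2N) - u_h^(k-2N)|, so that the estimate propagates from one delay interval
    to the next one. *)

Require Import Defs.
From HB Require Import structures.
From mathcomp Require Import zify ring lra measurable_realfun.

(** * Integrals over open intervals *)

(** Membership in H2 is known at almost every time only, while the scheme sees u at mesh nodes. So
    H2 bounds are passed from one good time to all others through the pairings (u(t), Z''), whose
    increments in time are controlled; this is why the interpolation estimate is stated by duality.
    Likewise p u'' + a u need not be continuous in time. It is replaced by [Fr], the fractional
    integral of order 1 - alpha of an expression [Eu] explicit in u and f, and by [weak_form], which
    involves nodal values and an L2 product of u and is continuous in t. Moreover f is continuous up
    to the ends in time but not in space, so that [Eu] may be unbounded near 0 and L: pairings are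
    first taken with bounded functions that vanish near the ends, and the resulting L2 bound on [Fr]
    then admits all finite element functions. Finally, the equation says nothing across the
    multiples of tau; there the paired quantities, which are Hoelder continuous in time, make the
    junction. As a <= 0 and the delay term refers to earlier intervals only, a comparison argument
    takes the place of a Gronwall inequality, and the constants obey a recursion of length K. *)

Section Int.
Context {R : realType}.
Local Notation mu := (@lebesgue_measure R).
Implicit Types (a b c : R) (f g : R -> R).

Definition Int a b f : R := \int[mu]_(x in `]a, b[) f x.
Definition itgb a b f : Prop := mu.-integrable `]a, b[ (EFin \o f).

Lemma in_oo a b x : (`]a, b[%classic : set R) x <-> a < x < b.
Proof. by rewrite /= in_itv. Qed.

Lemma eq_Int a b f g : (forall x, a < x < b -> f x = g x) -> Int a b f = Int a b g.
Proof. by move=> h; apply: eq_Rintegral => x /set_mem/in_oo; exact: h. Qed.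

Lemma itgb_meas a b f : itgb a b f -> measurable_fun (`]a, b[ : set R) f.
Proof. by move/(measurable_int mu)/measurable_EFinP. Qed.

Lemma eq_itgb a b f g : (forall x, a < x < b -> f x = g x) -> itgb a b f -> itgb a b g.
Proof.
by move=> h; apply: eq_integrable => // x /set_mem/in_oo /h /= ->.
Qed.

Lemma itgb_le a b f g : measurable_fun (`]a, b[ : set R) f ->
  (forall x, a < x < b -> `|f x| <= g x) -> itgb a b g -> itgb a b f.
Proof.
move=> mf h; apply: le_integrable => //; first exact/measurable_EFinP.
move=> x /in_oo/h /= fg; rewrite lee_fin (le_trans fg)// ler_norm //.
Qed.

Lemma itgb_cst a b c : itgb a b (fun=> c).
Proof.
apply: measurable_bounded_integrable => //.
  by rewrite /= lebesgue_measure_itv/=; case: ifP; rewrite ?ltry.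
exists `|c|; split; first exact: num_real.
by move=> x xc y _ /=; rewrite ltW.
Qed.

Lemma itgb_bnd a b f c : measurable_fun (`]a, b[ : set R) f ->
  (forall x, a < x < b -> `|f x| <= c) -> itgb a b f.
Proof. by move=> mf h; apply: itgb_le h (itgb_cst a b c). Qed.

Lemma itgbD a b f g : itgb a b f -> itgb a b g -> itgb a b (fun x => f x + g x).
Proof. exact: integrableD. Qed.

Lemma itgbB a b f g : itgb a b f -> itgb a b g -> itgb a b (fun x => f x - g x).
Proof. exact: integrableB. Qed.

Lemma itgbZ a b c f : itgb a b f -> itgb a b (fun x => c * f x).
Proof. by move=> h; exact: (integrableZl _ c h). Qed.

Lemma itgbZr a b c f : itgb a b f -> itgb a b (fun x => f x * c).
Proof. by move=> /(itgbZ c); apply: eq_itgb => x _; rewrite mulrC. Qed.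

Lemma itgb_norm a b f : itgb a b f -> itgb a b (fun x => `|f x|).
Proof. exact: integrable_norm. Qed.

Lemma itgbS a b c d f : a <= c -> d <= b -> itgb a b f -> itgb c d f.
Proof.
move=> ac db; apply: integrableS => // x /in_oo/andP[x1 x2]; apply/in_oo.
by rewrite (le_lt_trans ac x1) (lt_le_trans x2 db).
Qed.

Lemma IntD a b f g : itgb a b f -> itgb a b g ->
  Int a b (fun x => f x + g x) = Int a b f + Int a b g.
Proof. exact: RintegralD. Qed.

Lemma IntB a b f g : itgb a b f -> itgb a b g ->
  Int a b (fun x => f x - g x) = Int a b f - Int a b g.
Proof. exact: RintegralB. Qed.

Lemma IntZ a b c f : itgb a b f -> Int a b (fun x => c * f x) = c * Int a b f.
Proof. exact: RintegralZl. Qed.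

Lemma IntZr a b c f : itgb a b f -> Int a b (fun x => f x * c) = Int a b f * c.
Proof. exact: RintegralZr. Qed.

Lemma IntN a b f : itgb a b f -> Int a b (fun x => - f x) = - Int a b f.
Proof.
move=> h; rewrite -mulN1r -IntZ//; apply: eq_Int => x _; by rewrite mulN1r.
Qed.

Lemma Int_ge0 a b f : (forall x, a < x < b -> 0 <= f x) -> 0 <= Int a b f.
Proof. by move=> h; apply: Rintegral_ge0 => x /in_oo; exact: h. Qed.

Lemma Int_le a b f g : itgb a b f -> itgb a b g ->
  (forall x, a < x < b -> f x <= g x) -> Int a b f <= Int a b g.
Proof. by move=> hf hg h; apply: le_Rintegral => // x /in_oo; exact: h. Qed.

Lemma Int_abs a b f : itgb a b f -> `|Int a b f| <= Int a b (fun x => `|f x|).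
Proof. exact: le_normr_Rintegral. Qed.

Lemma Int_abs_le a b f g : itgb a b f -> itgb a b g ->
  (forall x, a < x < b -> `|f x| <= g x) -> `|Int a b f| <= Int a b g.
Proof.
move=> hf hg h; apply: (le_trans (Int_abs hf)); apply: Int_le => //.
exact: itgb_norm.
Qed.

(** The integral is not oriented: with its end points reversed it is 0, not the opposite. Hence the
    ordering hypotheses of the splitting lemmas, and the value 0 of primitives to the left of their
    origin. *)
Lemma Int_nil a b f : b <= a -> Int a b f = 0.
Proof.
by move=> ba; rewrite /Int set_itv_ge ?Rintegral_set0// bnd_simp -leNgt.
Qed.

Lemma Int_cst a b c : a <= b -> Int a b (fun=> c) = c * (b - a).
Proof.
move=> ab; rewrite /Int Rintegral_cst//= lebesgue_measure_itv/= lte_fin.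
by case: ltgtP ab => // -> _ /=; rewrite subrr.
Qed.

(** The two open intervals miss the point [c], which is restored by closing the second one on the
    left; this affects neither measurability nor integrals. *)
Lemma itgb_split a b c f : a <= c <= b -> itgb a c f -> itgb c b f -> itgb a b f.
Proof.
move=> /andP[ac cb] h1 h2.
case: (ltgtP a c) ac => // [ac _|e _]; last by subst c.
case: (ltgtP c b) cb => // [cb _|e _]; last by subst c.
have E : (`]a, b[ = `]a, c[ `|` `[c, b[ :> set R)%classic.
  by rewrite -itv_bndbnd_setU ?bnd_simp ?ltW.
have mf : measurable_fun (`]a, b[ : set R) f.
  rewrite E; apply/measurable_funU => //; split; first exact: itgb_meas h1.
  by apply/measurable_fun_itv_obnd_cbndP; exact: itgb_meas h2.
apply/integrableP; split; first exact/measurable_EFinP.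
rewrite E; move: mf; rewrite E => mf.
rewrite ge0_integral_setU//=.
- rewrite lte_add_pinfty//; first by case/integrableP: h1.
  rewrite -integral_itv_obnd_cbnd; first by case/integrableP: h2.
  apply/measurable_EFinP; apply: measurableT_comp => //; exact: itgb_meas h2.
- by apply/measurable_EFinP; apply: measurableT_comp.
- apply/disj_setPS => y [/=]; rewrite 2!in_itv/= => /andP[_ yx] /andP[].
  by rewrite leNgt yx.
Qed.

Lemma Int_split a b c f : a <= c <= b -> itgb a b f ->
  Int a b f = Int a c f + Int c b f.
Proof.
move=> /andP[ac cb] hf.
have := @Rintegral_itvB _ f (BRight a) (BLeft b) c hf.
case: (ltgtP a c) ac => // [ac _|e _]; last first.
  by subst c; rewrite (Int_nil f (lexx a)) add0r.
case: (ltgtP c b) cb => // [cb _|e _]; last first.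
  by subst c; rewrite (Int_nil f (lexx b)) addr0.
rewrite !bnd_simp (ltW ac) cb => /(_ isT isT) /eqP.
rewrite subr_eq {1}/Int => /eqP ->; rewrite addrC; congr (_ + _); rewrite /Int Rintegral_itv_bndo_bndc//.
by apply: itgbS hf => //; exact: ltW.
Qed.

Lemma itgb_continuous a b f : {within `[a, b], continuous f} -> itgb a b f.
Proof.
move=> cf; apply: (@integrableS _ _ _ mu `[a, b]) => //.
  exact: subset_itv_oo_cc.
by apply: continuous_compact_integrable => //; exact: segment_compact.
Qed.

(** The derivative is required in the open interval only, since some primitives below have no
    two-sided derivative at an end point. *)
Lemma FTC2 a b f F : a <= b -> {within `[a, b], continuous f} ->
  {within `[a, b], continuous F} ->
  (forall x, a < x < b -> is_derive x 1 F (f x)) ->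
  Int a b f = F b - F a.
Proof.
rewrite le_eqVlt => /predU1P[-> _ _ _|ab cf cF dF]; first by rewrite Int_nil// subrr.
have iF := itgb_continuous cf.
have [_ Fa Fb] := (continuous_within_itvP F ab).1 cF.
rewrite /Int Rintegral_itv_bndo_bndc//; last first.
rewrite Rintegral_itv_obnd_cbnd; last first.
  apply: (@integrableS _ _ _ mu `[a, b]) => //.
    exact: subset_itv_oc_cc.
  by apply: continuous_compact_integrable => //; exact: segment_compact.
rewrite /Rintegral (@continuous_FTC2 _ f F)//.
  by split=> // x; rewrite in_itv /= => /dF[].
by move=> x; rewrite in_itv /= => /dF h; rewrite derive1E derive_val.
Qed.

Lemma Int0_ae a b f : itgb a b f -> (forall x, a < x < b -> 0 <= f x) ->
  Int a b f = 0 -> {ae mu, forall x, a < x < b -> f x = 0}.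
Proof.
move=> hf f0 I0.
have : (\int[mu]_(x in `]a, b[) `|(f x)%:E| = 0)%E.
  transitivity (\int[mu]_(x in `]a, b[) (f x)%:E)%E.
    by apply: eq_integral => x /set_mem/in_oo/f0 h; rewrite gee0_abs.
  by rewrite -[LHS]fineK ?integrable_fin_num// -/(Rintegral mu _ f) -/(Int a b f) I0.
move/(ae_eq_integral_abs mu _ _ ).1 => /=.
have m : measurable_fun (`]a, b[ : set R) (EFin \o f) by apply/measurable_EFinP; exact: itgb_meas hf.
move=> /(_ (measurable_itv _) m); apply: filterS => x h /in_oo/h.
by case.
Qed.

End Int.

(** * Square-integrable functions and the Cauchy-Schwarz inequality *)

Section L2.
Context {R : realType}.
Local Notation mu := (@lebesgue_measure R).
Implicit Types (a b c : R) (f g : R -> R).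

Definition L2on a b f : Prop :=
  measurable_fun (`]a, b[ : set R) f /\ itgb a b (fun x => f x ^+ 2).

Lemma itgb_mulL2 a b f g : L2on a b f -> L2on a b g -> itgb a b (fun x => f x * g x).
Proof.
move=> [mf f2] [mg g2]; apply: itgb_le (itgbD f2 g2).
  exact: measurable_funM.
move=> x _ /=; rewrite ler_norml.
have := sqr_ge0 (f x - g x); have := sqr_ge0 (f x + g x).
have := sqr_ge0 (f x); have := sqr_ge0 (g x); nra.
Qed.

Lemma L2onD a b f g : L2on a b f -> L2on a b g -> L2on a b (fun x => f x + g x).
Proof.
move=> hf hg; split; first by apply: measurable_funD; [case: hf|case: hg].
have h := itgbD (itgbD hf.2 hg.2) (itgbZ 2 (itgb_mulL2 hf hg)).
by apply: eq_itgb h => x _; ring.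
Qed.

Lemma L2onZ a b c f : L2on a b f -> L2on a b (fun x => c * f x).
Proof.
move=> hf; split.
  by apply: measurable_funM; [exact: measurable_cst|case: hf].
by apply: eq_itgb (itgbZ (c ^+ 2) hf.2) => x _; rewrite exprMn.
Qed.

Lemma L2onB a b f g : L2on a b f -> L2on a b g -> L2on a b (fun x => f x - g x).
Proof.
move=> hf /(L2onZ (-1)) hg; have [h1 h2] := L2onD hf hg; split.
  by apply: eq_measurable_fun h1 => x _; rewrite mulN1r.
by apply: eq_itgb h2 => x _; rewrite mulN1r.
Qed.

Lemma eq_L2on a b f g : (forall x, a < x < b -> f x = g x) -> L2on a b f -> L2on a b g.
Proof.
move=> h [m i]; split; last by apply: eq_itgb i => x /h ->.
by apply: eq_measurable_fun m => x /set_mem/in_oo/h ->.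
Qed.

Lemma L2on_bnd a b f c : measurable_fun (`]a, b[ : set R) f ->
  (forall x, a < x < b -> `|f x| <= c) -> L2on a b f.
Proof.
move=> mf h; split => //; apply: (@itgb_bnd _ _ _ _ (c ^+ 2)).
  exact: measurable_funX.
move=> x /h hx; rewrite normrX ler_pXn2r// nnegrE //.
exact: le_trans hx.
Qed.

Lemma L2on_continuous a b f : {within `[a, b], continuous f} -> L2on a b f.
Proof.
move=> cf; split; first exact: itgb_meas (itgb_continuous cf).
by apply: itgb_continuous => x; apply: continuousM; exact: cf.
Qed.

Lemma itgb_L2 a b f : L2on a b f -> itgb a b f.
Proof.
move=> hf; have h1 : L2on a b (fun=> 1).
  by split => //; exact: itgb_cst.
by apply: eq_itgb (itgb_mulL2 hf h1) => x _; rewrite mulr1.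
Qed.

(** The quadratic form in (s, t) obtained by integrating (s f - t g)^2 is nonnegative; its value at
    (B, C) is B (A B - C^2). *)
Lemma CauchySchwarz a b f g : L2on a b f -> L2on a b g ->
  Int a b (fun x => f x * g x) ^+ 2 <=
  Int a b (fun x => f x ^+ 2) * Int a b (fun x => g x ^+ 2).
Proof.
move=> hf hg; set A := Int a b (fun x => f x ^+ 2); set B := Int a b (fun x => g x ^+ 2).
set C := Int _ _ _.
have A0 : 0 <= A by apply: Int_ge0 => x _; exact: sqr_ge0.
have B0 : 0 <= B by apply: Int_ge0 => x _; exact: sqr_ge0.
have key s t : 0 <= s ^+ 2 * A - 2 * s * t * C + t ^+ 2 * B.
  have : 0 <= Int a b (fun x => (s * f x - t * g x) ^+ 2).
    by apply: Int_ge0 => x _; exact: sqr_ge0.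
  have i1 := itgbZ (s ^+ 2) hf.2; have i2 := itgbZ (t ^+ 2) hg.2.
  have i3 := itgbZ (2 * s * t) (itgb_mulL2 hf hg).
  rewrite (@eq_Int _ _ _ _ (fun x => s ^+ 2 * f x ^+ 2 - 2 * s * t * (f x * g x)
     + t ^+ 2 * g x ^+ 2)); last by move=> x _; ring.
  rewrite IntD// ?IntB ?IntZ//; [exact: hg.2|exact: itgb_mulL2|exact: hf.2|exact: itgbB].
have [B00|Bn0] := eqVneq B 0.
  have [->|Cn0] := eqVneq C 0; first by rewrite expr0n/= mulr_ge0.
  (* For B = 0 the form at (1, t) is A - 2 t C; this t gives the value -1. *)
  have := key 1 ((A + 1) / C / 2).
  rewrite B00; set k := _ / 2.
  have -> : 2 * 1 * k * C = A + 1 by rewrite /k; field.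
  nra.
have Bp : 0 < B by rewrite lt_def Bn0.
have := key B C.
have -> : B ^+ 2 * A - 2 * B * C * C + C ^+ 2 * B = B * (A * B - C ^+ 2) by ring.
by rewrite pmulr_rge0// subr_ge0.
Qed.

Lemma L2dotE L f g : L2dot L f g = Int 0 L (fun x => f x * g x).
Proof. by []. Qed.

Lemma L2norm_sqr L f : L2norm L f ^+ 2 = Int 0 L (fun x => f x ^+ 2).
Proof.
rewrite /L2norm sqr_sqrtr; first by apply: eq_Int => x _.
by apply: Int_ge0 => x _; rewrite -expr2 sqr_ge0.
Qed.

Lemma L2norm_ge0 L f : 0 <= L2norm L f.
Proof. exact: sqrtr_ge0. Qed.

Lemma eq_L2norm L f g : (forall x, 0 < x < L -> f x = g x) -> L2norm L f = L2norm L g.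
Proof.
move=> h; rewrite /L2norm !L2dotE; congr Num.sqrt; apply: eq_Int => x /h ->; by [].
Qed.

Lemma eq_L2dot L f g f' g' : (forall x, 0 < x < L -> f x = f' x) ->
  (forall x, 0 < x < L -> g x = g' x) -> L2dot L f g = L2dot L f' g'.
Proof. by move=> h1 h2; apply: eq_Int => x hx; rewrite h1 ?h2. Qed.

Lemma L2norm_le L f c : 0 <= c -> Int 0 L (fun x => f x ^+ 2) <= c ^+ 2 -> L2norm L f <= c.
Proof.
by move=> c0; rewrite -L2norm_sqr ler_pXn2r// nnegrE// L2norm_ge0.
Qed.

Lemma L2dot_le L f g : L2on 0 L f -> L2on 0 L g ->
  `|L2dot L f g| <= L2norm L f * L2norm L g.
Proof.
move=> hf hg; have := CauchySchwarz hf hg; rewrite -!L2norm_sqr -exprMn -L2dotE.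
rewrite -[X in X <= _]real_normK ?num_real// ler_pXn2r// nnegrE// mulr_ge0//; exact: L2norm_ge0.
Qed.

Lemma L2norm_triangle L f g : L2on 0 L f -> L2on 0 L g ->
  L2norm L (fun x => f x + g x) <= L2norm L f + L2norm L g.
Proof.
move=> hf hg; apply: L2norm_le; first by rewrite addr_ge0// L2norm_ge0.
rewrite (@eq_Int _ _ _ _ (fun x => f x ^+ 2 + 2 * (f x * g x) + g x ^+ 2)); last first.
  by move=> x _; ring.
have i3 := itgbZ 2 (itgb_mulL2 hf hg).
rewrite IntD ?IntD ?IntZ//; [|exact: itgb_mulL2|exact: hf.2|by apply: itgbD => //; exact: hf.2|exact: hg.2].
rewrite -!L2norm_sqr -L2dotE.
have := L2dot_le hf hg; rewrite ler_norml => /andP[_]; nra.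
Qed.

Lemma L2normZ L c f : L2on 0 L f -> L2norm L (fun x => c * f x) = `|c| * L2norm L f.
Proof.
move=> hf; rewrite /L2norm !L2dotE -sqrtr_sqr -sqrtrM ?sqr_ge0//; congr Num.sqrt.
by rewrite -IntZ; [apply: eq_Int => x _; ring|exact: hf.2].
Qed.

Lemma L2norm_sub L f g : L2on 0 L f -> L2on 0 L g ->
  L2norm L (fun x => f x - g x) <= L2norm L f + L2norm L g.
Proof.
move=> hf hg.
rewrite (@eq_L2norm _ _ (fun x => f x + (-1) * g x)); last by move=> x _; ring.
apply: (le_trans (L2norm_triangle hf (L2onZ (-1) hg))).
by rewrite lerD2l /L2norm !L2dotE (@eq_Int _ _ _ _ (fun x => g x * g x))// => x _; ring.
Qed.

Lemma L2norm_bnd L f c : 0 < L -> L2on 0 L f -> 0 <= c ->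
  (forall x, 0 < x < L -> `|f x| <= c) -> L2norm L f <= c * Num.sqrt L.
Proof.
move=> L0 hf c0 h; apply: L2norm_le; first by rewrite mulr_ge0 ?sqrtr_ge0.
rewrite exprMn sqr_sqrtr ?(ltW L0)// -[X in _ * X](subr0 L) -Int_cst ?(ltW L0)//.
apply: Int_le; [exact: hf.2|exact: itgb_cst|move=> x /h hx].
by rewrite -real_normK ?num_real// ler_pXn2r// nnegrE.
Qed.

End L2.

(** * Affine change of variables *)

Section affine.
Context {R : realType}.
Local Notation mu := (@lebesgue_measure R).
Implicit Types (a b c d : R).

Let phi c d : measurableTypeR R -> measurableTypeR R := fun x : R => (c * x + d : R).

Let mphi c d : measurable_fun setT (phi c d).
Proof.
apply: continuous_measurable_fun => x; apply: cvgD; last exact: cvg_cst.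
by apply: cvgM; [exact: cvg_cst|exact: cvg_id].
Qed.

(** Lebesgue measure is determined by its values on half-open intervals, and the pushforward by x ->
    c x + d, scaled by |c|, takes the same ones. For negative c the preimage of such an interval is
    closed on the left instead, which has the same measure. *)
Lemma lebesgue_measure_affine c d (A : set R) : c != 0 -> measurable A ->
  (`|c|%:E * mu (phi c d @^-1` A) = mu A)%E.
Proof.
move=> c0 mA.
have nc0 : 0 < `|c| by rewrite normr_gt0.
pose nu0 : {measure set (measurableTypeR R) -> \bar R} :=
  mscale (NngNum (ltW nc0)) (pushforward mu (phi c d)).
pose nu := nu0 (mphi c d).
have -> : (`|c|%:E * mu (phi c d @^-1` A))%E = nu A by [].
apply/esym/lebesgue_measure_unique => //= _ [[a b]] _ <- /=.
rewrite lebesgue_measure_itv/= lte_fin /nu /mscale/= /pushforward /=.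
case: (ltrgt0P c) c0 => // [cp|cn] _.
- have -> : (phi c d @^-1` `]a, b] = `](a - d) / c, (b - d) / c])%classic.
    apply/seteqP; split => x /=; rewrite !in_itv/= /phi ltr_pdivrMr// ler_pdivlMr// ltrBlDr lerBrDr [x * c]mulrC//.
  rewrite [X in (_ = _ * X)%E]lebesgue_measure_itv/= lte_fin ltr_pM2r ?invr_gt0// ltrD2r.
  case: ifP; rewrite ?mule0// => _; rewrite -!EFinD -EFinM; congr EFin; field.
  by rewrite gt_eqF.
- have -> : (phi c d @^-1` `]a, b] = `[(b - d) / c, (a - d) / c[)%classic.
    apply/seteqP; split => x /=; rewrite !in_itv/= /phi ltr_ndivlMr// ler_ndivrMr// ltrBlDr lerBrDr [x * c]mulrC andbC//.
  rewrite [X in (_ = _ * X)%E]lebesgue_measure_itv/= lte_fin ltr_nM2r ?invr_lt0// ltrD2r.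
  case: ifP; rewrite ?mule0// => _; rewrite -!EFinD -EFinM; congr EFin; field.
  by rewrite lt_eqF.
Qed.

Lemma ge0_integral_affine c d (f : R -> \bar R) : c != 0 ->
  measurable_fun setT f -> (forall x, 0 <= f x)%E ->
  (\int[mu]_x f x = `|c|%:E * \int[mu]_x f (c * x + d)%R)%E.
Proof.
move=> c0 mf f0.
have nc0 : 0 < `|c| by rewrite normr_gt0.
pose nu0 : {measure set (measurableTypeR R) -> \bar R} :=
  mscale (NngNum (ltW nc0)) (pushforward mu (phi c d)).
pose nu := nu0 (mphi c d).
transitivity (\int[nu]_x f x)%E.
  apply: eq_measure_integral => A mA _.
  exact/esym/(@lebesgue_measure_affine c d A c0 mA).
rewrite ge0_integral_mscale//; congr (_ * _)%E.
by rewrite ge0_integral_pushforward//= ?preimage_setT//; exact: mphi.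
Qed.

Lemma integral_affine c d (f : R -> \bar R) : c != 0 ->
  measurable_fun setT f ->
  (\int[mu]_x f x = `|c|%:E * \int[mu]_x f (c * x + d)%R)%E.
Proof.
move=> c0 mf; rewrite [LHS]integralE [in RHS]integralE.
have mp := measurable_funepos mf; have mn := measurable_funeneg mf.
rewrite (ge0_integral_affine d c0 mp)// (ge0_integral_affine d c0 mn)//.
set A := (\int[_]_x _)%E; set B := (\int[_]_x _)%E.
have A0 : (0 <= A)%E by exact: integral_ge0.
have B0 : (0 <= B)%E by exact: integral_ge0.
(* Valid for infinite values too, as |c| is neither 0 nor infinite. *)
have cD (X Y : \bar R) : (`|c|%:E * X - `|c|%:E * Y = `|c|%:E * (X - Y))%E.
  have cp : (0%R < `|c|%:E)%E by rewrite lte_fin normr_gt0.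
  case: X => [x| |]; case: Y => [y| |] //=; rewrite ?gt0_muley ?gt0_muleNy//.
  by rewrite -[LHS]/((`|c| * x - `|c| * y)%:E) -[RHS]/((`|c| * (x - y))%:E) mulrBr.
rewrite cD; congr (_ * (_ - _))%E; apply: eq_integral => x _.
  by rewrite !funeposE.
by rewrite !funenegE.
Qed.

Let in_affine c d a b x : 0 < c -> (c * a + d < c * x + d < c * b + d) = (a < x < b).
Proof. by move=> c0; rewrite !ltrD2r !ltr_pM2l. Qed.

Let restr_meas (a b : R) (f : R -> R) : measurable_fun (`]a, b[ : set R) f ->
  measurable_fun setT (EFin \o (f \_ `]a, b[)).
Proof.
move=> mf; apply/measurable_EFinP; apply/(measurable_restrictT _ _).1 => //.
Qed.

(** Measurability suffices: when the extended integral is not finite, [fine] sends both sides to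
    0. *)
Lemma Int_affine c d a b (f : R -> R) : 0 < c ->
  measurable_fun (`](c * a + d), (c * b + d)[ : set R) f ->
  Int (c * a + d) (c * b + d) f = c * Int a b (fun x => f (c * x + d)).
Proof.
move=> c0 mf; rewrite /Int [LHS]Rintegral_mkcond [in RHS]Rintegral_mkcond /Rintegral.
rewrite (@integral_affine c d); [|by rewrite gt_eqF|exact: restr_meas].
rewrite gtr0_norm// [X in _ = c * fine X](_ : _ =
   \int[mu]_x ((f \_ `](c * a + d), (c * b + d)[) (c * x + d))%:E)%E; last first.
  apply: eq_integral => x _ /=; rewrite !patchE.
  by rewrite !mem_setE !in_itv/= in_affine.
have cD (X : \bar R) : fine (c%:E * X)%E = c * fine X.
  have cp : (0%R < c%:E)%E by rewrite lte_fin.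
  by case: X => [x| |] //=; rewrite ?gt0_muley ?gt0_muleNy//= mulr0.
exact: cD.
Qed.

Lemma measurable_affine c d a b (f : R -> R) : 0 < c ->
  measurable_fun (`](c * a + d), (c * b + d)[ : set R) f ->
  measurable_fun (`]a, b[ : set R) (fun x => f (c * x + d)).
Proof.
move=> c0 mf; apply: (measurable_comp (F := `](c * a + d), (c * b + d)[%classic)) => //.
  by move=> _ [x /in_oo xab <-]; apply/in_oo; rewrite /phi in_affine.
by apply: measurable_funTS; exact: mphi.
Qed.

Lemma itgb_affine c d a b (f : R -> R) : 0 < c ->
  itgb (c * a + d) (c * b + d) f -> itgb a b (fun x => f (c * x + d)).
Proof.
move=> c0 hf; have mf := itgb_meas hf; apply/integrableP; split.
  by apply/measurable_EFinP; exact: measurable_affine.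
case/integrableP: hf => _ /=.
rewrite [in X in X -> _]integral_mkcond [in X in _ -> X]integral_mkcond.
rewrite (@ge0_integral_affine c d); first last.
- by move=> x; rewrite patchE; case: ifP.
- have := @restr_meas _ _ (fun x => `|f x|) (measurableT_comp (@normr_measurable R setT) mf).
  by apply: eq_measurable_fun => x _; rewrite /= !patchE; case: ifP.
- by rewrite gt_eqF.
rewrite gtr0_norm// [X in (_ < +oo)%E -> (X < +oo)%E](_ : _ =
   \int[mu]_x (((fun x : R => `|f x|%:E) \_ `](c * a + d)%R, (c * b + d)%R[) (c * x + d)%R))%E; last first.
  apply: eq_integral => x _ /=; rewrite !patchE.
  by rewrite !mem_setE !in_itv/= in_affine.
have cp : (0%R < c%:E)%E by rewrite lte_fin.
by move: (integral _ _ _) => [x| |] //=; rewrite ?gt0_muley ?ltry.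
Qed.

End affine.

(** * Fubini *)

Section fubini.
Context {R : realType}.
Local Notation mu := (@lebesgue_measure R).
Local Notation TR := (measurableTypeR R).
Implicit Types (A B : set TR) (H : TR -> TR -> R).

Definition mfun2 A B H :=
  measurable_fun (A `*` B : set (TR * TR)) (fun z : TR * TR => H z.1 z.2).

Lemma mfun2_swap A B H : measurable A -> measurable B -> mfun2 A B H ->
  mfun2 B A (fun y x => H x y).
Proof.
move=> mA mB mH; rewrite /mfun2.
apply: (measurable_comp (F := A `*` B) (f := fun z : TR * TR => H z.1 z.2) (g := fun z : TR * TR => (z.2, z.1))) => //.
- exact: measurableX.
- by move=> _ [[x y] [/= Bx Ay] <-].
- by apply: measurable_funTS; apply: measurable_fun_pair.
Qed.

(** Extension by zero to the whole plane, where the theorems of Fubini and Tonelli apply; the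
    iterated integrals over A and B are those of the extension. *)
Let rest A B H : TR * TR -> R := (fun z : TR * TR => H z.1 z.2) \_ (A `*` B).

Let mrest A B H : measurable A -> measurable B -> mfun2 A B H ->
  measurable_fun setT (rest A B H).
Proof.
move=> mA mB mH; apply/(measurable_restrictT _ _).1 => //; exact: measurableX.
Qed.

Let restE A B H x y : A x -> B y -> rest A B H (x, y) = H x y.
Proof. by move=> Ax By; rewrite /rest patchE mem_set. Qed.

Let restN1 A B H x y : ~ A x -> rest A B H (x, y) = 0.
Proof. by move=> Ax; rewrite /rest patchE memNset// => -[]. Qed.

Let restN2 A B H x y : ~ B y -> rest A B H (x, y) = 0.
Proof. by move=> Ax; rewrite /rest patchE memNset// => -[]. Qed.

Lemma mfun2_section A B H x : measurable A -> measurable B -> mfun2 A B H -> A x ->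
  measurable_fun B (H x).
Proof.
move=> mA mB /(mrest mA mB) m Ax.
have := measurable_funTS (measurableT_comp m (@pair1_measurable _ _ _ _ x)).
move=> /(_ B); apply: eq_measurable_fun => y /set_mem By.
by rewrite /= restE.
Qed.

Let integral_rest A B H x (g : R -> \bar R) : measurable B -> A x ->
  g 0 = 0%E ->
  (\int[mu]_y g (rest A B H (x, y)) = \int[mu]_(y in B) g (H x y))%E.
Proof.
move=> mB Ax g0; rewrite [RHS]integral_mkcond; apply: eq_integral => y _.
rewrite patchE; case: ifPn => [/set_mem By|/negP yB]; first by rewrite restE.
by rewrite restN2// => By; apply: yB; rewrite inE.
Qed.

Let integral_rest0 A B H x (g : R -> \bar R) : ~ A x -> g 0 = 0%E ->
  (\int[mu]_y g (rest A B H (x, y)) = 0)%E.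
Proof.
move=> Ax g0; rewrite -[RHS](integral0 mu setT); apply: eq_integral => y _.
by rewrite restN1.
Qed.

(** The extended integral is the difference of the Tonelli integrals of the positive and negative
    parts, each measurable in x; [fine] preserves this, so that integrability does not enter. *)
Lemma measurable_Rint A B H : measurable A -> measurable B -> mfun2 A B H ->
  measurable_fun A (fun x => \int[mu]_(y in B) H x y).
Proof.
move=> mA mB mH; have m := mrest mA mB mH.
have mp : measurable_fun setT (fun z => (rest A B H z)%:E) by exact/measurable_EFinP.
have m1 := @measurable_fun_fubini_tonelli_F _ _ _ _ _ mu _ (measurable_funepos mp) (fun z => funepos_ge0 _ _).
have m2 := @measurable_fun_fubini_tonelli_F _ _ _ _ _ mu _ (measurable_funeneg mp) (fun z => funeneg_ge0 _ _).
have m3 := measurable_funTS (emeasurable_funB m1 m2).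
have := measurableT_comp (fine_measurable measurableT) (m3 A).
apply: eq_measurable_fun => x /set_mem Ax; rewrite /= /Rintegral; congr fine.
rewrite [RHS]integralE /fubini_F.
congr (_ - _)%E.
- transitivity (\int[mu]_y (fun r => maxe r%:E 0) (rest A B H (x, y)))%E.
    by apply: eq_integral => y _; rewrite funeposE.
  have := @integral_rest A B H x (fun r => maxe r%:E 0)%E mB Ax (maxxx _) => /= ->.
  by apply: eq_integral => y _; rewrite funeposE.
- transitivity (\int[mu]_y (fun r => maxe (- r%:E) 0) (rest A B H (x, y)))%E.
    by apply: eq_integral => y _; rewrite funenegE.
  have := @integral_rest A B H x (fun r => maxe (- r%:E) 0)%E mB Ax => /= ->.
    by apply: eq_integral => y _; rewrite funenegE.
  by rewrite oppr0 maxxx.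
Qed.

Lemma tonelli A B H : measurable A -> measurable B -> mfun2 A B H ->
  (\int[mu]_(y in B) \int[mu]_(x in A) `|H x y|%:E =
   \int[mu]_(x in A) \int[mu]_(y in B) `|H x y|%:E)%E.
Proof.
move=> mA mB mH; have m := mrest mA mB mH.
have ma : measurable_fun setT (fun z => `|rest A B H z|%:E).
  by apply/measurable_EFinP; exact: measurableT_comp.
have := @fubini_tonelli _ _ _ _ _ mu mu _ ma.
have e (x : TR) : (\int[mu]_y `|rest A B H (x, y)|%:E =
   ((fun x => \int[mu]_(y in B) `|H x y|%:E) \_ A) x)%E.
  rewrite patchE; case: ifPn => [/set_mem Ax|/negP xA].
    by rewrite (integral_rest H (g := fun r => `|r|%:E)) ?normr0.
  by rewrite (@integral_rest0 _ _ _ _ (fun r => `|r|%:E)) ?normr0// => Ax; apply: xA; rewrite inE.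
have e' (y : TR) : (\int[mu]_x `|rest A B H (x, y)|%:E =
   ((fun y => \int[mu]_(x in A) `|H x y|%:E) \_ B) y)%E.
  rewrite patchE; case: ifPn => [/set_mem By|/negP yB].
    rewrite [RHS]integral_mkcond; apply: eq_integral => x _; rewrite patchE.
    case: ifPn => [/set_mem Ax|/negP xA]; first by rewrite restE.
    by rewrite restN1 ?normr0// => Ax; apply: xA; rewrite inE.
  rewrite -[RHS](integral0 mu setT); apply: eq_integral => x _.
  by rewrite restN2 ?normr0// => By; apply: yB; rewrite inE.
under eq_integral do rewrite e.
rewrite -integral_mkcond => ->; last by move=> z; rewrite lee_fin.
by rewrite integral_mkcond; apply: eq_integral => y _; rewrite -e'.
Qed.

Lemma measurable_abs_int A B H : measurable A -> measurable B -> mfun2 A B H ->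
  measurable_fun A (fun x => \int[mu]_(y in B) `|H x y|%:E)%E.
Proof.
move=> mA mB mH; have m := mrest mA mB mH.
have ma : measurable_fun setT (fun z => `|rest A B H z|%:E).
  by apply/measurable_EFinP; exact: measurableT_comp.
have m1 := @measurable_fun_fubini_tonelli_F _ _ _ _ _ mu _ ma (fun z => normr_ge0 _).
have := measurable_funTS (m1) => /(_ A).
apply: eq_measurable_fun => x /set_mem Ax; rewrite /fubini_F.
by rewrite (integral_rest H (g := fun r => `|r|%:E)) ?normr0.
Qed.

Let ae_int A B H : measurable A -> measurable B -> mfun2 A B H ->
  (\int[mu]_(x in A) \int[mu]_(y in B) `|H x y|%:E < +oo)%E ->
  {ae mu, forall x, A x -> mu.-integrable B (EFin \o H x)} /\
  mu.-integrable A (EFin \o (fun x => \int[mu]_(y in B) H x y)).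
Proof.
move=> mA mB mH fin.
have i0 : mu.-integrable A (fun x => \int[mu]_(y in B) `|H x y|%:E)%E.
  apply/integrableP; split; first exact: measurable_abs_int.
  by under eq_integral do rewrite gee0_abs ?integral_ge0//.
have aei : {ae mu, forall x, A x -> mu.-integrable B (EFin \o H x)}.
  have := integrable_ae mA i0; apply: filterS => x /= h Ax.
  apply/integrableP; split.
    by apply/measurable_EFinP; exact: (mfun2_section mA mB mH Ax).
  by have := h Ax; rewrite ge0_fin_numE// integral_ge0.
split => //; apply/integrableP; split.
  by apply/measurable_EFinP; exact: measurable_Rint.
apply: le_lt_trans fin; apply: ae_ge0_le_integral => //.
- by apply/measurable_EFinP; apply: measurableT_comp => //; exact: measurable_Rint.
- by move=> x _; exact: integral_ge0.
- exact: measurable_abs_int.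
- apply: filterS aei => x /= + Ax => /(_ Ax) ix.
  rewrite EFin_normr_Rintegral//; apply: le_abse_integral => //.
  exact: measurable_int ix.
Qed.

Let irest A B H : measurable A -> measurable B -> mfun2 A B H ->
  (\int[mu]_(x in A) \int[mu]_(y in B) `|H x y|%:E < +oo)%E ->
  (mu \x mu)%E.-integrable setT (fun z => (rest A B H z)%:E).
Proof.
move=> mA mB mH fin; have m := mrest mA mB mH.
have me : measurable_fun setT (fun z => (rest A B H z)%:E) by exact/measurable_EFinP.
apply/(integrable12ltyP _ _ me).2.
  apply: le_lt_trans fin; rewrite [leRHS]integral_mkcond le_eqVlt; apply/orP; left.
  apply/eqP; apply: eq_integral => x _; rewrite patchE.
  case: ifPn => [/set_mem Ax|/negP xA].
    by rewrite (integral_rest H (g := fun r => `|r|%:E)) ?normr0.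
  by rewrite (@integral_rest0 _ _ _ _ (fun r => `|r|%:E)) ?normr0// => Ax; apply: xA; rewrite inE.
Qed.

Let RintF A B H : measurable A -> measurable B -> mfun2 A B H ->
  (\int[mu]_(x in A) \int[mu]_(y in B) `|H x y|%:E < +oo)%E ->
  (\int[mu]_(x in A) (\int[mu]_(y in B) H x y)%R%:E =
   \int[mu]_x \int[mu]_y (rest A B H (x, y))%:E)%E.
Proof.
move=> mA mB mH fin; have [a1 i1] := ae_int mA mB mH fin.
have m := mrest mA mB mH.
have me : measurable_fun setT (fun z => (rest A B H z)%:E) by exact/measurable_EFinP.
have ir := irest mA mB mH fin.
rewrite integral_mkcond; apply: ae_eq_integral => //.
- apply/(measurable_restrictT _ _).1 => //; exact: measurable_int i1.
- exact: measurable_fubini_F ir.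
- apply: filterS a1 => x /= h _; rewrite patchE; case: ifPn => [/set_mem Ax|/negP xA].
    rewrite (integral_rest H (g := fun r => r%:E))// /Rintegral fineK//.
    by apply: integrable_fin_num => //; exact: h.
  by rewrite (@integral_rest0 _ _ _ _ (fun r => r%:E))// => Ax; apply: xA; rewrite inE.
Qed.

(** Tonelli carries the finiteness of one iterated integral over to the other, which makes the
    extension integrable on the plane. A section may fail to be integrable on a null set, where its
    [Rintegral] is a default value that the outer integral does not see. *)
Lemma Rfubini A B H : measurable A -> measurable B -> mfun2 A B H ->
  (\int[mu]_(y in B) \int[mu]_(x in A) `|H x y|%:E < +oo)%E ->
  [/\ {ae mu, forall x, A x -> mu.-integrable B (EFin \o H x)},
      {ae mu, forall y, B y -> mu.-integrable A (EFin \o H^~ y)},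
      mu.-integrable A (EFin \o (fun x => \int[mu]_(y in B) H x y)),
      mu.-integrable B (EFin \o (fun y => \int[mu]_(x in A) H x y)) &
      \int[mu]_(x in A) \int[mu]_(y in B) H x y = \int[mu]_(y in B) \int[mu]_(x in A) H x y].
Proof.
move=> mA mB mH fin.
have fin' : (\int[mu]_(x in A) \int[mu]_(y in B) `|H x y|%:E < +oo)%E.
  by rewrite -(tonelli mA mB mH).
have [a1 i1] := ae_int mA mB mH fin'.
have [a2 i2] := ae_int mB mA (mfun2_swap mA mB mH) fin.
split; [exact: a1|exact: a2|exact: i1|exact: i2|].
have F := Fubini (irest mA mB mH fin').
rewrite /Rintegral -!/(Rintegral _ _ _); congr fine.
rewrite (RintF mA mB mH fin') (RintF mB mA (mfun2_swap mA mB mH) fin) F.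
apply: eq_integral => y _; apply: eq_integral => x _; congr EFin.
rewrite /rest !patchE /=; congr (if _ then _ else _).
by apply/idP/idP; rewrite !inE => -[].
Qed.

End fubini.

(** * Composition of fractional integrals *)

Section powers.
Context {R : realType}.
Local Notation mu := (@lebesgue_measure R).
Implicit Types (a b c d s t x : R).

Lemma is_derive_powR a x : 0 < x -> is_derive x (1 : R) (fun s : R => s `^ a) (a * x `^ (a - 1)).
Proof.
move=> x0; have xin : x \in `]0, +oo[ by rewrite in_itv/= x0.
apply: DeriveDef; first exact: derivable_powR.
by rewrite -derive1E powR_derive1.
Qed.

Lemma continuous_powR a x : 0 < x -> {for x, continuous (fun s : R => s `^ a)}.
Proof.
move=> x0; apply/differentiable_continuous/derivable1_diffP.
by have [] := is_derive_powR a x0.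
Qed.

Lemma measurable_powRf a (D : set R) : measurable_fun D (fun s : R => s `^ a).
Proof. by apply: measurable_funTS; exact: measurable_powR. Qed.

Let powint_pos a c d : 0 < a -> 0 < c -> c <= d ->
  itgb c d (fun s => s `^ (a - 1)) /\ Int c d (fun s => s `^ (a - 1)) = (d `^ a - c `^ a) / a.
Proof.
move=> a0 c0 cd.
have cont b : {within `[c, d], continuous (fun s : R => s `^ b)}.
  apply: continuous_in_subspaceT => x /set_mem; rewrite /= in_itv/= => /andP[cx _].
  by apply: continuous_powR; exact: lt_le_trans cx.
split; first exact: itgb_continuous.
have dF x : c < x < d -> is_derive x (1 : R) (fun s : R => a^-1 * s `^ a) (x `^ (a - 1)).
  move=> /andP[cx _]; have x0 := lt_trans c0 cx.
  have h := is_derive_powR a x0.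
  have -> : x `^ (a - 1) = a^-1 * (a * x `^ (a - 1)) by rewrite mulrA mulVf ?mul1r// gt_eqF.
  exact: is_deriveZ.
rewrite (FTC2 cd (cont _) _ dF); first by rewrite -mulrBr mulrC.
by move=> x; apply: cvgM; [exact: cvg_cst|exact: cont].
Qed.

Let cvg_itv (d : R) (f : R -> \bar R) : 0 < d -> measurable_fun (`]0, d[ : set R) f ->
  (forall x, 0 < x < d -> (0 <= f x)%E) ->
  (\int[mu]_(x in `](d / n.+2%:R)%R, d[) f x @[n --> \oo] --> \int[mu]_(x in `]0%R, d[) f x)%E.
Proof.
move=> d0 mf f0.
have U : (\bigcup_n `](d / n.+2%:R), d[ = `]0, d[ :> set R)%classic.
  apply/seteqP; split => [x [n _] /=|x /=]; rewrite !in_itv/=.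
    by move=> /andP[h ->]; rewrite (le_lt_trans _ h)// divr_ge0// ltW.
  move=> /andP[x0 xd]; have [n _ hn] := near_infty_natSinv_lt (PosNum (divr_gt0 x0 d0)).
  exists n => //=; rewrite in_itv/= xd andbT.
  have := hn n (leqnn _); rewrite /= ltr_pdivlMr// mulrC => /(le_lt_trans _); apply.
  by rewrite ler_pM2l// lef_pV2 ?posrE// ler_nat.
rewrite -U; apply: ge0_nondecreasing_set_cvg_integral => //.
- apply/nondecreasing_seqP => n; apply/subsetPset => x /=; rewrite !in_itv/= => /andP[h ->].
  by rewrite (le_lt_trans _ h)// ler_pM2l// lef_pV2 ?posrE// ler_nat.
- move=> n; apply: measurable_funS mf => // x /=; rewrite !in_itv/= => /andP[h ->].
  by rewrite (lt_trans _ h)// divr_gt0.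
- by move=> n x /=; rewrite in_itv/= => /andP[h xd]; apply: f0; rewrite xd (lt_trans _ h)// divr_gt0.
Qed.

(** For a < 1 the integrand is singular at 0. The fundamental theorem gives the integral over [](d /
    n.+2%:R), d[] and monotone convergence closes the gap; the finite limit also proves
    integrability. *)
Lemma powint0 a d : 0 < a -> 0 <= d ->
  itgb 0 d (fun s => s `^ (a - 1)) /\ Int 0 d (fun s => s `^ (a - 1)) = d `^ a / a.
Proof.
move=> a0; rewrite le_eqVlt => /predU1P[<-|d0].
  by rewrite Int_nil// powR0 ?gt_eqF// mul0r /itgb set_itvoo0; split => //; exact: integrable_set0.
have mf : measurable_fun (`]0, d[ : set R) (fun s : R => (s `^ (a - 1))%:E).
  by apply/measurable_EFinP; exact: measurable_powRf.
have fge0 x : 0 < x < d -> (0 <= (x `^ (a - 1))%:E)%E by rewrite lee_fin powR_ge0.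
have h1 := cvg_itv d0 mf fge0.
have h2 : ((fun n : nat => \int[mu]_(x in `](d / n.+2%:R)%R, d[) (x `^ (a - 1))%:E)%E =
   (fun n : nat => ((d `^ a - (d / n.+2%:R) `^ a) / a)%:E)).
  apply/funext => n.
  have p0 : 0 < d / n.+2%:R by rewrite divr_gt0.
  have pd : d / n.+2%:R <= d by rewrite ler_pdivrMr// ler_peMr ?ler1n ?ltW.
  have [i1 i2] := powint_pos a0 p0 pd.
  by rewrite -i2 /Int /Rintegral fineK// integrable_fin_num.
have h3 : (((d `^ a - (d / n.+2%:R) `^ a) / a)%:E @[n --> \oo] --> ((d `^ a / a)%:E : \bar R))%E.
  apply: cvg_EFin; first by near=> n.
  rewrite -[X in _ --> X]/(d `^ a / a) -[X in X / a](subr0 (d `^ a)).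
  apply: cvgMl; apply: cvgB; first exact: cvg_cst.
  have /cvg_at_rightP := powR_cvg0 a0; apply; split => [n|].
    by rewrite divr_gt0.
  rewrite -[X in _ --> X](mulr0 d); apply: cvgMr.
  by have := @cvg_harmonic R; rewrite -cvg_shiftS.
have E : (\int[mu]_(x in `]0%R, d[) (x `^ (a - 1))%:E = (d `^ a / a)%:E)%E.
  by rewrite h2 in h1; exact: (cvg_unique _ h1 h3).
split; last by rewrite /Int /Rintegral E.
apply/integrableP; split => //.
under eq_integral do rewrite /= ger0_norm ?powR_ge0//.
by rewrite E ltry.
Unshelve. all: by end_near. Qed.

(** The truncated power s_+^(a-1). The test is there because [powR] is not 0 at a negative base;
    with it a convolution over ]0, t[ becomes an integral over the line. *)
Definition ppow a s : R := if 0 < s then s `^ (a - 1) else 0.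

Lemma ppow_ge0 a s : 0 <= ppow a s.
Proof. by rewrite /ppow; case: ifP => // _; exact: powR_ge0. Qed.

Lemma measurable_ppow a (D : set R) : measurable_fun D (ppow a).
Proof.
apply: measurable_funTS.
rewrite (_ : ppow a = (fun s => s `^ (a - 1)) \_ `]0, +oo[).
  by apply/(measurable_restrictT _ _).1 => //; exact: measurable_powRf.
by apply/funext => s; rewrite /ppow patchE mem_setE in_itv/= andbT.
Qed.

Lemma measurable_ppow_comp a (dd : measure_display) (T : measurableType dd) (D : set T) (g : T -> R) :
  measurable_fun D g -> measurable_fun D (fun z => ppow a (g z)).
Proof. by move=> mg; exact: (measurableT_comp (@measurable_ppow a setT) mg). Qed.

(** Gamma as an extended real, so that the product formula can be stated before finiteness is known,
    without default values. *)
Definition eGamma a : \bar R := (\int[mu]_s (ppow a s * expR (- s))%:E)%E.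

Lemma GammaE a : Gamma a = fine (eGamma a).
Proof.
rewrite /Gamma Rintegral_mkcond /Rintegral; congr fine; apply: eq_integral => s _.
rewrite patchE /ppow -[s \in _]/((s : R) \in `]0, +oo[%classic) mem_setE in_itv/= andbT.
by case: ifP; rewrite ?mul0r.
Qed.

Let mg a (D : set R) : measurable_fun D (fun s => ppow a s * expR (- s)).
Proof.
apply: measurable_funM; first exact: measurable_ppow.
by apply: measurable_funTS; apply: measurableT_comp => //; exact: measurable_oppr.
Qed.

(** On ]1, 2[ the integrand is at least exp (-2) / 2, as s^(a-1) >= s^(-1) there. *)
Lemma eGamma_gt0 a : 0 < a <= 2 -> (0 < eGamma a)%E.
Proof.
move=> /andP[a0 a2].
have : (\int[mu]_(s in `]1%R, 2%R[) (2^-1 * expR (- 2))%:E <= eGamma a)%E.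
  apply: (@le_trans _ _ (\int[mu]_(s in `]1%R, 2%R[) (ppow a s * expR (- s))%:E)%E).
    apply: ge0_le_integral => //.
    - by apply/measurable_EFinP; exact: mg.
    - move=> s /in_oo/andP[s1 s2]; rewrite lee_fin /ppow (lt_trans ltr01 s1).
      apply: ler_pM; rewrite ?expR_ge0// ?ler_expR ?lerN2 ?(ltW s2)//.
      have s0 := lt_trans ltr01 s1.
      apply: (@le_trans _ _ (s `^ (-1))).
        by rewrite powR_inv1 ?(ltW s0)// lef_pV2 ?posrE// ltW.
      by rewrite ler_powR ?(ltW s1)//; lra.
  apply: ge0_subset_integral => //.
    by apply/measurable_EFinP; exact: mg.
  by move=> s _; rewrite lee_fin mulr_ge0 ?ppow_ge0 ?expR_ge0.
apply: lt_le_trans; rewrite integral_cst//= lebesgue_measure_itv/= lte_fin ltrDl ltr01 -EFinD -EFinM lte_fin.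
by rewrite mulr_gt0 ?mulr_gt0 ?expR_gt0 ?invr_gt0//; lra.
Qed.

(** Below 1 the power is integrable. From 1 on, s^(a-1) <= s <= 2 exp (s/2), so that the integrand
    is at most four times the exponential density of rate 1/2. All the orders in use lie in ]0,
    2]. *)
Lemma eGamma_lty a : 0 < a <= 2 -> (eGamma a < +oo)%E.
Proof.
move=> /andP[a0 a2].
pose e2 (s : R) := exponential_pdf (2^-1 : R) s.
apply: (@le_lt_trans _ _ (\int[mu]_s ((ppow a \_ `]0, 1[) s + 4 * e2 s)%:E)%E).
  apply: ge0_le_integral => //.
  - by move=> s _; rewrite lee_fin mulr_ge0 ?ppow_ge0 ?expR_ge0.
  - by apply/measurable_EFinP; exact: mg.
  - apply/measurable_EFinP; apply: measurable_funD.
      by apply/(measurable_restrictT _ _).1 => //; exact: measurable_ppow.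
    by apply: measurable_funM => //; exact: measurable_exponential_pdf.
  - move=> s _; rewrite lee_fin patchE -[s \in _]/((s : R) \in `]0, 1[%classic) mem_setE in_itv/=.
    have e0 : 0 <= 4 * e2 s by rewrite mulr_ge0 ?exponential_pdf_ge0.
    have [s0|s0] := ltP 0 s; last by rewrite /ppow ltNge s0/= mul0r add0r.
    have [s1|s1] := ltP s 1 => /=.
      rewrite -[leLHS]addr0 lerD// ler_piMr ?ppow_ge0// -[leRHS]expR0 ler_expR oppr_le0 ltW//.
    rewrite add0r /e2 exponential_pdfE ?(ltW s0)// /ppow s0.
    have h1 : s `^ (a - 1) <= s by rewrite -[leRHS]powRr1 ?(ltW s0)// ler_powR//; lra.
    have h2 : s / 2 <= expR (s / 2) by apply: le_trans (expR_ge1Dx _); lra.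
    have -> : - s = - 2^-1 * s - s / 2 by field.
    rewrite expRD expRN; set E := expR (s / 2) in h2 *; set F := expR _.
    have E0 : 0 < E by exact: expR_gt0.
    have F0 : 0 < F by exact: expR_gt0.
    rewrite mulrCA [leRHS](_ : _ = F * 2); last by field.
    by rewrite ler_pM2l// ler_pdivrMr//; lra.
under eq_integral do rewrite EFinD.
rewrite ge0_integralD//; first last.
- by apply/measurable_EFinP; apply: measurable_funM => //; exact: measurable_exponential_pdf.
- by move=> s _; rewrite lee_fin mulr_ge0 ?exponential_pdf_ge0.
- by apply/measurable_EFinP; apply/(measurable_restrictT _ _).1 => //; exact: measurable_ppow.
- by move=> s _; rewrite lee_fin patchE; case: ifP => // _; exact: ppow_ge0.
rewrite lte_add_pinfty//.
  rewrite [X in (X < _)%E](_ : _ = (\int[mu]_(s in `]0%R, 1%R[) (s `^ (a - 1))%:E)%E).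
    have [i1 i2] := powint0 a0 ler01.
    by rewrite -ge0_fin_numE ?integral_ge0// ?integrable_fin_num// => s _; rewrite lee_fin powR_ge0.
  rewrite [RHS]integral_mkcond; apply: eq_integral => s _; rewrite !patchE.
  rewrite -[s \in _]/((s : R) \in `]0, 1[%classic) mem_setE in_itv/=.
  by case: ifP => // /andP[s0 _]; rewrite /ppow s0.
under eq_integral do rewrite EFinM.
rewrite ge0_integralZl//.
- by rewrite integral_exponential_pdf// mule1 ltry.
- by apply/measurable_EFinP; exact: measurable_exponential_pdf.
- by move=> s _; rewrite lee_fin exponential_pdf_ge0.
Qed.

Lemma Gamma_gt0 a : 0 < a <= 2 -> 0 < Gamma a.
Proof.
by move=> ha; rewrite GammaE fine_gt0// eGamma_gt0//= eGamma_lty.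
Qed.

Lemma GammaK a : 0 < a <= 2 -> eGamma a = (Gamma a)%:E.
Proof.
move=> ha; rewrite GammaE fineK// ge0_fin_numE ?eGamma_lty// ltW// eGamma_gt0//.
Qed.

(** The integrand is the exponential density of rate 1 except at s = 0. *)
Lemma Gamma1 : Gamma 1 = 1 :> R.
Proof.
rewrite GammaE (_ : eGamma 1 = 1%E)//.
rewrite -(@integral_exponential_pdf R 1)//; apply/esym.
apply: ae_eq_integral => //.
- by apply/measurable_EFinP; exact: measurable_exponential_pdf.
- by apply/measurable_EFinP; exact: mg.
have n0 : mu.-negligible [set (0 : R)].
  by exists [set (0:R)]; split => //; exact: lebesgue_measure_set1.
apply: negligibleS n0 => s /=; apply: contra_notP => /eqP s0 _; congr EFin.
rewrite /ppow subrr powRr0; have [sp|] := ltP 0 s.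
  by rewrite exponential_pdfE ?(ltW sp)// !mul1r mulN1r.
by rewrite le_eqVlt (negbTE s0)/= => sn; rewrite lt0_exponential_pdf// mul0r.
Qed.

End powers.

(** * The Beta integral and the semigroup of kernels *)

Section beta.
Context {R : realType}.
Local Notation mu := (@lebesgue_measure R).
Local Notation TR := (measurableTypeR R).
Implicit Types (a b c d s t x : R).

Let ebeta a b : \bar R := (\int[mu]_x (ppow a x * ppow b (1 - x))%:E)%E.

Lemma ppow_scale a t x : 0 < t -> ppow a (t * x) = t `^ (a - 1) * ppow a x.
Proof.
move=> t0; rewrite /ppow pmulr_rgt0//; case: ifP => [x0|_]; last by rewrite mulr0.
by rewrite powRM ?ltW.
Qed.

Lemma measurable_ppow_conv a b t (D : set R) :
  measurable_fun D (fun x => ppow a x * ppow b (t - x)).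
Proof.
apply: measurable_funM; first exact: measurable_ppow.
apply: measurable_ppow_comp; apply: measurable_funB => //; exact: measurable_cst.
Qed.

Let ebetaE a b t : 0 < t ->
  (\int[mu]_x (ppow a x * ppow b (t - x))%:E = (t `^ (a + b - 1))%:E * ebeta a b)%E.
Proof.
move=> t0; rewrite (@ge0_integral_affine _ t 0); first last.
- by move=> x; rewrite lee_fin mulr_ge0 ?ppow_ge0.
- by apply/measurable_EFinP; exact: measurable_ppow_conv.
- by rewrite gt_eqF.
rewrite (gtr0_norm t0).
transitivity (t%:E * \int[mu]_x ((t `^ (a - 1) * t `^ (b - 1))%:E * (ppow a x * ppow b (1 - x))%:E))%E.
  congr (_ * _)%E; apply: eq_integral => x _; rewrite -EFinM; congr EFin; rewrite addr0 ppow_scale//.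
  by rewrite (_ : t - t * x = t * (1 - x)) ?ppow_scale//; ring.
rewrite ge0_integralZl//; first last.
- by rewrite lee_fin mulr_ge0 ?powR_ge0.
- by move=> x _; rewrite lee_fin mulr_ge0 ?ppow_ge0.
- by apply/measurable_EFinP; exact: measurable_ppow_conv.
rewrite muleA -EFinM; congr (_ %:E * _)%E.
rewrite -powRD; last by rewrite (gt_eqF t0) implybT.
rewrite -[X in X * _](powRr1 (ltW t0)) -powRD; last by rewrite (gt_eqF t0) implybT.
by congr (_ `^ _); ring.
Qed.

Let ppow_conv0 a b t x : t <= 0 -> ppow a x * ppow b (t - x) = 0.
Proof.
move=> t0; rewrite /ppow; case: ifP => [x0|_]; last by rewrite mul0r.
by rewrite ifF ?mulr0//; apply/negP; lra.
Qed.

Let H a b : TR -> TR -> R := fun x t => ppow a x * ppow b (t - x) * expR (- t).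

Let mH a b : mfun2 setT setT (H a b).
Proof.
rewrite /mfun2 /H setXTT; apply: measurable_funM; first apply: measurable_funM.
- exact: measurable_ppow_comp.
- by apply: measurable_ppow_comp; apply: measurable_funB.
- apply: (measurableT_comp (@measurable_expR R)).
  by apply: measurable_funN.
Qed.

(** The function x_+^(a-1) (t-x)_+^(b-1) exp (-t) is integrated over the plane in both orders. With
    x inside, homogeneity factors out the Beta integral; with t inside, the shift t = x + s
    separates the two Gamma integrals. *)
Lemma eGamma_mul a b : 0 < a -> 0 < b ->
  (eGamma a * eGamma b = ebeta a b * eGamma (a + b))%E.
Proof.
move=> a0 b0.
have B0 : (0 <= ebeta a b)%E.
  by apply: integral_ge0 => x _; rewrite lee_fin mulr_ge0 ?ppow_ge0.
have G0 c : (0 <= eGamma c)%E.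
  by apply: integral_ge0 => x _; rewrite lee_fin mulr_ge0 ?ppow_ge0 ?expR_ge0.
have mg c : measurable_fun setT (fun s => ppow c s * expR (- s)).
  apply: measurable_funM; first exact: measurable_ppow.
  by apply: measurableT_comp => //; exact: measurable_oppr.
have := tonelli measurableT measurableT (mH a b).
have H0 x t : 0 <= H a b x t by rewrite !mulr_ge0 ?ppow_ge0 ?expR_ge0.
have -> : (\int[mu]_(y in setT) \int[mu]_(x in setT) `|H a b x y|%:E =
  ebeta a b * eGamma (a + b))%E.
  rewrite /eGamma -ge0_integralZl//; first last.
  - by move=> s _; rewrite lee_fin mulr_ge0 ?ppow_ge0 ?expR_ge0.
  - by apply/measurable_EFinP; exact: mg.
  apply: eq_integral => t _; have [t0|t0] := leP t 0.
    rewrite {1}/ppow ltNge t0/= mul0r mule0.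
    rewrite -[RHS](integral0 mu setT); apply: eq_integral => x _.
    by rewrite /H ppow_conv0// mul0r normr0.
  rewrite {1}/ppow t0 EFinM muleA [(ebeta _ _ * _)%E]muleC -ebetaE//.
  rewrite -ge0_integralZr//; first last.
  - by move=> s _; rewrite lee_fin mulr_ge0 ?ppow_ge0 ?expR_ge0.
  - by apply/measurable_EFinP; exact: measurable_ppow_conv.
  by apply: eq_integral => x _; rewrite ger0_norm.
move=> ->; rewrite /eGamma -/(eGamma b) -ge0_integralZr//; first last.
- by move=> s _; rewrite lee_fin mulr_ge0 ?ppow_ge0 ?expR_ge0.
- by apply/measurable_EFinP; exact: mg.
apply: eq_integral => x _.
rewrite (@ge0_integral_affine _ 1 x); first last.
- by move=> s; rewrite lee_fin.
- apply/measurable_EFinP; apply: measurableT_comp => //.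
  by apply: (mfun2_section measurableT measurableT (mH a b)).
- exact: oner_neq0.
rewrite normr1 mul1e /eGamma -ge0_integralZl//; first last.
- by rewrite lee_fin mulr_ge0 ?ppow_ge0 ?expR_ge0.
- by move=> s _; rewrite lee_fin mulr_ge0 ?ppow_ge0 ?expR_ge0.
- by apply/measurable_EFinP; exact: mg.
apply: eq_integral => s _; rewrite ger0_norm// -EFinM; congr EFin.
by rewrite /H mul1r addrK opprD expRD; ring.
Qed.

(** The Beta integral is read off from the product formula: it is finite because the product of the
    two Gamma values is finite and [Gamma (a + b)] is positive. *)
Lemma ppow_conv a b t : 0 < a <= 2 -> 0 < b <= 2 -> a + b <= 2 ->
  (\int[mu]_x (ppow a x * ppow b (t - x))%:E =
   (ppow (a + b) t * (Gamma a * Gamma b / Gamma (a + b)))%:E)%E.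
Proof.
move=> ha hb hab; have hc : 0 < a + b <= 2 by rewrite hab andbT; lra.
have [t0|t0] := leP t 0.
  rewrite /ppow ltNge t0/= mul0r.
  by rewrite -[RHS](integral0 mu setT); apply: eq_integral => x _; rewrite ppow_conv0.
rewrite ebetaE// {1}/ppow t0 EFinM; congr (_ * _)%E.
have a0 : 0 < a by lra. have b0 : 0 < b by lra.
have := eGamma_mul a0 b0; rewrite !GammaK//.
have gp := Gamma_gt0 hc.
case: (ebeta a b) => [e| |].
- rewrite -!EFinM => -[->]; congr EFin; rewrite mulfK// gt_eqF//.
- by rewrite gt0_mulye ?lte_fin.
- by rewrite gt0_mulNye ?lte_fin.
Qed.

(** [omega] cut off on the negative half-line, for the same reason as [ppow]; the factor Gamma makes
    these kernels a convolution semigroup. *)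
Definition kap a s : R := if 0 < s then omega a s else 0.

Lemma kapE a s : kap a s = ppow a s / Gamma a.
Proof. by rewrite /kap /ppow /omega; case: ifP; rewrite ?mul0r. Qed.

Lemma kap_ge0 a s : 0 < a <= 2 -> 0 <= kap a s.
Proof. by move=> /Gamma_gt0 h; rewrite kapE divr_ge0 ?ppow_ge0 ?ltW. Qed.

Lemma measurable_kap a (D : set R) : measurable_fun D (kap a).
Proof.
rewrite (_ : kap a = fun s => ppow a s / Gamma a); last by apply/funext => s; rewrite kapE.
by apply: measurable_funM; [exact: measurable_ppow|exact: measurable_cst].
Qed.

Lemma measurable_kap_comp a (dd : measure_display) (T : measurableType dd) (D : set T) (g : T -> R) :
  measurable_fun D g -> measurable_fun D (fun z => kap a (g z)).
Proof. by move=> mg; exact: (measurableT_comp (@measurable_kap a setT) mg). Qed.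

Lemma kap_conv a b s t : 0 < a <= 2 -> 0 < b <= 2 -> a + b <= 2 ->
  (\int[mu]_x (kap a (t - x) * kap b (x - s))%:E = (kap (a + b) (t - s))%:E)%E.
Proof.
move=> ha hb hab; have hc : 0 < a + b <= 2 by rewrite hab andbT; lra.
have hba : b + a <= 2 by rewrite addrC.
rewrite (@ge0_integral_affine _ 1 s); first last.
- by move=> x; rewrite lee_fin mulr_ge0// kap_ge0.
- apply/measurable_EFinP; apply: measurable_funM.
    by apply: measurable_kap_comp; apply: measurable_funB => //; exact: measurable_cst.
  by apply: measurable_kap_comp; apply: measurable_funB => //; exact: measurable_cst.
- exact: oner_neq0.
rewrite normr1 mul1e.
transitivity (\int[mu]_x (((Gamma b * Gamma a)^-1)%:E * (ppow b x * ppow a ((t - s) - x))%:E))%E.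
  apply: eq_integral => x _; rewrite -EFinM !kapE invfM; congr EFin.
  have -> : t - (1 * x + s) = t - s - x by ring.
  rewrite mul1r addrK; move: (Gamma a)^-1 (Gamma b)^-1 (ppow a _) (ppow b _) => ? ? ? ?; ring.
rewrite ge0_integralZl//; first last.
- by rewrite lee_fin invr_ge0 mulr_ge0// ltW// Gamma_gt0.
- by move=> x _; rewrite lee_fin mulr_ge0 ?ppow_ge0.
- by apply/measurable_EFinP; exact: measurable_ppow_conv.
rewrite ppow_conv// kapE -EFinM addrC; congr EFin.
have := Gamma_gt0 ha; have := Gamma_gt0 hb; rewrite addrC in hc; have := Gamma_gt0 hc.
rewrite [in a + b]addrC; move: (Gamma _) (Gamma _) (Gamma _) (ppow _ _) => x y z v z0 y0 x0.
by field; rewrite !gt_eqF.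
Qed.

Lemma omega1 s : omega 1 s = 1.
Proof. by rewrite /omega Gamma1 subrr powRr0 divr1. Qed.

End beta.

(** * Associativity of fractional integration *)

Section conv.
Context {R : realType}.
Local Notation mu := (@lebesgue_measure R).
Local Notation TR := (measurableTypeR R).
Implicit Types (a b c d s t x : R) (f g v : R -> R).

(** In contrast with [IntZ], integrability is not assumed: the inner integral of [conv_assoc] is
    handled at every s although it converges for almost every s only. *)
Lemma IntZ_ge0 a b c f : 0 <= c -> measurable_fun (`]a, b[ : set R) f ->
  Int a b (fun x => c * f x) = c * Int a b f.
Proof.
move=> c0 mf; have [->|cn] := eqVneq c 0.
  by rewrite mul0r (@eq_Int _ _ _ _ (fun=> 0)) => [|x _]; rewrite ?mul0r// /Int Rintegral_cst//= mul0r.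
have cp : 0 < c by rewrite lt_def cn.
have me : measurable_fun (`]a, b[ : set R) (fun x => (f x)%:E) by exact/measurable_EFinP.
rewrite /Int /Rintegral.
have -> : (\int[mu]_(x in `]a, b[) (c * f x)%:E = c%:E * \int[mu]_(x in `]a, b[) (f x)%:E)%E.
  rewrite [LHS]integralE [X in (_ * X)%E]integralE.
  rewrite (_ : (fun x => (c * f x)%:E) = (fun x => c%:E * (f x)%:E)%E)//.
  rewrite ge0_funeposM// ge0_funenegM//.
  rewrite ge0_integralZl//; last exact: measurable_funepos.
  rewrite ge0_integralZl//; last exact: measurable_funeneg.
  set X := integral _ _ _; set Y := integral _ _ _.
  have cp' : (0%R < c%:E)%E by rewrite lte_fin.
  case: X => [x| |]; case: Y => [y| |] //=; rewrite ?gt0_muley ?gt0_muleNy//.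
  by rewrite -[LHS]/((c * x - c * y)%:E) -[RHS]/((c * (x - y))%:E) mulrBr.
have cD (X : \bar R) : fine (c%:E * X)%E = c * fine X.
  have cp' : (0%R < c%:E)%E by rewrite lte_fin.
  by case: X => [x| |] //=; rewrite ?gt0_muley ?gt0_muleNy//= mulr0.
exact: cD.
Qed.

Lemma Int_supp a b c d f : a <= c -> d <= b ->
  (forall x, a < x < b -> ~~ (c < x < d) -> f x = 0) -> Int a b f = Int c d f.
Proof.
move=> ac db h; rewrite /Int [LHS]Rintegral_mkcond [RHS]Rintegral_mkcond.
apply: eq_Rintegral => x _; rewrite !patchE.
rewrite -![x \in [set` _]]/((x : R) \in [set` _]) !mem_setE !in_itv/=.
case: ifPn => [xab|xab]; case: ifPn => // xcd; first by rewrite h.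
by move: xab xcd; lra.
Qed.

Lemma omega_kap b s : 0 < s -> omega b s = kap b s.
Proof. by rewrite /kap => ->. Qed.

Lemma omega_ge0 b s : 0 < b <= 2 -> 0 <= omega b s.
Proof. by move=> /Gamma_gt0 h; rewrite /omega divr_ge0 ?powR_ge0 ?ltW. Qed.

Lemma omega_gt0 b s : 0 < b <= 2 -> 0 < s -> 0 < omega b s.
Proof. by move=> /Gamma_gt0 h s0; rewrite /omega divr_gt0 ?powR_gt0. Qed.

Lemma measurable_omega_conv b t c d :
  measurable_fun (`]c, d[ : set R) (fun s => omega b (t - s)).
Proof.
rewrite /omega; apply: measurable_funM => //.
apply: (measurableT_comp (@measurable_powR R (b - 1))).
by apply: measurable_funB => //; exact: measurable_cst.
Qed.

Let H a b t v : TR -> TR -> R := fun s x => kap a (t - s) * kap b (s - x) * v x.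

Let mH a b t v : measurable_fun (`]0, t[ : set R) v ->
  mfun2 (`]0, t[%classic : set TR) (`]0, t[%classic : set TR) (H a b t v).
Proof.
move=> mv; rewrite /mfun2 /H.
have mX : measurable ((`]0, t[%classic : set TR) `*` (`]0, t[%classic : set TR)).
  by apply: measurableX.
apply: measurable_funM; first apply: measurable_funM.
- apply: measurable_kap_comp; apply: measurable_funB => //; apply: measurable_funTS.
  exact: measurable_fst.
- apply: measurable_kap_comp; apply: measurable_funB; apply: measurable_funTS.
    exact: measurable_fst.
  exact: measurable_snd.
- apply: (measurable_comp (F := (`]0, t[%classic : set TR))) => //.
    by move=> _ [[x y] [/= _ h] <-].
  by apply: measurable_funTS; exact: measurable_snd.
Qed.

(** The law I^a I^b v = I^(a+b) v at a single time t. The cut-off kernels turn the triangle x < s <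
    t into a square; when the kernels are integrated in s first, [kap_conv] shows that the
    integrability of the right-hand integrand is exactly Tonelli's condition. *)
Lemma conv_assoc a b t v : 0 < a <= 2 -> 0 < b <= 2 -> a + b <= 2 ->
  measurable_fun (`]0, t[ : set R) v ->
  itgb 0 t (fun s => omega (a + b) (t - s) * v s) ->
  itgb 0 t (fun s => omega a (t - s) * Int 0 s (fun x => omega b (s - x) * v x)) /\
  Int 0 t (fun s => omega a (t - s) * Int 0 s (fun x => omega b (s - x) * v x)) =
  Int 0 t (fun s => omega (a + b) (t - s) * v s).
Proof.
move=> ha hb hab mv iv.
have k0 (u w : R) : 0 <= kap a u * kap b w by rewrite mulr_ge0 ?kap_ge0.
have mk (x : R) : measurable_fun setT (fun s => (kap a (t - s) * kap b (s - x))%:E).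
  apply/measurable_EFinP; apply: measurable_funM; apply: measurable_kap_comp; apply: measurable_funB => //.
have inner x : 0 < x < t -> (\int[mu]_(s in `]0%R, t[) (kap a (t - s) * kap b (s - x))%:E)%E
   = (omega (a + b) (t - x))%:E.
  move=> /andP[x0 xt]; rewrite omega_kap ?subr_gt0// -kap_conv//.
  rewrite integral_mkcond; apply: eq_integral => s _; rewrite patchE.
  rewrite -[s \in [set` _]]/((s : R) \in [set` _]) mem_setE in_itv/=.
  case: ifPn => //; rewrite negb_and -!leNgt => /orP[h|h].
    by rewrite [kap b _]/kap ifF ?mulr0//; apply/negP; lra.
  by rewrite [kap a _]/kap ifF ?mul0r//; apply/negP; lra.
pose J : set TR := `]0, t[%classic.
have mJ : measurable J by exact: measurable_itv.
have fin : (\int[mu]_(y in J) \int[mu]_(x in J) `|H a b t v x y|%:E < +oo)%E.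
  apply: (@le_lt_trans _ _ (\int[mu]_(y in `]0%R, t[) `|omega (a + b) (t - y) * v y|%:E)%E); last first.
    by have /integrableP[] := iv.
  rewrite le_eqVlt; apply/orP; left; apply/eqP; apply: eq_integral => y /set_mem/in_oo yt.
  rewrite normrM ger0_norm; last by rewrite omega_ge0//; lra.
  rewrite EFinM -inner// -ge0_integralZr//; first last.
    by move=> s _; rewrite lee_fin.
    by apply: measurable_funTS; exact: mk.
  by apply: eq_integral => s _; rewrite /H normrM ger0_norm// EFinM.
have [_ _ iA _ eI] := Rfubini mJ mJ (mH a b mv) fin.
have E s : 0 < s < t -> \int[mu]_(y in `]0, t[) H a b t v s y =
   omega a (t - s) * Int 0 s (fun x => omega b (s - x) * v x).
  move=> /andP[s0 st]; rewrite omega_kap ?subr_gt0//.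
  have mw : measurable_fun (`]0, s[ : set R) (fun x => omega b (s - x) * v x).
    apply: measurable_funM; first exact: measurable_omega_conv.
    apply: measurable_funS mv => // y; rewrite /= !in_itv/= => /andP[-> ys].
    exact: lt_trans st.
  rewrite -(IntZ_ge0 (kap_ge0 _ ha) mw); transitivity (Int 0 s (H a b t v s)).
    apply: Int_supp; [exact: lexx|exact: ltW|].
    move=> y /andP[y0 yt]; rewrite y0/= -leNgt => sy.
    by rewrite /H [kap b _]/kap ifF ?mulr0 ?mul0r//; apply/negP; clear -sy; lra.
  by apply: eq_Int => y /andP[y0 ys]; rewrite /H omega_kap ?subr_gt0// mulrA.
split.
  by apply: eq_itgb iA => s hs; rewrite /= E.
rewrite (@eq_Int _ _ _ _ (fun s => \int[mu]_(y in `]0, t[) H a b t v s y)); last first.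
  by move=> s hs; rewrite E.
rewrite /Int eI; apply: eq_Rintegral => y /set_mem/in_oo yt.
have := inner y yt; rewrite /Rintegral => I.
have iK : itgb 0 t (fun s => kap a (t - s) * kap b (s - y)).
  apply/integrableP; split; first by apply: measurable_funTS; exact: mk.
  under eq_integral do rewrite /= ger0_norm//.
  by rewrite I ltry.
rewrite -/(Rintegral _ _ _) -/(Int 0 t _).
rewrite (@eq_Int _ _ _ _ (fun s => (kap a (t - s) * kap b (s - y)) * v y))//.
by rewrite IntZr// /Int /Rintegral I.
Qed.

End conv.

(** * Integrals and monotonicity of the kernels *)

Section kernel.
Context {R : realType}.
Local Notation mu := (@lebesgue_measure R).
Implicit Types (a b c d s t x : R) (f g v : R -> R).

Lemma itgb_ge0 a b f c : measurable_fun (`]a, b[ : set R) f ->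
  (forall x, a < x < b -> 0 <= f x) ->
  (\int[mu]_(x in `]a, b[) (f x)%:E = c%:E)%E -> itgb a b f /\ Int a b f = c.
Proof.
move=> mf f0 E; split; last by rewrite /Int /Rintegral E.
apply/integrableP; split; first exact/measurable_EFinP.
rewrite [X in (X < _)%E](_ : _ = c%:E)%E ?ltry// -E; apply: eq_integral => x /set_mem/in_oo/f0 h /=.
by rewrite ger0_norm.
Qed.

Let omega_conv_full a b s t : 0 < a <= 2 -> 0 < b <= 2 -> a + b <= 2 -> s < t ->
  itgb s t (fun x => omega a (t - x) * omega b (x - s)) /\
  Int s t (fun x => omega a (t - x) * omega b (x - s)) = omega (a + b) (t - s).
Proof.
move=> ha hb hab st; apply: itgb_ge0.
- apply: measurable_funM; first exact: measurable_omega_conv.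
  rewrite /omega; apply: measurable_funM => //.
  apply: (measurableT_comp (@measurable_powR R (b - 1))).
  by apply: measurable_funB => //; exact: measurable_cst.
- by move=> x _; rewrite mulr_ge0 ?omega_ge0.
rewrite omega_kap ?subr_gt0// -kap_conv// [LHS]integral_mkcond.
apply: eq_integral => x _; rewrite patchE.
rewrite -[x \in [set` _]]/((x : R) \in [set` _]) mem_setE in_itv/=.
case: ifPn => [/andP[h1 h2]|]; first by rewrite !omega_kap ?subr_gt0.
rewrite negb_and -!leNgt => /orP[h|h].
  by rewrite [kap b _]/kap ifF ?mulr0//; apply/negP; lra.
by rewrite [kap a _]/kap ifF ?mul0r//; apply/negP; lra.
Qed.

Lemma omega_conv a b t : 0 < a <= 2 -> 0 < b <= 2 -> a + b <= 2 -> 0 < t ->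
  itgb 0 t (fun x => omega a (t - x) * omega b x) /\
  Int 0 t (fun x => omega a (t - x) * omega b x) = omega (a + b) t.
Proof.
move=> ha hb hab t0; have [h1 h2] := omega_conv_full ha hb hab t0.
split; first by apply: eq_itgb h1 => x _; rewrite subr0.
by rewrite -[t in RHS]subr0 -h2; apply: eq_Int => x _; rewrite subr0.
Qed.

(** The semigroup law with the constant [omega 1] = 1 as second kernel; the factor Gamma (b + 1)
    comes with it. *)
Let omega_int_full b s t : 0 < b <= 1 -> s <= t ->
  itgb s t (fun x => omega b (t - x)) /\
  Int s t (fun x => omega b (t - x)) = omega (b + 1) (t - s).
Proof.
move=> hb; rewrite le_eqVlt => /predU1P[->|st].
  rewrite Int_nil// subrr /omega addrK powR0 ?mul0r; last by rewrite gt_eqF//; lra.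
  by split => //; rewrite /itgb set_itvoo0; exact: integrable_set0.
have hb2 : 0 < b <= 2 by lra. have h1 : 0 < (1 : R) <= 2 by lra. have hb1 : b + 1 <= 2 by lra.
have [i1 <-] := omega_conv_full hb2 h1 hb1 st; split.
  by apply: eq_itgb i1 => x _; rewrite omega1 mulr1.
by apply: eq_Int => x _; rewrite omega1 mulr1.
Qed.

Lemma itgb_omega b t c d : 0 < b <= 1 -> d <= t -> itgb c d (fun x => omega b (t - x)).
Proof.
move=> hb dt; have [cd|dc] := leP c d; last first.
  rewrite /itgb (_ : `]c, d[ = set0)%classic; first exact: integrable_set0.
  by rewrite set_itv_ge// bnd_simp -leNgt ltW.
have [h _] := omega_int_full hb (le_trans cd dt).
by apply: itgbS h.
Qed.

Lemma omega_int b t c d : 0 < b <= 1 -> c <= d <= t ->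
  Int c d (fun x => omega b (t - x)) = omega (b + 1) (t - c) - omega (b + 1) (t - d).
Proof.
move=> hb /andP[cd dt]; have [h1 <-] := omega_int_full hb (le_trans cd dt).
have [h2 <-] := omega_int_full hb dt.
by rewrite (@Int_split _ c t d) ?cd ?dt// addrK.
Qed.

Lemma omega_decr b s t : 0 < b <= 1 -> 0 < s -> s <= t -> omega b t <= omega b s.
Proof.
move=> /andP[b0 b1] s0 st; have g0 : 0 < Gamma b by apply: Gamma_gt0; lra.
have t0 := lt_le_trans s0 st.
rewrite /omega ler_pM2r ?invr_gt0// -(opprK (b - 1)) [leLHS]powRN [leRHS]powRN lef_pV2 ?posrE ?powR_gt0//.
by apply: ge0_ler_powR => //; rewrite ?nnegrE; lra.
Qed.

End kernel.

(** * Interpolation error by duality *)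

Section test_functions.
Context {R : realType}.
Local Notation mu := (@lebesgue_measure R).
Implicit Types (a b c d s t x : R).

(** A named form of continuity on the line, which [solve_ccont] can match syntactically. *)
Definition ccont (f : R -> R) : Prop := continuous f.

Lemma contD (f g : R -> R) : ccont f -> ccont g -> ccont (fun x => f x + g x).
Proof. by move=> cf cg x; apply: cvgD; [exact: cf|exact: cg]. Qed.

Lemma contB (f g : R -> R) : ccont f -> ccont g -> ccont (fun x => f x - g x).
Proof. by move=> cf cg x; apply: cvgB; [exact: cf|exact: cg]. Qed.

Lemma contM (f g : R -> R) : ccont f -> ccont g -> ccont (fun x => f x * g x).
Proof. by move=> cf cg x; apply: cvgM; [exact: cf|exact: cg]. Qed.

Lemma contX (f : R -> R) n : ccont f -> ccont (fun x => f x ^+ n).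
Proof.
move=> cf; elim: n => [|n IH]; first by move=> x; exact: cvg_cst.
rewrite (_ : (fun x => _) = fun x => f x * f x ^+ n); first exact: contM.
by apply/funext => x; rewrite exprS.
Qed.

Lemma contNorm (f : R -> R) : ccont f -> ccont (fun x => `|f x|).
Proof. by move=> cf x; apply: cvg_norm; exact: cf. Qed.

Lemma contC c : ccont (fun _ : R => c).
Proof. by move=> x; exact: cvg_cst. Qed.

Lemma contI : ccont (fun x : R => x).
Proof. by move=> x; exact: cvg_id. Qed.

Lemma itgb_cont (f : R -> R) a b : continuous f -> itgb a b f.
Proof. by move=> cf; apply: itgb_continuous; exact: continuous_subspaceT. Qed.

Lemma cont_measurable (f : R -> R) (D : set R) : continuous f -> measurable_fun D f.
Proof. by move=> cf; apply: measurable_funTS; exact: continuous_measurable_fun. Qed.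

(** As f vanishes to the left of c > a, the primitive is 0 near every x < c, also for x <= a, where
    [Int] is 0 by convention. Hence it is differentiable on the whole line, as a test function must
    be. *)
Lemma is_derive_Int (f : R -> R) a c x : continuous f -> a < c ->
  (forall y, y < c -> f y = 0) -> is_derive x 1 (fun z : R => Int a z f) (f x).
Proof.
move=> cf ac f0; have [xc|cx] := ltP x c.
  rewrite f0//; apply: (@near_eq_is_derive _ _ _ (cst 0)).
  near=> y; have yc : y < c by near: y; exact: lt_nbhsl.
  rewrite /= /Int (@eq_Rintegral _ _ _ _ _ (fun=> 0)) ?Rintegral_cst//= ?mul0r//.
  by move=> z /set_mem/in_oo/andP[_ zy]; rewrite f0// (lt_trans zy).
have ax := lt_le_trans ac cx.
have x1 : x < x + 1 by rewrite ltrDl.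
have iI : mu.-integrable `]a, x + 1] (EFin \o f).
  apply: (@integrableS _ _ _ mu `[a, x + 1]) => //; first exact: subset_itv_oc_cc.
  by apply: continuous_compact_integrable; [exact: segment_compact|exact: continuous_subspaceT].
have := @continuous_FTC1 _ f (BRight a) _ _ x1 iI.
have ax' : (BRight a < BRight x)%O by rewrite bnd_simp.
move=> /(_ ax' (cf x)) /=.
have -> : (fun x0 : R => \int[mu]_(t in `]a, x0]) f t) = (fun z : R => Int a z f).
  apply/funext => z; rewrite /Int; have [az|za] := ltP a z; last first.
    by rewrite !set_itv_ge// bnd_simp -leNgt.
  by rewrite Rintegral_itv_bndo_bndc//; exact: itgb_cont.
move=> [d1 d2]; rewrite -d2; apply: (DeriveDef d1); by rewrite derive1E.
Unshelve. all: by end_near. Qed.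

(** Z is C^2 with compact support in ]a, b[ and Q = Z''. Both are carried along, as functions are
    paired with Q while the bounds are in terms of Z. *)
Definition ctest a b (Z Q : R -> R) : Prop := exists (Z1 : R -> R) c d,
  [/\ [/\ a < c, c <= d & d < b], continuous Q,
   forall x, is_derive x 1 Z (Z1 x), forall x, is_derive x 1 Z1 (Q x) &
   forall x, ~~ (c <= x <= d) -> [/\ Z x = 0, Z1 x = 0 & Q x = 0]].

Lemma is_derive_fun (f g : R -> R) : (forall x, is_derive x 1 f (g x)) -> derive1 f = g.
Proof. by move=> h; apply/funext => x; rewrite derive1E; exact: derive_val. Qed.

Lemma is_derive_cont (f g : R -> R) : (forall x, is_derive x 1 f (g x)) -> continuous f.
Proof.
move=> h x; apply/differentiable_continuous/derivable1_diffP.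
by have [] := h x.
Qed.

Lemma ctestP a b Z Q : ctest a b Z Q ->
  [/\ test_function a b Z, test_function a b (derive1 Z) & derive1 (derive1 Z) = Q].
Proof.
move=> [Z1 [c [d [[ac cd db] cQ dZ dZ1 z0]]]].
have E1 := is_derive_fun dZ; have E2 := is_derive_fun dZ1.
have nin x : x \notin `[c, d] -> ~~ (c <= x <= d) by rewrite in_itv.
split; last by rewrite E1 E2.
  split; [by move=> x; have [] := dZ x|by rewrite E1; exact: is_derive_cont dZ1|].
  by exists c, d; split => // x /nin/z0[].
rewrite E1; split; [by move=> x; have [] := dZ1 x|by rewrite E2|].
by exists c, d; split => // x /nin/z0[].
Qed.

Lemma Int_zero a b (f : R -> R) : (forall x, a < x < b -> f x = 0) -> Int a b f = 0.
Proof. by move=> h; rewrite (eq_Int h) /Int Rintegral_cst//= mul0r. Qed.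

(** The integral of (x - y) Q y over ]a, x[, expanded so that the product rule applies; its second
    derivative is Q. *)
Definition prim2 a (Q : R -> R) x := x * Int a x Q - Int a x (fun y => y * Q y).

(** To the right of the support of Q the double primitive is x times the moment of order 0 minus the
    moment of order 1. Both vanish, whence the compact support. *)
Lemma prim2_test a b c d (Q : R -> R) : a < c -> c <= d -> d < b ->
  continuous Q -> (forall x, ~~ (c <= x <= d) -> Q x = 0) ->
  Int a b Q = 0 -> Int a b (fun y => y * Q y) = 0 ->
  ctest a b (prim2 a Q) Q.
Proof.
move=> ac cd db cQ Q0 I0 I1.
have cyQ : continuous (fun y : R => y * Q y).
  by move=> y; apply: cvgM; [exact: cvg_id|exact: cQ].
have Qc y : y < c -> Q y = 0 by move=> yc; rewrite Q0//; apply/negP; lra.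
have d0 := is_derive_Int _ cQ ac Qc.
have yQc y : y < c -> y * Q y = 0 by move=> /Qc ->; rewrite mulr0.
have d1 := is_derive_Int _ cyQ ac yQc.
exists (fun z => Int a z Q), c, d; split => //.
  move=> x; rewrite /prim2.
  have h1 : is_derive x (1 : R) (fun z : R => z * Int a z Q) (x *: Q x + Int a x Q *: 1).
    exact: (is_deriveM (is_derive_id x (1 : R)) (d0 x)).
  have h2 := is_deriveB h1 (d1 x).
  apply: is_derive_eq; rewrite /GRing.scale/= mulr1; ring.
move=> x; rewrite negb_and -!ltNge => /orP[xc|dx].
  split; rewrite ?Qc// /prim2 ?(@Int_zero a x) ?mulr0 ?subr0//.
  - by move=> y /andP[_ yx]; rewrite Qc ?mulr0// (lt_trans yx).
  - by move=> y /andP[_ yx]; rewrite Qc// (lt_trans yx).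
  - by move=> y /andP[_ yx]; rewrite Qc// (lt_trans yx).
have Qd y : d < y -> Q y = 0 by move=> yc; rewrite Q0//; apply/negP; lra.
have tail (f : R -> R) : (forall y, d < y -> f y = 0) -> Int a b f = 0 -> Int a x f = 0.
  move=> f0; have [xb|bx] := leP x b.
    rewrite (@Int_supp _ a b a x)// => y /andP[-> _] /=; rewrite -leNgt => xy.
    by rewrite f0// (lt_le_trans dx).
  rewrite (@Int_supp _ a x a b)//; first exact: ltW.
  move=> y /andP[-> _] /=; rewrite -leNgt => xy.
  by rewrite f0// (lt_le_trans db).
split; rewrite ?Qd// /prim2 ?tail ?mulr0 ?subr0// => y /Qd -> //; exact: mulr0.
Unshelve. all: by end_near. Qed.

Lemma prim2_bound a b x (Q : R -> R) : continuous Q -> a <= x <= b ->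
  `|prim2 a Q x| <= (b - a) * Int a b (fun y => `|Q y|).
Proof.
move=> cQ /andP[ax xb].
have cn : continuous (fun y => `|Q y|).
  by move=> y; apply: cvg_norm; exact: cQ.
have cyQ : continuous (fun y : R => y * Q y).
  by move=> y; apply: cvgM; [exact: cvg_id|exact: cQ].
have iQ c d := itgb_cont c d cQ.
have iy c d := itgb_cont c d cyQ.
have i_n c d := itgb_cont c d cn.
rewrite /prim2 -IntZ// -IntB//; last exact: itgbZ.
apply: (@le_trans _ _ (Int a x (fun y => (b - a) * `|Q y|))).
  apply: Int_abs_le; [by apply: itgbB => //; exact: itgbZ|exact: itgbZ|].
  move=> y /andP[ay yx]; rewrite -mulrBl normrM ler_wpM2r// ger0_norm ?subr_ge0 ?(ltW yx)//.
  by rewrite lerB// ltW.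
rewrite IntZ// ler_wpM2l ?subr_ge0 ?(le_trans ax)//.
by rewrite [leRHS](@Int_split _ a b x) ?ax// lerDl Int_ge0.
Qed.

Definition tent c e x : R := Num.max 0 (e - `|x - c|).

Lemma tent_cont c e : continuous (tent c e).
Proof.
move=> x; apply: (@continuous_max _ _ (cst 0) (fun y => e - `|y - c|)); first exact: cvg_cst.
apply: cvgB; first exact: cvg_cst.
by apply: cvg_norm; apply: cvgB; [exact: cvg_id|exact: cvg_cst].
Qed.

Lemma tent_ge0 c e x : 0 <= tent c e x.
Proof. by rewrite /tent le_max lexx. Qed.

Lemma tent_out c e x : ~~ (c - e <= x <= c + e) -> tent c e x = 0.
Proof.
move=> h; rewrite /tent; apply/max_idPl; rewrite subr_le0.
move: h; rewrite negb_and -!ltNge => /orP[h|h].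
  by rewrite ler_normr; apply/orP; right; lra.
by rewrite ler_normr; apply/orP; left; lra.
Qed.

Lemma tent_int_gt0 a b c e : 0 < e -> a <= c - e -> c + e <= b -> 0 < Int a b (tent c e).
Proof.
move=> e0 ac cb.
have i1 := itgb_cont a b (@tent_cont c e).
have h1 : Int (c - e / 2) (c + e / 2) (fun=> e / 2) <= Int (c - e / 2) (c + e / 2) (tent c e).
  apply: Int_le; [exact: itgb_cst|exact: itgb_cont (@tent_cont _ _)|] => x hx.
  rewrite /tent le_max; apply/orP; right.
  suff : `|x - c| <= e / 2 by lra.
  by rewrite ler_norml; lra.
have : Int (c - e / 2) (c + e / 2) (tent c e) <= Int a b (tent c e).
  rewrite [leRHS](@Int_split _ a b (c - e / 2)) ?[in leRHS](@Int_split _ (c - e / 2) b (c + e / 2))//; try lra.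
    have p1 : 0 <= Int a (c - e / 2) (tent c e) by apply: Int_ge0 => x _; exact: tent_ge0.
    have p2 : 0 <= Int (c + e / 2) b (tent c e) by apply: Int_ge0 => x _; exact: tent_ge0.
    lra.
  exact: itgb_cont (@tent_cont _ _).
apply: lt_le_trans; apply: lt_le_trans h1.
rewrite Int_cst; last by lra.
by rewrite mulr_gt0; lra.
Qed.

(** A normalized tent. That its first moment is within e of c keeps the moment system in
    [element_test] invertible. *)
Lemma bump_exists a b c e : 0 < e -> a <= c - e -> c + e <= b -> exists B : R -> R,
  [/\ continuous B, forall x, 0 <= B x, forall x, ~~ (c - e <= x <= c + e) -> B x = 0,
   Int a b B = 1 & c - e <= Int a b (fun x => x * B x) <= c + e].
Proof.
move=> e0 ac cb; have I0 := tent_int_gt0 e0 ac cb; set I := Int a b _ in I0.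
pose B x := I^-1 * tent c e x.
have cB : continuous B by move=> x; apply: cvgM; [exact: cvg_cst|exact: tent_cont].
have cxB : continuous (fun x => x * B x).
  by move=> y; apply: cvgM; [exact: cvg_id|exact: cB].
have B0 x : 0 <= B x by rewrite mulr_ge0 ?tent_ge0// invr_ge0 ltW.
have Bo x : ~~ (c - e <= x <= c + e) -> B x = 0 by move=> /tent_out; rewrite /B => ->; rewrite mulr0.
have IB : Int a b B = 1 by rewrite /B IntZ ?mulVf ?gt_eqF//; exact: itgb_cont (@tent_cont _ _).
exists B; split => //.
have iB := itgb_cont a b cB.
apply/andP; split.
  rewrite -[leLHS]mulr1 -IB -IntZ//; apply: Int_le; [exact: itgbZ|exact: itgb_cont|] => x _.
  have [/andP[h _]|/Bo ->] := boolP (c - e <= x <= c + e); last by rewrite !mulr0.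
  exact: ler_wpM2r.
rewrite -[leRHS]mulr1 -IB -IntZ//; apply: Int_le; [exact: itgb_cont|exact: itgbZ|] => x _.
have [/andP[_ h]|/Bo ->] := boolP (c - e <= x <= c + e); last by rewrite !mulr0.
exact: ler_wpM2r.
Qed.

End test_functions.

Ltac solve_ccont := lazymatch goal with
  | |- ccont (fun x => x) => exact (@contI _)
  | |- ccont (fun _ => ?c) => exact (@contC _ c)
  | |- ccont (fun x => @?f x - @?g x) => apply (@contB _ f g); solve_ccont
  | |- ccont (fun x => @?f x + @?g x) => apply (@contD _ f g); solve_ccont
  | |- ccont (fun x => @?f x * @?g x) => apply (@contM _ f g); solve_ccont
  | |- ccont (fun x => @?f x ^+ ?n) => apply (@contX _ f n); solve_ccont
  | |- ccont (fun x => `|@?f x|) => apply (@contNorm _ f); solve_ccont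
  | |- ccont _ => assumption
  end.
Ltac solve_cont := lazymatch goal with
  | |- ccont _ => solve_ccont
  | |- forall x, continuous_at x ?F => change (ccont F); solve_ccont
  end.

(** * The dual test function on one cell *)

Section element.
Context {R : realType}.
Local Notation mu := (@lebesgue_measure R).
Implicit Types (a b c d s t x : R).

(** Shrinkage of y towards 0 by th. An error that is below th near the end points becomes 0 there,
    while it stays continuous and its modulus does not grow. *)
Definition soft (th y : R) : R := y - Num.max (- th) (Num.min th y).

Lemma soft_props th y : 0 <= th ->
  [/\ `|soft th y| <= `|y|, `|y| * `|soft th y| <= y * soft th y,
   y ^+ 2 - th * `|y| <= y * soft th y & (`|y| <= th -> soft th y = 0)].
Proof.
move=> th0; rewrite /soft /Num.max /Num.min.
case: (ltP th y) => h1; case: ltP => h2; split; rewrite ?expr2;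
  case: (ger0P y) => hy; try (rewrite ler_norml; apply/andP; split; lra);
  try (move=> ?; lra); try nra;
  try (case: (ger0P (y - _)) => ?; nra).
Qed.

Lemma soft_cont th (f : R -> R) : continuous f -> continuous (fun x => soft th (f x)).
Proof.
move=> cf x; apply: cvgB; first exact: cf.
apply: (@continuous_max _ _ (cst (- th)) (fun y => Num.min th (f y))); first exact: cvg_cst.
by apply: (@continuous_min _ _ (cst th) f); [exact: cvg_cst|exact: cf].
Qed.

(* [Q] is the soft threshold of [e], corrected by two bumps near the end points so that its moments
   of order 0 and 1 vanish; then its double primitive [Z] has compact support. *)
Lemma element_test a b (e : R -> R) dl : a < b -> continuous e ->
  (forall x, ~~ (a < x < b) -> e x = 0) -> 0 < dl ->
  exists Z Q : R -> R, [/\ ctest a b Z Q,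
    forall l m, Int a b (fun x => (l + m * x) * Q x) = 0,
    Int a b (fun x => e x ^+ 2) - dl * (b - a) <= Int a b (fun x => e x * Q x) &
    Int a b (fun x => Z x ^+ 2) <= 4 * (b - a) ^+ 4 * Int a b (fun x => e x ^+ 2)].
Proof.
move=> ab ce e0 dl0.
have [cm _ hcm] := EVT_max (ltW ab) (continuous_subspaceT (fun x => cvg_norm (ce x))).
set E := `|e cm| in hcm.
have hE x : `|e x| <= E.
  have [/andP[h1 h2]|/e0 ->] := boolP (a < x < b); last by rewrite normr0 normr_ge0.
  by apply: hcm; rewrite in_itv/= !ltW.
have E0 : 0 <= E by exact: normr_ge0.
(* The shrinkage and the pair of bumps each cost at most th E (b - a); together they must stay below
   dl (b - a). *)
pose th := dl / (4 * (E + 1)).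
have th0 : 0 < th by rewrite divr_gt0//; lra.
have thE : 4 * th * (E + 1) = dl by rewrite /th; field; lra.
have near0 y : ~~ (a < y < b) -> exists2 eta, 0 < eta & forall x, `|x - y| < eta -> `|e x| <= th.
  move=> /e0 ey; have /cvgrPdist_le/(_ _ th0) := ce y.
  move=> [eta /= eta0 h]; exists eta => // x xy.
  by have := h x; rewrite /ball_/= distrC ey sub0r normrN; apply.
have [e1 e10 h1] : exists2 eta, 0 < eta & forall x, `|x - a| < eta -> `|e x| <= th.
  by apply: near0; rewrite ltxx.
have [e2 e20 h2] : exists2 eta, 0 < eta & forall x, `|x - b| < eta -> `|e x| <= th.
  by apply: near0; rewrite ltxx andbF.
(* The shrunk function vanishes within 4 ep of the ends, and the bumps occupy [a + ep, a + 3 ep] and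
   [b - 3 ep, b - ep], on either side of its support. *)
pose ep := Num.min (Num.min e1 e2) (b - a) / 8.
have ep0 : 0 < ep by rewrite divr_gt0// !lt_min e10 e20 subr_gt0.
have ep1 : 8 * ep <= e1 by rewrite /ep mulrC divfK// !ge_min lexx.
have ep2 : 8 * ep <= e2 by rewrite /ep mulrC divfK// !ge_min lexx orbT.
have ep3 : 8 * ep <= b - a by rewrite /ep mulrC divfK// !ge_min lexx !orbT.
pose q x := soft th (e x).
have {}ce : ccont e := ce.
have cq : ccont q by exact: soft_cont.
have qp x : [/\ `|q x| <= `|e x|, `|e x| * `|q x| <= e x * q x,
   e x ^+ 2 - th * `|e x| <= e x * q x & (`|e x| <= th -> q x = 0)] := soft_props (e x) (ltW th0).
clearbody q.
have q0l x : x < a + 4 * ep -> q x = 0.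
  move=> h; have [_ _ _] := qp x; apply; have [ax|xa] := ltP a x.
    by apply: h1; rewrite ltr_norml; clear -h ax ep1 ep0 e10; lra.
  by rewrite e0 ?normr0 ?(ltW th0)//; apply/negP; clear -xa; lra.
have q0r x : b - 4 * ep < x -> q x = 0.
  move=> h; have [_ _ _] := qp x; apply; have [xb|bx] := ltP x b.
    by apply: h2; rewrite ltr_norml; clear -h xb ep2 ep0 e20; lra.
  by rewrite e0 ?normr0 ?(ltW th0)//; apply/negP; clear -bx; lra.
have [||BL [cBL BL0 BLo IBL mBL]] := @bump_exists R a b (a + 2 * ep) ep ep0; try (by clear -ep0 ep3; lra).
have [||BR [cBR BR0 BRo IBR mBR]] := @bump_exists R a b (b - 2 * ep) ep ep0; try (by clear -ep0 ep3; lra).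
have {}cBL : ccont BL := cBL. have {}cBR : ccont BR := cBR.
set mL := Int a b (fun x => x * BL x) in mBL; set mR := Int a b (fun x => x * BR x) in mBR.
have mLR : 0 < mR - mL by clear -mBL mBR ep0 ep3; lra.
have it (f : R -> R) (cf : continuous f) := itgb_cont a b cf.
have iq := it _ cq. have ixq : itgb a b (fun x => x * q x) by apply: it; solve_cont.
(* [al] and [ga] solve the 2 x 2 system that matches the moments of order 0 and 1 of [q]. *)
pose al := (mR * Int a b q - Int a b (fun x => x * q x)) / (mR - mL).
pose ga := (Int a b (fun x => x * q x) - mL * Int a b q) / (mR - mL).
have alga : al + ga = Int a b q by rewrite /al /ga; field; clear -mLR; lra.
have algam : al * mL + ga * mR = Int a b (fun x => x * q x) by rewrite /al /ga; field; clear -mLR; lra.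
pose Q x := q x - al * BL x - ga * BR x.
have cQ : ccont Q by rewrite /Q; solve_cont.
have Iq0 : 0 <= Int a b (fun x => `|q x|) by apply: Int_ge0 => x _; exact: normr_ge0.
have IQl l m : Int a b (fun x => (l + m * x) * Q x) = 0.
  rewrite (@eq_Int _ _ _ _ (fun x => l * q x + m * (x * q x) - al * (l * BL x + m * (x * BL x)) -
     ga * (l * BR x + m * (x * BR x)))); last by move=> x _; rewrite /Q; ring.
  rewrite !IntB ?IntD ?IntZ ?IntD ?IntZ//; try (by apply: it; solve_cont).
  rewrite IBL IBR -/mL -/mR -algam -alga. ring.
have wgt x : q x != 0 -> mL <= x <= mR.
  move=> qx; apply/andP; split; rewrite leNgt; apply/negP => h; move/eqP: qx; apply.
    by apply: q0l; clear -h mBL ep0; lra.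
  by apply: q0r; clear -h mBR ep0; lra.
(* On the support of [q] one has mL <= x <= mR, so that mR - x and x - mL are nonnegative weights of
   sum mR - mL; the two coefficients together cost no more than the L1 norm of [q]. *)
have al_le : `|al| + `|ga| <= Int a b (fun x => `|q x|).
  have h w : Int a b (fun x => (w - x) * q x) = w * Int a b q - Int a b (fun x => x * q x).
    by rewrite -IntZ// -IntB//; [apply: eq_Int => x _; ring|exact: itgbZ].
  have ha : `|al| * (mR - mL) <= Int a b (fun x => (mR - x) * `|q x|).
    rewrite -[X in _ * X](gtr0_norm mLR) -normrM /al divfK ?gt_eqF// -h.
    apply: Int_abs_le; try (by apply: it; solve_cont).
    move=> x _; rewrite normrM; have [->|/wgt/andP[_ ?]] := eqVneq (q x) 0; first by rewrite normr0 !mulr0.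
    by rewrite (@ger0_norm _ (mR - x)) ?subr_ge0.
  have hg : `|ga| * (mR - mL) <= Int a b (fun x => (x - mL) * `|q x|).
    rewrite -[X in _ * X](gtr0_norm mLR) -normrM /ga divfK ?gt_eqF// -normrN opprB -h.
    apply: Int_abs_le; try (by apply: it; solve_cont).
    move=> x _; rewrite normrM; have [->|/wgt/andP[? _]] := eqVneq (q x) 0; first by rewrite normr0 !mulr0.
    by rewrite distrC (@ger0_norm _ (x - mL)) ?subr_ge0.
  rewrite -(ler_pM2r mLR) mulrDl; apply: (le_trans (lerD ha hg)).
  rewrite -IntD; [|by apply: it; solve_cont|by apply: it; solve_cont].
  rewrite [leRHS]mulrC -IntZ; last by apply: it; solve_cont.
  rewrite le_eqVlt; apply/orP; left; apply/eqP; apply: eq_Int => x _; ring.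
have IQ : Int a b (fun x => `|Q x|) <= 2 * Int a b (fun x => `|q x|).
  apply: (@le_trans _ _ (Int a b (fun x => `|q x| + `|al| * BL x + `|ga| * BR x))).
    apply: Int_le; [by apply: it; solve_cont| |move=> x _].
      by apply: it; solve_cont.
    rewrite /Q -[in leRHS](ger0_norm (BL0 x)) -[in leRHS](ger0_norm (BR0 x)) -!normrM.
    exact: le_trans (ler_normB _ _) (lerD (ler_normB _ _) (lexx _)).
  rewrite !IntD ?IntZ ?IBL ?IBR//; try (by apply: it; solve_cont).
  by rewrite !mulr1 -addrA mulr2n mulrDl mul1r lerD2l.
have Qout x : ~~ (a + ep <= x <= b - ep) -> Q x = 0.
  move=> h; rewrite /Q BLo ?BRo; last 2 first.
  - by apply/negP => h'; move/negP: h; apply; clear -h' ep0 ep3; lra.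
  - by apply/negP => h'; move/negP: h; apply; clear -h' ep0 ep3; lra.
  rewrite !mulr0 !subr0; move: h; rewrite negb_and -!ltNge => /orP[h|h].
    by apply: q0l; clear -h ep0; lra.
  by apply: q0r; clear -h ep0; lra.
have [I0 I1] : Int a b Q = 0 /\ Int a b (fun y => y * Q y) = 0.
  split.
    by rewrite -[RHS](IQl 1 0); apply: eq_Int => x _; ring.
  by rewrite -[RHS](IQl 0 1); apply: eq_Int => x _; ring.
have ct : ctest a b (prim2 a Q) Q.
  by apply: (@prim2_test _ _ _ (a + ep) (b - ep)) => //; clear -ab ep0 ep3; lra.
exists (prim2 a Q), Q; split => //.
- rewrite (@eq_Int _ _ _ (fun x => e x * Q x) (fun x => e x * q x - al * (e x * BL x) - ga * (e x * BR x))); last first.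
    by move=> x _; rewrite /Q; ring.
  rewrite !IntB ?IntZ//; try (by apply: it; solve_cont).
  have hB (B : R -> R) c : ccont B -> (forall x, 0 <= B x) -> Int a b B = 1 ->
     (forall x, ~~ (c - ep <= x <= c + ep) -> B x = 0) -> (c = a + 2 * ep \/ c = b - 2 * ep) ->
     `|Int a b (fun x => e x * B x)| <= th.
    move=> cB B0 IB Bo hc; rewrite -[leRHS]mulr1 -IB -IntZ; last exact: it.
    apply: Int_abs_le; try (by apply: it; solve_cont).
    move=> x _; rewrite normrM (ger0_norm (B0 x)).
    have [h|/Bo ->] := boolP (c - ep <= x <= c + ep); last by rewrite !mulr0.
    apply: ler_wpM2r => //; case: hc => hc; subst c.
      by apply: h1; rewrite ltr_norml; clear -h ep0 ep1 e10; lra.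
    by apply: h2; rewrite ltr_norml; clear -h ep0 ep2 e20; lra.
  have b1 := hB _ _ cBL BL0 IBL BLo (or_introl erefl).
  have b2 := hB _ _ cBR BR0 IBR BRo (or_intror erefl).
  have m1 : Int a b (fun x => e x ^+ 2) - th * (E * (b - a)) <= Int a b (fun x => e x * q x).
    rewrite -Int_cst ?(ltW ab)// -IntZ -?IntB; try exact: itgb_cst.
    + apply: Int_le; try (by apply: it; solve_cont).
      move=> x _; have [_ _ h _] := qp x; apply: le_trans h.
      by rewrite lerD2l lerN2 ler_pM2l.
    + by apply: it; solve_cont.
  have b3 : al * Int a b (fun x => e x * BL x) + ga * Int a b (fun x => e x * BR x) <= th * (E * (b - a)).
    apply: (@le_trans _ _ (th * (`|al| + `|ga|))).
      rewrite mulrDr; apply: lerD; apply: le_trans (ler_norm _) _; rewrite normrM mulrC ler_wpM2r//.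
    rewrite ler_pM2l// (le_trans al_le)// -Int_cst ?(ltW ab)//.
    apply: Int_le; [by apply: it; solve_cont|exact: itgb_cst|] => x _.
    by have [h _ _ _] := qp x; exact: le_trans h (hE x).
  have : 2 * (th * (E * (b - a))) <= dl * (b - a).
    rewrite -thE (_ : 2 * _ = (2 * th * E) * (b - a)); last by ring.
    by rewrite ler_pM2r ?subr_gt0//; clear -th0 E0; nra.
  move: b3 m1; clear; lra.
(* By [prim2_bound], |Z| <= h |Q|_1 <= 2 h |q|_1. Squaring, integrating over the cell and
   Cauchy-Schwarz produce the factor 4 h^4. *)
- set h := b - a; set Iq := Int a b (fun x => `|q x|) in Iq0 IQ al_le.
  have h0 : 0 < h by rewrite subr_gt0.
  have bd x : a < x < b -> prim2 a Q x ^+ 2 <= (h * (2 * Iq)) ^+ 2.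
    move=> /andP[ax xb]; rewrite -[leLHS]real_normK ?num_real// ler_pXn2r// ?nnegrE ?normr_ge0// ?mulr_ge0 ?(ltW h0)//.
    have axb : a <= x <= b by rewrite (ltW ax) (ltW xb).
    apply: (le_trans (prim2_bound cQ axb)).
    by rewrite ler_pM2l.
  have cZ : ccont (prim2 a Q).
    have [Z1 [c' [d' [_ _ dZ _ _]]]] := ct.
    exact: is_derive_cont dZ.
  apply: (@le_trans _ _ ((h * (2 * Iq)) ^+ 2 * h)).
    rewrite -Int_cst ?(ltW ab)//; apply: Int_le => //; [|exact: itgb_cst].
    by apply: it; solve_cont.
  have CS : Iq ^+ 2 <= h * Int a b (fun x => e x ^+ 2).
    have L1 : L2on a b (fun x => `|q x|) by apply: L2on_continuous; apply: continuous_subspaceT; solve_cont.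
    have L2 : L2on a b (fun=> 1) by split => //; exact: itgb_cst.
    have := CauchySchwarz L1 L2.
    rewrite (@eq_Int _ _ _ (fun x => `|q x| * 1) (fun x => `|q x|)) -/Iq; last by move=> x _; rewrite mulr1.
    rewrite (@eq_Int _ _ _ (fun _ : R => 1 ^+ 2) (fun=> 1)) ?Int_cst ?(ltW ab)// ?mul1r; last by move=> x _; rewrite expr1n.
    move=> /le_trans; apply; rewrite mulrC ler_pM2l//.
    apply: Int_le; try (by apply: it; solve_cont).
    move=> x _; rewrite -[leRHS]real_normK ?num_real// ler_pXn2r ?nnegrE//.
    by have [] := qp x.
  rewrite (_ : (h * (2 * Iq)) ^+ 2 * h = 4 * h ^+ 3 * Iq ^+ 2); last by ring.
  rewrite (_ : 4 * h ^+ 4 * _ = 4 * h ^+ 3 * (h * Int a b (fun x => e x ^+ 2))); last by ring.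
  by rewrite ler_pM2l// mulr_gt0// exprn_gt0.
Qed.

End element.

(** * Nodal interpolation *)

Section interpolation.
Context {R : realType}.
Local Notation mu := (@lebesgue_measure R).
Implicit Types (a b c d s t x L : R) (M : nat) (X : nat -> R) (v : R -> R).

(** The projection onto [a, b]. Composition with it extends a function continuous on [a, b] to one
    continuous on the line. *)
Definition clamp a b x : R := Num.max a (Num.min b x).

Lemma clamp_in a b x : a <= b -> a <= clamp a b x <= b.
Proof. by move=> ab; rewrite /clamp le_max lexx/= ge_max ab ge_min lexx. Qed.

Lemma clampE a b x : a <= x <= b -> clamp a b x = x.
Proof.
move=> /andP[ax xb]; rewrite /clamp; have -> : Num.min b x = x by apply/min_idPr.
exact/max_idPr.
Qed.

Lemma clamp_out a b x : a <= b -> ~~ (a < x < b) -> clamp a b x = a \/ clamp a b x = b.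
Proof.
move=> ab; rewrite negb_and -!leNgt => /orP[h|h].
  by left; apply/max_idPl; rewrite ge_min h orbT.
by right; rewrite /clamp (_ : Num.min b x = b); [exact/max_idPr|exact/min_idPl].
Qed.

Lemma clamp_dist a b x y : `|clamp a b x - clamp a b y| <= `|x - y|.
Proof.
have lipmax (p u w : R) : `|Num.max p u - Num.max p w| <= `|u - w|.
  have := ler_norm (u - w); have := ler_norm (w - u); rewrite [`|w - u|]distrC.
  by rewrite /Num.max; case: ltP => ?; case: ltP => ? ? ?; rewrite ler_norml; lra.
have lipmin (p u w : R) : `|Num.min p u - Num.min p w| <= `|u - w|.
  have := ler_norm (u - w); have := ler_norm (w - u); rewrite [`|w - u|]distrC.
  by rewrite /Num.min; case: ltP => ?; case: ltP => ? ? ?; rewrite ler_norml; lra.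
exact: le_trans (lipmax _ _ _) (lipmin _ _ _).
Qed.

Lemma clamp_cont v a b : a <= b -> {within `[a, b], continuous v} ->
  ccont (fun x => v (clamp a b x)).
Proof.
move=> ab /subspace_continuousP cv x.
have cin y : [set` `[a, b]] (clamp a b y) by rewrite /= in_itv/= clamp_in.
apply/cvgrPdist_lt => e e0.
have /cvgrPdist_lt/(_ e e0) := cv _ (cin x).
rewrite /within/= => /nbhs_ballP[dl /= dl0 h].
apply/nbhs_ballP; exists dl => //= y; rewrite /ball/= => xy.
apply: h; last by rewrite /= in_itv/= clamp_in.
exact: le_lt_trans (clamp_dist _ _ _ _) xy.
Qed.

Lemma cont_within v a b : ccont v -> {within `[a, b], continuous v}.
Proof. by move=> cv; exact: continuous_subspaceT. Qed.

Lemma within_sub v a b c d : a <= c -> d <= b ->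
  {within `[a, b], continuous v} -> {within `[c, d], continuous v}.
Proof.
move=> ac db; apply: continuous_subspaceW => x /=; rewrite !in_itv/= => /andP[h1 h2].
by rewrite (le_trans ac h1) (le_trans h2 db).
Qed.

Lemma ctest_sub a b c d Z Q : a <= c -> d <= b -> ctest c d Z Q -> ctest a b Z Q.
Proof.
move=> ac db [Z1 [c' [d' [[h1 h2 h3] cQ dZ dZ1 z0]]]].
exists Z1, c', d'; split => //; split => //; first exact: le_lt_trans ac h1.
exact: lt_le_trans h3 db.
Qed.

Lemma ctest0 a b : a < b -> ctest a b (fun=> 0) (fun=> 0).
Proof.
move=> ab; exists (fun=> 0), ((a + b) / 2), ((a + b) / 2); split.
- by split; lra.
- exact: contC.
- by move=> y; exact: is_derive_cst.
- by move=> y; exact: is_derive_cst.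
- by [].
Qed.

Lemma ctestD a b Z Q Z' Q' : ctest a b Z Q -> ctest a b Z' Q' ->
  ctest a b (fun x => Z x + Z' x) (fun x => Q x + Q' x).
Proof.
move=> [Z1 [c [d [[h1 h2 h3] cQ dZ dZ1 z0]]]] [Z1' [c' [d' [[h1' h2' h3'] cQ' dZ' dZ1' z0']]]].
exists (fun x => Z1 x + Z1' x), (Num.min c c'), (Num.max d d'); split.
- by rewrite lt_min h1 h1' gt_max h3 h3' le_max ge_min h2 ge_min.
- exact: contD.
- by move=> x; exact: is_deriveD.
- by move=> x; exact: is_deriveD.
- move=> x; rewrite ge_min le_max => h.
  have [|-> -> ->] := z0 x; first by apply: contra h => /andP[-> ->].
  have [|-> -> ->] := z0' x; first by apply: contra h => /andP[-> ->]; rewrite !orbT.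
  by rewrite !addr0.
Qed.

Lemma ctest_sum a b (I : Type) (r : seq I) (Z Q : I -> R -> R) : a < b ->
  (forall i, ctest a b (Z i) (Q i)) ->
  ctest a b (fun x => \sum_(i <- r) Z i x) (fun x => \sum_(i <- r) Q i x).
Proof.
move=> ab h; elim: r => [|i r IH].
  have := ctest0 ab; congr (ctest a b _ _); apply/funext => x; by rewrite big_nil.
have := ctestD (h i) IH; congr (ctest a b _ _); apply/funext => x; by rewrite big_cons.
Qed.

Lemma mesh_le L M X i j : spatial_mesh L M X -> (i <= j <= M)%N -> X i <= X j.
Proof.
move=> [_ _ h] /andP[ij jM]; elim: j ij jM => [|j IH]; first by rewrite leqn0 => /eqP ->.
rewrite leq_eqVlt => /predU1P[->//|]; rewrite ltnS => ij jM.
by rewrite (le_trans (IH ij (ltnW jM)))// ltW// h.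
Qed.

Lemma mesh_lt L M X j : spatial_mesh L M X -> (j < M)%N -> X j < X j.+1.
Proof. by case=> _ _; apply. Qed.

Lemma mesh_in L M X i : spatial_mesh L M X -> (i <= M)%N -> 0 <= X i <= L.
Proof.
move=> hX iM; have [X0 XM _] := hX.
apply/andP; split; first by rewrite -X0 (mesh_le hX).
by rewrite -XM (mesh_le hX)// iM leqnn.
Qed.

Lemma mesh_diam_le M X j : (j < M)%N -> X j.+1 - X j <= mesh_diam M X.
Proof.
move=> jM; rewrite /mesh_diam.
exact: (bigmax_sup (Ordinal jM)).
Qed.

Lemma mesh_diam_ge0 M X : 0 <= mesh_diam M X.
Proof. exact: bigmax_ge_id. Qed.

Lemma Int_mesh L M X (f : R -> R) : spatial_mesh L M X -> itgb 0 L f ->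
  Int 0 L f = \sum_(j < M) Int (X j) (X j.+1) f.
Proof.
move=> hX hf; have [X0 XM _] := hX.
have key n : (n <= M)%N -> Int 0 (X n) f = \sum_(j < n) Int (X j) (X j.+1) f.
  elim: n => [_|n IH nM]; first by rewrite X0 big_ord0 Int_nil.
  rewrite big_ord_recr/= -IH ?(ltnW nM)//.
  have /andP[a1 _] := mesh_in hX (ltnW nM); have /andP[_ a2] := mesh_in hX nM.
  apply: Int_split; first by rewrite a1 ltW// (mesh_lt hX).
  exact: itgbS hf.
by rewrite -key// XM.
Qed.

(** A sum of ramps, one per cell, each 0 before its cell and equal to the increment of v after it.
    This form avoids searching for the cell of x, and shows linearity in v and continuity at
    once. *)
Definition interp M X v x : R := v (X 0%N) + \sum_(j < M)
  (v (X j.+1) - v (X j)) / (X j.+1 - X j) * clamp 0 (X j.+1 - X j) (x - X j).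

Lemma interp_elem L M X v j x : spatial_mesh L M X -> (j < M)%N -> X j <= x <= X j.+1 ->
  interp M X v x = v (X j) + (v (X j.+1) - v (X j)) / (X j.+1 - X j) * (x - X j).
Proof.
move=> hX jM /andP[xj xj1]; rewrite /interp.
pose T i := (v (X i.+1) - v (X i)) / (X i.+1 - X i) * clamp 0 (X i.+1 - X i) (x - X i).
rewrite -/(T _).
have pos i : (i < M)%N -> 0 < X i.+1 - X i by move=> h; rewrite subr_gt0 (mesh_lt hX).
have lo i : (i < j)%N -> T i = v (X i.+1) - v (X i).
  move=> ij; have iM := ltn_trans ij jM.
  have le1 : X i.+1 <= x by apply: le_trans xj; apply: (mesh_le hX); rewrite ij ltnW.
  rewrite /T; have -> : clamp 0 (X i.+1 - X i) (x - X i) = X i.+1 - X i.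
    rewrite /clamp (_ : Num.min _ _ = X i.+1 - X i); first by apply/max_idPr; exact: ltW (pos _ iM).
    by apply/min_idPl; lra.
  by rewrite divfK// gt_eqF// pos.
have hi i : (j < i)%N -> (i < M)%N -> T i = 0.
  move=> ji iM; have le1 : x <= X i by apply: (le_trans xj1); apply: (mesh_le hX); rewrite ji ltnW.
  rewrite /T /clamp (_ : Num.max _ _ = 0) ?mulr0//.
  by apply/max_idPl; rewrite ge_min; apply/orP; right; lra.
have key n : (n <= j)%N -> v (X 0%N) + \sum_(i < n) T i = v (X n).
  elim: n => [_|n IH nj]; first by rewrite big_ord0 addr0.
  by rewrite big_ord_recr/= addrA IH ?(ltnW nj)// lo//; ring.
have key2 n : (j < n <= M)%N -> v (X 0%N) + \sum_(i < n) T i =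
   v (X j) + (v (X j.+1) - v (X j)) / (X j.+1 - X j) * (x - X j).
  elim: n => // n IH /andP[]; rewrite ltnS leq_eqVlt => /predU1P[<- _|jn nM].
    rewrite big_ord_recr/= addrA key//; congr (_ + _); rewrite /T clampE//.
    by rewrite subr_ge0 xj lerD2r.
  by rewrite big_ord_recr/= addrA IH ?jn ?(ltnW nM)// hi// addr0.
by have := key2 M; rewrite jM leqnn => /(_ isT).
Qed.

Lemma interp_cont L M X v : spatial_mesh L M X -> ccont (interp M X v).
Proof.
move=> hX; rewrite /interp; apply: contD; first exact: contC.
have : forall n, (n <= M)%N -> ccont (fun x => \sum_(j < n)
  (v (X j.+1) - v (X j)) / (X j.+1 - X j) * clamp 0 (X j.+1 - X j) (x - X j)).
  elim=> [_|n IH nM].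
    by under eq_fun do rewrite big_ord0; exact: contC.
  under eq_fun do rewrite big_ord_recr/=.
  apply: contD; first exact: IH (ltnW nM).
  apply: contM; first exact: contC.
  have h0 : 0 <= X n.+1 - X n by rewrite subr_ge0 ltW// (mesh_lt hX).
  have cI := clamp_cont h0 (cont_within (a := 0) (b := X n.+1 - X n) (@contI R)).
  move=> x; apply: (@continuous_comp _ _ _ (fun y => y - X n) (clamp 0 (X n.+1 - X n))).
    by apply: contB; [exact: contI|exact: contC].
  exact: cI.
by apply.
Qed.

Lemma interp_nodes L M X v i : spatial_mesh L M X -> (0 < M)%N -> (i <= M)%N ->
  interp M X v (X i) = v (X i).
Proof.
move=> hX M0; rewrite leq_eqVlt => /predU1P[->|iM].
  have hM : (M.-1 < M)%N by rewrite ltn_predL.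
  rewrite (interp_elem v hX hM) ?prednK// ?lexx ?andbT; last first.
    by apply: (mesh_le hX); rewrite leq_pred leqnn.
  have := mesh_lt hX hM; rewrite prednK// => h.
  by rewrite divfK ?gt_eqF ?subr_gt0// addrC subrK.
rewrite (interp_elem v hX iM) ?lexx ?subrr ?mulr0 ?addr0//=.
exact: ltW (mesh_lt hX iM).
Qed.

(** In each cell the error vanishes at the nodes, and [element_test] yields a Q orthogonal to affine
    functions. In the pairing with the sum of these Q the error may therefore be replaced by v, and
    the hypothesis bounds the result by S |Z|, where |Z| <= 2 h^2 |v - Pi v| cell by cell. Dividing
    by |v - Pi v| concludes. *)
Lemma interp_error L M X v S : 0 < L -> spatial_mesh L M X ->
  {within `[0, L], continuous v} -> 0 <= S ->
  (forall Z Q, ctest 0 L Z Q -> `|Int 0 L (fun x => v x * Q x)| <= S * L2norm L Z) ->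
  L2norm L (fun x => v x - interp M X v x) <= 2 * mesh_diam M X ^+ 2 * S.
Proof.
move=> L0 hX cv S0 hS.
have [X0 XM _] := hX.
have M0 : (0 < M)%N by rewrite lt0n; apply/negP => /eqP M0; move: L0; rewrite -XM M0 X0 ltxx.
set h := mesh_diam M X; have h0 : 0 <= h := mesh_diam_ge0 M X.
pose q x := v x - interp M X v x.
have cq : {within `[0, L], continuous q}.
  have ci : {within `[0, L], continuous (interp M X v)}.
    by apply: cont_within; exact: interp_cont hX.
  by move=> x; apply: cvgB; [exact: cv|exact: ci].
have Lq : L2on 0 L q := L2on_continuous cq.
have [l_lt l_in] : (forall j : 'I_M, X j < X j.+1) /\ (forall j : 'I_M, 0 <= X j /\ X j.+1 <= L).
  split=> j; first exact: mesh_lt hX _.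
  by have /andP[-> _] := mesh_in hX (ltnW (ltn_ord j)); have /andP[_ ->] := mesh_in hX (ltn_ord j).
pose e (j : 'I_M) x := q (clamp (X j) (X j.+1) x).
have q0 i : (i <= M)%N -> q (X i) = 0.
  by move=> iM; rewrite /q (interp_nodes v hX)// subrr.
have ce j : ccont (e j).
  apply: clamp_cont; first exact: ltW (l_lt j).
  by have [a1 a2] := l_in j; exact: within_sub cq.
have e0 (j : 'I_M) x : ~~ (X j < x < X j.+1) -> e j x = 0.
  move=> /(clamp_out (ltW (l_lt j))) [] h1; rewrite /e h1 q0//.
  exact: ltnW.
have eE (j : 'I_M) x : X j < x < X j.+1 -> e j x = q x.
  by move=> /andP[h1 h2]; rewrite /e clampE// !ltW.
set N2 := L2norm L q; have N0 : 0 <= N2 := L2norm_ge0 L q.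
have N2E : N2 ^+ 2 = \sum_(j < M) Int (X j) (X j.+1) (fun x => e j x ^+ 2).
  rewrite /N2 L2norm_sqr (Int_mesh hX Lq.2); apply: eq_bigr => j _.
  by apply: eq_Int => x hx; rewrite eE.
have key dl : 0 < dl -> N2 ^+ 2 - dl * L <= S * (2 * h ^+ 2 * N2).
  move=> dl0.
  have H (j : 'I_M) : exists p : (R -> R) * (R -> R), [/\ ctest (X j) (X j.+1) p.1 p.2,
    forall l m, Int (X j) (X j.+1) (fun x => (l + m * x) * p.2 x) = 0,
    Int (X j) (X j.+1) (fun x => e j x ^+ 2) - dl * (X j.+1 - X j) <= Int (X j) (X j.+1) (fun x => e j x * p.2 x) &
    Int (X j) (X j.+1) (fun x => p.1 x ^+ 2) <= 4 * (X j.+1 - X j) ^+ 4 * Int (X j) (X j.+1) (fun x => e j x ^+ 2)].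
    have [Z [Q hZQ]] := element_test (l_lt j) (@ce j) (e0 j) dl0.
    by exists (Z, Q).
  have [ZQ hZQ] := choice H.
  pose Z x := \sum_(j < M) (ZQ j).1 x; pose Q x := \sum_(j < M) (ZQ j).2 x.
  have tZQ : ctest 0 L Z Q.
    apply: ctest_sum => // j; have [a1 a2] := l_in j; have [h1 _ _ _] := hZQ j.
    exact: ctest_sub a1 a2 h1.
  have sep (i j : 'I_M) x : X j < x < X j.+1 -> i != j -> ~~ (X i < x < X i.+1).
    move=> /andP[x1 x2] ij; apply/negP => /andP[x3 x4].
    have : (i < j)%N || (j < i)%N by rewrite -neq_ltn.
    case/orP => lt.
      have : X i.+1 <= X j by apply: (mesh_le hX); rewrite lt ltnW.
      by move=> h1; have := lt_le_trans x4 h1; rewrite ltNge (ltW x1).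
    have : X j.+1 <= X i by apply: (mesh_le hX); rewrite lt ltnW.
    by move=> h1; have := lt_le_trans x2 h1; rewrite ltNge (ltW x3).
  have van (i : 'I_M) x : ~~ (X i < x < X i.+1) -> (ZQ i).1 x = 0 /\ (ZQ i).2 x = 0.
    move=> hx; have [[Z1 [c [d [[h1 h2 h3] _ _ _ z0]]]] _ _ _] := hZQ i.
    have [|-> _ ->//] := z0 x; apply: contra hx => /andP[h4 h5].
    by rewrite (lt_le_trans h1 h4) (le_lt_trans h5 h3).
  have ZE (j : 'I_M) x : X j < x < X j.+1 -> Z x = (ZQ j).1 x /\ Q x = (ZQ j).2 x.
    move=> hx; rewrite /Z /Q (bigD1 j)//= [X in _ = _ /\ X = _](bigD1 j)//=.
    by rewrite !big1 ?addr0// => i ij; have [] := van i x (sep _ _ _ hx ij).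
  have := hS Z Q tZQ; move: (tZQ) => [Z1 [c [d [_ cQ dZ _ _]]]].
  have cZ : ccont Z := is_derive_cont dZ.
  have cvQ : {within `[0, L], continuous (fun x => v x * Q x)}.
    have ciQ : {within `[0, L], continuous Q} by exact: cont_within.
    by move=> x; apply: cvgM; [exact: cv|exact: ciQ].
  have -> : Int 0 L (fun x => v x * Q x) =
     \sum_(j < M) Int (X j) (X j.+1) (fun x => e j x * (ZQ j).2 x).
    rewrite (Int_mesh hX (itgb_continuous cvQ)); apply: eq_bigr => j _.
    have [a1 a2] := l_in j; have [[Z1' [c' [d' [_ cQ' _ _ _]]]] lin _ _] := hZQ j.
    set sl := (v (X j.+1) - v (X j)) / (X j.+1 - X j).
    (* On the cell v is its error plus an affine function, and the latter is orthogonal to Q. *)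
    rewrite (@eq_Int _ _ _ _ (fun x => e j x * (ZQ j).2 x +
       ((v (X j) - sl * X j) + sl * x) * (ZQ j).2 x)); last first.
      move=> x hx; have [_ ->] := ZE j x hx; rewrite eE// /q (interp_elem v hX (ltn_ord j)); last first.
        by case/andP: hx => h1 h2; rewrite !ltW.
      by rewrite -/sl; ring.
    rewrite IntD ?lin ?addr0//; apply: itgb_cont; first by apply: contM.
    by apply: contM => //; apply: contD; [exact: contC|apply: contM; [exact: contC|exact: contI]].
  have lo : N2 ^+ 2 - dl * L <= \sum_(j < M) Int (X j) (X j.+1) (fun x => e j x * (ZQ j).2 x).
    have -> : dl * L = \sum_(j < M) dl * (X j.+1 - X j).
      rewrite -mulr_sumr; congr (_ * _).
      by rewrite -(big_mkord xpredT (fun i => X i.+1 - X i)) telescope_sumr// XM X0 subr0.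
    by rewrite N2E -sumrB; apply: ler_sum => j _; have [] := hZQ j.
  have hi : L2norm L Z <= 2 * h ^+ 2 * N2.
    apply: L2norm_le; first by rewrite !mulr_ge0// exprn_ge0.
    rewrite (Int_mesh hX); last by apply: itgb_cont; exact: contX.
    rewrite !exprMn N2E mulr_sumr; apply: ler_sum => j _.
    rewrite (@eq_Int _ _ _ _ (fun x => (ZQ j).1 x ^+ 2)); last by move=> x /(ZE j)[->].
    have [_ _ _ h4] := hZQ j; apply: (le_trans h4); apply: ler_wpM2r.
      by apply: Int_ge0 => x _; exact: sqr_ge0.
    have -> : 2 ^+ 2 * (h ^+ 2) ^+ 2 = 4 * h ^+ 4 by ring.
    have hj0 : 0 <= X j.+1 - X j by rewrite subr_ge0; exact: ltW (l_lt j).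
    apply: ler_wpM2l => //; apply: lerXn2r; rewrite ?nnegrE//.
    exact: mesh_diam_le.
  move=> h1; apply: (le_trans lo); apply: (le_trans (ler_norm _)); apply: (le_trans h1).
  exact: ler_wpM2l.
(* With dl = ep / L the losses of [element_test], summed over the cells, amount to ep. *)
have fin : N2 ^+ 2 <= S * (2 * h ^+ 2 * N2).
  apply/ler_addgt0Pr => ep ep0.
  have := key (ep / L); rewrite divr_gt0// divfK ?gt_eqF// => /(_ isT); lra.
have [->|Nn0] := eqVneq N2 0; first by rewrite !mulr_ge0// exprn_ge0.
have Np : 0 < N2 by rewrite lt_def Nn0.
by rewrite -(ler_pM2r Np); move: fin; rewrite expr2; lra.
Qed.

End interpolation.

(** * Weak derivatives and H2 functions *)

Section primitive.
Context {R : realType}.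
Local Notation mu := (@lebesgue_measure R).
Local Notation TR := (measurableTypeR R).
Implicit Types (a b c d s t x L : R) (f g v : R -> R).

Lemma itgb_cc a b f : itgb a b f -> mu.-integrable `[a, b] (EFin \o f).
Proof.
have [ab hf|ba _] := leP a b; last by rewrite set_itv_ge ?bnd_simp -?ltNge//; exact: integrable_set0.
have mf : measurable_fun (`[a, b] : set R) f.
  exact: measurable_fun_itv_cc (itgb_meas hf).
apply/integrableP; split; first exact/measurable_EFinP.
have := @integral_itv_bndoo R a b (fun x => `|f x|%:E) true false.
move=> ->; first by case/integrableP: hf.
by apply/measurable_EFinP; apply: measurableT_comp => //; exact: itgb_meas hf.
Qed.

Lemma Int_continuous a b f : a <= b -> itgb a b f ->
  {within `[a, b], continuous (fun x => Int a x f)}.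
Proof.
move=> ab hf.
have h := @parameterized_integral_continuous R a b f ab (itgb_cc hf).
apply: (subspace_eq_continuous _ h) => x; rewrite inE/= in_itv/= => /andP[ax xb].
rewrite /from_subspace /parameterized_integral /Int.
have hx : itgb a x f by exact: itgbS hf.
rewrite -Rintegral_itv_obnd_cbnd; last first.
  by apply: (@integrableS _ _ _ mu `[a, x]) (itgb_cc hx) => //; exact: subset_itv_oc_cc.
by rewrite -Rintegral_itv_bndo_bndc.
Qed.

Lemma within_at a b f x : {within `[a, b], continuous f} -> a < x < b -> {for x, continuous f}.
Proof.
move=> cf /andP[ax xb]; have ab := lt_trans ax xb.
have [h _ _] := (continuous_within_itvP f ab).1 cf.
by apply: h; rewrite in_itv/= ax.
Qed.

(** For double primitives g is the primitive of |v|: its continuity makes the remainder negligible,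
    so that v itself need not be continuous. *)
Lemma is_derive_bound f g x l : {for x, continuous g} ->
  (\forall z \near x, `|f z - f x - (z - x) * l| <= `|z - x| * `|g z - g x|) ->
  is_derive x (1 : R) f l.
Proof.
move=> cg nf.
have H : (fun h => h^-1 *: (f (h *: (1 : R) + x) - f x)) @ 0^' --> l.
  apply/cvgrPdist_le => e e0.
  have /cvgrPdist_le/(_ e e0) cg' := cg.
  have /nbhs_ballP[dl /= dl0 h] : \forall z \near x, `|f z - f x - (z - x) * l| <= `|z - x| * e.
    near=> z; apply: le_trans (_ : `|z - x| * `|g z - g x| <= _); first by near: z.
    by apply: ler_wpM2l => //; rewrite distrC; near: z.
  apply/nbhs_ballP; exists dl => //= y; rewrite /ball/= sub0r normrN => yd y0.
  have := h (y + x); rewrite /ball/= opprD addrCA subrr addr0 normrN => /(_ yd).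
  rewrite addrK => hh; rewrite /GRing.scale/= mulr1.
  have -> : l - y^-1 * (f (y + x) - f x) = - (y^-1 * (f (y + x) - f x - y * l)).
    by field.
  by rewrite normrN normrM normfV mulrC ler_pdivrMr ?normr_gt0// [e * _]mulrC.
by apply: DeriveDef; [apply/cvg_ex; exists l|exact: cvg_lim].
Unshelve. all: by end_near. Qed.

Definition dprim v x := Int 0 x (fun y => (x - y) * v y).

Lemma itgb_lin a b (l m : R) v : itgb a b v -> itgb a b (fun y => (l + m * y) * v y).
Proof.
move=> hv; apply: (itgb_le (g := fun y => (`|l| + `|m| * (`|a| + `|b|)) * `|v y|)).
- apply: measurable_funM; last exact: itgb_meas hv.
  by apply: measurable_funD => //; apply: measurable_funM.
- move=> y /andP[ay yb]; rewrite normrM ler_wpM2r// (le_trans (ler_normD _ _))// lerD2l normrM ler_wpM2l//.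
  have := ler_norm b; have := ler_norm (- a); rewrite normrN => h1 h2.
  have := normr_ge0 a; have := normr_ge0 b => h3 h4.
  by rewrite ler_norml; lra.
- by apply: itgbZ; exact: itgb_norm.
Qed.

Lemma itgb_xv a b (x : R) v : itgb a b v -> itgb a b (fun y => (x - y) * v y).
Proof. by move=> /(itgb_lin x (-1)); apply: eq_itgb => y _; rewrite mulN1r. Qed.

Lemma dprimE L v x : itgb 0 L v -> 0 <= x <= L ->
  dprim v x = x * Int 0 x v - Int 0 x (fun y => y * v y).
Proof.
move=> hv /andP[x0 xL]; have hx : itgb 0 x v by exact: itgbS hv.
have h1 : itgb 0 x (fun y => y * v y) by apply: eq_itgb (itgb_lin 0 1 hx) => y _; ring.
by rewrite -IntZ// -IntB//; [apply: eq_Int => y _; ring|exact: itgbZ].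
Qed.

Lemma dprim_taylor L v x z : itgb 0 L v -> 0 <= x <= z -> z <= L ->
  dprim v z = dprim v x + (z - x) * Int 0 x v + Int x z (fun y => (z - y) * v y).
Proof.
move=> hv /andP[x0 xz] zL; have z0 := le_trans x0 xz; have xL := le_trans xz zL.
rewrite (@dprimE L v x)// ?x0//.
have hx : itgb 0 x v by exact: itgbS hv.
have hz : itgb 0 z v by exact: itgbS hv.
have h1 : itgb 0 x (fun y => y * v y) by apply: eq_itgb (itgb_lin 0 1 hx) => y _; ring.
rewrite /dprim (@Int_split _ 0 z x) ?x0//; last exact: itgb_xv.
congr (_ + _).
have -> : Int 0 x (fun y => (z - y) * v y) = z * Int 0 x v - Int 0 x (fun y => y * v y).
  by rewrite -IntZ// -IntB//; [apply: eq_Int => y _; ring|exact: itgbZ].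
ring.
Qed.

Lemma dprim_cont L v : 0 <= L -> itgb 0 L v -> {within `[0, L], continuous (dprim v)}.
Proof.
move=> L0 hv.
have h1 : itgb 0 L (fun y => y * v y) by apply: eq_itgb (itgb_lin 0 1 hv) => y _; ring.
have c1 := Int_continuous L0 hv; have c2 := Int_continuous L0 h1.
have cI : {within `[0, L], continuous (fun x : R => x)} by apply: cont_within; exact: contI.
have c3 : {within `[0, L], continuous (fun x => x * Int 0 x v - Int 0 x (fun y => y * v y))}.
  by move=> x; apply: cvgB; [apply: cvgM; [exact: cI|exact: c1]|exact: c2].
apply: (subspace_eq_continuous _ c3) => x; rewrite inE/= in_itv/= => hx.
by rewrite /from_subspace (dprimE hv).
Qed.

(** By [dprim_taylor] the remainder is an integral between x and z of (z - y) v y, at most |z - x|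
    times the increment of the primitive of |v|. Hence differentiability at every interior point,
    although v is only integrable. *)
Lemma is_derive_dprim L v x : itgb 0 L v -> 0 < x < L ->
  is_derive x 1 (dprim v) (Int 0 x v).
Proof.
move=> hv /andP[x0 xL].
have hn := itgb_norm hv.
have L0 : 0 <= L by rewrite ltW// (lt_trans x0).
have cn : {for x, continuous (fun z => Int 0 z (fun y => `|v y|))}.
  by apply: (within_at (Int_continuous L0 hn)); rewrite x0.
apply: (is_derive_bound cn); near=> z.
have z0 : 0 < z by near: z; exact: lt_nbhsr.
have zL : z < L by near: z; exact: lt_nbhsl.
have bd s t : 0 <= s -> s <= t -> t <= L -> forall c, c = s \/ c = t ->
   `|Int s t (fun y => (c - y) * v y)| <= (t - s) * Int s t (fun y => `|v y|).
  move=> s0 st tL c hc; have hst : itgb s t v by exact: itgbS hv.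
  have hst' := itgb_norm hst.
  rewrite -IntZ//; apply: Int_abs_le; [exact: itgb_xv|exact: itgbZ|].
  move=> y /andP[sy yt]; rewrite normrM ler_wpM2r// ler_norml; case: hc => ->; lra.
have [xz|zx] := leP x z.
  rewrite (@dprim_taylor L v x z hv) ?(ltW x0)// ?(ltW zL)//.
  have := bd x z (ltW x0) xz (ltW zL) z (or_intror erefl).
  rewrite [in X in _ -> _ <= _ * `|X|](@Int_split _ 0 z x) ?(ltW x0) ?xz//; last exact: itgbS (lexx _) (ltW zL) hn.
  set I1 := Int x z _; set I2 := Int x z _; set I3 := Int 0 x (fun y => `|v y|).
  have -> : dprim v x + (z - x) * Int 0 x v + I1 - dprim v x - (z - x) * Int 0 x v = I1 by ring.
  have -> : I3 + I2 - I3 = I2 by ring.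
  have I20 : 0 <= I2 by apply: Int_ge0.
  by rewrite (ger0_norm I20) (ger0_norm (_ : 0 <= z - x)) ?subr_ge0.
rewrite (@dprim_taylor L v z x hv) ?(ltW z0) ?(ltW zx)// ?(ltW xL)//.
have := bd z x (ltW z0) (ltW zx) (ltW xL) z (or_introl erefl).
have hzx : itgb z x v by exact: itgbS (ltW z0) (ltW xL) hv.
rewrite [in X in _ -> _ <= _ * `|X|](@Int_split _ 0 x z) ?(ltW z0)// ?(ltW zx)//; last exact: itgbS (lexx _) (ltW xL) hn.
rewrite (@Int_split _ 0 x z v) ?(ltW z0)// ?(ltW zx)//; last exact: itgbS (lexx _) (ltW xL) hv.
have -> : Int z x (fun y => (x - y) * v y) = Int z x (fun y => (z - y) * v y) + (x - z) * Int z x v.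
  rewrite -IntZ// -IntD//; [by apply: eq_Int => y _; ring|exact: itgb_xv|exact: itgbZ].
set I1 := Int z x (fun y => (z - y) * v y); set I2 := Int z x _; set I3 := Int 0 z (fun y => `|v y|).
set I4 := Int z x v.
have -> : dprim v z - (dprim v z + (x - z) * Int 0 z v + (I1 + (x - z) * I4)) - (z - x) * (Int 0 z v + I4) = - I1 by ring.
have -> : I3 - (I3 + I2) = - I2 by ring.
have I20 : 0 <= I2 by apply: Int_ge0.
by rewrite !normrN (ger0_norm I20) distrC (ger0_norm (_ : 0 <= x - z)) ?subr_ge0 ?(ltW zx).
Unshelve. all: by end_near. Qed.

End primitive.

(** * Fubini with an integrable majorant of the sections *)

Section fubini_itv.
Context {R : realType}.
Local Notation mu := (@lebesgue_measure R).
Local Notation TR := (measurableTypeR R).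
Implicit Types (a b c d s t x L : R) (f g v w : R -> R) (A B : set TR) (H : TR -> TR -> R).

Lemma mf2_1 A B f : measurable A -> measurable B -> measurable_fun A f -> mfun2 A B (fun x _ => f x).
Proof.
move=> mA mB mf; apply: (measurable_comp (F := A)) => //.
  by move=> _ [[x y] [/= h _] <-].
by apply: measurable_funTS; exact: measurable_fst.
Qed.

Lemma mf2_2 A B f : measurable A -> measurable B -> measurable_fun B f -> mfun2 A B (fun _ y => f y).
Proof.
move=> mA mB mf; apply: (measurable_comp (F := B)) => //.
  by move=> _ [[x y] [/= _ h] <-].
by apply: measurable_funTS; exact: measurable_snd.
Qed.

Lemma mf2M A B H H' : mfun2 A B H -> mfun2 A B H' -> mfun2 A B (fun x y => H x y * H' x y).
Proof. by move=> h h'; apply: measurable_funM. Qed.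

Lemma mf2B A B H H' : mfun2 A B H -> mfun2 A B H' -> mfun2 A B (fun x y => H x y - H' x y).
Proof. by move=> h h'; apply: measurable_funB. Qed.

Lemma mf2D A B H H' : mfun2 A B H -> mfun2 A B H' -> mfun2 A B (fun x y => H x y + H' x y).
Proof. by move=> h h'; apply: measurable_funD. Qed.

Lemma mf2S A B A' B' H : measurable A -> measurable B -> A' `<=` A -> B' `<=` B ->
  mfun2 A B H -> mfun2 A' B' H.
Proof.
move=> mA mB AA BB; apply: measurable_funS; first exact: measurableX.
by move=> [x y] [/= hx hy]; split => /=; [exact: AA|exact: BB].
Qed.

Lemma mf2_lt A B : measurable A -> measurable B -> mfun2 A B (fun x y => kap 1 (x - y)).
Proof.
move=> mA mB; apply: measurable_kap_comp; apply: measurable_funB; apply: measurable_funTS.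
  exact: measurable_fst.
exact: measurable_snd.
Qed.

Lemma aeS (P Q : R -> Prop) : (forall x, P x -> Q x) -> {ae mu, forall x, P x} -> {ae mu, forall x, Q x}.
Proof. by move=> PQ; apply: (@filterS _ _ (ae_filter_ringOfSetsType mu)) => x; exact: PQ. Qed.

Lemma kap1 x : kap 1 x = (0 < x)%R%:R.
Proof. by rewrite /kap; case: ifP; rewrite ?omega1. Qed.

(** Tonelli's condition from a majorant of the L1 norms of the sections, asked for almost every y
    only; this suits functions that are regular at almost every time. *)
Lemma Ifubini a b c d H g :
  mfun2 (`]a, b[%classic : set TR) (`]c, d[%classic : set TR) H ->
  {ae mu, forall y, c < y < d -> itgb a b (H^~ y) /\ Int a b (fun x => `|H x y|) <= g y} ->
  itgb c d g ->
  [/\ {ae mu, forall x, a < x < b -> itgb c d (H x)},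
      itgb a b (fun x => Int c d (H x)),
      itgb c d (fun y => Int a b (H^~ y)) &
      Int a b (fun x => Int c d (H x)) = Int c d (fun y => Int a b (H^~ y))].
Proof.
move=> mH bd ig.
have mA : measurable (`]a, b[%classic : set TR) by exact: measurable_itv.
have mB : measurable (`]c, d[%classic : set TR) by exact: measurable_itv.
have fin : (\int[mu]_(y in (`]c, d[%classic : set TR)) \int[mu]_(x in (`]a, b[%classic : set TR)) `|H x y|%:E < +oo)%E.
  apply: (@le_lt_trans _ _ (\int[mu]_(y in `]c, d[) `|g y|%:E)%E); last first.
    by have /integrableP[] := ig.
  apply: ae_ge0_le_integral => //.
  - by move=> y _; apply: integral_ge0 => x _; rewrite lee_fin.
  - exact: (measurable_abs_int mB mA (mfun2_swap mA mB mH)).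
  - by apply/measurable_EFinP; apply: measurableT_comp => //; exact: itgb_meas ig.
  apply: aeS bd => y h /in_oo/h[iy ly].
  rewrite -(@fineK _ (\int[mu]_(x in _) _)%E).
    by rewrite lee_fin (le_trans ly)// ler_norm.
  rewrite ge0_fin_numE; first by have /integrableP[] := iy.
  by apply: integral_ge0 => x _; rewrite lee_fin.
have [h1 _ h3 h4 h5] := Rfubini mA mB mH fin.
by split => //; apply: aeS h1 => x h /in_oo/h.
Qed.

End fubini_itv.

(** * Functions with an integrable weak second derivative *)

Section h2rep.
Context {R : realType}.
Local Notation mu := (@lebesgue_measure R).
Local Notation TR := (measurableTypeR R).
Implicit Types (a b c d s t x L : R) (f g v w : R -> R).

(** Fubini on the triangle y < x, which [kap 1] encodes; the inner integral of Z1 over ]y, L[ is - Z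
    y. *)
Lemma Int_parts_L1 L w Z Z1 : 0 <= L -> itgb 0 L w -> (forall x, is_derive x (1 : R) Z (Z1 x)) ->
  continuous Z1 -> Z L = 0 ->
  Int 0 L (fun x => Int 0 x w * Z1 x) = - Int 0 L (fun y => w y * Z y).
Proof.
move=> L0 iw dZ cZ1 ZL.
pose H : TR -> TR -> R := fun x y => Z1 x * w y * kap 1 (x - y).
have mI : measurable (`]0, L[%classic : set TR) by exact: measurable_itv.
have mH : mfun2 (`]0, L[%classic : set TR) (`]0, L[%classic : set TR) H.
  apply: mf2M; last exact: mf2_lt.
  by apply: mf2M; [apply: mf2_1|apply: mf2_2] => //; [exact: cont_measurable|exact: itgb_meas iw].
have iZ1 : itgb 0 L Z1 by exact: itgb_cont.
have iZ y : itgb 0 L (fun x => Z1 x * kap 1 (x - y)).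
  apply: itgb_le (itgb_norm iZ1).
    apply: measurable_funM; first exact: itgb_meas iZ1.
    by apply: measurable_kap_comp; apply: measurable_funB.
  by move=> x _; rewrite normrM kap1; case: (0 < _); rewrite ?normr1 ?normr0 ?mulr1 ?mulr0.
have eH y : H^~ y = fun x => w y * (Z1 x * kap 1 (x - y)).
  by apply/funext => x; rewrite /H; ring.
have [|||_ _ _ e] := @Ifubini R 0 L 0 L H (fun y => Int 0 L (fun x => `|Z1 x|) * `|w y|).
- exact: mH.
- apply: aeW => y _; rewrite eH; split; first exact: itgbZ.
  rewrite (@eq_Int _ _ _ _ (fun x => `|w y| * `|Z1 x * kap 1 (x - y)|)); last first.
    by move=> x _; rewrite /H !normrM; ring.
  rewrite IntZ; last exact: itgb_norm.
  rewrite mulrC ler_wpM2r//; apply: Int_le; [exact: itgb_norm|exact: itgb_norm|].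
  by move=> x _; rewrite normrM kap1; case: (0 < _); rewrite ?normr1 ?normr0 ?mulr1 ?mulr0.
- by apply: itgbZ; exact: itgb_norm.
have e1 x : 0 < x < L -> Int 0 x w * Z1 x = Int 0 L (H x).
  move=> /andP[x0 xL]; have -> : Int 0 L (H x) = Int 0 x (H x).
    apply: Int_supp; [exact: lexx|exact: ltW|].
    by move=> y /andP[y0 yL]; rewrite y0/= => yx; rewrite /H kap1 subr_gt0 (negbTE yx) mulr0.
  rewrite mulrC -IntZ; last exact: itgbS (lexx _) (ltW xL) iw.
  by apply: eq_Int => y /andP[y0 yx]; rewrite /H kap1 subr_gt0 yx mulr1.
rewrite (eq_Int e1) e -IntN; last first.
  apply: itgb_le (itgbZ (Int 0 L (fun x => `|Z1 x|)) (itgb_norm iw)).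
    apply: measurable_funM; first exact: itgb_meas iw.
    by apply: cont_measurable; exact: is_derive_cont dZ.
  move=> y /andP[y0 yL]; rewrite normrM mulrC; apply: ler_wpM2r; first exact: normr_ge0.
  have := @FTC2 _ y L Z1 Z (ltW yL) (@cont_within _ _ _ _ cZ1) (@cont_within _ _ _ _ (is_derive_cont dZ)) (fun x _ => dZ x).
  rewrite ZL sub0r -normrN => <-.
  have iy : itgb y L Z1 by exact: itgbS (ltW y0) (lexx _) iZ1.
  apply: (le_trans (Int_abs iy)).
  rewrite (@Int_split _ 0 L y _ _ (itgb_norm iZ1)); last by rewrite (ltW y0) (ltW yL).
  by rewrite lerDr; apply: Int_ge0.
apply: eq_Int => y /andP[y0 yL].
transitivity (w y * Int 0 L (fun x => Z1 x * kap 1 (x - y))).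
  by rewrite -(IntZ _ (iZ y)); apply: eq_Int => x _; rewrite /H; ring.
rewrite -mulrN; congr (_ * _).
have := @FTC2 _ y L Z1 Z (ltW yL) (@cont_within _ _ _ _ cZ1) (@cont_within _ _ _ _ (is_derive_cont dZ)) (fun x _ => dZ x).
rewrite ZL sub0r => <-.
have -> : Int 0 L (fun x => Z1 x * kap 1 (x - y)) = Int y L (fun x => Z1 x * kap 1 (x - y)).
  apply: Int_supp; [exact: ltW|exact: lexx|].
  by move=> x /andP[x0 xL]; rewrite xL andbT => /negbTE yx; rewrite kap1 subr_gt0 yx mulr0.
by apply: eq_Int => x /andP[yx _]; rewrite kap1 subr_gt0 yx mulr1.
Qed.

(** A nonzero value would persist on an interval of positive length. The extension by [clamp] treats
    the end points like the others. *)
Lemma cont_ae0 a b v : a < b -> {within `[a, b], continuous v} ->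
  {ae mu, forall x, a < x < b -> v x = 0} -> forall x, a <= x <= b -> v x = 0.
Proof.
move=> ab cv v0 x hx; apply/eqP; apply: contraT => vx.
have /(_ x)/cvgrPdist_lt/(_ _ (_ : 0 < `|v x|)) := clamp_cont (ltW ab) cv.
rewrite normr_gt0 => /(_ vx)/nbhs_ballP[e /= e0 he].
pose c := Num.max a (x - e); pose d := Num.min b (x + e).
have cd : c < d by rewrite /c /d gt_max !lt_min; lra.
have : mu.-negligible (`]c, d[ : set R).
  apply: negligibleS v0 => y /=; rewrite in_itv/= gt_max lt_min => /andP[/andP[y0 yx] /andP[yL xy]] h.
  have := he y; rewrite /ball/= => /(_ _)/wrap[]; first by rewrite ltr_norml; lra.
  rewrite !clampE//; last by rewrite (ltW y0) (ltW yL).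
  by rewrite h ?y0//  subr0 ltxx.
rewrite negligibleP; last exact: measurable_itv.
change (mu (`]c, d[ : set R) = 0 -> false).
rewrite lebesgue_measure_itv/= lte_fin cd => /eqP; rewrite -EFinB eqe subr_eq0 => /eqP dc.
by move: cd; rewrite dc ltxx.
Qed.

Lemma ctest_ends a b Z Q : ctest a b Z Q -> exists Z1, [/\ continuous Q,
  forall x, is_derive x (1 : R) Z (Z1 x), forall x, is_derive x (1 : R) Z1 (Q x), Z b = 0 & Z1 a = 0 /\ Z1 b = 0].
Proof.
move=> [Z1 [c [d [[ac cd db] cQ dZ dZ1 out]]]]; exists Z1.
have [|_ z1a _] := out a; first by apply/negP => /andP[]; lra.
have [|zb z1b _] := out b; first by apply/negP => /andP[]; lra.
by split.
Qed.

(** Two integrations by parts: the first by the fundamental theorem, as [dprim] has a continuous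
    derivative, the second by [Int_parts_L1]. *)
Lemma dprim_weak L w Z Q : 0 < L -> itgb 0 L w -> ctest 0 L Z Q ->
  Int 0 L (fun x => dprim w x * Q x) = Int 0 L (fun x => w x * Z x).
Proof.
move=> L0 iw /ctest_ends[Z1 [cQ dZ dZ1 ZL [Z10 Z1L]]].
have cZ1 := is_derive_cont dZ1; have cZ := is_derive_cont dZ.
have cD := dprim_cont (ltW L0) iw; have cP := Int_continuous (ltW L0) iw.
have cW (f : R -> R) : continuous f -> {within `[0, L], continuous f} by exact: cont_within.
have i1 : itgb 0 L (fun x => Int 0 x w * Z1 x).
  by apply: itgb_continuous => x; apply: cvgM; [exact: cP|exact: (cW Z1)].
have i2 : itgb 0 L (fun x => dprim w x * Q x).
  by apply: itgb_continuous => x; apply: cvgM; [exact: cD|exact: (cW Q)].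
have := @FTC2 _ 0 L (fun x => Int 0 x w * Z1 x + dprim w x * Q x) (fun x => dprim w x * Z1 x) (ltW L0).
rewrite Z10 Z1L !mulr0 subr0 IntD// (Int_parts_L1 (ltW L0) iw dZ cZ1 ZL) => h.
apply/eqP; rewrite -subr_eq0 addrC; apply/eqP; apply: h.
- move=> x; apply: cvgD; apply: cvgM; [exact: cP|exact: (cW Z1)|exact: cD|exact: (cW Q)].
- by move=> x; apply: cvgM; [exact: cD|exact: (cW Z1)].
move=> x hx; have d1 := is_derive_dprim iw hx.
have := is_deriveM d1 (dZ1 x); congr (is_derive _ _ _ _).
by rewrite /GRing.scale/= addrC mulrC.
Qed.

Lemma mesh1 L : 0 < L -> spatial_mesh L 1 (fun j => if j == 0%N then 0 else L).
Proof. by move=> L0; split => // -[]. Qed.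

(** A lemma of du Bois-Reymond of order two, obtained from the interpolation estimate on the mesh
    with a single cell and with S = 0: v - dprim w pairs to 0 with every Q, so it equals its
    chord. *)
Lemma dprim_unique L v w : 0 < L -> {within `[0, L], continuous v} -> itgb 0 L w ->
  (forall Z Q, ctest 0 L Z Q -> Int 0 L (fun x => v x * Q x) = Int 0 L (fun x => w x * Z x)) ->
  exists A B : R, forall x, 0 <= x <= L -> v x = A + B * x + dprim w x.
Proof.
move=> L0 cv iw h.
have cD := dprim_cont (ltW L0) iw.
pose e x := v x - dprim w x.
have ce : {within `[0, L], continuous e} by move=> x; apply: cvgB; [exact: cv|exact: cD].
have hX := mesh1 L0; set X := (fun j => _) in hX.
have := @interp_error R L 1 X e 0 L0 hX ce (lexx 0).
rewrite mulr0 => H.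
have /H e0 : forall Z Q, ctest 0 L Z Q -> `|Int 0 L (fun x => e x * Q x)| <= 0 * L2norm L Z.
  move=> Z Q ZQ; rewrite mul0r normr_le0; apply/eqP.
  have cQ : continuous Q by have [? []] := ctest_ends ZQ.
  rewrite (@eq_Int _ _ _ _ (fun x => v x * Q x - dprim w x * Q x)); last first.
    by move=> x _; rewrite /e mulrBl.
  have cQ' := @cont_within _ Q 0 L cQ.
  rewrite IntB; first by rewrite (h Z Q ZQ) (dprim_weak L0 iw ZQ) subrr.
    by apply: itgb_continuous => x; apply: cvgM; [exact: cv|exact: cQ'].
  by apply: itgb_continuous => x; apply: cvgM; [exact: cD|exact: cQ'].
pose q x := e x - interp 1 X e x.
have cq : {within `[0, L], continuous q}.
  have cI : {within `[0, L], continuous (interp 1 X e)}.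
    by apply: cont_within; exact: interp_cont hX.
  by move=> x; apply: cvgB; [exact: ce|exact: cI].
have q0 : Int 0 L (fun x => q x ^+ 2) = 0.
  by rewrite -L2norm_sqr; apply/eqP; rewrite sqrf_eq0 eq_le e0 L2norm_ge0.
have eE x : 0 <= x <= L -> interp 1 X e x = e 0 + (e L - e 0) / L * x.
  by move=> hx; rewrite (@interp_elem R L 1 X e 0 x)//= !subr0.
have z x : 0 <= x <= L -> q x = 0.
  apply: (cont_ae0 L0 cq); have iq : itgb 0 L (fun x => q x ^+ 2).
    by apply: itgb_continuous => y; apply: cvgM; exact: cq.
  have := Int0_ae iq (fun x _ => sqr_ge0 _) q0.
  by apply: aeS => y hy /hy/eqP; rewrite sqrf_eq0 => /eqP.
exists (e 0), ((e L - e 0) / L) => x hx; rewrite -eE//.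
by move: (z x hx) => /eqP; rewrite /q subr_eq0 => /eqP <-; rewrite /e subrK.
Qed.

End h2rep.

(** * Continuous functions as primitives of their weak derivatives *)

Section h2conseq.
Context {R : realType}.
Local Notation mu := (@lebesgue_measure R).
Local Notation TR := (measurableTypeR R).
Implicit Types (a b c d s t x L : R) (f g v w : R -> R).

Lemma Int_bndc a y f : itgb a y f -> \int[mu]_(x in `]a, y]) f x = Int a y f.
Proof. by move=> h; rewrite /Int -Rintegral_itv_bndo_bndc. Qed.

Lemma itgb_oc a y f : itgb a y f -> mu.-integrable `]a, y] (EFin \o f).
Proof.
move=> h; apply: integrableS (itgb_cc h) => //; exact: subset_itv_oc_cc.
Qed.

Lemma near_oo a b x : a < x < b -> \forall y \near x, a < y < b.
Proof.
move=> /andP[ax xb]; near=> y; apply/andP; split; near: y; [exact: lt_nbhsr|exact: lt_nbhsl].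
Unshelve. all: by end_near. Qed.

Lemma is_derive_Int_at L f x : itgb 0 L f -> 0 < x < L -> {for x, continuous f} ->
  is_derive x 1 (fun z => Int 0 z f) (f x).
Proof.
move=> hf hx cf; have /andP[x0 xL] := hx.
have h0 : ((BRight 0 : itv_bound R) < BRight x)%O by rewrite bnd_simp.
have [] := @continuous_FTC1 R f (BRight 0) x L xL (itgb_oc hf) h0 cf.
rewrite derive1E => d1 d2; apply: near_eq_is_derive (DeriveDef d1 d2).
near=> y; apply: Int_bndc.
have /andP[y0 yL] : 0 < y < L by near: y; exact: near_oo.
exact: itgbS (lexx _) (ltW yL) hf.
Unshelve. all: by end_near. Qed.

Lemma derive_Int_ae L f : itgb 0 L f ->
  {ae mu, forall x, 0 < x < L -> is_derive x 1 (fun z => Int 0 z f) (f x)}.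
Proof.
move=> hf; pose F := f \_ `]0, L[%classic.
have iF : mu.-integrable setT (EFin \o F).
  rewrite (_ : EFin \o F = (EFin \o f) \_ `]0, L[%classic); last first.
    by apply/funext => x; rewrite /F /= !patchE; case: ifP.
  by rewrite -integrable_mkcond.
have lF : locally_integrable setT F by apply: open_integrable_locally => //; exact: openT.
have iFy y : mu.-integrable `]0, y] (EFin \o F) by apply: integrableS iF.
have FE x : 0 < x < L -> F x = f x by move=> hx; rewrite /F patchE mem_set//= in_itv.
apply: aeS (FTC1 (a := BRight 0) iFy lF) => x h hx.
have h0 : ((BRight 0 : itv_bound R) < BRight x)%O by rewrite bnd_simp; case/andP: hx.
have [d1 d2] := h h0.
rewrite -(FE x hx); rewrite derive1E in d2.
apply: near_eq_is_derive (DeriveDef d1 d2).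
near=> y; have /andP[y0 yL] : 0 < y < L by near: y; exact: near_oo.
rewrite Int_bndc; last by apply: integrableS iF.
by apply: eq_Int => z /andP[z0 zy]; rewrite FE// z0 (lt_trans zy).
Unshelve. all: by end_near. Qed.

(** The primitive of v has g as second weak derivative, so [dprim_unique] makes it an affine
    function plus [dprim g]. Differentiating this identity gives v = B + the primitive of g inside,
    and continuity extends it to the ends. *)
Lemma weak1_0 L v g : 0 < L -> {within `[0, L], continuous v} -> itgb 0 L g ->
  weak_deriv 0 L v g -> forall x, 0 <= x <= L -> v x = v 0 + Int 0 x g.
Proof.
move=> L0 cv ig wd.
have iv := itgb_continuous cv.
have cV := Int_continuous (ltW L0) iv; have cG := Int_continuous (ltW L0) ig.
have dV x : 0 < x < L -> is_derive x 1 (fun z => Int 0 z v) (v x).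
  by move=> hx; exact: is_derive_Int_at iv hx (within_at cv hx).
have [] := @dprim_unique R L (fun x => Int 0 x v) g L0 cV ig.
  move=> Z Q ZQ; have [tZ _ _] := ctestP ZQ.
  have [Z1 [cQ dZ dZ1 ZL [Z10 Z1L]]] := ctest_ends ZQ.
  have cZ1 := is_derive_cont dZ1.
  have cW (f : R -> R) : continuous f -> {within `[0, L], continuous f} by exact: cont_within.
  have := wd _ tZ; rewrite (is_derive_fun dZ) => /eqP; rewrite -subr_eq0 opprK => /eqP h.
  have := @FTC2 _ 0 L (fun x => v x * Z1 x + Int 0 x v * Q x) (fun x => Int 0 x v * Z1 x) (ltW L0).
  rewrite Z10 Z1L !mulr0 subr0 IntD//; first last.
  - by apply: itgb_continuous => x; apply: cvgM; [exact: cV|exact: (cW Q)].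
  - by apply: itgb_continuous => x; apply: cvgM; [exact: cv|exact: (cW Z1)].
  have c1 : {within `[0, L], continuous (fun x => v x * Z1 x + Int 0 x v * Q x)}.
    by move=> x; apply: cvgD; apply: cvgM; [exact: cv|exact: (cW Z1)|exact: cV|exact: (cW Q)].
  have c2 : {within `[0, L], continuous (fun x => Int 0 x v * Z1 x)}.
    by move=> x; apply: cvgM; [exact: cV|exact: (cW Z1)].
  move=> /(_ c1 c2) H; have {H} : Int 0 L (fun x => v x * Z1 x) + Int 0 L (fun x => Int 0 x v * Q x) = 0.
    apply: H => x hx; have := is_deriveM (dV x hx) (dZ1 x); congr (is_derive _ _ _ _).
    by rewrite /GRing.scale/= addrC mulrC.
  move: h; rewrite -/(Int 0 L _) -/(Int 0 L (fun x => g x * Z x)).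
  move: (Int 0 L _) (Int 0 L _) (Int 0 L _) => i j k; lra.
move=> A [B h].
have e0 x : 0 < x < L -> v x - (B + Int 0 x g) = 0.
  move=> hx; apply/eqP; rewrite subr_eq0; apply/eqP.
  have d1 := is_derive_dprim ig hx.
  have d2 : is_derive x 1 (fun z => A + B * z + dprim g z) (B + Int 0 x g).
    have := is_deriveD (is_deriveD (is_derive_cst A x (1 : R)) (is_deriveZ B (is_derive_id x (1 : R)))) d1.
    by rewrite add0r /GRing.scale/= mulr1.
  have d3 := dV x hx.
  rewrite -(derive_val (is_derive := d3)) -(derive_val (is_derive := d2)).
  apply: near_eq_derive; near=> y.
  have /andP[y0 yL] : 0 < y < L by near: y; exact: near_oo.
  by rewrite h// (ltW y0) (ltW yL).
have ce : {within `[0, L], continuous (fun x => v x - (B + Int 0 x g))}.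
  have cB : {within `[0, L], continuous (fun=> B)} by apply: cont_within; exact: contC.
  by move=> x; apply: cvgB; [exact: cv|apply: cvgD; [exact: cB|exact: cG]].
have z x : 0 <= x <= L -> v x - (B + Int 0 x g) = 0.
  by apply: (cont_ae0 L0 ce); apply: aeW => y; exact: e0.
have := z 0; rewrite lexx (ltW L0) => /(_ isT) /eqP.
rewrite [Int 0 0 g]Int_nil// addr0 subr_eq0 => /eqP ->.
by move=> x hx; apply/eqP; rewrite -subr_eq0; apply/eqP; exact: z.
Unshelve. all: by end_near. Qed.

(** Moves an interval such as ]- tau, T[ to one starting at 0, where [dprim] is based. *)
Lemma weak_deriv_shift a b v g : {within `[a, b], continuous v} -> itgb a b g ->
  weak_deriv a b v g -> weak_deriv 0 (b - a) (fun x => v (x + a)) (fun x => g (x + a)).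
Proof.
move=> cv ig wd psi [dpsi cpsi [c [d [c0 cd db pz]]]].
have E (f : R -> R) : itgb a b f -> Int a b f = Int 0 (b - a) (fun x => f (x + a)).
  move=> mf; have := @Int_affine R 1 a 0 (b - a) f ltr01.
  rewrite !mul1r add0r subrK => ->; last exact: itgb_meas mf.
  by apply: eq_Int => x _; rewrite mul1r.
have dP x : is_derive x 1 (fun z => psi (z - a)) (derive1 psi (x - a)).
  have d1 : is_derive (x - a) 1 psi (derive1 psi (x - a)).
    by apply: DeriveDef; [exact: dpsi|rewrite derive1E].
  have d2 : is_derive x 1 (fun z : R => z - a) 1.
    have := is_deriveB (is_derive_id x (1 : R)) (is_derive_cst a x (1 : R)).
    by rewrite subr0.
  by have := @is_derive1_comp _ psi (fun z => z - a) x _ _ d1 d2; rewrite mulr1.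
have eP := is_derive_fun dP.
have cP : continuous (fun z => psi (z - a)) by exact: is_derive_cont dP.
have cP' : continuous (fun z => derive1 psi (z - a)).
  by move=> x; apply: continuous_comp; [apply: cvgB => //; exact: cvg_cst|exact: cpsi].
have tP : test_function a b (fun z => psi (z - a)).
  split; first by move=> x; have [] := dP x.
    by rewrite eP.
  exists (c + a), (d + a); split; [lra|lra|lra|].
  move=> x xn; apply: pz; apply: contra xn; rewrite !in_itv/=; lra.
have := wd _ tP; rewrite eP.
rewrite -/(Int a b _) -/(Int a b (fun x => g x * _)).
have i1 : itgb a b (fun x => v x * derive1 psi (x - a)).
  have cP'' := @cont_within _ _ a b cP'.
  by apply: itgb_continuous => x; apply: cvgM; [exact: cv|exact: cP''].
have i2 : itgb a b (fun x => g x * psi (x - a)).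
  have [M hM] : exists M, forall x, a <= x <= b -> `|psi (x - a)| <= M.
    have [ab|ba] := leP a b; last by exists 0 => x; lra.
    have [m _ hm] := EVT_max ab (@cont_within _ _ a b (contNorm cP)).
    by exists (`|psi (m - a)|) => x hx; apply: hm; rewrite in_itv.
  apply: itgb_le (itgbZ M (itgb_norm ig)).
    by apply: measurable_funM; [exact: itgb_meas ig|exact: cont_measurable].
  move=> x /andP[ax xb]; rewrite normrM mulrC ler_wpM2r// hM// (ltW ax)//; exact: ltW.
rewrite (E _ i1) (E _ i2) => h; rewrite -!/(Int 0 (b - a) _).
rewrite -(@eq_Int _ _ _ (fun x => v (x + a) * derive1 psi (x + a - a))); last first.
  by move=> x _; rewrite addrK.
by rewrite h; congr (- _); apply: eq_Int => x _; rewrite addrK.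
Qed.

Lemma weak1 a b v g s t : {within `[a, b], continuous v} -> itgb a b g ->
  weak_deriv a b v g -> a <= s -> s <= t -> t <= b -> v t - v s = Int s t g.
Proof.
move=> cv ig wd as' st tb.
have [->|sNt] := eqVneq s t; first by rewrite subrr Int_nil.
have ab : a < b by rewrite (le_lt_trans as')// (lt_le_trans _ tb)// lt_neqAle sNt.
have cv' : {within `[0, b - a], continuous (fun x => v (x + a))}.
  have h : ccont (fun x => v (clamp a b (x + a))).
    move=> x; apply: (@continuous_comp _ _ _ (fun x => x + a) (fun y => v (clamp a b y))).
      by apply: cvgD => //; exact: cvg_cst.
    exact: clamp_cont (ltW ab) cv _.
  have h' := @cont_within _ _ 0 (b - a) h.
  apply: (subspace_eq_continuous _ h') => x; rewrite inE/= in_itv/= => hx.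
  by rewrite /from_subspace clampE//; lra.
have ig' : itgb 0 (b - a) (fun x => g (x + a)).
  have := @itgb_affine R 1 a 0 (b - a) g ltr01; rewrite !mul1r add0r subrK => /(_ ig).
  by apply: eq_itgb => x _; rewrite mul1r.
have E x : a <= x <= b -> v x = v a + Int a x g.
  move=> hx; have := @weak1_0 (b - a) _ _ _ cv' ig' (weak_deriv_shift cv ig wd) (x - a).
  rewrite add0r subrK subr_gt0 => /(_ ab) ->; last lra.
  have := @Int_affine R 1 a 0 (x - a) g ltr01; rewrite !mul1r add0r subrK => ->.
    by congr (_ + _); apply: eq_Int => y _; rewrite mul1r.
  by apply: itgb_meas; apply: itgbS ig => //; lra.
rewrite (E t) ?tb ?(le_trans as')// (E s) ?as' ?(le_trans st)//.
rewrite (@Int_split _ a t s g); [ring|by rewrite as'|].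
exact: itgbS ig.
Qed.

End h2conseq.

(** * H2 functions against finite element functions *)

Section h2fe.
Context {R : realType}.
Local Notation mu := (@lebesgue_measure R).
Local Notation TR := (measurableTypeR R).
Implicit Types (a b c d s t x L : R) (f g v w : R -> R) (M : nat) (X : nat -> R).

Lemma H2_weak L v v1 v2 Z Q : in_H2 L v v1 v2 -> ctest 0 L Z Q ->
  Int 0 L (fun x => v x * Q x) = Int 0 L (fun x => v2 x * Z x).
Proof.
move=> [_ _ _ w1 w2] ZQ; have [t1 t2 e] := ctestP ZQ.
by have := w1 _ t2; have := w2 _ t1; rewrite e /Int => -> ->; rewrite opprK.
Qed.

Lemma H2_rep L v v1 v2 : 0 < L -> {within `[0, L], continuous v} -> in_H2 L v v1 v2 ->
  exists A B : R, forall x, 0 <= x <= L -> v x = A + B * x + dprim v2 x.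
Proof.
move=> L0 cv h; have [_ _ l2 _ _] := h.
by apply: (dprim_unique L0 cv (itgb_L2 l2)) => Z Q; exact: H2_weak h.
Qed.

(** The equation uses the classical second derivative, the regularity hypothesis the weak one. By
    [H2_rep] the classical first derivative is a primitive of [v2] plus a constant, and Lebesgue's
    theorem differentiates it almost everywhere. *)
Lemma H2_classic L v v1 v2 : 0 < L -> {within `[0, L], continuous v} -> in_H2 L v v1 v2 ->
  {ae mu, forall x, 0 < x < L -> derive1n 2 v x = v2 x}.
Proof.
move=> L0 cv h; have [A [B e]] := H2_rep L0 cv h.
have i2 : itgb 0 L v2 by have [_ _ l2 _ _] := h; exact: itgb_L2 l2.
have d1 x : 0 < x < L -> derive1 v x = B + Int 0 x v2.
  move=> hx; have d := is_derive_dprim i2 hx.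
  have d2 : is_derive x 1 (fun z => A + B * z + dprim v2 z) (B + Int 0 x v2).
    have := is_deriveD (is_deriveD (is_derive_cst A x (1 : R)) (is_deriveZ B (is_derive_id x (1 : R)))) d.
    by rewrite add0r /GRing.scale/= mulr1.
  rewrite derive1E -(derive_val (is_derive := d2)).
  apply: near_eq_derive; near=> y.
  have /andP[y0 yL] : 0 < y < L by near: y; exact: near_oo.
  by rewrite e// (ltW y0) (ltW yL).
apply: aeS (derive_Int_ae i2) => x dI hx; have {}dI := dI hx.
have d2 : is_derive x 1 (fun z => B + Int 0 z v2) (v2 x).
  by have := is_deriveD (is_derive_cst B x (1 : R)) dI; rewrite add0r.
rewrite /= derive1E -(derive_val (is_derive := d2)).
apply: near_eq_derive; near=> y.
by rewrite -d1//; near: y; exact: near_oo.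
Unshelve. all: by end_near. Qed.

Definition slope X v j : R := (v (X j.+1) - v (X j)) / (X j.+1 - X j).

Lemma slopeE L M X v j : spatial_mesh L M X -> (j < M)%N ->
  slope X v j * (X j.+1 - X j) = v (X j.+1) - v (X j).
Proof. by move=> hX jM; rewrite divfK// subr_eq0 gt_eqF// (mesh_lt hX). Qed.

Lemma slopeB X v w j : slope X (fun x => v x - w x) j = slope X v j - slope X w j.
Proof. by rewrite /slope -mulrBl; congr (_ / _); ring. Qed.

Lemma mesh_M L M X : 0 < L -> spatial_mesh L M X -> (0 < M)%N.
Proof. by case: M => // L0 [X0 XL _]; move: L0; rewrite -XL X0 ltxx. Qed.

Lemma fe_elem L M X v j x : spatial_mesh L M X -> fe_space L M X v -> (j < M)%N ->
  X j <= x <= X j.+1 -> v x = v (X j) + slope X v j * (x - X j).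
Proof.
move=> hX [_ _ _ h] jM hx; have [c [d e]] := h j jM.
have lt := mesh_lt hX jM.
rewrite /slope (e x) ?in_itv//= (e (X j)) ?in_itv/= ?lexx ?(ltW lt)// (e (X j.+1)) ?in_itv/= ?lexx ?(ltW lt)//.
by field; rewrite subr_eq0 gt_eqF.
Qed.

Lemma fe_spaceB L M X v w : fe_space L M X v -> fe_space L M X w ->
  fe_space L M X (fun x => v x - w x).
Proof.
move=> [cv v0 vL ev] [cw w0 wL ew]; split.
- by move=> x; apply: cvgB; [exact: cv|exact: cw].
- by rewrite v0 w0 subrr.
- by rewrite vL wL subrr.
move=> j jM; have [c [d e]] := ev j jM; have [c' [d' e']] := ew j jM.
by exists (c - c'), (d - d') => x hx; rewrite e// e'//; ring.
Qed.

Lemma interp_fe L M X v : 0 < L -> spatial_mesh L M X -> v 0 = 0 -> v L = 0 ->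
  fe_space L M X (interp M X v).
Proof.
move=> L0 hX v0 vL; have M0 := mesh_M L0 hX; have [X0 XM _] := hX.
split.
- by apply: cont_within; exact: interp_cont hX.
- by rewrite -[in LHS]X0 (interp_nodes v hX)// X0.
- by rewrite -[in LHS]XM (interp_nodes v hX)// XM.
move=> j jM; exists (v (X j) - slope X v j * X j), (slope X v j) => x; rewrite in_itv/= => hx.
by rewrite (interp_elem v hX jM hx) /slope; ring.
Qed.

Lemma slope_interp L M X v j : 0 < L -> spatial_mesh L M X -> (j < M)%N ->
  slope X (interp M X v) j = slope X v j.
Proof.
move=> L0 hX jM; have M0 := mesh_M L0 hX.
by rewrite /slope !(interp_nodes v hX)// ltnW.
Qed.

(** The Dirichlet form read off from nodal values. It makes sense for any function and does not
    distinguish u from its interpolant, which thereby plays the role of the Ritz projection of this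
    form. *)
Definition gform M X v w : R := \sum_(j < M) slope X v j * slope X w j * (X j.+1 - X j).

Lemma gform_ge0 L M X v : spatial_mesh L M X -> 0 <= gform M X v v.
Proof.
move=> hX; apply: sumr_ge0 => j _; rewrite mulr_ge0 ?sqr_ge0//.
by rewrite subr_ge0 ltW// (mesh_lt hX).
Qed.

Lemma gformB M X v v' w :
  gform M X (fun x => v x - v' x) w = gform M X v w - gform M X v' w.
Proof. by rewrite -sumrB; apply: eq_bigr => j _; rewrite slopeB; ring. Qed.

Lemma itgb_mesh L M X f : spatial_mesh L M X ->
  (forall j, (j < M)%N -> itgb (X j) (X j.+1) f) -> itgb 0 L f.
Proof.
move=> hX hf; have [X0 XM _] := hX; rewrite -XM -{1}X0.
suff H k : (k <= M)%N -> itgb (X 0%N) (X k) f by exact: H.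
elim: k => [_|k IH kM].
  by rewrite /itgb set_itv_ge ?bnd_simp ?ltxx//; exact: integrable_set0.
apply: (@itgb_split _ _ _ (X k)); [|exact: IH (ltnW kM)|exact: hf].
by rewrite (mesh_le hX) ?(ltnW kM)// (mesh_le hX)// leqnSn.
Qed.

Lemma fe_derive L M X v j x : spatial_mesh L M X -> fe_space L M X v -> (j < M)%N ->
  X j < x < X j.+1 -> derive1 v x = slope X v j.
Proof.
move=> hX fv jM hx.
have d2 : is_derive x 1 (fun z => v (X j) - slope X v j * X j + slope X v j * z) (slope X v j).
  have := is_deriveD (is_derive_cst (v (X j) - slope X v j * X j) x (1 : R)) (is_deriveZ (slope X v j) (is_derive_id x (1 : R))).
  by rewrite add0r /GRing.scale/= mulr1.
rewrite derive1E -(derive_val (is_derive := d2)).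
apply: near_eq_derive; near=> y.
have /andP[y0 yL] : X j < y < X j.+1 by near: y; exact: near_oo.
by rewrite (@fe_elem L M X v j y)//; [ring|rewrite (ltW y0) (ltW yL)].
Unshelve. all: by end_near. Qed.

Lemma fe_grad L M X v w : spatial_mesh L M X -> fe_space L M X v -> fe_space L M X w ->
  L2dot L (derive1 v) (derive1 w) = gform M X v w.
Proof.
move=> hX fv fw; rewrite L2dotE.
have e (j : 'I_M) x : X j < x < X j.+1 -> slope X v j * slope X w j = derive1 v x * derive1 w x.
  by move=> hx; rewrite (fe_derive hX fv (ltn_ord j) hx) (fe_derive hX fw (ltn_ord j) hx).
rewrite (Int_mesh hX); last first.
  by apply: (itgb_mesh hX) => j jM; apply: eq_itgb (e (Ordinal jM)) (itgb_cst _ _ _).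
apply: eq_bigr => j _; rewrite -(eq_Int (e j)) Int_cst//.
exact: ltW (mesh_lt hX (ltn_ord j)).
Qed.

Lemma Bform_fe L M X p a v w : spatial_mesh L M X -> fe_space L M X v -> fe_space L M X w ->
  Bform L p a v w = p * gform M X v w - a * L2dot L v w.
Proof.
move=> hX fv fw; rewrite /Bform (fe_grad hX fv fw); congr (_ - _).
have [cv _ _ _] := fv; have [cw _ _ _] := fw.
rewrite !L2dotE -IntZ; first by apply: eq_Int => x _; rewrite mulrA.
by apply: itgb_continuous => x; apply: cvgM; [exact: cv|exact: cw].
Qed.

(** Integration by parts in each cell, with [P x + B] in the role of v': the boundary terms
    telescope to 0, and the integral of v' over a cell is an increment of v, hence gives a slope. *)
Lemma H2_fe L M X v v1 v2 vh : 0 < L -> spatial_mesh L M X -> {within `[0, L], continuous v} ->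
  in_H2 L v v1 v2 -> fe_space L M X vh ->
  Int 0 L (fun x => v2 x * vh x) = - gform M X v vh.
Proof.
move=> L0 hX cv h fh; have [A [B e]] := H2_rep L0 cv h.
have l2 : L2on 0 L v2 by have [] := h.
have i2 := itgb_L2 l2; have [ch h0 hL _] := fh; have [X0 XM _] := hX.
have i1 : itgb 0 L (fun y => y * v2 y) by apply: eq_itgb (itgb_lin 0 1 i2) => y _; ring.
pose P x := Int 0 x v2; pose E x := Int 0 x (fun y => y * v2 y).
have ev x : 0 <= x <= L -> v x = A + B * x + (x * P x - E x).
  by move=> hx; rewrite e// (dprimE i2).
have iv : itgb 0 L (fun x => v2 x * vh x) by exact: itgb_mulL2 l2 (L2on_continuous ch).
rewrite (Int_mesh hX iv).
have el (j : 'I_M) : Int (X j) (X j.+1) (fun x => v2 x * vh x) =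
   ((P (X j.+1) + B) * vh (X j.+1) - (P (X j) + B) * vh (X j)) - slope X v j * slope X vh j * (X j.+1 - X j).
  have jM := ltn_ord j; have lt := mesh_lt hX jM.
  have /andP[a0 _] := mesh_in hX (ltnW jM); have /andP[_ bL] := mesh_in hX jM.
  set c := X j in lt a0 *; set d := X j.+1 in lt bL *.
  pose m := slope X vh j; pose l := vh c - m * c.
  have fE x : c <= x <= d -> vh x = l + m * x.
    by move=> hx; rewrite (fe_elem hX fh jM hx) /l /m /c; ring.
  have icd : itgb c d v2 by exact: itgbS i2.
  have icd1 : itgb c d (fun y => y * v2 y) by exact: itgbS i1.
  have i0d : itgb 0 d v2 by exact: itgbS i2.
  have i0d1 : itgb 0 d (fun y => y * v2 y) by exact: itgbS i1.
  rewrite (@eq_Int _ _ _ _ (fun x => l * v2 x + m * (x * v2 x))); last first.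
    by move=> x /andP[cx xd]; rewrite fE ?(ltW cx) ?(ltW xd)//; ring.
  rewrite IntD; [|exact: itgbZ|exact: itgbZ]; rewrite !IntZ//.
  have -> : Int c d v2 = P d - P c.
    by rewrite /P (@Int_split _ 0 d c v2) ?a0 ?(ltW lt)//; ring.
  have -> : Int c d (fun y => y * v2 y) = E d - E c.
    by rewrite /E (@Int_split _ 0 d c (fun y => y * v2 y)) ?a0 ?(ltW lt)//; ring.
  rewrite [slope X v j * _ * _]mulrAC; have := slopeE v hX jM; rewrite -/c -/d -/m => ->.
  rewrite (fE d) ?(ltW lt) ?lexx// (fE c) ?(ltW lt) ?lexx// (ev d) ?bL ?(le_trans a0 (ltW lt))//.
  rewrite (ev c) ?a0 ?(le_trans (ltW lt) bL)//.
  ring.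
rewrite (eq_bigr _ (fun j _ => el j)) sumrB.
rewrite -(big_mkord xpredT (fun j => (P (X j.+1) + B) * vh (X j.+1) - (P (X j) + B) * vh (X j))) //.
by rewrite (@telescope_sumr _ 0 M (fun j => (P (X j) + B) * vh (X j)))// X0 XM h0 hL !mulr0 subrr sub0r.
Qed.

Lemma H2_weak_bound L v v1 v2 Z Q : in_H2 L v v1 v2 -> ctest 0 L Z Q ->
  `|Int 0 L (fun x => v x * Q x)| <= H2norm L v v1 v2 * L2norm L Z.
Proof.
move=> h ZQ; rewrite (H2_weak h ZQ) -L2dotE.
have [_ _ l2 _ _] := h.
have cZ : continuous Z by have [Z1 [_ dZ _ _ _]] := ctest_ends ZQ; exact: is_derive_cont dZ.
have cZ' := @cont_within _ _ 0 L cZ.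
apply: le_trans (L2dot_le l2 (L2on_continuous cZ')) _.
apply: ler_wpM2r; first exact: L2norm_ge0.
rewrite /H2norm -[leLHS]ger0_norm ?L2norm_ge0// -sqrtr_sqr ler_wsqrtr//.
by rewrite lerDr addr_ge0 ?sqr_ge0.
Qed.

End h2fe.

(** * Regularity in time *)

Section joint_measurability.
Context {R : realType}.
Local Notation mu := (@lebesgue_measure R).
Local Notation TR := (measurableTypeR R).
Implicit Types (a b c d s t x L : R) (f g v w : R -> R) (A B : set TR) (H : TR -> TR -> R).

Lemma invS_cvg0 : (fun m => m.+1%:R^-1 : R) @ \oo --> (0 : R).
Proof. exact: cvg_harmonic. Qed.

Lemma mfun2_lim A B (F : nat -> TR -> TR -> R) H : (forall m, mfun2 A B (F m)) ->
  (forall x t, A x -> B t -> (fun m => F m x t) @ \oo --> H x t) -> mfun2 A B H.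
Proof.
move=> mF h; apply: (measurable_fun_cvg mF) => -[x t] [/= Ax Bt]; exact: h.
Qed.

Lemma eq_mfun2 A B H H' : (forall x t, A x -> B t -> H x t = H' x t) -> mfun2 A B H -> mfun2 A B H'.
Proof.
by move=> h; apply: eq_measurable_fun => -[x t] /set_mem[/= Ax Bt]; exact: h.
Qed.

Let grid (m : nat) t : R := (Num.floor (m.+1%:R * t))%:~R / m.+1%:R.

Let grid_dist m t : `|grid m t - t| <= m.+1%:R^-1.
Proof.
have m0 : 0 < m.+1%:R :> R by rewrite ltr0n.
have /andP[h1 h2] := floor_itv (m.+1%:R * t).
rewrite intrD in h2.
have -> : grid m t - t = ((Num.floor (m.+1%:R * t))%:~R - m.+1%:R * t) / m.+1%:R.
  by rewrite /grid mulrBl [_ * t]mulrC mulfK// gt_eqF.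
rewrite normrM [`|_^-1|]gtr0_norm ?invr_gt0// -[leRHS]mul1r ler_wpM2r ?invr_ge0 ?(ltW m0)//.
rewrite ler_norml; lra.
Qed.

(** Caratheodory functions are jointly measurable. With time rounded down to a grid of step 1 / (m +
    1), a preimage is a countable union of measurable rectangles; continuity in time gives the
    limit. *)
Lemma carath A H : measurable A -> (forall t, measurable_fun A (H^~ t)) ->
  (forall x, A x -> ccont (H x)) -> mfun2 A setT H.
Proof.
move=> mA mH cH.
apply: (@mfun2_lim _ _ (fun m x t => H x (grid m t))); last first.
  move=> x t Ax _; have hg : (fun m => grid m t) @ \oo --> t.
    apply/cvgrPdist_le => e e0.
    have /cvgrPdist_le/(_ e e0) := invS_cvg0; apply: filterS => m.
    rewrite sub0r normrN ger0_norm ?invr_ge0// => h.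
    by rewrite distrC (le_trans (grid_dist m t)).
  exact: (cvg_comp _ _ hg (cH x Ax t)).
move=> m _ Y mY.
rewrite [X in measurable X](_ : _ = \bigcup_(k : int)
  ((A `&` (H^~ (k%:~R / m.+1%:R)) @^-1` Y) `*` `[k%:~R / m.+1%:R, (k + 1)%:~R / m.+1%:R[%classic)).
  apply: countable_bigcupT_measurable => //.
  by move=> k; apply: measurableX; [exact: mH|exact: measurable_itv].
have m0 : 0 < m.+1%:R :> R by rewrite ltr0n.
apply/seteqP; split=> [[x t] [[/= Ax _] Hx]|[x t] [k _ [/= [Ax Hx]]]].
  exists (Num.floor (m.+1%:R * t)) => //; split => //=.
  by rewrite in_itv/= ler_pdivrMr// ltr_pdivlMr// mulrC floor_itv.
rewrite in_itv/= ler_pdivrMr// ltr_pdivlMr// mulrC => kt; split => //=.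
by rewrite /grid (floor_def kt).
Qed.

Lemma cvg_dnbhs0 (h : nat -> R) : h @ \oo --> (0 : R) -> (forall m, h m != 0) -> h @ \oo --> (0 : R)^'.
Proof.
move=> c n0 U hU; have : \forall m \near \oo, h m != 0 -> U (h m) by exact: (c _ hU).
by apply: filterS => m; apply.
Qed.

Lemma derive_seq f x (h : nat -> R) : derivable f x 1 -> h @ \oo --> (0 : R) -> (forall m, h m != 0) ->
  (fun m => (f (x + h m) - f x) / h m) @ \oo --> derive1 f x.
Proof.
move=> df h0 hn; have hc := cvg_dnbhs0 h0 hn.
rewrite derive1E; have := cvg_comp _ _ hc df; rewrite /derive.
set q := (X in X @ 0^').
rewrite (_ : (fun m => (f (x + h m) - f x) / h m) = q \o h)//.
by apply/funext => m; rewrite /q /= /GRing.scale/= mulr1 mulrC [h m + x]addrC.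
Qed.

(** A point to the right of x at distance at most 1 / (m + 1). The midpoint of x and L caps the
    step, so that difference quotients do not leave ]0, L[. *)
Let nudge L (m : nat) x : R := Num.min (x + m.+1%:R^-1) ((x + L) / 2).

(** As the derivative exists, it is the limit of the quotients along the single sequence [nudge],
    each of which is jointly measurable. *)
Lemma mfun2_dx L B H : measurable B -> mfun2 (`]0, L[%classic : set TR) B H ->
  (forall x t, 0 < x < L -> B t -> derivable (H^~ t) x 1) ->
  mfun2 (`]0, L[%classic : set TR) B (fun x t => derive1 (H^~ t) x).
Proof.
move=> mB mH dH.
have mI : measurable (`]0, L[%classic : set TR) by exact: measurable_itv.
have n_in m x : 0 < x < L -> x < nudge L m x < L.
  move=> hx; have m0 : 0 < m.+1%:R^-1 :> R by rewrite invr_gt0 ltr0n.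
  rewrite /nudge lt_min gt_min; move: (m.+1%:R^-1) m0 => z z0.
  by apply/andP; split; [apply/andP; split|apply/orP; right]; lra.
have mn m : measurable_fun [set: TR] (nudge L m : TR -> TR).
  apply: measurable_minr; first exact: measurable_funD.
  by apply: measurable_funM => //; apply: measurable_funD.
pose F (m : nat) (x t : TR) : R := (H (nudge L m x) t - H x t) / (nudge L m x - x).
apply: (@mfun2_lim _ _ F).
  move=> m; rewrite /F; apply: mf2M; last first.
    apply: mf2_1 => //.
    apply: (@eq_measurable_fun _ _ _ _ _ (fun x : R => (nudge L m x - x) `^ (-1))).
      move=> x /set_mem/in_oo hx; rewrite powR_inv1// subr_ge0.
      by have /andP[/ltW] := n_in m x hx.
    have mh : measurable_fun (`]0, L[ : set R) (fun x => nudge L m x - x) by apply: measurable_funB; [apply: measurable_funTS; exact: mn|exact: measurable_id].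
    exact: (measurableT_comp (@measurable_powR R (-1)) mh).
  apply: mf2B => //.
  apply: (measurable_comp (F := (`]0, L[%classic : set TR) `*` B)
     (f := fun z : TR * TR => H z.1 z.2) (g := fun z : TR * TR => (nudge L m z.1, z.2))) => //.
  - exact: measurableX.
  - move=> _ [[x t] [/= hx Bt] <-]; split => //=; rewrite in_itv/=.
    move/in_oo : hx => hx; have /andP[h1 h2] := n_in m x hx; rewrite h2 andbT.
    by rewrite (lt_trans _ h1)//; case/andP: hx.
  apply: measurable_funTS; apply: measurable_fun_pair; last exact: measurable_snd.
  exact: (measurableT_comp (mn m) (@measurable_fst _ _ _ _)).
move=> x t /in_oo hx Bt.
have c0 : (fun m => nudge L m x - x) @ \oo --> (0 : R).
  apply/cvgrPdist_le => e e0.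
  have /cvgrPdist_le/(_ e e0) := invS_cvg0; apply: filterS => m.
  rewrite sub0r normrN ger0_norm ?invr_ge0// => h.
  have /andP[h1 h2] := n_in m x hx.
  rewrite distrC subr0 ger0_norm ?subr_ge0 ?(ltW h1)// (le_trans _ h)// lerBlDr addrC.
  by rewrite /nudge ge_min lexx.
have n0 m : nudge L m x - x != 0.
  by have /andP[h1 _] := n_in m x hx; rewrite subr_eq0 gt_eqF.
have h := @derive_seq (H^~ t) x (fun m => nudge L m x - x) (dH x t hx Bt) c0 n0.
rewrite (_ : (fun m => F m x t) = (fun m => (H (x + (nudge L m x - x)) t - H x t) / (nudge L m x - x))) //.
by apply/funext => m; rewrite /F [x + (_ - _)]addrC subrK.
Qed.

End joint_measurability.

(** * Derivatives relative to a half-open interval *)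

Section derive_in.
Context {R : realType}.
Implicit Types (a b c d s t x : R) (f g : R -> R) (A : set R).

Lemma derivable_in_seq A g t (s : nat -> R) : derivable_in A g t ->
  s @ \oo --> t -> (forall m, s m != t) -> (\forall m \near \oo, A (s m)) ->
  (fun m => (g (s m) - g t) / (s m - t)) @ \oo --> derive_in A g t.
Proof.
move=> dg st sn sA.
have hc : s @ \oo --> within A t^'.
  move=> U hU; have : \forall m \near \oo, s m != t -> A (s m) -> U (s m) by exact: (st _ hU).
  by apply: filterS2 sA => m h1 h2; apply: h2.
exact: (cvg_comp _ _ hc dg).
Qed.

Lemma derivable_in_oo a b g t : a < t < b -> derivable_in `]a, b] g t ->
  is_derive t 1 g (derive_in `]a, b] g t).
Proof.
move=> /andP[at' tb] dg.
have H : (fun h => h^-1 *: (g (h *: (1 : R) + t) - g t)) @ (0 : R)^' --> derive_in `]a, b] g t.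
  have hc : (fun h : R => h *: (1 : R) + t) @ (0 : R)^' --> within `]a, b] t^'.
    move=> U hU.
    have [e /= e0 he] : nbhs t (fun y => y != t -> y \in `]a, b] -> U y) by exact: hU.
    exists (Num.min e (Num.min (t - a) (b - t))) => /=; first by rewrite !lt_min e0 !subr_gt0 at' tb.
    move=> y; rewrite /ball/= sub0r normrN !lt_min => /andP[ye /andP[y1 y2]] y0.
    rewrite /GRing.scale/= mulr1; apply: he.
    - by rewrite /ball/= opprD addrCA subrr addr0 normrN.
    - by rewrite -subr_eq0 addrK.
    rewrite in_itv/=; move: y1 y2; rewrite !ltr_norml; lra.
  have := cvg_comp _ _ hc dg; apply: cvg_trans; apply: near_eq_cvg; apply: nearW => h /=.
  by rewrite addrK /GRing.scale/= mulr1 mulrC.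
by apply: DeriveDef; [apply/cvg_ex; eexists; exact: H|exact: cvg_lim].
Qed.

Lemma derivable_in_cvg A g t : derivable_in A g t -> g s @[s --> within A (nbhs t)] --> g t.
Proof.
move=> dg; apply/cvgrPdist_le => e e0.
pose q s := (g s - g t) / (s - t).
have /cvgrPdist_le/(_ 1 ltr01) h : q s @[s --> within A t^'] --> derive_in A g t by exact: dg.
pose l := `|derive_in A g t| + 1.
have l0 : 0 < l by rewrite ltr_wpDl.
have h1 : nbhs t (fun s => s != t -> A s -> `|derive_in A g t - q s| <= 1) by exact: h.
have h2 : nbhs t (fun s => `|t - s| <= e / l).
  by have /cvgrPdist_le := @cvg_id _ (nbhs t); apply; rewrite divr_gt0.
move: h1 h2; apply: filterS2 => s h1 h2 As.
have [->|st] := eqVneq s t; first by rewrite subrr normr0 ltW.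
have {}h1 := h1 st As.
have -> : g t - g s = q s * (t - s).
  by rewrite /q -[t - s]opprB mulrN divfK ?subr_eq0// opprB.
rewrite normrM; have hq : `|q s| <= l.
  have -> : q s = derive_in A g t - (derive_in A g t - q s) by ring.
  by rewrite (le_trans (ler_normB _ _))// lerD2l.
apply: (le_trans (ler_pM (normr_ge0 _) (normr_ge0 _) hq h2)).
by rewrite mulrC divfK// gt_eqF.
Qed.

Lemma derivable_in_cont a b c d g : a < c -> d <= b -> (forall t, a < t <= b -> derivable_in `]a, b] g t) ->
  {within `[c, d], continuous g}.
Proof.
move=> ac db dg; apply/subspace_continuousP => t; rewrite /= in_itv/= => /andP[ct td].
have := derivable_in_cvg (dg t _); rewrite (lt_le_trans ac ct) (le_trans td db) => /(_ isT).
apply: cvg_trans; apply: cvg_app; apply: within_subset => s /=; rewrite !in_itv/= => /andP[cs sd].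
by rewrite (lt_le_trans ac cs) (le_trans sd db).
Qed.

(** The segment [s, t] stays away from the left end, where the derivative may be singular, but may
    reach the right end, which belongs to the interval. *)
Lemma FTC_in a b g D s t : a < s -> s <= t -> t <= b ->
  (forall r, a < r <= b -> derivable_in `]a, b] g r) ->
  (forall r, a < r <= b -> derive_in `]a, b] g r = D r) ->
  {within `[s, t], continuous D} -> Int s t D = g t - g s.
Proof.
move=> as' st tb dg eD cD; apply: (FTC2 st cD); first exact: derivable_in_cont dg.
move=> r /andP[sr rt]; have r1 : a < r < b by rewrite (lt_trans as' sr) (lt_le_trans rt tb).
rewrite -eD; last by case/andP: r1 => -> /ltW ->.
by apply: (derivable_in_oo r1); apply: dg; case/andP: r1 => -> /ltW ->.
Qed.

(** Both Psi + g and Psi - g have a nonnegative derivative, hence are nondecreasing. This bounds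
    increments of g without integrating its derivative; g will be the first time derivative of u,
    whose derivative is only known to exist. *)
Lemma derive_in_osc a b g Psi psi s t : a < s -> s <= t -> t <= b ->
  (forall r, a < r <= b -> derivable_in `]a, b] g r) ->
  (forall r, s < r < t -> `|derive_in `]a, b] g r| <= psi r) ->
  {within `[s, t], continuous Psi} -> (forall r, s < r < t -> is_derive r 1 Psi (psi r)) ->
  `|g t - g s| <= Psi t - Psi s.
Proof.
move=> as' st tb dg bd cP dP; have cg := derivable_in_cont as' tb dg.
have dg' r : s < r < t -> is_derive r 1 g (derive_in `]a, b] g r).
  move=> /andP[sr rt]; have r1 : a < r < b by rewrite (lt_trans as' sr) (lt_le_trans rt tb).
  by apply: (derivable_in_oo r1); apply: dg; case/andP: r1 => -> /ltW ->.
have mono (q dq : R -> R) : {within `[s, t], continuous q} ->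
    (forall r, s < r < t -> is_derive r 1 q (dq r) /\ 0 <= dq r) -> q s <= q t.
  move=> cq hq; have [->//|sNt] := eqVneq s t.
  have lt : s < t by rewrite lt_neqAle sNt.
  have [|r r1 e] := @MVT R q dq s t lt _ cq.
    by move=> r; rewrite in_itv/= => /hq[].
  rewrite in_itv/= in r1; rewrite -subr_ge0 e mulr_ge0 ?subr_ge0//.
  by have [] := hq r r1.
rewrite ler_norml; apply/andP; split.
  have := @mono (fun r => Psi r + g r) (fun r => psi r + derive_in `]a, b] g r).
  have h1 : Psi s + g s <= Psi t + g t -> - (Psi t - Psi s) <= g t - g s by lra.
  move=> h; apply: h1; apply: h.
    by move=> r; apply: cvgD; [exact: cP|exact: cg].
  move=> r hr; split; first by have := is_deriveD (dP r hr) (dg' r hr).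
  by have := bd r hr; rewrite ler_norml; lra.
have := @mono (fun r => Psi r - g r) (fun r => psi r - derive_in `]a, b] g r).
have h1 : Psi s - g s <= Psi t - g t -> g t - g s <= Psi t - Psi s by lra.
move=> h; apply: h1; apply: h.
  by move=> r; apply: cvgB; [exact: cP|exact: cg].
move=> r hr; split; first by have := is_deriveB (dP r hr) (dg' r hr).
by have := bd r hr; rewrite ler_norml; lra.
Qed.

End derive_in.

(** * Increments of the solution in time *)

Section time_regularity.
Context {R : realType}.
Local Notation mu := (@lebesgue_measure R).
Local Notation TR := (measurableTypeR R).
Implicit Types (a b c d s t x L : R) (v w : R -> R).

Lemma aeS2 (P Q W : R -> Prop) : (forall x, P x -> Q x -> W x) ->
  {ae mu, forall x, P x} -> {ae mu, forall x, Q x} -> {ae mu, forall x, W x}.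
Proof. by move=> PQ; apply: (@filterS2 _ _ (ae_filter_ringOfSetsType mu)) => x; exact: PQ. Qed.

Lemma ae_exists a b (P : R -> Prop) : a < b -> {ae mu, forall x, a < x < b -> P x} ->
  exists2 x, a < x < b & P x.
Proof.
move=> ab aP; apply: contrapT => nP.
have : mu.-negligible (`]a, b[ : set R).
  apply: negligibleS aP => y /=; rewrite in_itv/= => hy h.
  by apply: nP; exists y => //; exact: h.
rewrite negligibleP; last exact: measurable_itv.
change (mu (`]a, b[ : set R) = 0 -> False).
rewrite lebesgue_measure_itv/= lte_fin ab => /eqP; rewrite -EFinB eqe subr_eq0 => /eqP dc.
by move: ab; rewrite dc ltxx.
Qed.

Lemma eq_Int_ae a b f g : measurable_fun (`]a, b[ : set R) f -> measurable_fun (`]a, b[ : set R) g ->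
  {ae mu, forall x, a < x < b -> f x = g x} -> Int a b f = Int a b g.
Proof.
move=> mf mg e; rewrite /Int /Rintegral; congr fine.
apply: ae_eq_integral => //; [exact/measurable_EFinP|exact/measurable_EFinP|].
by apply: aeS e => x h /in_oo hx; rewrite h.
Qed.

Lemma itgb_ae a b f g : measurable_fun (`]a, b[ : set R) g -> itgb a b f ->
  {ae mu, forall x, a < x < b -> f x = g x} -> itgb a b g.
Proof.
move=> mg /integrableP[mf fi] e; apply/integrableP; split; first exact/measurable_EFinP.
move: fi; congr (_ < _)%E; apply: ae_eq_integral => //.
- exact: measurableT_comp.
- by apply/measurable_EFinP; apply: measurableT_comp.
by apply: aeS e => x h /in_oo hx /=; rewrite h.
Qed.

(** Replacing h by its maximum with |f| changes it on a null set and makes the bound hold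
    everywhere. *)
Lemma Int_abs_le_ae a b f h : itgb a b f -> itgb a b h ->
  {ae mu, forall x, a < x < b -> `|f x| <= h x} -> `|Int a b f| <= Int a b h.
Proof.
move=> hf hh le; apply: (le_trans (Int_abs hf)).
have hn := itgb_norm hf.
rewrite (@eq_Int_ae a b h (fun x => Num.max (h x) `|f x|)).
- apply: Int_le => //; last by move=> x _; rewrite le_max lexx orbT.
  apply: (itgb_le (g := fun x => `|h x| + `|f x|)).
  + by apply: measurable_maxr; [exact: itgb_meas hh|exact: itgb_meas hn].
  + move=> x _; rewrite /Num.max; case: ifP => _; first by rewrite normr_id lerDr.
    by rewrite lerDl.
  + by apply: itgbD => //; exact: itgb_norm.
- exact: itgb_meas hh.
- by apply: measurable_maxr; [exact: itgb_meas hh|exact: itgb_meas hn].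
by apply: aeS le => x l /l lx; rewrite max_l.
Qed.

Lemma L2norm_le_H2 L v v1 v2 : L2norm L v <= H2norm L v v1 v2.
Proof.
rewrite /H2norm -[leLHS]ger0_norm ?L2norm_ge0// -sqrtr_sqr ler_wsqrtr// -addrA.
by rewrite lerDl addr_ge0 ?sqr_ge0.
Qed.

Lemma L2norm_le_H2_2 L v v1 v2 : L2norm L v2 <= H2norm L v v1 v2.
Proof.
rewrite /H2norm -[leLHS]ger0_norm ?L2norm_ge0// -sqrtr_sqr ler_wsqrtr//.
by rewrite lerDr addr_ge0 ?sqr_ge0.
Qed.

Context (L c0 d0 : R) (u g g1 g2 : R -> R -> R).
Context (L0 : 0 < L) (cd : c0 < d0).
Context (cu : forall x, 0 <= x <= L -> {within `[c0, d0], continuous (u x)}).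
Context (cux : forall t, c0 <= t <= d0 -> {within `[0, L], continuous (u^~ t)}).
Context (mg : mfun2 (`]0, L[%classic : set TR) (`]c0, d0[%classic : set TR) g).
Context (hg : {ae mu, forall t, t \in `]c0, d0[ -> in_H2 L (g^~ t) (g1^~ t) (g2^~ t)}).
Let N t := H2norm L (g^~ t) (g1^~ t) (g2^~ t).
Context (ig : itgb c0 d0 N).
Context (wg : {ae mu, forall x, x \in `]0, L[ -> weak_deriv c0 d0 (u x) (g x)}).

(** The integral of the H2 norm of the time derivative: an additive function of intervals that
    dominates the increments of u both in L2 and in duality with Z''. *)
Definition incr s t := Int s t N.

Lemma incr_ge0 s t : 0 <= incr s t.
Proof. by apply: Int_ge0 => x _; exact: sqrtr_ge0. Qed.

Lemma incrD s r t : c0 <= s -> s <= r -> r <= t -> t <= d0 -> incr s t = incr s r + incr r t.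
Proof.
move=> cs sr rt td; apply: Int_split; first by rewrite sr.
exact: itgbS ig.
Qed.

Lemma incr_le s t s' t' : c0 <= s -> s <= s' -> s' <= t' -> t' <= t -> t <= d0 -> incr s' t' <= incr s t.
Proof.
move=> cs ss st tt td; rewrite (@incrD s s' t)//; last exact: le_trans tt.
rewrite (@incrD s' t' t)//; last exact: le_trans ss.
have := incr_ge0 s s'; have := incr_ge0 t' t; lra.
Qed.

Let dual_pair Q s t : L2on 0 L Q -> c0 <= s -> s <= t -> t <= d0 ->
  [/\ {ae mu, forall x, 0 < x < L -> itgb s t (fun r => g x r * Q x)},
      itgb 0 L (fun x => Int s t (fun r => g x r * Q x)),
      itgb s t (fun r => Int 0 L (fun x => g x r * Q x)) &
      Int 0 L (fun x => Int s t (fun r => g x r * Q x)) = Int s t (fun r => Int 0 L (fun x => g x r * Q x))].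
Proof.
move=> lQ cs st td; have iN : itgb s t N by exact: itgbS ig.
have mA : measurable (`]0, L[%classic : set TR) by exact: measurable_itv.
have mB : measurable (`]s, t[%classic : set TR) by exact: measurable_itv.
have mB' : measurable (`]c0, d0[%classic : set TR) by exact: measurable_itv.
have lQ' : L2on 0 L (fun x => `|Q x|).
  have [mQ iQ] := lQ; split; first exact: measurableT_comp.
  by apply: eq_itgb iQ => x _; rewrite real_normK ?num_real.
apply: (@Ifubini _ _ _ _ _ (fun x r => g x r * Q x) (fun r => L2norm L Q * N r)).
- apply: mf2M; last by apply: mf2_1 => //; exact: (proj1 lQ).
  apply: mf2S mg => // r; rewrite /= !in_itv/= => /andP[sr rt].
  by rewrite (le_lt_trans cs sr) (lt_le_trans rt td).
- apply: aeS hg => r hr /andP[sr rt].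
  have /hr[lg _ _ _ _] : r \in `]c0, d0[ by rewrite in_itv/= (le_lt_trans cs sr) (lt_le_trans rt td).
  have lg' : L2on 0 L (fun x => `|g x r|).
    have [m i] := lg; split; first exact: measurableT_comp.
    by apply: eq_itgb i => x _; rewrite real_normK ?num_real.
  split; first exact: itgb_mulL2.
  have e v : L2norm L (fun x => `|v x|) = L2norm L v.
    rewrite /L2norm; congr Num.sqrt; rewrite !L2dotE; apply: eq_Int => x _.
    by rewrite -!expr2 real_normK ?num_real.
  have := L2dot_le lg' lQ'; rewrite !e L2dotE => h.
  rewrite mulrC; apply: le_trans (_ : L2norm L (g^~ r) * L2norm L Q <= _).
    apply: le_trans h; apply: le_trans (ler_norm _).
    by apply: Int_le; [exact: itgb_norm (itgb_mulL2 lg lQ)|exact: itgb_mulL2|move=> x _; rewrite normrM].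
  by apply: ler_wpM2r; [exact: L2norm_ge0|exact: L2norm_le_H2].
- exact: itgbZ.
Qed.

(** The exceptional set of x does not depend on s and t, so that the identity can be integrated in x
    for each pair of times. *)
Lemma time_incr : {ae mu, forall x, 0 < x < L -> forall s t, c0 <= s -> s <= t -> t <= d0 ->
  u x t - u x s = Int s t (g x)}.
Proof.
have l1 : L2on 0 L (fun=> 1) by apply: L2on_bnd (_ : forall x, _ -> _ <= 1) => // x _; rewrite normr1.
have [a1 _ _ _] := dual_pair l1 (lexx c0) (ltW cd) (lexx d0).
apply: aeS2 a1 wg => x hi hw hx s t cs st td; apply: (weak1 _ _ _ cs st td).
- by apply: cu; case/andP: hx => /ltW -> /ltW ->.
- by apply: eq_itgb (hi hx) => r _; rewrite mulr1.
- by apply: hw; rewrite in_itv.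
Qed.

Lemma incr_dual Q s t : L2on 0 L Q -> c0 <= s -> s <= t -> t <= d0 ->
  itgb s t (fun r => Int 0 L (fun x => g x r * Q x)) /\
  Int 0 L (fun x => (u x t - u x s) * Q x) = Int s t (fun r => Int 0 L (fun x => g x r * Q x)).
Proof.
move=> lQ cs st td; have [a1 i1 i2 <-] := dual_pair lQ cs st td; split => //.
have cu' r : c0 <= r <= d0 -> measurable_fun (`]0, L[ : set R) (u^~ r).
  by move=> hr; exact: itgb_meas (itgb_continuous (cux hr)).
have hs : c0 <= s <= d0 by rewrite cs (le_trans st).
have ht : c0 <= t <= d0 by rewrite td (le_trans cs).
apply: eq_Int_ae.
- apply: measurable_funM; last exact: (proj1 lQ).
  by apply: measurable_funB; exact: cu'.
- exact: itgb_meas i1.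
have l1 : L2on 0 L (fun=> 1) by apply: L2on_bnd (_ : forall x, _ -> _ <= 1) => // x _; rewrite normr1.
have [a2 _ _ _] := dual_pair l1 cs st td.
apply: aeS2 time_incr a2 => x h1 h2 hx.
rewrite (h1 hx s t cs st td) -IntZr//.
by apply: eq_itgb (h2 hx) => r _; rewrite mulr1.
Qed.

(** The increment is paired with itself; Cauchy-Schwarz inside the time integral leaves a factor by
    which to divide. *)
Lemma incr_L2 s t : c0 <= s -> s <= t -> t <= d0 -> L2norm L (fun x => u x t - u x s) <= incr s t.
Proof.
move=> cs st td; set v := fun x => _.
have hs : c0 <= s <= d0 by rewrite cs (le_trans st).
have ht : c0 <= t <= d0 by rewrite td (le_trans cs).
have lv : L2on 0 L v.
  by apply: L2on_continuous => x; apply: cvgB; [exact: (cux ht)|exact: (cux hs)].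
have [i e] := incr_dual lv cs st td.
have iN : itgb s t N by exact: itgbS ig.
have : L2norm L v ^+ 2 <= L2norm L v * incr s t.
  rewrite L2norm_sqr (@eq_Int _ _ _ _ (fun x => (u x t - u x s) * v x))// e /incr -IntZ//.
  apply: le_trans (ler_norm _) _.
  have : {ae mu, forall r, s < r < t -> `|Int 0 L (fun x => g x r * v x)| <= L2norm L v * N r}.
    apply: aeS hg => r hr /andP[sr rt].
    have /hr[lg _ _ _ _] : r \in `]c0, d0[ by rewrite in_itv/= (le_lt_trans cs sr) (lt_le_trans rt td).
    have := L2dot_le lg lv; rewrite L2dotE => h; apply: (le_trans h); rewrite mulrC.
    by apply: ler_wpM2l; [exact: L2norm_ge0|exact: L2norm_le_H2].
  exact: Int_abs_le_ae i (itgbZ _ iN).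
have := L2norm_ge0 L v; rewrite expr2; have [->|v0 v1] := eqVneq (L2norm L v) 0.
  by rewrite incr_ge0.
by rewrite ler_pM2l// lt_neqAle eq_sym v0.
Qed.

Lemma incr_weak Z Q s t : ctest 0 L Z Q -> c0 <= s -> s <= t -> t <= d0 ->
  `|Int 0 L (fun x => (u x t - u x s) * Q x)| <= incr s t * L2norm L Z.
Proof.
move=> ZQ cs st td.
have cQ : continuous Q by have [? []] := ctest_ends ZQ.
have lQ : L2on 0 L Q by apply: L2on_continuous; apply: cont_within.
have [i ->] := incr_dual lQ cs st td; rewrite /incr mulrC.
have iN : itgb s t N by exact: itgbS ig.
rewrite -IntZ//; apply: Int_abs_le_ae i (itgbZ _ iN) _.
apply: aeS hg => r hr /andP[sr rt].
have /hr h : r \in `]c0, d0[ by rewrite in_itv/= (le_lt_trans cs sr) (lt_le_trans rt td).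
by rewrite mulrC; exact: H2_weak_bound h ZQ.
Qed.

End time_regularity.

(** * Continuous functions on a rectangle open in space *)

Section rectangle.
Context {R : realType}.
Local Notation TR := (measurableTypeR R).
Implicit Types (s t x : R).
Context (L c d : R) (F : R -> R -> R).
Context (hF : {within (`]0, L[ : set R) `*` (`[c, d] : set R), continuous (fun z : R * R => F z.1 z.2)}).

Lemma rect_t x : 0 < x < L -> {within `[c, d], continuous (F x)}.
Proof.
move=> hx; have /subspace_continuousP h := hF.
apply/subspace_continuousP => t; rewrite /= => ht.
have hA : ((`]0, L[ : set R) `*` (`[c, d] : set R)) (x, t) by split => //=; rewrite in_itv.
have hc : (fun s => (x, s)) @ within `[c, d] (nbhs t) --> within ((`]0, L[ : set R) `*` (`[c, d] : set R)) (nbhs (x, t)).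
  move=> U hU; have cp : (fun s : R => (x, s)) @ nbhs t --> (x, t).
    move=> V [[P Q] [/= hP hQ] PQ]; have : nbhs t Q by exact: hQ.
    by apply: filterS => s qs; apply: PQ; split => //=; exact: nbhs_singleton.
  have : nbhs t (fun s => ((`]0, L[ : set R) `*` (`[c, d] : set R)) (x, s) -> U (x, s)) by exact: (cp _ hU).
  by apply: filterS => s hs hs'; apply: hs; split => //=; rewrite in_itv.
exact: (cvg_comp _ _ hc (h _ hA)).
Qed.

Lemma rect_x t : c <= t <= d -> measurable_fun (`]0, L[ : set R) (F^~ t).
Proof.
move=> ht; have /subspace_continuousP h := hF.
apply: open_continuous_measurable_fun; first exact: interval_open.
move=> x /set_mem hx.
have hA : ((`]0, L[ : set R) `*` (`[c, d] : set R)) (x, t) by split => //=; rewrite in_itv.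
have hc : (fun s => (s, t)) @ nbhs x --> within ((`]0, L[ : set R) `*` (`[c, d] : set R)) (nbhs (x, t)).
  move=> U hU; have cp : (fun s : R => (s, t)) @ nbhs x --> (x, t).
    move=> V [[P Q] [/= hP hQ] PQ]; have : nbhs x P by exact: hP.
    by apply: filterS => s ps; apply: PQ; split => //=; exact: nbhs_singleton.
  have h1 : nbhs x (fun s => ((`]0, L[ : set R) `*` (`[c, d] : set R)) (s, t) -> U (s, t)) by exact: (cp _ hU).
  have h2 : nbhs x (fun s => 0 < s < L) by apply: near_oo; exact/in_oo.
  by move: h1 h2; apply: filterS2 => s hs hs'; apply: hs; split => //=; rewrite in_itv.
exact: (cvg_comp _ _ hc (h _ hA)).
Qed.

Lemma rect_mfun2 : c <= d -> mfun2 (`]0, L[%classic : set TR) (`]c, d[%classic : set TR) F.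
Proof.
move=> cd; have mI : measurable (`]0, L[%classic : set TR) by exact: measurable_itv.
have m : mfun2 (`]0, L[%classic : set TR) setT (fun x t => F x (clamp c d t)).
  apply: carath => //; first by move=> t; apply: rect_x; exact: clamp_in.
  by move=> x /in_oo hx; apply: clamp_cont => //; exact: rect_t.
apply: eq_mfun2 (mf2S mI measurableT _ _ m) => // x t _ /in_oo /andP[/ltW ct /ltW td].
by rewrite clampE// ct.
Qed.

(** The rectangle is not compact in x and the function may blow up towards 0 and L; compactness is
    available at distance dl from them. *)
Lemma rect_bnd dl : 0 < dl -> exists2 C, 0 <= C & forall x t, dl <= x <= L - dl -> c <= t <= d -> `|F x t| <= C.
Proof.
move=> dl0; pose A := (`[dl, L - dl] : set R) `*` (`[c, d] : set R).
have cA : {within A, continuous (fun z : R * R => F z.1 z.2)}.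
  apply: continuous_subspaceW hF => -[x t] [/=]; rewrite !in_itv/= => /andP[h1 h2] ht; split => //=.
  lra.
have kA : compact A by apply: compact_setX; exact: segment_compact.
have [M [_ hM]] := compact_bounded (continuous_compact cA kA).
exists (`|M| + 1) => [|x t hx ht]; first by rewrite addr_ge0.
have := hM (`|M| + 1) _; apply; first by rewrite (le_lt_trans (ler_norm _))// ltrDl.
by exists (x, t) => //; split => /=; rewrite in_itv.
Qed.

End rectangle.

(** * Junction of the delay intervals *)

Section delay_blocks.
Context {R : realType}.
Local Notation TR := (measurableTypeR R).
Implicit Types (s t x tau : R) (g e : R -> R) (k K : nat).

Lemma block_locate tau K t : 0 < t <= K%:R * tau ->
  exists2 k, (1 <= k <= K)%N & (k%:R - 1) * tau < t <= k%:R * tau.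
Proof.
move=> /andP[t0]; elim: K => [|K IH tK]; first by rewrite mul0r; lra.
have [/IH[k /andP[k1 kK] hk]|lt] := leP t (K%:R * tau).
  by exists k => //; rewrite k1 (leq_trans kK).
exists K.+1; first by rewrite ltnS leqnn.
by rewrite tK andbT -natr1 addrK.
Qed.

Lemma const_closure a b (G : R -> R) A : a < b -> {within `[a, b], continuous G} ->
  (forall s, a < s <= b -> G s = A) -> G a = A.
Proof.
move=> ab cG h; have cA : {within `[a, b], continuous (fun=> A)} by apply: cont_within; exact: contC.
have ce : {within `[a, b], continuous (fun s => G s - A)} by move=> x; apply: cvgB; [exact: cG|exact: cA].
apply/eqP; rewrite -subr_eq0; apply/eqP; apply: (cont_ae0 ab ce); last by rewrite lexx ltW.
by apply: aeW => s /andP[sa sb]; rewrite h ?subrr// sa ltW.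
Qed.

(** The increments are given inside the delay intervals, never from a left end point. The difference
    between g and the primitive of e is constant on each of them, and its continuity makes the
    constants agree. *)
Lemma FTC_blocks tau K g e : 0 < tau -> {within `[0, K%:R * tau], continuous g} -> itgb 0 (K%:R * tau) e ->
  (forall k s t, (1 <= k <= K)%N -> (k%:R - 1) * tau < s -> s <= t -> t <= k%:R * tau -> Int s t e = g t - g s) ->
  forall s t, 0 <= s -> s <= t -> t <= K%:R * tau -> Int s t e = g t - g s.
Proof.
move=> tau0 cg ie h; pose T := K%:R * tau.
have T0 : 0 <= T by rewrite mulr_ge0 ?ler0n ?(ltW tau0).
pose G t := g t - Int 0 t e.
have cG : {within `[0, T], continuous G}.
  by move=> x; apply: cvgB; [exact: cg|exact: (Int_continuous T0 ie)].
have Gc k t : (k <= K)%N -> 0 <= t <= k%:R * tau -> G t = G 0.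
  elim: k t => [t _|k IH t kK].
    by rewrite mul0r => /le_anti <-.
  have kT : k.+1%:R * tau <= T by rewrite ler_wpM2r ?(ltW tau0)// ler_nat.
  have k0 : 0 <= k%:R * tau by rewrite mulr_ge0 ?ler0n ?(ltW tau0).
  have lt : k%:R * tau < k.+1%:R * tau by rewrite ltr_pM2r// ltr_nat.
  have [tk /andP[t0 _]|tk /andP[t0 tk1]] := leP t (k%:R * tau).
    by apply: IH; [exact: ltnW|rewrite t0].
  have E s : k%:R * tau < s <= k.+1%:R * tau -> G s = G (k.+1%:R * tau).
    move=> /andP[sk sk1]; rewrite /G (@Int_split _ 0 (k.+1%:R * tau) s)//; first last.
    - exact: itgbS (lexx _) kT ie.
    - by rewrite sk1 (le_trans k0 (ltW sk)).
    rewrite (h k.+1 s)//; [ring|by rewrite -natr1 addrK].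
  rewrite (E t) ?tk ?tk1// -(IH (k%:R * tau) (ltnW kK)) ?k0 ?lexx//.
  symmetry; apply: (const_closure lt _ E).
  exact: within_sub cG.
move=> s t s0 st tT.
have eq1 : G t = G s by rewrite (Gc K s) ?(Gc K t)// ?s0 ?tT ?(le_trans st)// (le_trans s0).
have iet : itgb 0 t e by exact: itgbS (lexx _) tT ie.
have := @Int_split _ 0 t s e; rewrite s0 st => /(_ isT iet).
move: eq1; rewrite /G; lra.
Qed.

End delay_blocks.

(** * Continuity of fractional integrals *)

Section frac_tools.
Context {R : realType}.
Local Notation mu := (@lebesgue_measure R).
Local Notation TR := (measurableTypeR R).
Implicit Types (a b c d s t x r be al : R) (e f g v w W : R -> R).

Lemma itgb_le_ae a b f g : measurable_fun (`]a, b[ : set R) f ->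
  {ae mu, forall x, a < x < b -> `|f x| <= g x} -> itgb a b g -> itgb a b f.
Proof.
move=> mf le ig; pose h x := Num.max (- `|g x|) (Num.min `|g x| (f x)).
have mg := itgb_meas (itgb_norm ig).
have ih : itgb a b h.
  apply: itgb_le (itgb_norm ig) => [|x _].
    by apply: measurable_maxr; [exact: measurableT_comp|exact: measurable_minr].
  rewrite /h ler_norml le_max lexx/= ge_max ge_min lexx andbT.
  by have := normr_ge0 (g x); lra.
apply: itgb_ae ih _ => //; apply: aeS le => x hx /hx; rewrite ler_norml => /andP[h1 h2].
have h3 := ler_norm (g x); rewrite /h min_r; last lra.
by rewrite max_r//; lra.
Qed.

Lemma L1_dot_le L f g : L2on 0 L f -> L2on 0 L g ->
  Int 0 L (fun x => `|f x * g x|) <= L2norm L f * L2norm L g.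
Proof.
move=> lf lg.
have ln h : L2on 0 L h -> L2on 0 L (fun x => `|h x|).
  move=> [m i]; split; first exact: measurableT_comp.
  by apply: eq_itgb i => x _; rewrite real_normK ?num_real.
have en v : L2norm L (fun x => `|v x|) = L2norm L v.
  rewrite /L2norm; congr Num.sqrt; rewrite !L2dotE; apply: eq_Int => x _.
  by rewrite -!expr2 real_normK ?num_real.
have := L2dot_le (ln _ lf) (ln _ lg); rewrite !en L2dotE; apply: le_trans.
apply: le_trans (ler_norm _); rewrite le_eqVlt; apply/orP; left; apply/eqP.
by apply: eq_Int => x _; rewrite normrM.
Qed.

(** Exchanges a fractional integral in time with a pairing in space. The majorant [m] of the L2
    norms serves Fubini; the integrability at every x serves to pull [v x] out of the time
    integral. *)
Lemma pair_fub L be t (H : TR -> TR -> R) v (m : R -> R) : 0 < be <= 1 ->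
  mfun2 (`]0, L[%classic : set TR) (`]0, t[%classic : set TR) H -> L2on 0 L v ->
  {ae mu, forall s, 0 < s < t -> L2on 0 L (H^~ s) /\ L2norm L (H^~ s) <= m s} ->
  itgb 0 t (fun s => omega be (t - s) * m s) ->
  (forall x, 0 < x < L -> itgb 0 t (fun s => omega be (t - s) * H x s)) ->
  [/\ itgb 0 L (fun x => Int 0 t (fun s => omega be (t - s) * H x s) * v x),
      itgb 0 t (fun s => omega be (t - s) * Int 0 L (fun x => H x s * v x)) &
      Int 0 L (fun x => Int 0 t (fun s => omega be (t - s) * H x s) * v x) =
      Int 0 t (fun s => omega be (t - s) * Int 0 L (fun x => H x s * v x))].
Proof.
move=> hbe mH lv bd im ix.
have mA : measurable (`]0, L[%classic : set TR) by exact: measurable_itv.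
have mB : measurable (`]0, t[%classic : set TR) by exact: measurable_itv.
have be2 : 0 < be <= 2 by lra.
have := @Ifubini R 0 L 0 t (fun x s => omega be (t - s) * (H x s * v x)) (fun s => L2norm L v * (omega be (t - s) * m s)).
case.
- apply: mf2M; first by apply: mf2_2 => //; exact: measurable_omega_conv.
  by apply: mf2M => //; apply: mf2_1 => //; exact: (proj1 lv).
- apply: aeS bd => s h hs; have [ls nm] := h hs.
  have i := itgb_mulL2 ls lv; split; first exact: itgbZ.
  rewrite (@eq_Int _ _ _ _ (fun x => omega be (t - s) * `|H x s * v x|)); last first.
    by move=> x _; rewrite normrM (ger0_norm (omega_ge0 _ be2)).
  rewrite IntZ; last exact: itgb_norm.
  rewrite mulrCA ler_wpM2l ?omega_ge0//.
  apply: (le_trans (L1_dot_le ls lv)); rewrite mulrC.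
  by apply: ler_wpM2l => //; exact: L2norm_ge0.
- exact: itgbZ.
move=> a1 i1 i2 e.
have E1 x : 0 < x < L -> Int 0 t (fun s => omega be (t - s) * (H x s * v x)) =
    Int 0 t (fun s => omega be (t - s) * H x s) * v x.
  by move=> hx; rewrite -IntZr; [apply: eq_Int => s _; rewrite mulrA|exact: ix].
have E2 : {ae mu, forall s, 0 < s < t -> Int 0 L (fun x => omega be (t - s) * (H x s * v x)) =
    omega be (t - s) * Int 0 L (fun x => H x s * v x)}.
  by apply: aeS bd => s h hs; have [ls _] := h hs; rewrite IntZ//; exact: itgb_mulL2 ls lv.
have mR : measurable_fun (`]0, t[ : set R) (fun s => omega be (t - s) * Int 0 L (fun x => H x s * v x)).
  apply: measurable_funM; first exact: measurable_omega_conv.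
  apply: (measurable_Rint (H := fun s x => H x s * v x)) => //.
  have h : mfun2 (`]0, L[%classic : set TR) (`]0, t[%classic : set TR) (fun x s => H x s * v x).
    by apply: mf2M; [exact: mH|apply: mf2_1; [exact: mA|exact: mB|exact: (proj1 lv)]].
  exact: (mfun2_swap mA mB h).
split; first exact: eq_itgb E1 i1.
  exact: itgb_ae mR i2 E2.
by rewrite -(eq_Int E1) e; apply: eq_Int_ae => //; exact: itgb_meas i2.
Qed.

Lemma omega_incr be s t : 1 <= be <= 2 -> 0 <= s -> s <= t -> omega be s <= omega be t.
Proof.
move=> hb s0 st; have g0 : 0 < Gamma be by apply: Gamma_gt0; lra.
rewrite /omega ler_wpM2r ?invr_ge0 ?(ltW g0)// ge0_ler_powR ?subr_ge0 ?nnegrE//; first lra.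
exact: le_trans st.
Qed.

(* Both the change of the kernel and the new piece integrate to at most [omega (al + 1) (t - s)]. *)
Lemma frac_hoelder c s t al W M : 0 < al <= 1 -> c <= s -> s <= t -> 0 <= M ->
  measurable_fun (`]c, t[ : set R) W -> {ae mu, forall r, c < r < t -> `|W r| <= M} ->
  [/\ itgb c t (fun r => omega al (t - r) * W r), itgb c s (fun r => omega al (s - r) * W r) &
  `|Int c t (fun r => omega al (t - r) * W r) - Int c s (fun r => omega al (s - r) * W r)| <=
    2 * M * omega (al + 1) (t - s)].
Proof.
move=> hal cs st M0 mW bW; have ct := le_trans cs st; have al2 : 0 < al <= 2 by lra.
have mWs : measurable_fun (`]c, s[ : set R) W.
  by apply: measurable_funS mW => // r /=; rewrite !in_itv/= => /andP[-> /lt_le_trans]; exact.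
have I z d : c <= d -> d <= t -> d <= z -> measurable_fun (`]c, d[ : set R) W -> itgb c d (fun r => omega al (z - r) * W r).
  move=> cd dt dz mWd; apply: (itgb_le_ae (g := fun r => M * omega al (z - r))).
  - by apply: measurable_funM => //; exact: measurable_omega_conv.
  - apply: aeS bW => r h /andP[h1 h2]; rewrite normrM (ger0_norm (omega_ge0 _ al2)) mulrC.
    by rewrite ler_wpM2r ?omega_ge0// h// h1 (lt_le_trans h2).
  - by apply: itgbZ; exact: itgb_omega.
have it := I t t ct (lexx t) (lexx t) mW; have iss := I s s cs st (lexx s) mWs.
have its := I t s cs st st mWs.
split => //.
rewrite (@Int_split _ c t s _ _ it) ?cs//.
have -> : Int c s (fun r => omega al (t - r) * W r) + Int s t (fun r => omega al (t - r) * W r)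
   - Int c s (fun r => omega al (s - r) * W r) =
   Int s t (fun r => omega al (t - r) * W r) - Int c s (fun r => (omega al (s - r) - omega al (t - r)) * W r).
  have -> : Int c s (fun r => (omega al (s - r) - omega al (t - r)) * W r) =
     Int c s (fun r => omega al (s - r) * W r) - Int c s (fun r => omega al (t - r) * W r).
    by rewrite -IntB//; apply: eq_Int => r _; rewrite mulrBl.
  move: (Int c s (fun r => omega al (t - r) * W r)) (Int s t _) (Int c s _) => i j k; ring.
apply: (le_trans (ler_normB _ _)).
have b1 : `|Int s t (fun r => omega al (t - r) * W r)| <= M * omega (al + 1) (t - s).
  have <- : Int s t (fun r => M * omega al (t - r)) = M * omega (al + 1) (t - s).
    rewrite IntZ; last exact: itgb_omega.
    rewrite omega_int ?st ?lexx// subrr [X in _ - X]/omega addrK.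
    by rewrite powR0 ?mul0r ?subr0// gt_eqF//; lra.
  apply: Int_abs_le_ae; first exact: itgbS it.
    by apply: itgbZ; exact: itgb_omega.
  apply: aeS bW => r h /andP[h1 h2]; rewrite normrM (ger0_norm (omega_ge0 _ al2)) mulrC.
  by rewrite ler_wpM2r ?omega_ge0// h// (le_lt_trans cs h1).
have b2 : `|Int c s (fun r => (omega al (s - r) - omega al (t - r)) * W r)| <= M * omega (al + 1) (t - s).
  have iw1 : itgb c s (fun r => omega al (s - r)) by exact: itgb_omega.
  have iw2 : itgb c s (fun r => omega al (t - r)) by exact: itgb_omega.
  apply: le_trans (_ : Int c s (fun r => M * (omega al (s - r) - omega al (t - r))) <= _).
    apply: Int_abs_le_ae.
    - by apply: eq_itgb (itgbB iss its) => r _; rewrite mulrBl.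
    - by apply: itgbZ; exact: itgbB.
    apply: aeS bW => r h /andP[h1 h2]; rewrite normrM mulrC.
    rewrite (ger0_norm (_ : 0 <= omega al (s - r) - omega al (t - r))); last first.
      by rewrite subr_ge0 omega_decr// ?subr_gt0// lerB.
    rewrite ler_wpM2r ?h ?h1 ?(lt_le_trans h2)//.
    by rewrite subr_ge0 omega_decr// ?subr_gt0// lerB.
  rewrite IntZ; last exact: itgbB.
  rewrite ler_wpM2l// IntB//.
  rewrite !omega_int ?cs ?lexx ?st// subrr.
  have -> : omega (al + 1) 0 = 0 :> R.
    by rewrite /omega addrK powR0 ?mul0r// gt_eqF//; lra.
  have := @omega_incr (al + 1) (s - c) (t - c); have := hal => ?.
  by move=> h; have {}h := h _ _ _; lra.
lra.
Qed.

(** Left continuity at t, which is all that averages over short intervals ]s, t[ can see. *)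
Definition lcont t0 t (c : R -> R) : Prop :=
  forall eta : R, 0 < eta -> exists2 s0, t0 <= s0 < t & forall r, s0 < r < t -> `|c r - c t| <= eta.

Lemma powR_small be A eta : 0 < be -> 0 <= A -> 0 < eta -> exists2 d, 0 < d &
  forall h, 0 <= h <= d -> A * h `^ be <= eta.
Proof.
move=> b0 A0 e0; have A1 : 0 < A + 1 by rewrite ltr_wpDl.
exists ((eta / (A + 1)) `^ be^-1); first by rewrite powR_gt0// divr_gt0.
move=> h /andP[h0 hd].
have : h `^ be <= eta / (A + 1).
  apply: le_trans (ge0_ler_powR (ltW b0) _ _ hd) _; rewrite ?nnegrE ?powR_ge0//.
  by rewrite -powRrM mulVf ?gt_eqF// powRr1// divr_ge0 ?(ltW e0) ?(ltW A1).
rewrite ler_pdivlMr// => h1; apply: le_trans h1; rewrite mulrC ler_wpM2l ?powR_ge0//.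
by rewrite lerDl.
Qed.

Lemma hoelder_lcont t0 t be A (c : R -> R) : t0 < t -> 0 < be -> 0 <= A ->
  (forall r, t0 < r < t -> `|c r - c t| <= A * (t - r) `^ be) -> lcont t0 t c.
Proof.
move=> tt b0 A0 h eta e0; have [d d0 hd] := powR_small b0 A0 e0.
exists (Num.max t0 (t - d)); first by rewrite le_max lexx gt_max tt ltrBlDr ltrDl.
move=> r; rewrite gt_max => /andP[/andP[r0 rd] rt].
by rewrite (le_trans (h r _)) ?r0// hd//; lra.
Qed.

Lemma lcont_sub t0 t1 t (c : R -> R) : t0 <= t1 -> lcont t1 t c -> lcont t0 t c.
Proof.
by move=> tt h eta /h[s /andP[s0 st] hs]; exists s => //; rewrite (le_trans tt).
Qed.

Lemma hoelder_cont t0 t be A g : t0 <= t -> 0 < be -> 0 <= A ->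
  (forall r s, t0 <= r -> r <= s -> s <= t -> `|g s - g r| <= A * (s - r) `^ be) ->
  {within `[t0, t], continuous g}.
Proof.
move=> tt b0 A0 h; apply/subspace_continuousP => x; rewrite /= in_itv/= => /andP[tx xt].
apply/cvgrPdist_le => eta e0; have [d d0 hd] := powR_small b0 A0 e0.
have : nbhs x (fun y => `|x - y| <= d) by have /cvgrPdist_le := @cvg_id _ (nbhs x); apply.
apply: filterS => y xy; rewrite /= in_itv/= => /andP[ty yt].
have [le|/ltW le] := leP x y.
  rewrite distrC (le_trans (h _ _ tx le yt))// hd// subr_ge0 le/=.
  by move: xy; rewrite distrC ger0_norm ?subr_ge0.
rewrite (le_trans (h _ _ ty le xt))// hd// subr_ge0 le/=.
by move: xy; rewrite ger0_norm ?subr_ge0.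
Qed.

Lemma lcont_within t0 t t1 (c : R -> R) : t0 < t -> t <= t1 -> {within `[t0, t1], continuous c} -> lcont t0 t c.
Proof.
move=> tt tt1 /subspace_continuousP/(_ t); rewrite /= in_itv/= (ltW tt) tt1 => /(_ isT) h eta e0.
have /cvgrPdist_le/(_ _ e0) h' := h.
have {h'} : nbhs t (fun y => y \in `[t0, t1] -> `|c t - c y| <= eta) by exact: h'.
move=> /nbhs_ballP[d /= d0 hd].
exists (Num.max t0 (t - d)); first by rewrite le_max lexx gt_max tt ltrBlDr ltrDl.
move=> r; rewrite gt_max => /andP[/andP[r0 rd] rt].
rewrite distrC; apply: hd; last by rewrite in_itv/= (ltW r0) (le_trans (ltW rt)).
by rewrite /ball/= ger0_norm; lra.
Qed.

(** On ]s, t[ the functions H and W have the same mean, W is within eps of c almost everywhere, and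
    H and c are close to their values at t. An inequality known at almost every time thus passes to
    the given time. *)
Lemma avg_bound t0 t (H W c : R -> R) eps : t0 < t -> itgb t0 t H -> itgb t0 t W -> itgb t0 t c ->
  (forall s, t0 <= s -> s <= t -> Int s t H = Int s t W) ->
  {ae mu, forall r, t0 < r < t -> `|W r - c r| <= eps} ->
  lcont t0 t H -> lcont t0 t c -> `|H t - c t| <= eps.
Proof.
move=> tt iH iW ic e bW lH lc; apply/ler_addgt0Pr => eta e0.
have e2 : 0 < eta / 2 by rewrite divr_gt0.
have [s1 /andP[s10 s1t] h1] := lH _ e2; have [s2 /andP[s20 s2t] h2] := lc _ e2.
pose s := Num.max s1 s2.
have st : s < t by rewrite gt_max s1t s2t.
have s0 : t0 <= s by rewrite le_max s10.
have S f : itgb t0 t f -> itgb s t f by exact: itgbS.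
have id : itgb s t (fun r => W r - H r) by apply: itgbB; exact: S.
have z : Int s t (fun r => W r - H r) = 0 by rewrite (IntB (S _ iW) (S _ iH)) -(e s s0 (ltW st)) subrr.
rewrite -(ler_pM2r (_ : 0 < t - s)) ?subr_gt0// -[X in _ * X]ger0_norm ?subr_ge0 ?(ltW st)//.
rewrite -normrM -(Int_cst _ (ltW st)) -[X in `|X|]addr0 -z -IntD//; last exact: itgb_cst.
rewrite -(Int_cst (eps + eta) (ltW st)).
apply: Int_abs_le_ae; [by apply: itgbD => //; exact: itgb_cst|exact: itgb_cst|].
apply: aeS bW => r h /andP[sr rt]; move: sr; rewrite gt_max => /andP[sr1 sr2].
have := h1 r; have := h2 r; rewrite sr1 sr2 rt => /(_ isT) k1 /(_ isT) k2.
have k3 : `|W r - c r| <= eps by apply: h; rewrite rt (le_lt_trans s10 sr1).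
have -> : H t - c t + (W r - H r) = - (H r - H t) + ((W r - c r) + (c r - c t)) by ring.
rewrite (le_trans (ler_normD _ _))// normrN.
have := ler_normD (W r - c r) (c r - c t); lra.
Qed.

Lemma powR_lip be x y : be <= 0 -> 0 < x -> x <= y ->
  0 <= x `^ be - y `^ be <= - be * x `^ (be - 1) * (y - x).
Proof.
move=> b0 x0 xy; have y0 := lt_le_trans x0 xy.
apply/andP; split.
  rewrite subr_ge0 -[be]opprK !(powRN _ (- be)) lef_pV2 ?posrE ?powR_gt0//.
  by apply: ge0_ler_powR; rewrite ?nnegrE ?oppr_ge0 ?(ltW x0) ?(ltW y0).
have [->|xNy] := eqVneq x y; first by rewrite !subrr mulr0.
have lt : x < y by rewrite lt_neqAle xNy.
have [||z] := @MVT R (fun s => s `^ be) (fun s => be * s `^ (be - 1)) x y lt.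
- by move=> z; rewrite in_itv/= => /andP[xz _]; apply: is_derive_powR; exact: lt_trans xz.
- apply: derivable_within_continuous => z; rewrite in_itv/= => /andP[xz _].
  by have [] := is_derive_powR be (lt_le_trans x0 xz).
rewrite in_itv/= => /andP[xz zy] e; rewrite -opprB e -mulNr ler_wpM2r ?subr_ge0//.
rewrite -mulNr ler_wpM2l ?oppr_ge0//.
rewrite -[be - 1]opprB !powRN lef_pV2 ?posrE ?powR_gt0// ?(lt_trans x0)//.
by apply: ge0_ler_powR; rewrite ?nnegrE ?(ltW x0) ?(ltW xz) ?(le_trans (ltW x0) (ltW xz))//; lra.
Qed.

(** The singularities of e at 0 and of the kernel at r are separated at c = t / 2. Before c the
    kernel is Lipschitz in r for r > 3 t / 4; after c the function e is bounded and [frac_hoelder]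
    applies. *)
Lemma frac_lcont be al e A t : 0 < be < 1 -> 0 < al <= 1 -> 0 < t -> 0 <= A ->
  measurable_fun (`]0, t[ : set R) e -> (forall s, 0 < s < t -> `|e s| <= A * s `^ (al - 1)) ->
  lcont 0 t (fun r => Int 0 r (fun s => omega be (r - s) * e s)).
Proof.
move=> hbe hal t0 A0 me be'; pose c := t / 2; have c0 : 0 < c by rewrite divr_gt0.
have be1 : 0 < be <= 1 by lra.
have ct : c < t by rewrite /c; lra.
have be2 : 0 < be <= 2 by lra.
have g0 := Gamma_gt0 be2.
have g1 : 0 < Gamma (be + 1) :> R by apply: Gamma_gt0; lra.
(* A Lipschitz constant of the kernel on [t / 4, +oo[; for s < c and r > 3 t / 4 the argument r - s
   is at least t / 4. *)
pose lam := - (be - 1) * (t / 4) `^ (be - 1 - 1) / Gamma be.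
have lam0 : 0 <= lam.
  by rewrite /lam divr_ge0 ?(ltW g0)// mulr_ge0 ?powR_ge0//; clear -hbe; lra.
pose I0 := Int 0 c (fun s => A * s `^ (al - 1)).
have [ipow _] := @powint0 R al c (proj1 (andP hal)) (ltW c0).
have iA : itgb 0 c (fun s => A * s `^ (al - 1)) by exact: itgbZ.
have I00 : 0 <= I0 by apply: Int_ge0 => s _; rewrite mulr_ge0 ?powR_ge0.
pose M := A * c `^ (al - 1); have M0 : 0 <= M by rewrite mulr_ge0 ?powR_ge0.
have eM s : c <= s -> s < t -> `|e s| <= M.
  move=> cs st; have s0 := lt_le_trans c0 cs.
  rewrite (le_trans (be' s _)) ?s0// ler_wpM2l//.
  rewrite -[al - 1]opprB !powRN lef_pV2 ?posrE ?powR_gt0//.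
  by apply: ge0_ler_powR; rewrite ?nnegrE ?(ltW c0) ?(ltW s0)//; clear -hal; lra.
apply: lcont_sub (_ : 0 <= 3 / 4 * t) _; first by rewrite mulr_ge0 ?(ltW t0)//; clear; lra.
apply: (@hoelder_lcont _ _ be (lam * I0 * t `^ (1 - be) + 2 * M / Gamma (be + 1))).
- by clear -t0; lra.
- by case/andP: hbe.
- apply: addr_ge0; first by rewrite mulr_ge0 ?powR_ge0// mulr_ge0.
  by rewrite divr_ge0 ?(ltW g1)// mulr_ge0.
move=> r /andP[r34 rt]; have cr : c <= r by rewrite /c; clear -r34 t0; lra.
have me' c' d' : 0 <= c' -> d' <= t -> measurable_fun (`]c', d'[ : set R) e.
  move=> c'0 d't; apply: measurable_funS me => // s /=; rewrite !in_itv/= => /andP[h1 h2].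
  by rewrite (le_lt_trans c'0 h1) (lt_le_trans h2 d't).
have eM' : {ae mu, forall s, c < s < t -> `|e s| <= M}.
  by apply: aeW => s /andP[/ltW h1 h2]; exact: eM.
have [i1 i2 hh] := @frac_hoelder c r t be e M be1 cr (ltW rt) M0 (me' _ _ (ltW c0) (lexx t)) eM'.
have near z : c < z -> z - c >= t / 4 -> z <= t -> itgb 0 c (fun s => omega be (z - s) * e s).
  move=> cz zc zt; apply: (itgb_le (g := fun s => omega be (t / 4) * (A * s `^ (al - 1)))).
  - by apply: measurable_funM; [exact: measurable_omega_conv|exact: me' (ltW ct)].
  - move=> s /andP[s0 sc]; rewrite normrM (ger0_norm (omega_ge0 _ be2)).
    apply: ler_pM => //; first exact: omega_ge0.
      by apply: omega_decr; [exact: be1|by clear -t0; lra|by clear -zc sc; lra].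
    by apply: be'; rewrite s0 (lt_trans sc).
  - exact: itgbZ.
have rc : r - c >= t / 4 by rewrite /c; clear -r34; lra.
have tc : t - c >= t / 4 by rewrite /c; clear -t0; lra.
have j1 : itgb 0 c (fun s => omega be (r - s) * e s) by apply: near; [by clear -rc t0; lra|exact: rc|exact: ltW].
have j2 : itgb 0 c (fun s => omega be (t - s) * e s) by apply: near; [exact: ct|exact: tc|exact: lexx].
have it : itgb 0 t (fun s => omega be (t - s) * e s).
  by apply: (itgb_split _ j2 i1); rewrite (ltW c0) (ltW ct).
have ir : itgb 0 r (fun s => omega be (r - s) * e s).
  by apply: (itgb_split _ j1 i2); rewrite (ltW c0) cr.
rewrite (@Int_split _ 0 t c _ _ it) ?(ltW c0) ?(ltW ct)// (@Int_split _ 0 r c _ _ ir) ?(ltW c0) ?cr//.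
have b1 : `|Int 0 c (fun s => omega be (r - s) * e s) - Int 0 c (fun s => omega be (t - s) * e s)| <= lam * (t - r) * I0.
  rewrite -IntB// /I0 -IntZ//; apply: Int_abs_le; [exact: itgbB|exact: itgbZ|].
  move=> s /andP[s0 sc]; rewrite -mulrBl normrM; apply: ler_pM => //; last first.
    by apply: be'; rewrite s0 (lt_trans sc).
  have x0 : 0 < r - s by clear -sc cr; lra.
  have xy : r - s <= t - s by clear -rt; lra.
  have be0 : be - 1 <= 0 by clear -hbe; lra.
  have be20 : 0 <= 1 + 1 - be by clear -hbe; lra.
  have rs4 : t / 4 <= r - s by clear -rc sc; lra.
  have t40 : 0 < t / 4 by clear -t0; lra.
  have /andP[p1 p2] := powR_lip be0 x0 xy.
  have -> : omega be (r - s) - omega be (t - s) = ((r - s) `^ (be - 1) - (t - s) `^ (be - 1)) / Gamma be.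
    by rewrite /omega mulrBl.
  rewrite ger0_norm; last by rewrite divr_ge0 ?(ltW g0).
  rewrite /lam mulrAC ler_wpM2r ?invr_ge0 ?(ltW g0)//.
  apply: (le_trans p2).
  have -> : t - s - (r - s) = t - r by ring.
  rewrite ler_wpM2r ?subr_ge0 ?(ltW rt)// ler_wpM2l ?oppr_ge0//.
  rewrite (_ : be - 1 - 1 = - (1 + 1 - be)); last by ring.
  rewrite !powRN lef_pV2 ?posrE ?powR_gt0//.
  by apply: ge0_ler_powR; rewrite ?nnegrE ?(ltW t40) ?(ltW x0).
have eo : omega (be + 1) (t - r) = (t - r) `^ be / Gamma (be + 1) by rewrite /omega addrK.
rewrite eo in hh.
(* The Lipschitz contribution is weakened to the Hoelder exponent [be] of the other one. *)
have tr : t - r <= t `^ (1 - be) * (t - r) `^ be.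
  have tr0 : 0 < t - r by rewrite subr_gt0.
  have {1}-> : t - r = (t - r) `^ (1 - be) * (t - r) `^ be.
    rewrite -powRD ?subrK ?powRr1 ?(ltW tr0)//; apply/implyP => _; rewrite gt_eqF//.
  rewrite ler_wpM2r ?powR_ge0//; apply: ge0_ler_powR; rewrite ?nnegrE; clear -hbe tr0 t0 r34; lra.
have : lam * (t - r) * I0 <= lam * I0 * (t `^ (1 - be) * (t - r) `^ be).
  by rewrite mulrAC ler_wpM2l// mulr_ge0.
rewrite distrC; move: b1 hh.
move: (Int 0 c _) (Int c r _) (Int 0 c _) (Int c t _) (lam * (t - r) * I0) => x1 x2 x3 x4 x5 b1 hh b2.
have -> : x1 + x4 - (x3 + x2) = (x4 - x2) - (x3 - x1) by ring.
rewrite (le_trans (ler_normB _ _))//.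
move: (lam * I0) b2 => x6 b2; rewrite mulrDl.
have -> : x6 * t `^ (1 - be) * (t - r) `^ be = x6 * (t `^ (1 - be) * (t - r) `^ be) by rewrite mulrA.
have -> : 2 * M / Gamma (be + 1) * (t - r) `^ be = 2 * M * ((t - r) `^ be / Gamma (be + 1)).
  by rewrite -mulrA [_^-1 * _]mulrC.
move: hh b1 b2; move: (2 * M * _) (x6 * _) => x7 x8; lra.
Qed.

(** Monotone convergence along dl = 1 / (n + 1): a bound uniform in dl yields square integrability
    up to the ends. *)
Lemma L2_exhaust L f B : 0 < L -> measurable_fun (`]0, L[ : set R) f -> 0 <= B ->
  (forall dl, 0 < dl -> itgb dl (L - dl) (fun x => f x ^+ 2) /\ Int dl (L - dl) (fun x => f x ^+ 2) <= B) ->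
  L2on 0 L f /\ Int 0 L (fun x => f x ^+ 2) <= B.
Proof.
move=> L0 mf B0 h; pose F x := (f x ^+ 2)%:E.
have mF : measurable_fun (`]0, L[ : set R) F by apply/measurable_EFinP; exact: measurable_funX.
pose d n : R := n.+1%:R^-1; have d0 n : 0 < d n by rewrite invr_gt0 ltr0n.
pose J n : set R := `]d n, L - d n[%classic.
have mJ n : measurable (J n) by exact: measurable_itv.
pose g (n : nat) : R -> \bar R := F \_ (J n).
have JE n x : (x \in J n) = (d n < x < L - d n) by rewrite /J mem_setE in_itv.
have mI : measurable (`]0, L[ : set R) by exact: measurable_itv.
have mg n : measurable_fun (`]0, L[ : set R) (g n).
  by apply/measurable_restrict => //; apply: measurable_funS mF => // x [].
have g0 n x : (`]0, L[%classic : set R) x -> (0 <= g n x)%E.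
  by move=> _; rewrite /g patchE; case: ifP => // _; rewrite lee_fin sqr_ge0.
have gm x : (`]0, L[%classic : set R) x -> {homo g^~ x : n m / (n <= m)%N >-> (n <= m)%E}.
  move=> _ n m nm; rewrite /g !patchE !JE.
  have dm : d m <= d n by rewrite lef_pV2 ?posrE ?ltr0n// ler_nat.
  case: ifP => [/andP[h1 h2]|_]; last by case: ifP => // _; rewrite lee_fin sqr_ge0.
  by rewrite ifT//; apply/andP; split; lra.
have := @cvg_monotone_convergence _ _ _ mu _ mI g mg g0 gm.
have -> : (\int[mu]_(x in (`]0%R, L[%classic : set R)) limn (fun n => g n x) = \int[mu]_(x in (`]0%R, L[%classic : set R)) F x)%E.
  apply: eq_integral => x /set_mem/in_oo hx; apply/cvg_lim => //.
  apply: cvg_near_cst.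
  have /cvgrPdist_lt/(_ (Num.min x (L - x))) := invS_cvg0 (R := R).
  rewrite lt_min subr_gt0 => /(_ hx); apply: filterS => n.
  rewrite sub0r normrN gtr0_norm; last exact: d0.
  rewrite lt_min -/(d n) => /andP[h1 h2].
  by rewrite /g patchE JE ifT//; apply/andP; split; lra.
move=> cv.
have bd n : (\int[mu]_(x in `]0%R, L[) g n x <= B%:E)%E.
  rewrite /g -integral_mkcondr (_ : _ `&` _ = J n); last first.
    apply/seteqP; split => x //=; first by case.
    rewrite /J /= !in_itv/= => /andP[h1 h2]; split; last by rewrite h1.
    by have dn := d0 n; apply/andP; split; lra.
  have [i le] := h _ (d0 n).
  rewrite -(@fineK _ (\int[mu]_(x in J n) F x)%E); first by rewrite lee_fin.
  have i' : mu.-integrable (J n) F by exact: i.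
  by apply: integrable_fin_num; [exact: measurable_itv|exact: i'].
have fin : (\int[mu]_(x in `]0%R, L[) F x <= B%:E)%E.
  by apply: (cvge_le _ cv) => //; apply: nearW => n; exact: bd.
have i2 : itgb 0 L (fun x => f x ^+ 2).
  apply/integrableP; split; first by apply/measurable_EFinP; exact: measurable_funX.
  apply: le_lt_trans (ltry B); apply: le_trans fin; rewrite le_eqVlt; apply/orP; left; apply/eqP.
  by apply: eq_integral => x _ /=; rewrite ger0_norm ?sqr_ge0.
split => //.
rewrite -lee_fin /Int /Rintegral fineK//.
have i' : mu.-integrable (`]0, L[%classic : set R) F by exact: i2.
by apply: integrable_fin_num; [exact: measurable_itv|exact: i'].
Qed.

End frac_tools.

(** * Fractional integrals of powers *)

Section more_tools.
Context {R : realType}.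
Local Notation mu := (@lebesgue_measure R).
Implicit Types (a b t x al : R) (v : R -> R).

Lemma cont_bnd a b v : a <= b -> {within `[a, b], continuous v} ->
  exists2 B, 0 <= B & forall x, a <= x <= b -> `|v x| <= B.
Proof.
move=> ab cv; have cc := contNorm (clamp_cont ab cv).
have [m _ hm] := EVT_max ab (@cont_within _ _ a b cc).
exists `|v (clamp a b m)| => // x hx; rewrite -[in leLHS](clampE hx).
by apply: hm; rewrite in_itv.
Qed.

Lemma itgb_omega_pow al t : 0 < al < 1 -> 0 < t ->
  itgb 0 t (fun s => omega (1 - al) (t - s) * s `^ (al - 1)).
Proof.
move=> hal t0; have g0 : 0 < Gamma al :> R by apply: Gamma_gt0; lra.
have [] := @omega_conv R (1 - al) al t _ _ _ t0; [lra|lra|lra|].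
move=> i _; apply: eq_itgb (itgbZ (Gamma al) i) => s _.
by rewrite [omega al s]/omega; field; rewrite gt_eqF.
Qed.

(** The power s^(al-1) is a multiple of [omega al], and the two kernels compose to [omega 1]. Hence
    a derivative bounded by t^(al-1) has a fractional integral of order 1 - al that is bounded
    uniformly in t. *)
Lemma omega1al_pow al t : 0 < al < 1 -> 0 < t ->
  Int 0 t (fun s => omega (1 - al) (t - s) * s `^ (al - 1)) = Gamma al.
Proof.
move=> hal t0; have g0 : 0 < Gamma al :> R by apply: Gamma_gt0; lra.
have [] := @omega_conv R (1 - al) al t _ _ _ t0; [lra|lra|lra|].
rewrite subrK omega1 => i e.
rewrite (@eq_Int _ _ _ _ (fun s => Gamma al * (omega (1 - al) (t - s) * omega al s))).
  by rewrite IntZ// e mulr1.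
by move=> s _; rewrite [omega al s]/omega; field; rewrite gt_eqF.
Qed.

(** A number of [0, 1] is at most its power al; this is applied to r / t and (t - r) / t, which sum
    to 1. *)
Lemma powR_subadd al r t : 0 < al <= 1 -> 0 <= r -> r <= t -> t `^ al - r `^ al <= (t - r) `^ al.
Proof.
move=> /andP[a0 a1] r0 rt; have [t0|t0] := leP t 0.
  have -> : r = t by apply/eqP; rewrite eq_le rt (le_trans t0).
  by rewrite subrr powR_ge0.
have H x : 0 <= x <= 1 -> x <= x `^ al.
  move=> /andP[x0 x1]; have [->|xN0] := eqVneq x 0; first by rewrite powR_ge0.
  have x0' : 0 < x by rewrite lt_neqAle eq_sym xN0.
  rewrite -{1}[x]powRr1// -[X in x `^ X](subrK al) powRD; last by apply/implyP.
  rewrite ler_piMl ?powR_ge0//.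
  have := @ge0_ler_powR R (1 - al) _ x 1; rewrite powR1; apply => //; rewrite ?nnegrE ?subr_ge0//.
have h1 : 0 <= r / t <= 1 by rewrite divr_ge0 ?(ltW t0)//= ler_pdivrMr// mul1r.
have h2 : 0 <= (t - r) / t <= 1.
  by rewrite divr_ge0 ?subr_ge0 ?(ltW t0)//= ler_pdivrMr// mul1r lerBlDr lerDl.
have E y : 0 <= y -> y `^ al = t `^ al * (y / t) `^ al.
  by move=> y0; rewrite -powRM ?(ltW t0) ?divr_ge0 ?(ltW t0)// mulrCA divff ?gt_eqF// mulr1.
rewrite lerBlDr (E (t - r)) ?subr_ge0// (E r)// -mulrDr ler_peMr ?powR_ge0//.
have := H _ h1; have := H _ h2.
have : r / t + (t - r) / t = 1 by rewrite -mulrDl addrC subrK divff// gt_eqF.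
by move: (r / t) ((t - r) / t) => y z; lra.
Qed.

Lemma cont_sum a b n (F : 'I_n -> R -> R) : (forall i, {within `[a, b], continuous (F i)}) ->
  {within `[a, b], continuous (fun t => \sum_i F i t)}.
Proof.
move=> h; elim: (index_enum _) => [|i s IH].
  have c := @cont_within R (fun=> 0) a b (@contC R 0).
  by apply: (subspace_eq_continuous _ c) => t _; rewrite /from_subspace big_nil.
have c : {within `[a, b], continuous (fun t => F i t + \sum_(j <- s) F j t)}.
  by move=> t; apply: cvgD; [exact: h|exact: IH].
by apply: (subspace_eq_continuous _ c) => t _; rewrite /from_subspace big_cons.
Qed.

End more_tools.

(** * The weak form of the equation *)

Section solution.
Context {R : realType}.
Local Notation mu := (@lebesgue_measure R).
Local Notation TR := (measurableTypeR R).
Implicit Types (s t x : R) (k : nat).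
Context (alpha tau : R) (K : nat) (p a b L : R) (f u : R -> R -> R) (C : R).
Context (halpha : 0 < alpha < 1) (htau : 0 < tau) (hL : 0 < L).
Local Notation T := (K%:R * tau).
Context (hf : {within (`]0, L[ : set R) `*` (`[0, T] : set R),
             continuous (fun z : R * R => f z.1 z.2)}).
Context (cu : forall x, 0 <= x <= L -> {within `[- tau, T], continuous (u x)}).
Context (cux : forall t, - tau <= t <= T -> {within `[0, L], continuous (u^~ t)}).
Context (pde : forall (k : nat) (x t : R), (1 <= k <= K)%N ->
        x \in `]0, L[ -> t \in delay_itv tau k ->
        [/\ derivable (u^~ t) x 1 /\ derivable (derive1 (u^~ t)) x 1,
            frac_integrable alpha (elliptic p a u x) t,
            derivable_in (delay_itv tau k) (u x) t,
            derivable_in (delay_itv tau k)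
              (frac_int alpha (elliptic p a u x)) t &
            derive_in (delay_itv tau k) (u x) t =
              derive_in (delay_itv tau k)
                (frac_int alpha (elliptic p a u x)) t
              + b * u x (t - tau) + f x t]).
Context (hC : forall (k : nat) (x t : R), (1 <= k <= K)%N ->
    x \in `]0, L[ -> t \in delay_itv tau k ->
    let I := delay_itv tau k in
    [/\ derivable_in I (u x) t,
        derivable_in I (derive_in I (u x)) t,
        `|derive_in I (u x) t| <= C * (1 + t `^ (alpha - 1)) &
        `|derive_in I (derive_in I (u x)) t| <=
          C * (1 + if k == 1%N then t `^ (alpha - 2)
                   else (t - tau) `^ (alpha - 1))]).

Lemma T_ge0 : 0 <= T. Proof. by rewrite mulr_ge0 ?ler0n ?(ltW htau). Qed.

Let tauT : - tau <= T. Proof. by have := T_ge0; have := htau; lra. Qed.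

Let inI k t : (k%:R - 1) * tau < t <= k%:R * tau -> t \in delay_itv tau k.
Proof. by move=> h; apply/mem_set; rewrite /delay_itv/= in_itv. Qed.

Lemma u_mfun2 c : mfun2 (`]0, L[%classic : set TR) setT (fun x t => u x (clamp (- tau) T (t - c))).
Proof.
have mI : measurable (`]0, L[%classic : set TR) by exact: measurable_itv.
apply: carath => // [t|x /in_oo/andP[/ltW x0 /ltW xL]].
  exact: itgb_meas (itgb_continuous (cux (clamp_in _ tauT))).
move=> t; apply: (@continuous_comp _ _ _ (fun s => s - c) (fun s => u x (clamp (- tau) T s))).
  by apply: cvgB => //; exact: cvg_cst.
by apply: clamp_cont => //; apply: cu; rewrite x0.
Qed.

Lemma u_mfun2_shift c s t : - tau <= s - c -> t - c <= T ->
  mfun2 (`]0, L[%classic : set TR) (`]s, t[%classic : set TR) (fun x r => u x (r - c)).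
Proof.
move=> h1 h2; have mI : measurable (`]0, L[%classic : set TR) by exact: measurable_itv.
apply: eq_mfun2 (mf2S mI measurableT _ _ (u_mfun2 c)) => // x r _ /in_oo hr.
by rewrite clampE//; lra.
Qed.

(** Backward quotients, which at the right end of a delay interval converge to the derivative of the
    restriction; - m.+1%:R is the inverse of the increment. The projection [clamp] makes them total
    and is inactive for large m. *)
Let quot (m : nat) x t : R :=
  (u x (clamp (- tau) T (t - m.+1%:R^-1)) - u x (clamp (- tau) T (t - 0))) * - m.+1%:R.

(** One jointly measurable function for all delay intervals, in place of K derivatives relative to K
    sets. *)
Definition Du x t : R := lim ((fun m => quot m x t) @ \oo).

Lemma quot_cvg k x t : (1 <= k <= K)%N -> 0 < x < L -> (k%:R - 1) * tau < t <= k%:R * tau ->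
  (fun m => quot m x t) @ \oo --> derive_in (delay_itv tau k) (u x) t.
Proof.
move=> hk hx ht; have hx' : x \in `]0, L[ by rewrite in_itv.
have [dg _ _ _] := hC hk hx' (inI ht).
have sc : (fun m => t - m.+1%:R^-1) @ \oo --> t.
  by rewrite -[X in _ --> X]subr0; apply: cvgB; [exact: cvg_cst|exact: invS_cvg0].
have m0 (m : nat) : 0 < m.+1%:R^-1 :> R by rewrite invr_gt0 ltr0n.
have sA : \forall m \near \oo, delay_itv tau k (t - m.+1%:R^-1).
  have /cvgrPdist_lt/(_ (t - (k%:R - 1) * tau)) := invS_cvg0 (R := R).
  rewrite subr_gt0; case/andP: (ht) => -> _ /(_ isT); apply: filterS => m.
  rewrite sub0r normrN gtr0_norm// => h; rewrite /delay_itv/= in_itv/=.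
  by move: (m.+1%:R^-1) (m0 m) h => z z0 h; lra.
have sn m : t - m.+1%:R^-1 != t by rewrite -subr_eq0 addrAC subrr sub0r oppr_eq0 gt_eqF.
have := derivable_in_seq dg sc sn sA; apply: cvg_trans; apply: near_eq_cvg.
apply: filterS sA => m; rewrite /delay_itv/= in_itv/= => hm.
have kK : k%:R * tau <= T by rewrite ler_wpM2r ?(ltW htau)// ler_nat; case/andP: hk.
have k1 : 0 <= (k%:R - 1) * tau by rewrite mulr_ge0 ?(ltW htau)// subr_ge0 ler1n; case/andP: hk.
have t0 := htau; have h1 : - tau <= t - m.+1%:R^-1 <= T by move: (m.+1%:R^-1) hm => z; lra.
rewrite /quot subr0 !clampE//; last lra.
by rewrite addrAC subrr sub0r invrN invrK.
Qed.

Lemma Du_in k x t : (1 <= k <= K)%N -> 0 < x < L -> (k%:R - 1) * tau < t <= k%:R * tau ->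
  Du x t = derive_in (delay_itv tau k) (u x) t.
Proof. by move=> hk hx ht; apply/cvg_lim => //; exact: quot_cvg. Qed.

Lemma Du_mfun2 : mfun2 (`]0, L[%classic : set TR) (`]0, T[%classic : set TR) Du.
Proof.
apply: (@mfun2_lim _ _ _ quot) => [m|x t /in_oo hx /in_oo/andP[t0 tT]].
  have mI : measurable (`]0, L[%classic : set TR) by exact: measurable_itv.
  apply: mf2M; last exact: measurable_cst.
  by apply: (mf2S mI measurableT) => //; apply: mf2B; exact: u_mfun2.
have [|k hk hkt] := @block_locate _ tau K t; first by rewrite t0 ltW.
by rewrite (Du_in hk hx hkt); exact: quot_cvg.
Qed.

Lemma powR_le_exp t (c d : R) : 0 < t <= T -> c <= d -> t `^ d <= T `^ (d - c) * t `^ c.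
Proof.
move=> /andP[t0 tT] cd.
have -> : t `^ d = t `^ (d - c) * t `^ c.
  by rewrite -powRD ?subrK//; apply/implyP => _; rewrite gt_eqF.
by rewrite ler_wpM2r ?powR_ge0// ge0_ler_powR ?subr_ge0// nnegrE ?(ltW t0)// (le_trans (ltW t0)).
Qed.

(** On ]0, T] the bound 1 + t^(alpha-1) is absorbed into its singular term, at the price of the
    factor T^(1-alpha) + 1. *)
Definition cD : R := `|C| * (T `^ (1 - alpha) + 1).

Lemma cD_ge0 : 0 <= cD. Proof. by rewrite mulr_ge0// addr_ge0 ?powR_ge0. Qed.

Let exp_bnd t c : 0 < t <= T -> c <= 0 -> C * (1 + t `^ c) <= `|C| * (T `^ (- c) + 1) * t `^ c.
Proof.
move=> ht c0; have := @powR_le_exp t c 0 ht c0; rewrite powRr0 sub0r => h.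
have h1 : 0 <= 1 + t `^ c by rewrite addr_ge0 ?powR_ge0.
apply: le_trans (_ : `|C| * (1 + t `^ c) <= _); first by rewrite ler_wpM2r// ler_norm.
by rewrite -mulrA ler_wpM2l// mulrDl mul1r lerD2r.
Qed.

Lemma Du_bnd x t : 0 < x < L -> 0 < t <= T -> `|Du x t| <= cD * t `^ (alpha - 1).
Proof.
move=> hx ht; have [k hk hkt] := block_locate ht.
rewrite (Du_in hk hx hkt).
have hx' : x \in `]0, L[ by rewrite in_itv.
have [_ _ h _] := hC hk hx' (inI hkt); apply: (le_trans h).
have ha := halpha; have := @exp_bnd t (alpha - 1) ht; rewrite opprB; apply; lra.
Qed.

Lemma Du_itgb x : 0 < x < L -> itgb 0 T (Du x).
Proof.
move=> hx; have [h _] := @powint0 R alpha T (proj1 (andP halpha)) T_ge0.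
apply: itgb_le (itgbZ cD h).
  have mI : measurable (`]0, L[%classic : set TR) by exact: measurable_itv.
  have mJ : measurable (`]0, T[%classic : set TR) by exact: measurable_itv.
  by apply: (mfun2_section mI mJ Du_mfun2); exact/in_oo.
by move=> t /andP[t0 tT]; apply: Du_bnd => //; rewrite t0 ltW.
Qed.

Lemma Du_cont k x s t : (1 <= k <= K)%N -> 0 < x < L -> (k%:R - 1) * tau < s -> t <= k%:R * tau ->
  {within `[s, t], continuous (Du x)}.
Proof.
move=> hk hx hs ht; have hx' : x \in `]0, L[ by rewrite in_itv.
have c : {within `[s, t], continuous (derive_in (delay_itv tau k) (u x))}.
  by apply: (derivable_in_cont hs ht) => r hr; have [] := hC hk hx' (inI hr).
apply: (subspace_eq_continuous _ c) => r; rewrite inE/= in_itv/= => /andP[h1 h2].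
rewrite /from_subspace (Du_in hk hx)// (lt_le_trans hs h1) (le_trans h2 ht)//.
Qed.

Lemma Du_FTC x s t : 0 < x < L -> 0 <= s -> s <= t -> t <= T -> Int s t (Du x) = u x t - u x s.
Proof.
move=> hx; have hx' : x \in `]0, L[ by rewrite in_itv.
apply: (@FTC_blocks _ tau K (u x)) => //.
- apply: within_sub (cu _) => //; last by case/andP: hx => /ltW -> /ltW ->.
  by rewrite oppr_le0 ltW.
- exact: Du_itgb.
move=> k r q hk hr rq hq; apply: (@FTC_in _ ((k%:R - 1) * tau) (k%:R * tau)) => //.
- by move=> z hz; have [] := hC hk hx' (inI hz).
- by move=> z hz; rewrite -/(delay_itv tau k) (Du_in hk hx hz).
- exact: (Du_cont hk).
Qed.

Definition cO1 : R := `|C| * (T `^ (2 - alpha) + 1).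

(** The bound on the second derivative decreases in time and is frozen at the left point s. The
    length t - s stays explicit, as the grading will be used on it. *)
Lemma Du_osc1 x s t : 0 < x < L -> (0 < K)%N -> 0 < s -> s <= t -> t <= tau ->
  `|Du x t - Du x s| <= cO1 * s `^ (alpha - 2) * (t - s).
Proof.
move=> hx K0 s0 st tt; have hx' : x \in `]0, L[ by rewrite in_itv.
have hk : (1 <= 1 <= K)%N by rewrite K0.
have e0 : (1 - 1) * tau = 0 by ring.
have ti r : 0 < r <= tau -> (1%:R - 1) * tau < r <= 1%:R * tau by rewrite e0 mul1r.
rewrite !(Du_in hk hx) ?ti ?s0 ?(le_trans st)// ?tt ?(lt_le_trans s0)//.
have -> : cO1 * s `^ (alpha - 2) * (t - s) = cO1 * s `^ (alpha - 2) * t - cO1 * s `^ (alpha - 2) * s by ring.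
apply: (@derive_in_osc _ ((1%:R - 1) * tau) (1%:R * tau) _ (fun r => cO1 * s `^ (alpha - 2) * r) (fun=> cO1 * s `^ (alpha - 2))).
- by rewrite e0.
- exact: st.
- by rewrite mul1r.
- by move=> z hz; have [] := hC hk hx' (inI hz).
- move=> r /andP[sr rt]; have r0 := lt_trans s0 sr.
  have hr : 0 < r <= tau by rewrite r0 (le_trans (ltW rt)).
  have [_ _ _ h] := hC hk hx' (inI (ti _ hr)); rewrite /= in h.
  have rT : 0 < r <= T.
    by rewrite r0 (le_trans (ltW rt))// (le_trans tt)// ler_peMl ?(ltW htau)// ler1n.
  apply: le_trans h _; have ha := halpha.
  have := @exp_bnd r (alpha - 2) rT; rewrite opprB => h1; apply: le_trans (h1 _) _; first lra.
  rewrite -/cO1 ler_wpM2l ?mulr_ge0 ?addr_ge0 ?powR_ge0//.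
  rewrite -[alpha - 2]opprB !powRN lef_pV2 ?posrE ?powR_gt0//.
  by apply: ge0_ler_powR; rewrite ?nnegrE ?(ltW s0) ?(ltW r0) ?(ltW sr)//; lra.
- by apply: cont_within; apply: contM; [exact: contC|exact: contI].
move=> r _; have := is_deriveZ (cO1 * s `^ (alpha - 2)) (is_derive_id r (1 : R)).
by rewrite /GRing.scale/= mulr1.
Qed.

Definition cO2 : R := `|C| * (T `^ (1 - alpha) + 1) / alpha.

(** The bound (r - tau)^(alpha-1) is integrable at tau. The estimate is kept as an increment of its
    primitive, whence the division by alpha in [cO2], so that sums over cells telescope. *)
Lemma Du_osc2 k x s t : 0 < x < L -> (2 <= k <= K)%N -> (k%:R - 1) * tau < s -> s <= t -> t <= k%:R * tau ->
  `|Du x t - Du x s| <= cO2 * (t - tau) `^ alpha - cO2 * (s - tau) `^ alpha.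
Proof.
move=> hx /andP[k2 kK] s0 st tt; have hx' : x \in `]0, L[ by rewrite in_itv.
have a0 : alpha != 0 by rewrite gt_eqF//; case/andP: halpha.
have hk : (1 <= k <= K)%N by rewrite kK (leq_trans _ k2).
have kT : k%:R * tau <= T by rewrite ler_wpM2r ?(ltW htau)// ler_nat.
have k1 : tau <= (k%:R - 1) * tau.
  by rewrite ler_peMl ?(ltW htau)// lerBrDr (_ : 1 + 1 = 2%:R)// ler_nat.
rewrite !(Du_in hk hx) ?s0 ?(le_trans st)// ?tt ?(lt_le_trans s0)//.
have dP r : s <= r <= t -> is_derive r 1 (fun z => cO2 * (z - tau) `^ alpha) (cO2 * (alpha * (r - tau) `^ (alpha - 1))).
  move=> /andP[sr rt]; have r0 : 0 < r - tau by lra.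
  have d1 := is_derive_powR alpha r0.
  have d2 : is_derive r 1 (fun z : R => z - tau) 1.
    by have := is_deriveB (is_derive_id r (1 : R)) (is_derive_cst tau r (1 : R)); rewrite subr0.
  have := is_deriveZ cO2 (@is_derive1_comp _ (fun z => z `^ alpha) (fun z => z - tau) r _ _ d1 d2).
  by rewrite mulr1.
apply: (@derive_in_osc _ ((k%:R - 1) * tau) (k%:R * tau) _ (fun r => cO2 * (r - tau) `^ alpha)
   (fun r => cO2 * (alpha * (r - tau) `^ (alpha - 1)))).
- exact: s0.
- exact: st.
- exact: tt.
- by move=> z hz; have [] := hC hk hx' (inI hz).
- move=> r /andP[sr rt]; have r0 : 0 < r - tau by lra.
  have hr : (k%:R - 1) * tau < r <= k%:R * tau by rewrite (lt_trans s0 sr) (le_trans (ltW rt) tt).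
  have [_ _ _ h] := hC hk hx' (inI hr); rewrite /= in h; move: h; have ha := halpha.
  rewrite ifF; last by apply/negbTE; rewrite neq_ltn k2 orbT.
  move=> h; apply: (le_trans h).
  have rT : 0 < r - tau <= T by rewrite r0; lra.
  have := @exp_bnd (r - tau) (alpha - 1) rT; rewrite opprB => h1; apply: le_trans (h1 _) _; first lra.
  by rewrite /cO2 mulrA -[X in _ <= X * _]mulrA mulVf// mulr1.
- by apply: derivable_within_continuous => r; rewrite in_itv/= => /dP[].
by move=> r /andP[sr rt]; apply: dP; rewrite !ltW.
Qed.

(** By the equation this is the time derivative of the fractional integral of order alpha of p u'' +
    a u. Being explicit in u and f, it has a pointwise bound. *)
Definition Eu x t : R := Du x t - b * u x (t - tau) - f x t.

Lemma Eu_cont k x s t : (1 <= k <= K)%N -> 0 < x < L -> (k%:R - 1) * tau < s -> t <= k%:R * tau ->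
  {within `[s, t], continuous (Eu x)}.
Proof.
move=> hk hx hs ht.
have kT : k%:R * tau <= T by rewrite ler_wpM2r ?(ltW htau)// ler_nat; case/andP: hk.
have k0 : 0 <= (k%:R - 1) * tau by rewrite mulr_ge0 ?(ltW htau)// subr_ge0 ler1n; case/andP: hk.
have c1 := Du_cont hk hx hs ht.
have c2 : {within `[s, t], continuous (fun r => u x (r - tau))}.
  have h : ccont (fun r => u x (clamp (- tau) T (r - tau))).
    move=> r; apply: (@continuous_comp _ _ _ (fun s => s - tau) (fun s => u x (clamp (- tau) T s))).
      by apply: cvgB => //; exact: cvg_cst.
    have cx : {within `[- tau, T], continuous (u x)} by apply: cu; case/andP: hx => /ltW -> /ltW ->.
    exact: (clamp_cont tauT cx).
  have h' := @cont_within _ _ s t h.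
  apply: (subspace_eq_continuous _ h') => r; rewrite inE/= in_itv/= => hr.
  by have t0 := htau; rewrite /from_subspace clampE//; lra.
have c3 : {within `[s, t], continuous (f x)} by apply: within_sub (rect_t hf hx); lra.
have cb : {within `[s, t], continuous (fun=> b)} by apply: cont_within; exact: contC.
by move=> r; apply: cvgB; [apply: cvgB; [exact: c1|apply: cvgM; [exact: cb|exact: c2]]|exact: c3].
Qed.

Lemma Eu_FTC k x s t : (1 <= k <= K)%N -> 0 < x < L -> (k%:R - 1) * tau < s -> s <= t -> t <= k%:R * tau ->
  Int s t (Eu x) = Int 0 t (fun r => omega alpha (t - r) * elliptic p a u x r)
                 - Int 0 s (fun r => omega alpha (s - r) * elliptic p a u x r).
Proof.
move=> hk hx hs st ht; have hx' : x \in `]0, L[ by rewrite in_itv.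
have := @FTC_in _ ((k%:R - 1) * tau) (k%:R * tau) (frac_int alpha (elliptic p a u x)) (Eu x) s t hs st ht.
apply.
- by move=> z hz; have [] := pde hk hx' (inI hz).
- move=> z hz; have [_ _ _ _] := pde hk hx' (inI hz).
  by rewrite /Eu (Du_in hk hx hz) => ->; rewrite -/(delay_itv tau k); ring.
exact: (Eu_cont hk hx hs ht).
Qed.

Lemma elliptic_mfun2 : mfun2 (`]0, L[%classic : set TR) (`]0, T[%classic : set TR) (elliptic p a u).
Proof.
have mJ : measurable (`]0, T[%classic : set TR) by exact: measurable_itv.
have mu0 : mfun2 (`]0, L[%classic : set TR) (`]0, T[%classic : set TR) u.
  have := @u_mfun2_shift 0 0 T; rewrite !subr0 => /(_ _ (lexx _)) h.
  by apply: eq_mfun2 (h _) => [x r _ _|]; rewrite ?subr0// oppr_le0 ltW.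
have dd x t : 0 < x < L -> (`]0, T[%classic : set TR) t ->
    derivable (u^~ t) x 1 /\ derivable (derive1 (u^~ t)) x 1.
  move=> hx /in_oo/andP[t0 tT]; have [|k hk hkt] := @block_locate _ tau K t; first by rewrite t0 ltW.
  by have [] := pde hk (_ : x \in `]0, L[) (inI hkt); rewrite ?in_itv.
have m1 := mfun2_dx mJ mu0 (fun x t hx ht => proj1 (dd x t hx ht)).
have m2 := mfun2_dx mJ m1 (fun x t hx ht => proj2 (dd x t hx ht)).
rewrite /elliptic; apply: mf2D; apply: mf2M => //; exact: measurable_cst.
Qed.

Context (Mm : R) (u1 u2 : R -> R -> R).
Context (hH2 : {ae mu, forall t, t \in `]- tau, T[ ->
  in_H2 L (u^~ t) (u1^~ t) (u2^~ t) /\ H2norm L (u^~ t) (u1^~ t) (u2^~ t) <= Mm}).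
Context (hub0 : forall dl, 0 < dl -> exists2 B : R, 0 <= B &
  forall x t, dl <= x <= L - dl -> - tau <= t <= 0 -> `|u x t| <= B).
Local Notation w := (elliptic p a u).
Implicit Types (M : nat) (X : nat -> R) (v : R -> R) (dl : R).

Let I0L : measurable (`]0, L[%classic : set TR). Proof. exact: measurable_itv. Qed.
Let al2 : 0 < alpha <= 2. Proof. have := halpha; lra. Qed.
Let al1 : 0 < alpha <= 1. Proof. have := halpha; lra. Qed.
Let bl1 : 0 < 1 - alpha <= 1. Proof. have := halpha; lra. Qed.
Let bl2 : 0 < 1 - alpha <= 2. Proof. have := halpha; lra. Qed.
Let bl3 : 0 < 1 - alpha + 1 <= 2. Proof. have := halpha; lra. Qed.
Let bl4 : 1 <= 1 - alpha + 1 <= 2. Proof. have := halpha; lra. Qed.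
Let h12 : 0 < (1 : R) <= 2. Proof. lra. Qed.
Let bl5 : 0 < 1 - alpha < 1. Proof. have := halpha; lra. Qed.

(** The value of (p u'' + a u, v) after integration by parts. It is defined and continuous at all
    times, whereas the pairing itself is controlled at almost every time only. *)
Definition weak_form M X v t : R := - p * gform M X (u^~ t) v + a * Int 0 L (fun x => u x t * v x).

Definition Mw : R := (`|p| + `|a|) * `|Mm|.

Lemma Mw_ge0 : 0 <= Mw. Proof. by rewrite mulr_ge0 ?addr_ge0. Qed.

Lemma w_ae : {ae mu, forall s, 0 < s < T -> [/\ L2on 0 L (w^~ s), L2norm L (w^~ s) <= Mw &
  forall M X v, spatial_mesh L M X -> fe_space L M X v -> Int 0 L (fun x => w x s * v x) = weak_form M X v s]}.
Proof.
apply: aeS hH2 => s h /andP[s0 sT].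
have hs' : s \in `]- tau, T[ by rewrite in_itv/= sT andbT (lt_trans _ s0)// oppr_lt0.
have [H hM] := h hs'; have [l0 _ l2 _ _] := H.
have hs : - tau <= s <= T by move: hs'; rewrite in_itv/= => /andP[/ltW -> /ltW ->].
have cs := cux hs; have e2 := H2_classic hL cs H.
have we : {ae mu, forall x, 0 < x < L -> p * u2 x s + a * u x s = w x s}.
  by apply: aeS e2 => x e hx; rewrite /elliptic e.
have lz : L2on 0 L (fun x => p * u2 x s + a * u x s) by apply: L2onD; exact: L2onZ.
have mw : measurable_fun (`]0, L[ : set R) (w^~ s).
  have mJ : measurable (`]0, T[%classic : set TR) by exact: measurable_itv.
  apply: (mfun2_section mJ I0L (mfun2_swap I0L mJ elliptic_mfun2)).
  by apply/in_oo; rewrite s0.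
have lw : L2on 0 L (w^~ s).
  split => //; apply: itgb_ae (proj2 lz) _; first exact: measurable_funX.
  by apply: aeS we => x e hx; rewrite e.
split => //.
- have -> : L2norm L (w^~ s) = L2norm L (fun x => p * u2 x s + a * u x s).
    rewrite /L2norm !L2dotE; congr Num.sqrt; apply: eq_Int_ae.
    + exact: measurable_funM.
    + by apply: measurable_funM; exact: (proj1 lz).
    + by apply: aeS we => x e hx; rewrite e.
  apply: le_trans (L2norm_triangle (L2onZ p l2) (L2onZ a l0)) _.
  rewrite !L2normZ// /Mw mulrDl; have hMM := ler_norm Mm.
  apply: lerD; apply: ler_wpM2l => //.
    by apply: le_trans hMM; apply: le_trans hM; exact: L2norm_le_H2_2.
  by apply: le_trans hMM; apply: le_trans hM; exact: L2norm_le_H2.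
move=> M X v hX fv; have [cv _ _ _] := fv; have lv := L2on_continuous cv.
rewrite (@eq_Int_ae _ _ _ _ (fun x => p * (u2 x s * v x) + a * (u x s * v x))).
- have i1 := itgb_mulL2 l2 lv; have i2 := itgb_mulL2 l0 lv.
  rewrite IntD; [|exact: itgbZ|exact: itgbZ]; rewrite !IntZ// (H2_fe hL hX cs H fv) /weak_form.
  by rewrite mulrN mulNr.
- by apply: measurable_funM => //; exact: (proj1 lv).
- apply: measurable_funD; apply: measurable_funM => //; apply: measurable_funM => //;
    first [exact: (proj1 l2)|exact: (proj1 l0)|exact: (proj1 lv)].
- by apply: aeS we => x e hx; rewrite -e//; ring.
Qed.

(** On [- tau, 0] the bound is the one assumed there; afterwards the integral of cD t^(alpha-1) adds
    at most cD T^alpha / alpha. *)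
Lemma u_bnd dl : 0 < dl -> exists2 B : R, 0 <= B &
  forall x t, dl <= x <= L - dl -> - tau <= t <= T -> `|u x t| <= B.
Proof.
move=> dl0; have [B B0 hB] := hub0 dl0.
have a0 : 0 < alpha by case/andP: halpha.
have c0 : 0 <= cD * (T `^ alpha / alpha).
  by apply: mulr_ge0; [exact: cD_ge0|rewrite divr_ge0 ?powR_ge0 ?(ltW a0)].
exists (B + cD * (T `^ alpha / alpha)); first by rewrite addr_ge0.
move=> x t hx /andP[ht tT]; have [t0|/ltW t0] := leP t 0.
  by apply: le_trans (hB x t hx _) _; rewrite ?ht ?t0// lerDl.
have hx' : 0 < x < L by lra.
have [ip ep] := @powint0 R alpha t a0 t0.
have := Du_FTC hx' (lexx 0) t0 tT => /eqP; rewrite eq_sym subr_eq => /eqP ->.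
rewrite addrC (le_trans (ler_normD _ _))//; apply: lerD.
  by apply: hB => //; rewrite lexx andbT oppr_le0 ltW.
have h1 : cD * (t `^ alpha / alpha) <= cD * (T `^ alpha / alpha).
  apply: ler_wpM2l; first exact: cD_ge0.
  rewrite ler_wpM2r ?invr_ge0 ?(ltW a0)// ge0_ler_powR ?(ltW a0)// nnegrE//; exact: le_trans tT.
apply: le_trans h1; rewrite -ep -IntZ//; apply: Int_abs_le.
- exact: itgbS (lexx _) tT (Du_itgb hx').
- exact: itgbZ.
by move=> s /andP[s0 st]; apply: Du_bnd => //; rewrite s0 (le_trans (ltW st)).
Qed.

Lemma Eu_mfun2 : mfun2 (`]0, L[%classic : set TR) (`]0, T[%classic : set TR) Eu.
Proof.
apply: mf2B; last exact: rect_mfun2 hf T_ge0.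
apply: mf2B; first exact: Du_mfun2.
apply: mf2M; first exact: measurable_cst.
by apply: u_mfun2_shift; rewrite ?sub0r// lerBlDr lerDl ltW.
Qed.

Lemma Eu_bnd dl : 0 < dl -> exists2 A : R, 0 <= A &
  forall x t, dl <= x <= L - dl -> 0 < t <= T -> `|Eu x t| <= A * t `^ (alpha - 1).
Proof.
move=> dl0; have [B B0 hB] := u_bnd dl0; have [Cf Cf0 hCf] := rect_bnd hf dl0.
have k0 : 0 <= `|b| * B + Cf by rewrite addr_ge0// mulr_ge0.
exists (cD + (`|b| * B + Cf) * T `^ (1 - alpha)).
  by apply: addr_ge0; [exact: cD_ge0|rewrite mulr_ge0 ?powR_ge0].
move=> x t hx ht; have hx' : 0 < x < L by lra.
have /andP[t0 tT] := ht.
rewrite /Eu (le_trans (ler_normB _ _))// mulrDl.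
have h1 := Du_bnd hx' ht.
have h2 : `|b * u x (t - tau)| <= `|b| * B.
  rewrite normrM ler_wpM2l// hB//; have := htau; lra.
have h3 : `|f x t| <= Cf by apply: hCf => //; rewrite (ltW t0).
have h4 : `|b| * B + Cf <= (`|b| * B + Cf) * T `^ (1 - alpha) * t `^ (alpha - 1).
  rewrite -mulrA ler_peMr//; have := @powR_le_exp t (alpha - 1) 0 ht.
  by rewrite powRr0 sub0r opprB; apply; have := halpha; lra.
have := ler_normB (Du x t) (b * u x (t - tau)).
move=> h5; lra.
Qed.

(** * Pairings with bounded functions vanishing near the ends *)

Section bounded_test.
Context (dl : R) (v : R -> R) (B : R).
Context (dl0 : 0 < dl) (mv : measurable_fun (`]0, L[ : set R) v) (B0 : 0 <= B)
  (bv : forall x, 0 < x < L -> `|v x| <= B)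
  (sv : forall x, 0 < x < L -> ~~ (dl <= x <= L - dl) -> v x = 0).

(** [Wv] and [ev] are the pairings of p u'' + a u and of [Eu] with v, and [Yv] is the fractional
    integral of order alpha of [Wv]; the equation makes [ev] the derivative of [Yv] inside the delay
    intervals. *)
Let Wv s := Int 0 L (fun x => w x s * v x).
Let ev s := Int 0 L (fun x => Eu x s * v x).
Let Yv t := Int 0 t (fun s => omega alpha (t - s) * Wv s).

Let lv : L2on 0 L v. Proof. exact: L2on_bnd mv bv. Qed.

Let wv0 : 0 <= Mw * L2norm L v. Proof. by apply: mulr_ge0; [exact: Mw_ge0|exact: L2norm_ge0]. Qed.

Lemma Wv_bnd : {ae mu, forall s, 0 < s < T -> `|Int 0 L (fun x => w x s * v x)| <= Mw * L2norm L v}.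
Proof.
apply: aeS w_ae => s h /h[lw nw _].
have := L2dot_le lw lv; rewrite L2dotE => /le_trans; apply.
by apply: ler_wpM2r => //; exact: L2norm_ge0.
Qed.

Let meas_pair (H : TR -> TR -> R) d : mfun2 (`]0, L[%classic : set TR) (`]0, d[%classic : set TR) H ->
  measurable_fun (`]0, d[ : set R) (fun s => Int 0 L (fun x => H x s * v x)).
Proof.
move=> mH; have mJ : measurable (`]0, d[%classic : set TR) by exact: measurable_itv.
apply: (measurable_Rint (H := fun s x => H x s * v x)) => //.
by apply: (mfun2_swap I0L mJ (H := fun x s => H x s * v x)); apply: mf2M => //; exact: mf2_1.
Qed.

Let Wv_meas : measurable_fun (`]0, T[ : set R) Wv.
Proof. by apply: meas_pair; exact: elliptic_mfun2. Qed.

Let ev_meas : measurable_fun (`]0, T[ : set R) ev.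
Proof. by apply: meas_pair; exact: Eu_mfun2. Qed.

Let Ev_bnd : exists2 A : R, 0 <= A & forall x s, 0 < x < L -> 0 < s <= T ->
  `|Eu x s * v x| <= A * s `^ (alpha - 1).
Proof.
have [A A0 hA] := Eu_bnd dl0; exists (A * B); first exact: mulr_ge0.
move=> x s hx hs; have [hd|hd] := boolP (dl <= x <= L - dl).
  by rewrite normrM mulrAC; apply: ler_pM => //; [exact: hA|exact: bv].
by rewrite sv// mulr0 normr0 !mulr_ge0 ?powR_ge0.
Qed.

Let Ev_itgb s : 0 < s < T -> itgb 0 L (fun x => Eu x s * v x).
Proof.
move=> hs; have [A A0 hA] := Ev_bnd; have mJ : measurable (`]0, T[%classic : set TR) by exact: measurable_itv.
apply: (@itgb_bnd _ _ _ _ (A * s `^ (alpha - 1))).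
  apply: measurable_funM => //.
  by apply: (mfun2_section mJ I0L (mfun2_swap I0L mJ Eu_mfun2)); exact/in_oo.
by move=> x hx; apply: hA => //; case/andP: hs => -> /ltW ->.
Qed.

Let ev_bnd : exists2 A : R, 0 <= A & forall s, 0 < s < T -> `|ev s| <= A * s `^ (alpha - 1).
Proof.
have [A A0 hA] := Ev_bnd; exists (A * L); first by rewrite mulr_ge0// ltW.
move=> s hs; rewrite mulrAC.
have -> : A * s `^ (alpha - 1) * L = Int 0 L (fun=> A * s `^ (alpha - 1)).
  by rewrite Int_cst ?subr0// ltW.
apply: Int_abs_le; [exact: Ev_itgb|exact: itgb_cst|].
by move=> x hx; apply: hA => //; case/andP: hs => -> /ltW ->.
Qed.

Let ev_itgb : itgb 0 T ev.
Proof.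
have [A A0 hA] := ev_bnd; have [ip _] := @powint0 R alpha T (proj1 (andP halpha)) T_ge0.
exact: itgb_le ev_meas hA (itgbZ A ip).
Qed.

Let Wv_itgb : itgb 0 T Wv.
Proof. exact: itgb_le_ae Wv_meas Wv_bnd (itgb_cst _ _ _). Qed.

Let Yv_pair t : 0 <= t <= T -> Yv t = Int 0 L (fun x => Int 0 t (fun s => omega alpha (t - s) * w x s) * v x).
Proof.
move=> /andP[t0 tT]; have [<-|tN0] := eqVneq 0 t.
  rewrite /Yv Int_nil// -[LHS](@Int_zero _ 0 L (fun=> 0))//; apply: eq_Int => x _.
  by rewrite [Int 0 0 _]Int_nil// mul0r.
have t0' : 0 < t by rewrite lt_neqAle tN0.
have mJ : measurable (`]0, T[%classic : set TR) by exact: measurable_itv.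
have [] := @pair_fub _ L alpha t w v (fun=> Mw) al1 _ lv.
- apply: mf2S elliptic_mfun2 => // s; rewrite /= !in_itv/= => /andP[-> st].
  exact: lt_le_trans tT.
- apply: aeS w_ae => s h /andP[s0 st].
  have hs : 0 < s < T by rewrite s0 (lt_le_trans st).
  by have [l n _] := h hs.
- by apply: itgbZr; exact: itgb_omega.
- move=> x hx; have [|k hk hkt] := @block_locate _ tau K t; first by rewrite t0' tT.
  have hx' : x \in `]0, L[ by rewrite in_itv.
  by have [_ i _ _ _] := pde hk hx' (inI hkt).
by move=> _ _ ->.
Qed.

Let Yv_incr k s t : (1 <= k <= K)%N -> (k%:R - 1) * tau < s -> s <= t -> t <= k%:R * tau ->
  Int s t ev = Yv t - Yv s.
Proof.
move=> hk hs st ht.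
have kT : k%:R * tau <= T by rewrite ler_wpM2r ?(ltW htau)// ler_nat; case/andP: hk.
have k0 : 0 <= (k%:R - 1) * tau by rewrite mulr_ge0 ?(ltW htau)// subr_ge0 ler1n; case/andP: hk.
have s0 : 0 < s := le_lt_trans k0 hs; have tT : t <= T := le_trans ht kT.
have [A A0 hA] := Ev_bnd.
have mJ : measurable (`]0, T[%classic : set TR) by exact: measurable_itv.
have mJ' : measurable (`]s, t[%classic : set TR) by exact: measurable_itv.
have [ip _] := @powint0 R alpha T (proj1 (andP halpha)) T_ge0.
have [] := @Ifubini _ 0 L s t (fun x r => Eu x r * v x) (fun r => A * L * r `^ (alpha - 1)).
- apply: mf2M; last exact: mf2_1.
  apply: mf2S Eu_mfun2 => // r; rewrite /= !in_itv/= => /andP[sr rt].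
  by rewrite (lt_trans s0 sr) (lt_le_trans rt tT).
- apply: aeW => r /andP[sr rt]; have hr : 0 < r < T by rewrite (lt_trans s0 sr) (lt_le_trans rt tT).
  have i := Ev_itgb hr; split => //.
  rewrite mulrAC -[leRHS](_ : Int 0 L (fun=> A * r `^ (alpha - 1)) = _); last by rewrite Int_cst ?subr0// ltW.
  apply: Int_le; [exact: itgb_norm|exact: itgb_cst|].
  by move=> x hx; apply: hA => //; case/andP: hr => -> /ltW ->.
- by apply: itgbS (ltW s0) tT (itgbZ (A * L) ip).
move=> _ i _ e; rewrite -[LHS]e !Yv_pair; first last.
- by rewrite tT (le_trans (ltW s0)).
- by rewrite (ltW s0) (le_trans st).
have mY r : 0 < r <= T -> itgb 0 L (fun x => Int 0 r (fun s => omega alpha (r - s) * w x s) * v x).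
  move=> /andP[r0 rT].
  have [] := @pair_fub _ L alpha r w v (fun=> Mw) al1 _ lv.
  - apply: mf2S elliptic_mfun2 => // z; rewrite /= !in_itv/= => /andP[-> sz].
    exact: lt_le_trans rT.
  - apply: aeS w_ae => z h /andP[z0 zt].
    have hz : 0 < z < T by rewrite z0 (lt_le_trans zt).
    by have [l n _] := h hz.
  - by apply: itgbZr; exact: itgb_omega.
  - move=> x hx; have [|k' hk' hkt] := @block_locate _ tau K r; first by rewrite r0 rT.
    have hx' : x \in `]0, L[ by rewrite in_itv.
    by have [_ j _ _ _] := pde hk' hx' (inI hkt).
  by [].
rewrite -IntB; [|by apply: mY; rewrite tT (lt_le_trans s0)|by apply: mY; rewrite s0 (le_trans st)].
apply: eq_Int => x hx; rewrite -mulrBl -(Eu_FTC hk hx hs st ht) -IntZr//.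
exact: itgb_continuous (Eu_cont hk hx hs ht).
Qed.

(** [Wv] is bounded almost everywhere, so its fractional integral is Hoelder on all of [0, T]. The
    equation at fixed x gives no continuity to the right of a multiple of tau; after pairing it is
    available, and [FTC_blocks] can join the delay intervals. *)
Let Yv_cont : {within `[0, T], continuous Yv}.
Proof.
have g1 : 0 < Gamma (alpha + 1) :> R by apply: Gamma_gt0; have := halpha; lra.
apply: (@hoelder_cont _ _ _ alpha (2 * (Mw * L2norm L v) / Gamma (alpha + 1))).
- exact: T_ge0.
- by case/andP: halpha.
- by rewrite divr_ge0 ?(ltW g1)// mulr_ge0.
move=> r s r0 rs sT; have [] := @frac_hoelder _ 0 r s alpha Wv (Mw * L2norm L v) al1 r0 rs wv0.
- by apply: measurable_funS Wv_meas => // z; rewrite /= !in_itv/= => /andP[-> /lt_le_trans]; exact.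
- by apply: aeS Wv_bnd => z h /andP[z0 zs]; apply: h; rewrite z0 (lt_le_trans zs).
move=> _ _ /le_trans; apply; rewrite /omega addrK.
by rewrite -[_ / _ * _]mulrA [_^-1 * _]mulrC.
Qed.

Let Hv t := Int 0 t (fun s => omega (1 - alpha) (t - s) * ev s).

Let ev_sub t : t <= T -> measurable_fun (`]0, t[ : set R) ev.
Proof. by move=> tT; apply: measurable_funS ev_meas => // z; rewrite /= !in_itv/= => /andP[-> /lt_le_trans]; exact. Qed.

(** With I^b for the fractional integral of order b: I^1 H = I^1 I^(1-alpha) e = I^(1-alpha) I^1 e =
    I^(1-alpha) Y = I^(1-alpha) I^alpha W = I^1 W. *)
Let Hv_int t : 0 <= t <= T -> itgb 0 t Hv /\ Int 0 t Hv = Int 0 t Wv.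
Proof.
move=> /andP[t0 tT].
have Yev s : 0 <= s <= T -> Int 0 s ev = Yv s.
  move=> /andP[s0 sT]; rewrite (@FTC_blocks _ tau K Yv ev htau Yv_cont ev_itgb Yv_incr 0 s)//.
  by rewrite [Yv 0]/Yv Int_nil// subr0.
have mW : measurable_fun (`]0, t[ : set R) Wv.
  by apply: measurable_funS Wv_meas => // z; rewrite /= !in_itv/= => /andP[-> /lt_le_trans]; exact.
have iW : itgb 0 t Wv by exact: itgbS (lexx _) tT Wv_itgb.
have ie : itgb 0 t ev by exact: itgbS (lexx _) tT ev_itgb.
have [_ e1] : itgb 0 t (fun s => omega (1 - alpha) (t - s) * Yv s) /\
    Int 0 t (fun s => omega (1 - alpha) (t - s) * Yv s) = Int 0 t (fun s => omega 1 (t - s) * Wv s).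
  have := @conv_assoc R (1 - alpha) alpha t Wv bl2 al2; rewrite subrK; apply => //; first by lra.
  by apply: eq_itgb iW => s _; rewrite (omega1 (t - s)) mul1r.
have i2 : itgb 0 t (fun s => omega (1 - alpha + 1) (t - s) * ev s).
  apply: itgb_le (itgbZ (omega (1 - alpha + 1) t) (itgb_norm ie)).
    by apply: measurable_funM; [exact: measurable_omega_conv|exact: ev_sub].
  move=> s /andP[s0 st]; rewrite normrM (ger0_norm (omega_ge0 _ bl3)).
  apply: ler_wpM2r; first exact: normr_ge0.
  by apply: omega_incr; [exact: bl4|rewrite subr_ge0 ltW|rewrite gerBl ltW].
have hs2 : 1 - alpha + 1 <= 2 by case/andP: bl4.
have [_ e2] := @conv_assoc R (1 - alpha) 1 t ev bl2 h12 hs2 (ev_sub tT) i2.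
have hs2' : 1 + (1 - alpha) <= 2 by rewrite addrC.
have i2' : itgb 0 t (fun s => omega (1 + (1 - alpha)) (t - s) * ev s) by rewrite addrC.
have [i3 e3] := @conv_assoc R 1 (1 - alpha) t ev h12 bl2 hs2' (ev_sub tT) i2'.
have iH : itgb 0 t Hv.
  refine (eq_itgb _ i3) => s hs; rewrite omega1 mul1r; reflexivity.
split; first exact: iH.
have E1 : Int 0 t Hv = Int 0 t (fun s => omega 1 (t - s) * Int 0 s (fun x => omega (1 - alpha) (s - x) * ev x)).
  refine (eq_Int _) => s hs; rewrite omega1 mul1r; reflexivity.
have E2 : Int 0 t Wv = Int 0 t (fun s => omega 1 (t - s) * Wv s).
  refine (eq_Int _) => s hs; rewrite omega1 mul1r; reflexivity.
have E3 : Int 0 t (fun s => omega (1 - alpha) (t - s) * Yv s) =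
   Int 0 t (fun s => omega (1 - alpha) (t - s) * Int 0 s (fun x => omega 1 (s - x) * ev x)).
  refine (eq_Int _) => s /andP[s0 st]; apply: (congr1 (fun z => omega (1 - alpha) (t - s) * z)).
  rewrite -Yev; last by rewrite (ltW s0) (le_trans (ltW st)).
  refine (eq_Int _) => x hx; rewrite omega1 mul1r; reflexivity.
have eB : 1 + (1 - alpha) = 1 - alpha + 1 by rewrite addrC.
rewrite eB in e3.
exact: (etrans E1 (etrans e3 (etrans (esym e2) (etrans (esym E3) (etrans e1 (esym E2)))))).
Qed.

(** [Hv] has the same primitive as [Wv] and is left-continuous by [frac_lcont]; [avg_bound] then
    turns closeness of [Wv] to c at almost every time into closeness of [Hv] to c at the given
    time. *)
Lemma Hv_bound t c eps : 0 < t <= T -> itgb 0 t c -> lcont 0 t c ->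
  {ae mu, forall r, 0 < r < T -> `|Int 0 L (fun x => w x r * v x) - c r| <= eps} ->
  `|Int 0 t (fun s => omega (1 - alpha) (t - s) * Int 0 L (fun x => Eu x s * v x)) - c t| <= eps.
Proof.
move=> /andP[t0 tT] ic lc bc.
have [A A0 hA] := ev_bnd.
have htT : 0 <= t <= T by rewrite (ltW t0).
have [iH eH] := Hv_int htT.
have iW : itgb 0 t Wv by exact: itgbS (lexx _) tT Wv_itgb.
apply: (@avg_bound _ 0 t Hv Wv c eps t0 iH iW ic).
- move=> s s0 st; have hs : 0 <= s <= T by rewrite s0 (le_trans st).
  have [_ es] := Hv_int hs.
  have hst : 0 <= s <= t by rewrite s0.
  have E1 := Int_split hst iH; have E2 := Int_split hst iW.
  have E3 := etrans (esym E1) (etrans eH E2).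
  apply: (@addrI _ (Int 0 s Wv)).
  exact: (etrans (congr1 (fun z => z + Int s t Hv) (esym es)) E3).
- by apply: aeS bc => r h /andP[r0 rt]; apply: h; rewrite r0 (lt_le_trans rt).
- apply: (@frac_lcont _ (1 - alpha) alpha ev A t bl5 al1 t0 A0 (ev_sub tT)).
  by move=> s /andP[s0 st]; apply: hA; rewrite s0 (lt_le_trans st).
- exact: lc.
Qed.

(** [Eu] is not known to be square integrable in x, but only its part on [dl, L - dl] meets v; the
    indicator [chi] cuts it off before Fubini. *)
Lemma Eu_pair t : 0 < t <= T ->
  itgb 0 L (fun x => Int 0 t (fun s => omega (1 - alpha) (t - s) * Eu x s) * v x) /\
  Int 0 L (fun x => Int 0 t (fun s => omega (1 - alpha) (t - s) * Eu x s) * v x) =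
  Int 0 t (fun s => omega (1 - alpha) (t - s) * Int 0 L (fun x => Eu x s * v x)).
Proof.
move=> /andP[t0 tT]; have [A A0 hA] := Eu_bnd dl0.
pose chi x : R := \1_(`[dl, L - dl]%classic) x.
have chiE x : chi x = (dl <= x <= L - dl)%R%:R by rewrite /chi indicE mem_setE in_itv.
have mchi : measurable_fun (`]0, L[%classic : set TR) chi by exact: measurable_indic.
have mJ : measurable (`]0, t[%classic : set TR) by exact: measurable_itv.
have mJT : measurable (`]0, T[%classic : set TR) by exact: measurable_itv.
have mE : mfun2 (`]0, L[%classic : set TR) (`]0, t[%classic : set TR) Eu.
  apply: mf2S Eu_mfun2 => // r; rewrite /= !in_itv/= => /andP[-> rt].
  exact: lt_le_trans tT.
have mH : mfun2 (`]0, L[%classic : set TR) (`]0, t[%classic : set TR) (fun x s => chi x * Eu x s).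
  by apply: mf2M => //; exact: mf2_1.
have hb x s : 0 < x < L -> 0 < s < t -> `|chi x * Eu x s| <= A * s `^ (alpha - 1).
  move=> hx /andP[s0 st]; rewrite chiE; have [hd|hd] := boolP (dl <= x <= L - dl).
    by rewrite mul1r; apply: hA => //; rewrite s0 (le_trans (ltW st)).
  by rewrite mul0r normr0 mulr_ge0 ?powR_ge0.
have ip := itgb_omega_pow halpha t0.
have [] := @pair_fub _ L (1 - alpha) t (fun x s => chi x * Eu x s) v (fun s => A * Num.sqrt L * s `^ (alpha - 1)) bl1 mH lv.
- apply: aeW => s hs.
  have ls : L2on 0 L (fun x => chi x * Eu x s).
    apply: (@L2on_bnd _ _ _ _ (A * s `^ (alpha - 1))); last by move=> x hx; exact: hb.
    by apply: (mfun2_section mJ I0L (mfun2_swap I0L mJ mH)); exact/in_oo.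
  split => //; rewrite mulrAC; apply: L2norm_bnd => //; first by rewrite mulr_ge0 ?powR_ge0.
  by move=> x hx; exact: hb.
- by apply: eq_itgb (itgbZ (A * Num.sqrt L) ip) => s _; rewrite mulrCA.
- move=> x hx; apply: itgb_le (itgbZ A ip).
    apply: measurable_funM; first exact: measurable_omega_conv.
    by apply: (mfun2_section I0L mJ mH); exact/in_oo.
  move=> s hs; rewrite normrM (ger0_norm (omega_ge0 _ bl2)) mulrCA ler_wpM2l ?omega_ge0//.
  exact: hb.
have E x : 0 < x < L -> Int 0 t (fun s => omega (1 - alpha) (t - s) * (chi x * Eu x s)) * v x =
   Int 0 t (fun s => omega (1 - alpha) (t - s) * Eu x s) * v x.
  move=> hx; have [hd|hd] := boolP (dl <= x <= L - dl); last by rewrite sv// !mulr0.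
  by congr (_ * _); apply: eq_Int => s _; rewrite chiE hd mul1r.
rewrite (eq_Int E) => i1 _ ->; split; first exact: eq_itgb E i1.
apply: eq_Int => s _; congr (_ * _); apply: eq_Int => x hx.
have [hd|hd] := boolP (dl <= x <= L - dl); last by rewrite sv// !mulr0.
by rewrite chiE hd mul1r.
Qed.

End bounded_test.

(** The substitute for p u'' + a u, available at every t > 0; [Fr_weak] identifies its pairings with
    [weak_form]. *)
Definition Fr x t : R := Int 0 t (fun s => omega (1 - alpha) (t - s) * Eu x s).

Let Eu_sub t : t <= T -> mfun2 (`]0, L[%classic : set TR) (`]0, t[%classic : set TR) Eu.
Proof.
move=> tT; have mJT : measurable (`]0, T[%classic : set TR) by exact: measurable_itv.
apply: mf2S Eu_mfun2 => // r; rewrite /= !in_itv/= => /andP[-> rt].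
exact: lt_le_trans tT.
Qed.

Let frac_meas t (H : TR -> TR -> R) be : mfun2 (`]0, L[%classic : set TR) (`]0, t[%classic : set TR) H ->
  mfun2 (`]0, L[%classic : set TR) (`]0, t[%classic : set TR) (fun x s => omega be (t - s) * H x s).
Proof.
move=> mH; have mJ : measurable (`]0, t[%classic : set TR) by exact: measurable_itv.
by apply: mf2M => //; apply: mf2_2 => //; exact: measurable_omega_conv.
Qed.

Let Fr_meas t : t <= T -> measurable_fun (`]0, L[ : set R) (Fr^~ t).
Proof.
move=> tT; have mJ : measurable (`]0, t[%classic : set TR) by exact: measurable_itv.
exact: (measurable_Rint I0L mJ (frac_meas (1 - alpha) (Eu_sub tT))).
Qed.

Let Eu_frac dl t : 0 < dl -> 0 < t <= T -> exists2 A : R, 0 <= A & forall x, dl <= x <= L - dl ->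
  itgb 0 t (fun s => omega (1 - alpha) (t - s) * Eu x s) /\ `|Fr x t| <= A.
Proof.
move=> dl0 /andP[t0 tT]; have [A A0 hA] := Eu_bnd dl0.
have g0 : 0 < Gamma alpha :> R by exact: Gamma_gt0.
exists (A * Gamma alpha); first by rewrite mulr_ge0 ?(ltW g0).
move=> x hx; have hx' : 0 < x < L by lra.
have mJ : measurable (`]0, t[%classic : set TR) by exact: measurable_itv.
have ip := itgb_omega_pow halpha t0.
have le s : 0 < s < t -> `|omega (1 - alpha) (t - s) * Eu x s| <= A * (omega (1 - alpha) (t - s) * s `^ (alpha - 1)).
  move=> /andP[s0 st]; rewrite normrM (ger0_norm (omega_ge0 _ bl2)) mulrCA.
  by apply: ler_wpM2l; [exact: omega_ge0|apply: hA => //; rewrite s0 (le_trans (ltW st))].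
have i : itgb 0 t (fun s => omega (1 - alpha) (t - s) * Eu x s).
  apply: itgb_le (itgbZ A ip) => //.
  by apply: (mfun2_section I0L mJ (frac_meas (1 - alpha) (Eu_sub tT))); exact/in_oo.
split => //; rewrite -(omega1al_pow halpha t0) -IntZ//.
by apply: Int_abs_le => //; exact: itgbZ.
Qed.

Let chi dl x : R := \1_(`]dl, L - dl[%classic) x.
Let chiE dl x : chi dl x = (dl < x < L - dl)%R%:R.
Proof. by rewrite /chi indicE mem_setE in_itv. Qed.
Let chi_meas dl : measurable_fun (`]0, L[%classic : set TR) (chi dl).
Proof. exact: measurable_indic. Qed.

Let chi_bnd dl v B : (forall x, dl <= x <= L - dl -> `|v x| <= B) -> 0 <= B ->
  forall x, 0 < x < L -> `|chi dl x * v x| <= B.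
Proof.
move=> h B0 x hx; rewrite chiE; have [/andP[/ltW h1 /ltW h2]|_] := boolP (dl < x < L - dl).
  by rewrite mul1r; apply: h; rewrite h1.
by rewrite mul0r normr0.
Qed.

Let chi_out dl v x : ~~ (dl <= x <= L - dl) -> chi dl x * v x = 0.
Proof.
move=> h; rewrite chiE; have [/andP[/ltW h1 /ltW h2]|_] := boolP (dl < x < L - dl).
  by rewrite h1 h2 in h.
by rewrite mul0r.
Qed.

(** Tested against its own truncation v, it satisfies |v|^2 <= Mw |v| by [Hv_bound] with c = 0. As
    [Mw] does not depend on dl, [L2_exhaust] removes the truncation. *)
Lemma Fr_L2 t : 0 < t <= T -> L2on 0 L (Fr^~ t) /\ Int 0 L (fun x => Fr x t ^+ 2) <= Mw ^+ 2.
Proof.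
move=> ht; have /andP[t0 tT] := ht.
apply: L2_exhaust => //; [exact: Fr_meas|exact: sqr_ge0|].
move=> dl dl0; have [A A0 hA] := Eu_frac dl0 ht.
pose v x := chi dl x * Fr x t.
have mv : measurable_fun (`]0, L[ : set R) v by apply: measurable_funM; [exact: chi_meas|exact: Fr_meas].
have bv : forall x, 0 < x < L -> `|v x| <= A by apply: chi_bnd => // x /hA[].
have sv : forall x, 0 < x < L -> ~~ (dl <= x <= L - dl) -> v x = 0 by move=> x _ hx; exact: (@chi_out dl (Fr^~ t) x hx).
have lv : L2on 0 L v := L2on_bnd mv bv.
have vv x : Fr x t * v x = v x ^+ 2.
  by rewrite /v chiE; case: (_ && _); rewrite ?mul1r ?mul0r ?mulr0 ?expr0n// expr2.
have iF : itgb dl (L - dl) (fun x => Fr x t ^+ 2).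
  apply: (@itgb_bnd _ _ _ _ (A ^+ 2)).
    apply: measurable_funX; apply: measurable_funS (Fr_meas tT) => // x.
    by rewrite /= !in_itv/= => /andP[h1 h2]; apply/andP; split; lra.
  move=> x /andP[/ltW h1 /ltW h2]; have [_ h] := hA x (introT andP (conj h1 h2)).
  by rewrite normrX; apply: lerXn2r; rewrite ?nnegrE.
split => //.
have -> : Int dl (L - dl) (fun x => Fr x t ^+ 2) = Int 0 L (fun x => v x ^+ 2).
  rewrite (@Int_supp _ 0 L dl (L - dl) (fun x => v x ^+ 2)).
  - by apply: eq_Int => x hx; rewrite /v chiE hx mul1r.
  - exact: ltW.
  - by rewrite lerBlDr lerDl ltW.
  - by move=> x _ /negbTE hx; rewrite /v chiE hx mul0r expr0n.
rewrite -L2norm_sqr; have [_ e] := Eu_pair dl0 mv bv sv ht.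
have := @Hv_bound dl v A dl0 mv A0 bv sv t (fun=> 0) (Mw * L2norm L v) ht.
rewrite -e subr0.
have -> : Int 0 L (fun x => Int 0 t (fun s => omega (1 - alpha) (t - s) * Eu x s) * v x) = L2norm L v ^+ 2.
  by rewrite L2norm_sqr; apply: eq_Int => x _; exact: vv.
rewrite (ger0_norm (sqr_ge0 _)) => H.
have {}H : L2norm L v ^+ 2 <= Mw * L2norm L v.
  apply: H; first exact: itgb_cst.
    by move=> eta e0; exists 0; rewrite ?lexx// => r _; rewrite subrr normr0 ltW.
  by apply: aeS (Wv_bnd mv bv) => r h hr; rewrite subr0; exact: h.
have v0 := L2norm_ge0 L v; apply: lerXn2r; rewrite ?nnegrE ?Mw_ge0//.
have [->|vN0] := eqVneq (L2norm L v) 0; first exact: Mw_ge0.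
by move: H; rewrite expr2 ler_pM2r// lt_neqAle eq_sym vN0.
Qed.

Lemma u_hoelder x r t : 0 < x < L -> 0 <= r -> r <= t -> t <= T ->
  `|u x t - u x r| <= cD / alpha * (t - r) `^ alpha.
Proof.
move=> hx r0 rt tT; have t0 := le_trans r0 rt; have a0 : 0 < alpha by case/andP: halpha.
rewrite -(Du_FTC hx r0 rt tT).
have [ip ep] := @powint0 R alpha t a0 t0; have [ir er] := @powint0 R alpha r a0 r0.
have irt : itgb r t (fun s => s `^ (alpha - 1)) by exact: itgbS ip.
apply: le_trans (_ : Int r t (fun s => cD * s `^ (alpha - 1)) <= _).
  apply: Int_abs_le; [exact: itgbS r0 tT (Du_itgb hx)|exact: itgbZ|].
  by move=> s /andP[rs st]; apply: Du_bnd => //; rewrite (le_lt_trans r0 rs) (le_trans (ltW st)).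
rewrite IntZ//; have -> : Int r t (fun s => s `^ (alpha - 1)) = (t `^ alpha - r `^ alpha) / alpha.
  have := @Int_split _ 0 t r _ (_ : 0 <= r <= t) ip; rewrite r0 rt ep er => /(_ isT).
  by move=> h; rewrite mulrBl h addrAC subrr add0r.
rewrite -mulrA; apply: ler_wpM2l; first exact: cD_ge0.
by rewrite [leRHS]mulrC ler_wpM2r ?invr_ge0 ?(ltW a0)//; exact: powR_subadd.
Qed.

Lemma u_pair_hoelder v B r t : measurable_fun (`]0, L[ : set R) v -> (forall x, 0 < x < L -> `|v x| <= B) ->
  0 <= B -> 0 <= r -> r <= t -> t <= T ->
  `|Int 0 L (fun x => u x t * v x) - Int 0 L (fun x => u x r * v x)| <= cD / alpha * B * L * (t - r) `^ alpha.
Proof.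
move=> mv bv B0 r0 rt tT; have lv : L2on 0 L v := L2on_bnd mv bv.
have tau0 := htau.
have lu s : 0 <= s <= T -> itgb 0 L (fun x => u x s * v x).
  move=> hs; apply: itgb_mulL2 => //; apply: L2on_continuous; apply: cux; lra.
have a0 : 0 < alpha by case/andP: halpha.
have c0 : 0 <= cD / alpha by apply: divr_ge0; [exact: cD_ge0|exact: ltW].
rewrite -IntB; [|by apply: lu; rewrite tT (le_trans r0)|by apply: lu; rewrite r0 (le_trans rt)].
have -> : cD / alpha * B * L * (t - r) `^ alpha = Int 0 L (fun=> cD / alpha * (t - r) `^ alpha * B).
  by rewrite Int_cst ?(ltW hL)// subr0; ring.
apply: Int_abs_le; [|exact: itgb_cst|].
  by apply: itgbB; apply: lu; [rewrite tT (le_trans r0)|rewrite r0 (le_trans rt)].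
move=> x hx; rewrite -mulrBl normrM; apply: ler_pM => //; [exact: u_hoelder|exact: bv].
Qed.

(** The nodal values of u are continuous in t. The L2 product needs a modulus uniform in x, which
    the bound t^(alpha-1) on the derivative supplies. *)
Lemma weak_form_cont M X v : spatial_mesh L M X -> fe_space L M X v ->
  {within `[0, T], continuous (weak_form M X v)}.
Proof.
move=> hX fv; have [cv _ _ _] := fv; have [B B0 hB] := cont_bnd (ltW hL) cv.
have a0 : 0 < alpha by case/andP: halpha.
have cC (k : R) : {within `[0, T], continuous (fun=> k)} by apply: cont_within; exact: contC.
have c1 : {within `[0, T], continuous (fun t => gform M X (u^~ t) v)}.
  have cj j : (j <= M)%N -> {within `[0, T], continuous (u (X j))}.
    move=> jM; apply: within_sub (cu (mesh_in hX jM)) => //; have := htau; lra.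
  apply: cont_sum => j; have jM := ltn_ord j.
  move=> t; apply: cvgM; last exact: cC.
  apply: cvgM; last exact: cC.
  by apply: cvgM; last exact: cC; apply: cvgB; [exact: cj|exact: (cj _ (ltnW jM))].
have c2 : {within `[0, T], continuous (fun t => Int 0 L (fun x => u x t * v x))}.
  apply: (@hoelder_cont _ _ _ alpha (cD / alpha * B * L)) => //; first exact: T_ge0.
    by rewrite mulr_ge0 ?(ltW hL)// mulr_ge0// divr_ge0 ?(ltW a0)//; exact: cD_ge0.
  move=> r s r0 rs sT; apply: u_pair_hoelder => //.
    exact: itgb_meas (itgb_continuous cv).
  by move=> x /andP[/ltW h1 /ltW h2]; apply: hB; rewrite h1.
move=> t; apply: cvgD; apply: cvgM; [exact: cC|exact: c1|exact: cC|exact: c2].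
Qed.

Let cut_dist dl v B : 0 < dl -> dl <= L / 2 -> measurable_fun (`]0, L[ : set R) v ->
  (forall x, 0 < x < L -> `|v x| <= B) -> 0 <= B ->
  Int 0 L (fun x => (v x - chi dl x * v x) ^+ 2) <= B ^+ 2 * (dl + dl).
Proof.
move=> dl0 dlL mv bv B0.
pose e x := (v x - chi dl x * v x) ^+ 2.
have me : measurable_fun (`]0, L[ : set R) e.
  by apply: measurable_funX; apply: measurable_funB => //; apply: measurable_funM => //; exact: chi_meas.
have eb x : 0 < x < L -> e x <= B ^+ 2.
  move=> hx; rewrite /e chiE; case: (_ && _); first by rewrite mul1r subrr expr0n sqr_ge0.
  rewrite mul0r subr0 -real_normK ?num_real//; apply: lerXn2r; rewrite ?nnegrE//; exact: bv.
have ie : itgb 0 L e.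
  by apply: (itgb_bnd me) => x hx; rewrite ger0_norm ?sqr_ge0//; exact: eb.
have L0 := hL; have d1 : dl <= L - dl by lra.
have i1 : itgb 0 (L - dl) e by apply: itgbS ie => //; lra.
rewrite -/e (@Int_split _ 0 L (L - dl))//; last lra.
rewrite (@Int_split _ 0 (L - dl) dl)//; last lra.
have -> : Int dl (L - dl) e = 0 by apply: Int_zero => x hx; rewrite /e chiE hx mul1r subrr expr0n.
rewrite addr0 mulrDr; apply: lerD.
  rewrite -[X in _ * X]subr0 -(Int_cst _ (ltW dl0)); apply: Int_le.
  - by apply: itgbS ie => //; lra.
  - exact: itgb_cst.
  - by move=> x hx; apply: eb; lra.
have {2}-> : dl = L - (L - dl) by ring.
rewrite -Int_cst; last lra.
apply: Int_le; [by apply: itgbS ie => //; lra|exact: itgb_cst|by move=> x hx; apply: eb; lra].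
Qed.

(** A finite element function vanishes at 0 and L but not near them. Cutting it off there costs at
    most Mw B eps, once for [Fr] and once, at almost every time, for p u'' + a u. *)
Lemma Fr_weak M X v t : 0 < t <= T -> spatial_mesh L M X -> fe_space L M X v ->
  Int 0 L (fun x => Fr x t * v x) = weak_form M X v t.
Proof.
move=> ht hX fv; have /andP[t0 tT] := ht.
have [cv _ _ _] := fv; have [B B0 hB] := cont_bnd (ltW hL) cv.
have mv : measurable_fun (`]0, L[ : set R) v by exact: itgb_meas (itgb_continuous cv).
have bv x : 0 < x < L -> `|v x| <= B by move=> /andP[/ltW h1 /ltW h2]; apply: hB; rewrite h1.
have lv : L2on 0 L v := L2on_bnd mv bv.
have [lF nF] := Fr_L2 ht.
have nF' : L2norm L (Fr^~ t) <= Mw by apply: L2norm_le => //; exact: Mw_ge0.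
have cW := weak_form_cont hX fv.
have main eps : 0 < eps -> `|Int 0 L (fun x => Fr x t * v x) - weak_form M X v t| <= 2 * Mw * (B * eps).
  move=> e0; have L0 := hL.
  (* The cut-off changes v on a set of measure 2 dl, so that |v - vd|^2 <= 2 dl B^2 <= (B eps)^2. *)
  pose dl := Num.min (L / 2) (eps ^+ 2 / 2).
  have e2 : 0 < eps ^+ 2 by rewrite exprn_gt0.
  have dl0 : 0 < dl by rewrite lt_min !divr_gt0.
  have dlL : dl <= L / 2 by rewrite ge_min lexx.
  have dle : dl + dl <= eps ^+ 2.
    have : dl <= eps ^+ 2 / 2 by rewrite ge_min lexx orbT.
    by move: (dl) (eps ^+ 2) => y z; lra.
  pose vd x := chi dl x * v x.
  have mvd : measurable_fun (`]0, L[ : set R) vd by apply: measurable_funM => //; exact: chi_meas.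
  have bvd : forall x, 0 < x < L -> `|vd x| <= B.
    by apply: chi_bnd => // x hx; apply: hB; lra.
  have svd : forall x, 0 < x < L -> ~~ (dl <= x <= L - dl) -> vd x = 0 by move=> x _; exact: chi_out.
  have lvd : L2on 0 L vd := L2on_bnd mvd bvd.
  have ld : L2on 0 L (fun x => v x - vd x) by exact: L2onB.
  have dist : L2norm L (fun x => v x - vd x) <= B * eps.
    apply: L2norm_le; first by rewrite mulr_ge0 ?(ltW e0).
    apply: (le_trans (cut_dist dl0 dlL mv bv B0)).
    by rewrite exprMn ler_wpM2l ?sqr_ge0.
  have pairL g : L2on 0 L g -> L2norm L g <= Mw -> `|Int 0 L (fun x => g x * vd x) - Int 0 L (fun x => g x * v x)| <= Mw * (B * eps).
    move=> lg ng; rewrite distrC -IntB; [|exact: itgb_mulL2|exact: itgb_mulL2].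
    have := L2dot_le lg ld; rewrite L2dotE => h.
    rewrite (@eq_Int _ _ _ _ (fun x => g x * (v x - vd x))); last by move=> x _; rewrite mulrBr.
    apply: (le_trans h); apply: ler_pM => //; exact: L2norm_ge0.
  have h1 := pairL _ lF nF'.
  have h2 : `|Int 0 L (fun x => Fr x t * vd x) - weak_form M X v t| <= Mw * (B * eps).
    have [_ e] := Eu_pair dl0 mvd bvd svd ht.
    have := @Hv_bound dl vd B dl0 mvd B0 bvd svd t (weak_form M X v) (Mw * (B * eps)) ht.
    rewrite -e; apply.
    - by apply: itgb_continuous; apply: within_sub cW.
    - by apply: lcont_within t0 tT cW.
    - apply: aeS w_ae => r h hr; have [lw nw ew] := h hr.
      by rewrite -(ew M X v hX fv); exact: pairL.
  have := ler_normD (Int 0 L (fun x => Fr x t * v x) - Int 0 L (fun x => Fr x t * vd x)) (Int 0 L (fun x => Fr x t * vd x) - weak_form M X v t).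
  rewrite addrA subrK => /le_trans; apply.
  rewrite distrC in h1; move: h1 h2.
  move: (`|_ - _|) (`|_ - _|) (Mw) (B * eps) => y1 y2 y3 y4 h1 h2.
  by rewrite -mulrA mulr_natl mulr2n lerD.
apply/eqP; rewrite -subr_eq0 -normr_eq0; apply: contraT => nz.
have nz' : 0 < `|Int 0 L (fun x => Fr x t * v x) - weak_form M X v t| by rewrite lt_neqAle eq_sym nz normr_ge0.
pose cc := 2 * Mw * B + 1; have cc0 : 0 < cc.
  by rewrite /cc ltr_wpDl// mulr_ge0// mulr_ge0// Mw_ge0.
(* If the two sides were at distance z > 0, this eps proportional to z would give z <= z / 2. *)
have := main (`|Int 0 L (fun x => Fr x t * v x) - weak_form M X v t| / cc / 2) _.
rewrite !divr_gt0// => /(_ isT); rewrite leNgt => /negP[].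
move: nz' cc0; rewrite /cc; move: (`|_ - _|) => z z0 cc0.
have -> : 2 * Mw * (B * (z / (2 * Mw * B + 1) / 2)) = (2 * Mw * B) / (2 * Mw * B + 1) * (z / 2) by ring.
have : (2 * Mw * B) / (2 * Mw * B + 1) <= 1 by rewrite ler_pdivrMr// mul1r lerDl.
move: (_ / _) => q q1; have : q * (z / 2) <= z / 2 by rewrite ler_piMl// divr_ge0 ?(ltW z0).
by move=> h; apply: le_lt_trans h _; lra.
Qed.

Context (Mu : R) (hMu : forall t, - tau <= t <= T -> L2norm L (u^~ t) <= Mu).

(** The transformed equation tested with v: [Fr] splits into three terms which are paired
    separately, and its own pairing is [weak_form]. *)
Lemma pde_weak M X v t : 0 < t <= T -> spatial_mesh L M X -> fe_space L M X v ->
  [/\ itgb 0 t (fun s => omega (1 - alpha) (t - s) * Int 0 L (fun x => Du x s * v x)),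
      itgb 0 t (fun s => omega (1 - alpha) (t - s) * Int 0 L (fun x => u x (s - tau) * v x)) &
  L2dot L (fun x => frac_int (1 - alpha) (f x) t) v =
    Int 0 t (fun s => omega (1 - alpha) (t - s) * Int 0 L (fun x => Du x s * v x))
    - b * Int 0 t (fun s => omega (1 - alpha) (t - s) * Int 0 L (fun x => u x (s - tau) * v x))
    - weak_form M X v t].
Proof.
move=> ht hX fv; have /andP[t0 tT] := ht; have tau0 := htau; have T0 := T_ge0.
have [cv _ _ _] := fv; have lv := L2on_continuous cv.
have mJ : measurable (`]0, t[%classic : set TR) by exact: measurable_itv.
have mJT : measurable (`]0, T[%classic : set TR) by exact: measurable_itv.
have ip := itgb_omega_pow halpha t0.
have sub (H : TR -> TR -> R) : mfun2 (`]0, L[%classic : set TR) (`]0, T[%classic : set TR) H ->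
    mfun2 (`]0, L[%classic : set TR) (`]0, t[%classic : set TR) H.
  move=> mH; apply: mf2S mH => // r; rewrite /= !in_itv/= => /andP[-> rt]; exact: lt_le_trans tT.
have mD := sub _ Du_mfun2.
have mU : mfun2 (`]0, L[%classic : set TR) (`]0, t[%classic : set TR) (fun x r => u x (r - tau)).
  by apply: u_mfun2_shift; lra.
have hD x s : 0 < x < L -> 0 < s < t -> `|Du x s| <= cD * s `^ (alpha - 1).
  by move=> hx /andP[s0 st]; apply: Du_bnd => //; rewrite s0 (le_trans (ltW st)).
have iD x : 0 < x < L -> itgb 0 t (fun s => omega (1 - alpha) (t - s) * Du x s).
  move=> hx; apply: itgb_le (itgbZ cD ip).
    by apply: (mfun2_section I0L mJ (frac_meas (1 - alpha) mD)); exact/in_oo.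
  move=> s hs; rewrite normrM (ger0_norm (omega_ge0 _ bl2)) mulrCA.
  by apply: ler_wpM2l; [exact: omega_ge0|exact: hD].
have bounded_itgb (g : R -> R) (Bg : R) : measurable_fun (`]0, t[ : set R) g -> (forall s, 0 < s < t -> `|g s| <= Bg) ->
    itgb 0 t (fun s => omega (1 - alpha) (t - s) * g s).
  move=> mg hg; have io : itgb 0 t (fun s => omega (1 - alpha) (t - s)) by exact: itgb_omega.
  apply: itgb_le (itgbZ Bg io); first by apply: measurable_funM => //; exact: measurable_omega_conv.
  move=> s hs; rewrite normrM (ger0_norm (omega_ge0 _ bl2)) mulrC.
  by apply: ler_wpM2r; [exact: omega_ge0|exact: hg].
have iU x : 0 < x < L -> itgb 0 t (fun s => omega (1 - alpha) (t - s) * u x (s - tau)).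
  move=> hx; have cx : {within `[- tau, T], continuous (u x)} by apply: cu; case/andP: hx => /ltW -> /ltW ->.
  have [B B0 hB] := cont_bnd tauT cx.
  apply: (bounded_itgb _ B); first by apply: (mfun2_section I0L mJ mU); exact/in_oo.
  by move=> s hs; apply: hB; lra.
have iF x : 0 < x < L -> itgb 0 t (fun s => omega (1 - alpha) (t - s) * f x s).
  move=> hx; have cx := rect_t hf hx; have [B B0 hB] := cont_bnd T0 cx.
  apply: (bounded_itgb _ B); first by apply: (mfun2_section I0L mJ (sub _ (rect_mfun2 hf T0))); exact/in_oo.
  by move=> s hs; apply: hB; lra.
have E x : 0 < x < L -> frac_int (1 - alpha) (f x) t =
    Int 0 t (fun s => omega (1 - alpha) (t - s) * Du x s)
    - b * Int 0 t (fun s => omega (1 - alpha) (t - s) * u x (s - tau)) - Fr x t.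
  move=> hx; have -> : Fr x t = Int 0 t (fun s => omega (1 - alpha) (t - s) * Du x s
      - b * (omega (1 - alpha) (t - s) * u x (s - tau)) - omega (1 - alpha) (t - s) * f x s).
    by apply: eq_Int => s _; rewrite /Eu; ring.
  rewrite IntB; [|by apply: itgbB; [exact: iD|apply: itgbZ; exact: iU]|exact: iF].
  rewrite IntB; [|exact: iD|by apply: itgbZ; exact: iU].
  rewrite IntZ; last exact: iU.
  rewrite /frac_int -/(Int 0 t _).
  by move: (Int 0 t _) (Int 0 t _) (Int 0 t _) => z1 z2 z3; ring.
have [] := @pair_fub _ L (1 - alpha) t Du v (fun s => cD * Num.sqrt L * s `^ (alpha - 1)) bl1 mD lv _ _ iD.
- apply: aeW => s hs.
  have ls : L2on 0 L (Du^~ s).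
    apply: (@L2on_bnd _ _ _ _ (cD * s `^ (alpha - 1))); last by move=> x hx; exact: hD.
    by apply: (mfun2_section mJ I0L (mfun2_swap I0L mJ mD)); exact/in_oo.
  split => //; rewrite mulrAC; apply: L2norm_bnd => //.
    by apply: mulr_ge0; [exact: cD_ge0|exact: powR_ge0].
  by move=> x hx; exact: hD.
- by apply: eq_itgb (itgbZ (cD * Num.sqrt L) ip) => s _; rewrite mulrCA.
move=> jD jD' eD.
have [] := @pair_fub _ L (1 - alpha) t (fun x s => u x (s - tau)) v (fun=> Mu) bl1 mU lv _ _ iU.
- apply: aeW => s hs; have hs' : - tau <= s - tau <= T by lra.
  by split; [exact: L2on_continuous (cux hs')|exact: hMu].
- by apply: itgbZr; exact: itgb_omega.
move=> jU jU' eU; split => //.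
have [lF _] := Fr_L2 ht; have jF := itgb_mulL2 lF lv.
rewrite L2dotE -(Fr_weak ht hX fv) -eD -eU -IntZ//.
rewrite -IntB//; last exact: itgbZ.
rewrite -IntB//; last by apply: itgbB => //; exact: itgbZ.
by apply: eq_Int => x hx; rewrite E//; ring.
Qed.

End solution.

(** * The symmetric graded mesh *)

Section mesh.
Context {R : realType}.
Implicit Types (x y r tau : R) (N m k n : nat).

(** The mean value theorem; y = 0 is set apart, as the power is differentiated at positive points
    only. *)
Lemma powR_convex_diff r x y : 1 <= r -> 0 <= y -> y <= x -> x `^ r - y `^ r <= r * x `^ (r - 1) * (x - y).
Proof.
move=> r1 y0 yx; have [->|xNy] := eqVneq y x; first by rewrite !subrr mulr0.
have lt : y < x by rewrite lt_neqAle xNy.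
have x0 : 0 < x := le_lt_trans y0 lt.
have xr : x `^ r = x `^ (r - 1) * x.
  by rewrite -{3}[x]powRr1 ?(ltW x0)// -powRD ?subrK//; apply/implyP => _; rewrite gt_eqF.
have [y0'|yN0] := eqVneq y 0.
  rewrite y0' powR0 ?subr0; last by rewrite gt_eqF// (lt_le_trans _ r1).
  by rewrite -mulrA -xr ler_peMl// powR_ge0.
have {}y0 : 0 < y by rewrite lt_neqAle eq_sym yN0.
have [||z] := @MVT R (fun s => s `^ r) (fun s => r * s `^ (r - 1)) y x lt.
- by move=> z; rewrite in_itv/= => /andP[yz _]; apply: is_derive_powR; exact: lt_trans yz.
- apply: derivable_within_continuous => z; rewrite in_itv/= => /andP[yz _].
  by have [] := is_derive_powR r (lt_le_trans y0 yz).
rewrite in_itv/= => /andP[yz zx] ->; rewrite ler_wpM2r ?subr_ge0//.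
rewrite ler_wpM2l ?(le_trans _ r1)//; apply: ge0_ler_powR; rewrite ?subr_ge0// ?nnegrE ?(ltW x0) ?(ltW zx)//.
exact: ltW (lt_trans y0 yz).
Qed.

(** The position, within a delay interval, of the node number m counted from its left end, for m
    from 0 to 2 N. At m = N both formulas give tau / 2. *)
Definition profile tau r N m : R :=
  if (m < N)%N then tau / 2 * (m%:R / N%:R) `^ r
  else - (tau / 2) * ((2 * N - m)%N%:R / N%:R) `^ r + tau.

(** Here i counts the delay intervals from 0, one less than the block index of [graded_mesh]. *)
Lemma gm_block tau r N (i : int) m : (0 < N)%N -> r != 0 -> (m <= 2 * N)%N ->
  graded_mesh tau r N (2 * i * N%:Z + m%:Z) = i%:~R * tau + profile tau r N m.
Proof.
move=> N0 r0 m2; rewrite /graded_mesh /profile.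
have NZ : (0 < N%:Z :> int) by lia.
(* The node m = 0 is numbered as the last one of the preceding block, where the second formula gives
   i tau. *)
case: m m2 => [_|m m2].
  have -> : ((2 * i * N%:Z + 0%:Z - 1) %/ (2 * N%:Z))%Z = i - 1.
    have -> : 2 * i * N%:Z + 0%:Z - 1 = (i - 1) * (2 * N%:Z) + (2 * N%:Z - 1) :> int by lia.
    rewrite divzMDl; last by lia.
    by rewrite divz_small ?addr0//; lia.
  rewrite subrK ifF; last by apply/negbTE; lia.
  have -> : 2 * i * N%:Z - (2 * i * N%:Z + 0%:Z) = 0 :> int by lia.
  by rewrite N0 mulr0z !mul0r powR0// !mulr0 add0r addr0.
have -> : ((2 * i * N%:Z + m.+1%:Z - 1) %/ (2 * N%:Z))%Z = i.
  have -> : 2 * i * N%:Z + m.+1%:Z - 1 = i * (2 * N%:Z) + m%:Z :> int by lia.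
  rewrite divzMDl; last by lia.
  by rewrite divz_small ?addr0//; lia.
have -> : (2 * i * N%:Z + m.+1%:Z < (2 * (i + 1) - 1) * N%:Z) = (m.+1 < N)%N by lia.
case: ifP => mN.
  rewrite addrK; have -> : 2 * i * N%:Z + m.+1%:Z - 2 * i * N%:Z = m.+1%:Z :> int by lia.
  by rewrite addrC.
have -> : 2 * (i + 1) * N%:Z - (2 * i * N%:Z + m.+1%:Z) = (2 * N - m.+1)%N%:Z :> int by lia.
by rewrite intrD; ring.
Qed.

Lemma profile0 tau r N : (0 < N)%N -> r != 0 -> profile tau r N 0 = 0.
Proof. by move=> N0 r0; rewrite /profile N0 mul0r powR0// mulr0. Qed.

Lemma profile_half tau r N m : (0 < N)%N -> (m <= N)%N -> profile tau r N m = tau / 2 * (m%:R / N%:R) `^ r.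
Proof.
move=> N0; rewrite leq_eqVlt => /orP[/eqP ->|mN]; last by rewrite /profile mN.
rewrite /profile ltnn mul2n -addnn addnK divff ?pnatr_eq0 -?lt0n// powR1; by field.
Qed.

(** The symmetry of the mesh, by which step bounds on the second half of a delay interval reduce to
    the first. *)
Lemma profile_refl tau r N m : (0 < N)%N -> (m <= 2 * N)%N -> profile tau r N (2 * N - m) = tau - profile tau r N m.
Proof.
move=> N0 m2; have [mN|Nm] := leqP m N.
  rewrite (profile_half _ _ N0 mN) /profile ifF; last by lia.
  by rewrite (_ : 2 * N - (2 * N - m) = m)%N; [ring|lia].
rewrite (@profile_half tau r N (2 * N - m))//; last by lia.
by rewrite /profile ifF; [ring|lia].
Qed.

Lemma profile_step tau r N m : 0 < tau -> 1 <= r -> (0 < N)%N -> (m < N)%N ->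
  0 < profile tau r N m.+1 - profile tau r N m <= tau / 2 * (r * (m.+1%:R / N%:R) `^ (r - 1) / N%:R).
Proof.
move=> tau0 r1 N0 mN; have N0' : 0 < N%:R :> R by rewrite ltr0n.
rewrite !profile_half ?(ltnW mN)// -mulrBr; have t2 : 0 < tau / 2 by rewrite divr_gt0.
have lt : m%:R / N%:R < m.+1%:R / N%:R :> R by rewrite ltr_pM2r ?invr_gt0// ltr_nat.
have m0 : 0 <= m%:R / N%:R :> R by rewrite divr_ge0.
apply/andP; split.
  by rewrite mulr_gt0// subr_gt0 gt0_ltr_powR ?nnegrE ?divr_ge0// (lt_le_trans _ r1).
rewrite ler_pM2l//; apply: le_trans (powR_convex_diff r1 m0 (ltW lt)) _.
by rewrite -mulrBl -natrB// subSnn mul1r.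
Qed.

Context (tau r : R) (N : nat) (tau0 : 0 < tau) (r1 : 1 < r) (N0 : (0 < N)%N).
Local Notation t := (graded_mesh tau r N).
Let r0 : r != 0. Proof. by rewrite gt_eqF// (lt_trans _ r1). Qed.
Let N0' : 0 < N%:R :> R. Proof. by rewrite ltr0n. Qed.

Lemma mesh_nat n : t n%:Z = (n %/ (2 * N))%:R * tau + profile tau r N (n %% (2 * N)).
Proof.
have m2 : (n %% (2 * N) <= 2 * N)%N by rewrite ltnW// ltn_mod; lia.
have := @gm_block tau r N (n %/ (2 * N))%N%:Z _ N0 r0 m2.
rewrite [(_%:~R)]/= => <-; congr (graded_mesh _ _ _ _).
rewrite {1}(divn_eq n (2 * N)) PoszD PoszM; lia.
Qed.

Lemma mesh_delay n : t (n%:Z - 2 * N%:Z) = t n%:Z - tau.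
Proof.
have m2 : (n %% (2 * N) <= 2 * N)%N by rewrite ltnW// ltn_mod; lia.
have -> : n%:Z - 2 * N%:Z = 2 * ((n %/ (2 * N))%N%:Z - 1) * N%:Z + (n %% (2 * N))%N%:Z.
  by rewrite {1}(divn_eq n (2 * N)) PoszD PoszM; lia.
by rewrite gm_block// mesh_nat intrB mulrBl mul1r addrAC.
Qed.

Lemma mesh_node j : t (2 * j * N)%N%:Z = j%:R * tau.
Proof. by rewrite mesh_nat -mulnA mulnCA modnMl profile0// addr0 mulnK//; lia. Qed.

Lemma mesh0 : t 0%N%:Z = 0.
Proof. by have := mesh_node 0; rewrite muln0 mul0n mul0r. Qed.

Lemma mesh_first m : (m <= N)%N -> t m%:Z = tau / 2 * (m%:R / N%:R) `^ r.
Proof. by move=> mN; rewrite mesh_nat divn_small ?modn_small ?mul0r ?add0r ?profile_half//; lia. Qed.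

Lemma mesh_step n : exists2 m, (m < 2 * N)%N &
  t n.+1%:Z - t n%:Z = profile tau r N m.+1 - profile tau r N m /\
  ((n < 2 * N)%N -> m = n) .
Proof.
exists (n %% (2 * N))%N; first by rewrite ltn_mod; lia.
split; last by move=> h; rewrite modn_small.
have m2 : (n %% (2 * N) < 2 * N)%N by rewrite ltn_mod; lia.
have := @gm_block tau r N (n %/ (2 * N))%N%:Z _ N0 r0 m2.
rewrite (_ : 2 * _ * _ + _ = n.+1%:Z); last first.
  by rewrite {3}(divn_eq n (2 * N)) -addnS PoszD PoszM; lia.
by move=> ->; rewrite mesh_nat; ring.
Qed.

(** The derivative of (tau / 2) x^r at x = 1; divided by N it bounds every step. *)
Definition rho_max : R := tau / 2 * r.

Lemma mesh_step_bnd n : 0 < t n.+1%:Z - t n%:Z <= rho_max / N%:R.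
Proof.
have [m m2 [-> _]] := mesh_step n.
have bound k : (k < N)%N -> 0 < profile tau r N k.+1 - profile tau r N k <= rho_max / N%:R.
  move=> kN; have /andP[-> h] := profile_step tau0 (ltW r1) N0 kN.
  apply: (le_trans h); rewrite /rho_max -[leRHS]mulrA ler_wpM2l ?divr_ge0 ?(ltW tau0)//.
  rewrite ler_wpM2r ?invr_ge0// ler_piMr ?(le_trans _ (ltW r1))//.
  have := @ge0_ler_powR R (r - 1) _ (k.+1%:R / N%:R) 1; rewrite powR1; apply; rewrite ?nnegrE ?divr_ge0//.
    by rewrite subr_ge0 ltW.
  by rewrite ler_pdivrMr// mul1r ler_nat.
have [mN|Nm] := ltnP m N; first exact: bound.
have -> : profile tau r N m.+1 - profile tau r N m =
    profile tau r N (2 * N - m.+1).+1 - profile tau r N (2 * N - m.+1).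
  rewrite (_ : (2 * N - m.+1).+1 = 2 * N - m)%N; last by lia.
  by rewrite !profile_refl//; [ring|lia].
by apply: bound; lia.
Qed.

(** The effect of the grading: a step is at most r / (n + 1) times the distance of its right end
    from 0. It offsets the singularity t^(alpha-2) of the second derivative. *)
Lemma mesh_step_rel n : (n < N)%N -> t n.+1%:Z - t n%:Z <= r * t n.+1%:Z / n.+1%:R.
Proof.
move=> nN; have [m m2 [-> ->]] := mesh_step n; last by lia.
have /andP[_ h] := profile_step tau0 (ltW r1) N0 nN; apply: (le_trans h).
rewrite mesh_first//.
have x0 : 0 < n.+1%:R / N%:R :> R by rewrite divr_gt0.
have -> : (n.+1%:R / N%:R) `^ r = (n.+1%:R / N%:R) `^ (r - 1) * (n.+1%:R / N%:R) :> R.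
  by rewrite -{3}[_ / _]powRr1 ?(ltW x0)// -powRD ?subrK//; apply/implyP => _; rewrite gt_eqF.
rewrite le_eqVlt; apply/orP; left; apply/eqP.
have n0 : n.+1%:R != 0 :> R by rewrite pnatr_eq0.
have N1 : N%:R != 0 :> R by rewrite gt_eqF.
move: n0 N1; set y := n.+1%:R; set w := N%:R; move: (_ `^ _) => z; move: y w => y w n0 N1.
by field; rewrite n0 N1.
Qed.

Lemma mesh_mono m n : (m <= n)%N -> t m%:Z <= t n%:Z.
Proof.
elim: n => [|n IH]; first by rewrite leqn0 => /eqP ->.
rewrite leq_eqVlt => /orP[/eqP -> //|]; rewrite ltnS => /IH /le_trans; apply.
by have /andP[/ltW] := mesh_step_bnd n; rewrite subr_ge0.
Qed.

Lemma mesh_pos n : (0 < n)%N -> 0 < t n%:Z.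
Proof.
case: n => // n _; have /andP[h _] := mesh_step_bnd n.
rewrite subr_gt0 in h; apply: le_lt_trans h.
by rewrite -[X in X <= _]mesh0; exact: mesh_mono.
Qed.

(** No cell straddles a multiple of tau; the cell k lies in the delay interval number k / (2 N) +
    1. *)
Lemma mesh_block k : exists j, [/\ (1 <= j)%N, (j%:R - 1) * tau <= t k%:Z, t k.+1%:Z <= j%:R * tau,
  (forall J, (k < 2 * J * N)%N -> (j <= J)%N) & ((2 * N <= k)%N -> (2 <= j)%N)].
Proof.
exists (k %/ (2 * N)).+1; split => //.
- rewrite -natr1 addrK -mesh_node mesh_mono//.
  by rewrite [in leqRHS](divn_eq k (2 * N)) mulnAC mulnC leq_addr.
- rewrite -mesh_node mesh_mono//.
  have := ltn_ceil k (_ : 0 < 2 * N)%N; rewrite mulnC => h; rewrite -mulnA mulnCA mulnA.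
  by move: h; rewrite mulnC => h; apply: leq_trans (h _) _; lia.
- move=> J kJ; rewrite ltn_divLR; lia.
by move=> h; rewrite ltnS divn_gt0; lia.
Qed.

End mesh.

(** This m separates the far cells from the near ones. With j = min (n, N) >= 2 one has 2 m <= j <=
    3 m: the first inequality puts t_m below t_n / 2, the second bounds t_j / t_m by 3^r. *)
Lemma half_level n N m : (2 <= n)%N -> (2 <= N)%N -> m = (minn n N)./2 ->
  [/\ (m < n)%N, (m <= N)%N, (1 <= m)%N, (m <= minn n N)%N & (minn n N <= 3 * m)%N] /\
  forall k, (m <= k)%N -> (minn n N <= 2 * k.+1)%N.
Proof.
move=> n2 N2 e; have [h1 h2] := (geq_minl n N, geq_minr n N).
have h3 : (2 <= minn n N)%N by rewrite leq_min n2.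
move: (minn n N) e h1 h2 h3 => j -> h1 h2 h3; split; first by split; lia.
move=> k; lia.
Qed.

Lemma powR_le1_exp (R : realType) (x c d : R) : 0 < x <= 1 -> c <= d -> x `^ d <= x `^ c.
Proof.
move=> /andP[x0 x1] cd; rewrite -[d in leLHS](subrK c) powRD; last by apply/implyP => _; rewrite gt_eqF.
rewrite ler_piMl ?powR_ge0//.
have := @ge0_ler_powR R (d - c) _ x 1; rewrite powR1; apply; rewrite ?nnegrE ?(ltW x0) ?subr_ge0//.
Qed.

(** * Truncation error *)

Section truncation.
Context {R : realType}.
Implicit Types (s x : R) (k m n : nat).
Context (al r tau T A : R) (N P : nat) (t : nat -> R) (nu nu' : R -> R) (O : nat -> R).
Context (hal : 0 < al < 1) (tau0 : 0 < tau) (r1 : 1 < r) (N2 : (2 <= N)%N) (A0 : 0 <= A).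
Context (t0 : t 0%N = 0) (tS : forall k, t k < t k.+1) (tT : t P <= T).
Context (tN : forall k, (k <= N)%N -> t k = tau / 2 * (k%:R / N%:R) `^ r).
Context (trel : forall k, (k < N)%N -> t k.+1 - t k <= r * t k.+1 / k.+1%:R).
Context (inu : itgb 0 T nu').
Context (FTCnu : forall s x, 0 <= s -> s <= x -> x <= T -> Int s x nu' = nu x - nu s).
Context (bnu : forall s, 0 < s < T -> `|nu' s| <= A * s `^ (al - 1)).
Context (onu : forall k, (1 <= k < P)%N -> forall s x, t k < s < t k.+1 -> t k < x < t k.+1 -> `|nu' x - nu' s| <= O k).
Context (oN : forall k, (1 <= k < N)%N -> O k <= A * t k `^ (al - 2) * (t k.+1 - t k)).

Let al1 : 0 < 1 - al <= 1. Proof. have := hal; lra. Qed.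
Let al2 : 0 < 1 - al <= 2. Proof. have := hal; lra. Qed.
Let al3 : 0 < 1 - al. Proof. have := hal; lra. Qed.
Let ga : 0 < Gamma (1 - al) :> R. Proof. exact: Gamma_gt0. Qed.
Let ga2 : 0 < Gamma (1 - al + 1) :> R. Proof. by apply: Gamma_gt0; have := hal; lra. Qed.

Lemma grid_mono m n : (m <= n)%N -> t m <= t n.
Proof.
elim: n => [|n IH]; first by rewrite leqn0 => /eqP ->.
rewrite leq_eqVlt => /orP[/eqP -> //|]; rewrite ltnS => /IH /le_trans; apply; exact: ltW.
Qed.

Lemma grid_ge0 n : 0 <= t n. Proof. by rewrite -t0 grid_mono. Qed.

Lemma grid_gt0 n : (0 < n)%N -> 0 < t n.
Proof. by case: n => // n _; apply: le_lt_trans (grid_ge0 n) (tS n). Qed.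

Lemma grid_le_T n : (n <= P)%N -> t n <= T.
Proof. by move=> /grid_mono /le_trans; apply. Qed.

(** The step times the coefficient of the L1 formula, that is, the integral of the kernel over a
    cell. Cells are numbered from 0, so that k stands for the index k + 1 of [L1coef]. *)
Definition wgt n k : R := omega (1 - al + 1) (t n - t k) - omega (1 - al + 1) (t n - t k.+1).

Lemma wgtE n k : (k < n)%N -> wgt n k = Int (t k) (t k.+1) (fun s => omega (1 - al) (t n - s)).
Proof. by move=> kn; rewrite omega_int// (ltW (tS k)) grid_mono. Qed.

Lemma wgt_ge0 n k : (k < n)%N -> 0 <= wgt n k.
Proof. by move=> kn; rewrite wgtE//; apply: Int_ge0 => s _; exact: omega_ge0. Qed.

(** The derivative of the piecewise linear interpolant of [nu] minus that of [nu]; it has mean 0 on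
    the cell. *)
Let del k s := (nu (t k.+1) - nu (t k)) / (t k.+1 - t k) - nu' s.

Let rho0 k : 0 < t k.+1 - t k. Proof. by rewrite subr_gt0. Qed.

Let ink k : (k < P)%N -> itgb (t k) (t k.+1) nu'.
Proof. by move=> kP; apply: itgbS inu; [exact: grid_ge0|exact: grid_le_T]. Qed.

Let Ik k : (k < P)%N -> Int (t k) (t k.+1) nu' = nu (t k.+1) - nu (t k).
Proof. by move=> kP; apply: FTCnu; [exact: grid_ge0|exact: ltW|exact: grid_le_T]. Qed.

Let idel k : (k < P)%N -> itgb (t k) (t k.+1) (del k).
Proof. by move=> kP; apply: itgbB; [exact: itgb_cst|exact: ink]. Qed.

Let Idel k : (k < P)%N -> Int (t k) (t k.+1) (del k) = 0.
Proof.
move=> kP; rewrite IntB; [|exact: itgb_cst|exact: ink].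
by rewrite Int_cst ?(ltW (tS k))// divfK ?gt_eqF// Ik// subrr.
Qed.

Let del_osc k s : (1 <= k < P)%N -> t k < s < t k.+1 -> `|del k s| <= O k.
Proof.
move=> kP hs; have kP' : (k < P)%N by case/andP: kP.
have -> : del k s = Int (t k) (t k.+1) (fun x => nu' x - nu' s) / (t k.+1 - t k).
  rewrite IntB; [|exact: ink|exact: itgb_cst].
  by rewrite Int_cst ?(ltW (tS k))// Ik// mulrBl mulfK ?gt_eqF.
rewrite normrM [`|_^-1|]ger0_norm ?invr_ge0 ?(ltW (rho0 k))// ler_pdivrMr//.
rewrite -(Int_cst _ (ltW (tS k))); apply: Int_abs_le; [|exact: itgb_cst|].
  by apply: itgbB; [exact: ink|exact: itgb_cst].
by move=> x hx; exact: onu.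
Qed.

Let iod n k : (k < n)%N -> (n <= P)%N -> itgb (t k) (t k.+1) (fun s => omega (1 - al) (t n - s) * nu' s) ->
  itgb (t k) (t k.+1) (fun s => omega (1 - al) (t n - s) * del k s).
Proof.
move=> kn nP h; have io : itgb (t k) (t k.+1) (fun s => omega (1 - al) (t n - s)).
  by apply: itgb_omega => //; exact: grid_mono.
by apply: eq_itgb (itgbB (itgbZr ((nu (t k.+1) - nu (t k)) / (t k.+1 - t k)) io) h) => s _; rewrite /del mulrBr.
Qed.

Let itot n : (0 < n <= P)%N -> itgb 0 (t n) (fun s => omega (1 - al) (t n - s) * nu' s).
Proof.
move=> /andP[n0 nP]; have ip := itgb_omega_pow hal (grid_gt0 n0).
have nT := grid_le_T nP.
apply: itgb_le (itgbZ A ip).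
  apply: measurable_funM; first exact: measurable_omega_conv.
  exact: itgb_meas (itgbS (lexx _) nT inu).
move=> s /andP[s0 st]; rewrite normrM (ger0_norm (omega_ge0 _ al2)) mulrCA.
by apply: ler_wpM2l; [exact: omega_ge0|apply: bnu; rewrite s0 (lt_le_trans st)].
Qed.

Let trunc n k := Int (t k) (t k.+1) (fun s => omega (1 - al) (t n - s) * del k s).

Let iok n k : (k < n)%N -> (n <= P)%N -> itgb (t k) (t k.+1) (fun s => omega (1 - al) (t n - s) * del k s).
Proof.
move=> kn nP; apply: iod => //; apply: itgbS (itot _); [exact: grid_ge0|exact: grid_mono|].
by rewrite (leq_ltn_trans _ kn).
Qed.

Lemma trunc_sum n : (0 < n <= P)%N ->
  \sum_(0 <= k < n) wgt n k / (t k.+1 - t k) * (nu (t k.+1) - nu (t k))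
  - Int 0 (t n) (fun s => omega (1 - al) (t n - s) * nu' s) = \sum_(0 <= k < n) trunc n k.
Proof.
move=> hn; have /andP[n0 nP] := hn.
have -> : Int 0 (t n) (fun s => omega (1 - al) (t n - s) * nu' s) =
    \sum_(0 <= k < n) Int (t k) (t k.+1) (fun s => omega (1 - al) (t n - s) * nu' s).
  have H j : (j <= n)%N -> Int 0 (t j) (fun s => omega (1 - al) (t n - s) * nu' s) =
      \sum_(0 <= k < j) Int (t k) (t k.+1) (fun s => omega (1 - al) (t n - s) * nu' s).
    elim: j => [_|j IH jn]; first by rewrite t0 Int_nil// big_nil.
    rewrite big_nat_recr//= -IH ?(ltnW jn)//; apply: Int_split; first by rewrite grid_ge0 (ltW (tS j)).
    by apply: itgbS (itot hn); [exact: lexx|exact: grid_mono].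
  exact: H.
rewrite -sumrB; apply: eq_big_nat => k /andP[_ kn].
have h : itgb (t k) (t k.+1) (fun s => omega (1 - al) (t n - s) * nu' s).
  by apply: itgbS (itot hn); [exact: grid_ge0|exact: grid_mono].
have io : itgb (t k) (t k.+1) (fun s => omega (1 - al) (t n - s)).
  by apply: itgb_omega => //; exact: grid_mono.
rewrite wgtE// mulrAC -mulrA -IntZr// -IntB//; last exact: itgbZr.
by apply: eq_Int => s _; rewrite /del mulrBr.
Qed.

Lemma trunc_near n k : (1 <= k < n)%N -> (n <= P)%N -> `|trunc n k| <= wgt n k * O k.
Proof.
move=> /andP[k1 kn] nP; rewrite wgtE// -IntZr; last by apply: itgb_omega => //; exact: grid_mono.
apply: Int_abs_le; first exact: iok.
  by apply: itgbZr; apply: itgb_omega => //; exact: grid_mono.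
move=> s hs; rewrite normrM (ger0_norm (omega_ge0 _ al2)); apply: ler_wpM2l; first exact: omega_ge0.
by apply: del_osc => //; rewrite k1 (leq_trans kn).
Qed.

Let abs_nu k : (k < P)%N -> Int (t k) (t k.+1) (fun s => `|nu' s|) <= A / al * (t k.+1 `^ al - t k `^ al).
Proof.
move=> kP; have a0 : 0 < al by case/andP: hal.
have [i1 e1] := @powint0 R al (t k.+1) a0 (grid_ge0 _).
have [_ e0] := @powint0 R al (t k) a0 (grid_ge0 _).
have i2 : itgb (t k) (t k.+1) (fun s => s `^ (al - 1)) by apply: itgbS i1; [exact: grid_ge0|exact: lexx].
apply: le_trans (_ : Int (t k) (t k.+1) (fun s => A * s `^ (al - 1)) <= _).
  apply: Int_le; [by apply: itgb_norm; exact: ink|exact: itgbZ|].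
  move=> s /andP[s0 st]; apply: bnu; rewrite (le_lt_trans (grid_ge0 k) s0) (lt_le_trans st)//.
  exact: grid_le_T.
have hk : 0 <= t k <= t k.+1 by rewrite grid_ge0 (ltW (tS k)).
rewrite IntZ//; have := Int_split hk i1; rewrite e1 e0 => h.
have -> : Int (t k) (t k.+1) (fun s => s `^ (al - 1)) = (t k.+1 `^ al - t k `^ al) / al.
  by rewrite mulrBl h addrAC subrr add0r.
by rewrite mulrA mulrAC.
Qed.

Let dquot k : (k < P)%N -> `|(nu (t k.+1) - nu (t k)) / (t k.+1 - t k)| * (t k.+1 - t k) <= A / al * (t k.+1 `^ al - t k `^ al).
Proof.
move=> kP; rewrite normrM [`|_^-1|]ger0_norm ?invr_ge0 ?(ltW (rho0 k))// divfK ?gt_eqF//.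
rewrite -Ik//; apply: le_trans (abs_nu kP); apply: Int_abs; exact: ink.
Qed.

Let abs_del k : (k < P)%N -> Int (t k) (t k.+1) (fun s => `|del k s|) <= 2 * (A / al) * (t k.+1 `^ al - t k `^ al).
Proof.
move=> kP; have h1 := abs_nu kP; have h2 := dquot kP.
set d := (nu (t k.+1) - nu (t k)) / (t k.+1 - t k) in h2.
apply: le_trans (_ : Int (t k) (t k.+1) (fun s => `|d| + `|nu' s|) <= _).
  apply: Int_le; [by apply: itgb_norm; exact: idel| |].
    by apply: itgbD; [exact: itgb_cst|by apply: itgb_norm; exact: ink].
  by move=> s _; rewrite /del -/d ler_normB.
rewrite IntD; [|exact: itgb_cst|by apply: itgb_norm; exact: ink].
rewrite Int_cst ?(ltW (tS k))// -mulrA mulr_natl mulr2n; exact: lerD.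
Qed.

(* As [del k] has mean zero on the cell, the kernel may be replaced by its oscillation. *)
Lemma trunc_far n k : (k.+1 < n)%N -> (n <= P)%N ->
  `|trunc n k| <= (omega (1 - al) (t n - t k.+1) - omega (1 - al) (t n - t k)) * (2 * (A / al) * (t k.+1 `^ al - t k `^ al)).
Proof.
move=> kn nP; have kn' := ltnW kn; have kP : (k < P)%N by exact: leq_trans nP.
set D := _ - omega _ (t n - t k).
have tkn : t k.+1 < t n by apply: lt_le_trans (tS k.+1) (grid_mono kn).
have tk := tS k.
have D0 : 0 <= D.
  by rewrite subr_ge0; apply: omega_decr; [exact: al1|rewrite subr_gt0|rewrite lerB// ltW].
have -> : trunc n k = Int (t k) (t k.+1) (fun s => (omega (1 - al) (t n - s) - omega (1 - al) (t n - t k.+1)) * del k s).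
  rewrite -[LHS]subr0 -[X in _ - X](mulr0 (omega (1 - al) (t n - t k.+1))) -(Idel kP) -IntZ; last exact: idel.
  rewrite -IntB; [|exact: iok|by apply: itgbZ; exact: idel].
  by apply: eq_Int => s _; rewrite mulrBl.
apply: le_trans (_ : D * Int (t k) (t k.+1) (fun s => `|del k s|) <= _); last first.
  by apply: ler_wpM2l => //; exact: abs_del.
have iad := itgb_norm (idel kP).
rewrite -IntZ//; apply: Int_abs_le; [|exact: itgbZ|].
  apply: eq_itgb (itgbB (iok kn' nP) (itgbZ (omega (1 - al) (t n - t k.+1)) (idel kP))) => s _.
  by rewrite mulrBl.
move=> s /andP[ks sk]; rewrite normrM; apply: ler_wpM2r => //.
have h1 : omega (1 - al) (t n - s) <= omega (1 - al) (t n - t k.+1).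
  by apply: omega_decr; [exact: al1|rewrite subr_gt0|rewrite lerB// ltW].
have h2 : omega (1 - al) (t n - t k) <= omega (1 - al) (t n - s).
  by apply: omega_decr; [exact: al1|rewrite subr_gt0 (lt_trans sk)|rewrite lerB// ltW].
rewrite ler_norml /D; lra.
Qed.

(** No cancellation is used on the first cell: the slope is of order t_1^(al-1) and the weight of
    order t_1^(1-al), while the kernel against t^(al-1) gives Gamma al. A bounded term is admissible
    since t_1^(-al) N^(-mu) is bounded from below. *)
Lemma trunc_first : (0 < P)%N -> `|trunc 1 0| <= A * ((al * Gamma (1 - al + 1))^-1 + Gamma al).
Proof.
move=> P0; have a0 : 0 < al by case/andP: hal.
have t1 : 0 < t 1 by exact: grid_gt0.
set d := (nu (t 1) - nu (t 0%N)) / (t 1 - t 0%N).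
have io : itgb (t 0%N) (t 1) (fun s => omega (1 - al) (t 1 - s)) by apply: itgb_omega.
have iv : itgb (t 0%N) (t 1) (fun s => omega (1 - al) (t 1 - s) * nu' s) by rewrite t0; exact: itot.
have -> : trunc 1 0 = wgt 1 0 * d - Int (t 0%N) (t 1) (fun s => omega (1 - al) (t 1 - s) * nu' s).
  rewrite wgtE// -IntZr// -IntB//; last exact: itgbZr.
  by apply: eq_Int => s _; rewrite /del -/d mulrBr.
rewrite mulrDr (le_trans (ler_normB _ _))//; apply: lerD.
  have w0 : wgt 1 0 = t 1 `^ (1 - al) / Gamma (1 - al + 1).
    by rewrite /wgt t0 subr0 subrr /omega addrK [X in _ - X / _]powR0 ?mul0r ?subr0// gt_eqF.
  have := @dquot 0 P0; rewrite -/d t0 subr0 [X in _ - X]powR0 ?subr0 ?gt_eqF// => h.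
  rewrite normrM ger0_norm ?wgt_ge0// w0.
  have -> : A * (al * Gamma (1 - al + 1))^-1 = (Gamma (1 - al + 1))^-1 * (A / al).
    by rewrite invfM; ring.
  rewrite mulrAC mulrC; apply: ler_wpM2l; first by rewrite invr_ge0 ltW.
  have e : t 1 = t 1 `^ al * t 1 `^ (1 - al).
    rewrite -powRD; last by apply/implyP => _; rewrite gt_eqF.
    by rewrite (_ : al + (1 - al) = 1); [rewrite powRr1// ltW|ring].
  have p0 : 0 < t 1 `^ al by exact: powR_gt0.
  rewrite -(ler_pM2r p0); apply: le_trans h; rewrite [in X in _ <= X]e.
  by rewrite le_eqVlt; apply/orP; left; apply/eqP; ring.
rewrite t0 -(omega1al_pow hal t1) -IntZ; last exact: itgb_omega_pow.
apply: Int_abs_le; [by rewrite -[X in itgb X]t0|by apply: itgbZ; exact: itgb_omega_pow|].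
move=> s /andP[s0 st]; rewrite normrM (ger0_norm (omega_ge0 _ al2)) mulrCA.
apply: ler_wpM2l; first exact: omega_ge0.
by apply: bnu; rewrite s0 (lt_le_trans st)// grid_le_T.
Qed.

Let mu := Num.min 1 (al * r).
Let NR0 : 0 < N%:R :> R. Proof. by rewrite ltr0n; exact: leq_trans N2. Qed.
Let be0 : 0 < al * r. Proof. by rewrite mulr_gt0// ?(lt_trans _ r1)//; case/andP: hal. Qed.
Let mu0 : 0 < mu. Proof. by rewrite lt_min ltr01. Qed.
Let mu1 : mu <= 1. Proof. by rewrite ge_min lexx. Qed.
Let mub : mu <= al * r. Proof. by rewrite ge_min lexx orbT. Qed.

Let tpow k : (k <= N)%N -> t k `^ al = (tau / 2) `^ al * (k%:R / N%:R) `^ (al * r).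
Proof.
move=> kN; rewrite tN// powRM ?powR_ge0 ?divr_ge0 ?(ltW tau0)//.
by rewrite -powRrM [r * al]mulrC.
Qed.

Let Nmu : N%:R `^ (- mu) = (N%:R^-1) `^ mu.
Proof. by rewrite -powR_inv1 ?(ltW NR0)// -powRrM mulN1r. Qed.

(** In the first half delay t_k^al is a multiple of (k / N)^(al r). Its increments are bounded by
    subadditivity for al r <= 1 and by convexity for al r > 1; this is the origin of the exponent
    min (1, al r). *)
Lemma step_pow k : (k < N)%N -> t k.+1 `^ al - t k `^ al <= (tau / 2) `^ al * (1 + al * r) * N%:R `^ (- mu).
Proof.
move=> kN; rewrite !tpow ?(ltnW kN)// -mulrBr -mulrA; apply: ler_wpM2l; first exact: powR_ge0.
have x0 : 0 <= k%:R / N%:R :> R by rewrite divr_ge0.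
have xy : k%:R / N%:R <= k.+1%:R / N%:R :> R by rewrite ler_wpM2r ?invr_ge0 ?(ltW NR0)// ler_nat.
have dxy : k.+1%:R / N%:R - k%:R / N%:R = N%:R^-1 :> R.
  by rewrite -mulrBl -natrB// subSnn mul1r.
have N0 : 0 <= N%:R `^ (- mu) by exact: powR_ge0.
have [b1|b1] := leP (al * r) 1.
  have := @powR_subadd R (al * r) _ _ _ x0 xy; rewrite be0 b1 => /(_ isT) /le_trans; apply.
  rewrite dxy Nmu (_ : mu = al * r); last by apply/eqP; rewrite eq_le mub le_min b1 lexx.
  by rewrite ler_peMl ?powR_ge0// lerDl (ltW be0).
have m1 : mu = 1 by apply/eqP; rewrite eq_le mu1 le_min lexx (ltW b1).
apply: le_trans (powR_convex_diff (ltW b1) x0 xy) _.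
rewrite dxy Nmu m1 powRr1 ?invr_ge0 ?(ltW NR0)//; apply: ler_wpM2r; first by rewrite invr_ge0 (ltW NR0).
rewrite ler_wpDl// ler_piMr ?(ltW be0)//.
have := @ge0_ler_powR R (al * r - 1) _ (k.+1%:R / N%:R) 1; rewrite powR1; apply; rewrite ?nnegrE ?divr_ge0 ?(ltW NR0)//.
  by rewrite subr_ge0 ltW.
by rewrite ler_pdivrMr// mul1r ler_nat.
Qed.

(** For n <= N, t_n^al is a multiple of (n / N)^(al r) <= (n / N)^mu <= n N^(-mu). For n > N the
    factor 1 / N is at most N^(-mu), and t_n^al <= T^al. *)
Lemma inv_level n : (1 <= n)%N -> (n <= P)%N ->
  (minn n N)%:R^-1 <= ((tau / 2) `^ al + T `^ al) * (t n `^ (- al) * N%:R `^ (- mu)).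
Proof.
move=> n1 nP; have tn := grid_gt0 n1; have p0 : 0 < t n `^ al by exact: powR_gt0.
have a0 : 0 < al by case/andP: hal.
have j0 : 0 < (minn n N)%:R :> R by rewrite ltr0n leq_min n1 (leq_trans _ N2).
suff H : t n `^ al / (minn n N)%:R <= ((tau / 2) `^ al + T `^ al) * N%:R `^ (- mu).
  have -> : ((tau / 2) `^ al + T `^ al) * (t n `^ (- al) * N%:R `^ (- mu)) =
      ((tau / 2) `^ al + T `^ al) * N%:R `^ (- mu) / t n `^ al.
    by rewrite [t n `^ - _]powRN; ring.
  by rewrite ler_pdivlMr// mulrC.
have Nm0 : 0 <= N%:R `^ (- mu) by exact: powR_ge0.
rewrite mulrDl; have [nN|Nn] := leqP n N.
  apply: ler_wpDr; first by rewrite mulr_ge0 ?powR_ge0.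
  rewrite tpow// -mulrA ler_wpM2l ?powR_ge0//.
  rewrite ler_pdivrMr; last by rewrite ltr0n.
  have x1 : n%:R / N%:R <= 1 :> R by rewrite ler_pdivrMr// mul1r ler_nat.
  have x0 : 0 < n%:R / N%:R :> R by rewrite divr_gt0// ltr0n.
  apply: le_trans (_ : (n%:R / N%:R) `^ mu <= _).
    by apply: powR_le1_exp; rewrite ?x0.
  rewrite powRM ?invr_ge0 ?(ltW NR0)// -Nmu mulrC ler_wpM2l//.
  rewrite -[leRHS]powRr1//; apply: ler_powR => //; rewrite ler1n//.
apply: ler_wpDl; first by rewrite mulr_ge0 ?powR_ge0.
apply: ler_pM; [exact: powR_ge0|by rewrite invr_ge0 (ltW NR0)| |].
  by apply: ge0_ler_powR; rewrite ?(ltW a0) ?nnegrE ?(ltW tn) ?(le_trans (ltW tn)) ?grid_le_T.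
rewrite Nmu -[leLHS]powRr1 ?invr_ge0 ?(ltW NR0)//.
have i1 : N%:R^-1 <= 1 :> R by rewrite invf_le1// ler1n (leq_trans _ N2).
have i0 : 0 < N%:R^-1 :> R by rewrite invr_gt0.
by apply: powR_le1_exp; rewrite ?i0.
Qed.

(** In [cfar], 2 / al comes from the L1 norm of [del], the next factor from [step_pow] and the last
    one from the kernel at distance t_n / 2. In [cnear], 3^r bounds the ratio t_j / t_m. [cfirst]
    combines [trunc_first] and [inv_level]. *)
Definition cfar : R := 2 / al * ((tau / 2) `^ al * (1 + al * r)) * (2 `^ al / Gamma (1 - al)).
Definition cnear : R := 3 `^ (r * (2 - al)) * (2 * r) / Gamma (1 - al + 1) * ((tau / 2) `^ al + T `^ al).
Definition cfirst : R := ((al * Gamma (1 - al + 1))^-1 + Gamma al) * ((tau / 2) `^ al + T `^ al).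

Let ratio_low x y (q : R) : 0 < q -> 0 <= x -> x <= q * y -> x `^ r <= q `^ r * y `^ r.
Proof.
move=> q0 x0 xy; have y0 : 0 <= y by rewrite -(pmulr_rge0 _ q0) (le_trans x0).
rewrite -powRM ?(ltW q0)//; apply: ge0_ler_powR; [exact: ltW (lt_trans ltr01 r1)|by rewrite nnegrE| |exact: xy].
by rewrite nnegrE (le_trans x0).
Qed.

(** Each increment of t^al costs N^(-mu), and the oscillations of the kernel telescope to at most
    its value at t_n - t_m >= t_n / 2, of order t_n^(-al). *)
Lemma far_sum n : (2 <= n <= P)%N ->
  \sum_(0 <= k < (minn n N)./2) `|trunc n k| <= A * cfar * (t n `^ (- al) * N%:R `^ (- mu)).
Proof.
move=> /andP[n2 nP]; set m := (minn n N)./2.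
have a0 : 0 < al by case/andP: hal.
have [[mn mN _ _ _] _] := half_level n2 N2 (erefl m).
have tn : 0 < t n by apply: grid_gt0; exact: ltnW.
pose X := 2 * (A / al) * ((tau / 2) `^ al * (1 + al * r) * N%:R `^ (- mu)).
have X0 : 0 <= X.
  have q0 : 0 <= 1 + al * r by rewrite addr_ge0 ?(ltW be0).
  by rewrite /X !mulr_ge0 ?powR_ge0 ?invr_ge0 ?(ltW a0).
have h1 : \sum_(0 <= k < m) `|trunc n k| <= \sum_(0 <= k < m) (omega (1 - al) (t n - t k.+1) - omega (1 - al) (t n - t k)) * X.
  apply: ler_sum_nat => k /andP[_ km].
  have kn : (k.+1 < n)%N by exact: leq_ltn_trans mn.
  apply: (le_trans (trunc_far kn nP)); apply: ler_wpM2l.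
    have tkn : t k.+1 < t n by apply: lt_le_trans (tS k.+1) (grid_mono kn).
    have tk := tS k.
    by rewrite subr_ge0; apply: omega_decr; [exact: al1|rewrite subr_gt0|rewrite lerB// ltW].
  rewrite ler_wpM2l ?mulr_ge0 ?invr_ge0 ?(ltW a0)//; apply: step_pow; exact: leq_trans km mN.
apply: (le_trans h1); rewrite -big_distrl/= (@telescope_sumr _ 0 m (fun k => omega (1 - al) (t n - t k)))//.
have tm : t m <= t n / 2.
  have h2 : t m <= t (minn n N) / 2.
    rewrite (tN mN) (tN (geq_minr n N)) -[leRHS]mulrA; apply: ler_wpM2l; first by rewrite divr_ge0 ?(ltW tau0).
    have r0 : 0 <= r by rewrite (le_trans _ (ltW r1)).
    have q0 : 0 < 2^-1 :> R by rewrite invr_gt0.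
    apply: (le_trans (ratio_low (q := 2^-1) (y := (minn n N)%:R / N%:R) q0 _ _)).
    - by rewrite divr_ge0 ?(ltW NR0).
    - rewrite mulrA ler_wpM2r ?invr_ge0 ?(ltW NR0)// mulrC ler_pdivlMr// -natrM ler_nat /m.
      by rewrite muln2 -[X in (_ <= X)%N]odd_double_half leq_addl.
    rewrite mulrC ler_wpM2l ?powR_ge0//.
    rewrite -[leRHS]powRr1 ?(ltW q0)//; apply: powR_le1_exp; last exact: ltW.
    by rewrite q0 invf_le1// ler1n.
  apply: (le_trans h2); rewrite ler_wpM2r ?invr_ge0//; apply: grid_mono; exact: geq_minl.
have t2 : 0 < t n / 2 by rewrite divr_gt0.
have h3 : omega (1 - al) (t n - t m) - omega (1 - al) (t n - t 0%N) <= 2 `^ al / Gamma (1 - al) * t n `^ (- al).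
  apply: le_trans (_ : omega (1 - al) (t n - t m) <= _).
    by rewrite lerBlDr lerDl; exact: omega_ge0.
  apply: le_trans (_ : omega (1 - al) (t n / 2) <= _).
    by apply: omega_decr; [exact: al1|exact: t2|lra].
  rewrite /omega (_ : 1 - al - 1 = - al); last by ring.
  have e2 : (2^-1 : R) `^ (- al) = 2 `^ al by rewrite -powR_inv1// -powRrM; congr (_ `^ _); ring.
  rewrite powRM ?(ltW tn) ?invr_ge0// e2.
  by rewrite le_eqVlt; apply/orP; left; apply/eqP; ring.
apply: le_trans (ler_wpM2r X0 h3) _; rewrite le_eqVlt; apply/orP; left; apply/eqP.
by rewrite /X /cfar; ring.
Qed.

(** With j = min (n, N): by the grading [nu'] oscillates by at most order t_j^(al-2) (t_j / j) on
    these cells, and the weights sum to at most order t_j^(1-al). The product is of order 1 / j,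
    which [inv_level] converts. *)
Lemma near_sum n : (2 <= n <= P)%N ->
  \sum_((minn n N)./2 <= k < minn n N) `|trunc n k| <= A * cnear * (t n `^ (- al) * N%:R `^ (- mu)).
Proof.
move=> /andP[n2 nP]; set j := minn n N; set m := j./2.
have a0 : 0 < al by case/andP: hal.
have a2 : 0 <= 2 - al by have := hal; lra.
have j2 : (2 <= j)%N by rewrite leq_min n2 N2.
have jn : (j <= n)%N by exact: geq_minl.
have jN : (j <= N)%N by exact: geq_minr.
have [[_ _ m1 mj m3] m2] := half_level n2 N2 (erefl m).
have tj : 0 < t j by apply: grid_gt0; exact: ltnW.
have tm0 : 0 < t m by exact: grid_gt0.
have j0 : 0 < j%:R :> R by rewrite ltr0n; exact: ltnW.
pose Y := A * (3 `^ (r * (2 - al)) * t j `^ (al - 2)) * (2 * r * t j / j%:R).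
have three : 0 < 3 `^ r :> R by exact: powR_gt0.
have tjm : t j <= 3 `^ r * t m.
  rewrite (tN jN) (tN (leq_trans mj jN)) mulrCA ler_wpM2l ?divr_ge0 ?(ltW tau0)//.
  apply: ratio_low; [by []|by rewrite divr_ge0 ?(ltW NR0)|].
  rewrite mulrA; apply: ler_wpM2r; first by rewrite invr_ge0 (ltW NR0).
  by rewrite -natrM ler_nat.
have h1 : \sum_(m <= k < j) `|trunc n k| <= \sum_(m <= k < j) wgt n k * Y.
  apply: ler_sum_nat => k /andP[mk kj].
  have k1 : (1 <= k)%N := leq_trans m1 mk.
  have kn : (k < n)%N := leq_trans kj jn.
  have kn' : (1 <= k < n)%N by rewrite k1.
  apply: (le_trans (trunc_near kn' nP)); apply: ler_wpM2l; first exact: wgt_ge0.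
  have kN : (k < N)%N := leq_trans kj jN.
  have hk : (1 <= k < N)%N by rewrite k1.
  apply: (le_trans (oN hk)); have tk0 : 0 < t k by exact: grid_gt0.
  rewrite /Y; apply: ler_pM.
  - by rewrite mulr_ge0 ?powR_ge0.
  - by rewrite subr_ge0 ltW.
  - apply: ler_wpM2l => //.
    have tmk : t m <= t k by exact: grid_mono.
    have h : t j <= 3 `^ r * t k by apply: (le_trans tjm); rewrite ler_wpM2l ?(ltW three).
    have -> : 3 `^ (r * (2 - al)) * t j `^ (al - 2) = (t j / 3 `^ r) `^ (al - 2).
      rewrite powRM ?(ltW tj) ?invr_ge0 ?(ltW three)// mulrC; congr (_ * _).
      rewrite -powR_inv1 ?(ltW three)// -!powRrM; congr (_ `^ _); ring.
    rewrite -[al - 2]opprB !powRN lef_pV2 ?posrE ?powR_gt0 ?divr_gt0//.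
    apply: ge0_ler_powR; rewrite ?nnegrE ?divr_ge0 ?(ltW tj) ?(ltW tk0) ?(ltW three)//.
    by rewrite ler_pdivrMr// mulrC.
  apply: (le_trans (trel kN)).
  have tkj : t k.+1 <= t j by exact: grid_mono.
  rewrite -mulrA -[leRHS]mulrA [leRHS](_ : _ = r * (t j * (2 / j%:R))); last by ring.
  rewrite ler_wpM2l ?(le_trans _ (ltW r1))//; apply: ler_pM => //; [exact: grid_ge0|].
  rewrite ler_pdivlMr// mulrC ler_pdivrMr ?ltr0n// -natrM ler_nat.
  exact: m2.
apply: (le_trans h1); rewrite -big_distrl/=.
have h2 : \sum_(m <= k < j) wgt n k <= t j `^ (1 - al) / Gamma (1 - al + 1).
  have -> : \sum_(m <= k < j) wgt n k = omega (1 - al + 1) (t n - t m) - omega (1 - al + 1) (t n - t j).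
    rewrite -[RHS]opprB -(@telescope_sumr _ m j (fun k => omega (1 - al + 1) (t n - t k)))// -sumrN.
    by apply: eq_bigr => k _; rewrite /wgt opprB.
  rewrite /omega addrK -mulrBl ler_wpM2r ?invr_ge0 ?(ltW ga2)//.
  have tjn : t j <= t n by exact: grid_mono.
  have tmj : t m <= t j by exact: grid_mono.
  (* The weights telescope to a difference of powers 1 - al, at most (t_j - t_m)^(1-al). *)
  have := @powR_subadd R (1 - al) (t n - t j) (t n - t m) al1 _ _.
  rewrite subr_ge0 tjn lerB// => /(_ isT isT) /le_trans; apply.
  apply: ge0_ler_powR; rewrite ?(ltW al3) ?nnegrE ?(ltW tj)//; have := grid_ge0 m; lra.
have Y0 : 0 <= Y.
  rewrite /Y mulr_ge0//; first by rewrite !mulr_ge0 ?powR_ge0.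
  by rewrite divr_ge0// !mulr_ge0 ?(ltW tj) ?(le_trans _ (ltW r1)).
apply: le_trans (ler_wpM2r Y0 h2) _.
have n1 : (1 <= n)%N by exact: ltnW.
have lvl := inv_level n1 nP; rewrite -/j in lvl.
have E : t j `^ (1 - al) * t j `^ (al - 2) * t j = 1.
  rewrite -{3}[t j]powRr1 ?(ltW tj)// -!powRD; first last.
  - by apply/implyP => _; rewrite gt_eqF.
  - by apply/implyP => _; rewrite gt_eqF.
  by rewrite (_ : 1 - al + (al - 2) + 1 = 0) ?powRr0//; ring.
have -> : t j `^ (1 - al) / Gamma (1 - al + 1) * Y =
   A * (3 `^ (r * (2 - al)) * (2 * r) / Gamma (1 - al + 1)) * (t j `^ (1 - al) * t j `^ (al - 2) * t j) / j%:R.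
  by rewrite /Y; ring.
rewrite E mulr1 /cnear.
have c0 : 0 <= A * (3 `^ (r * (2 - al)) * (2 * r) / Gamma (1 - al + 1)).
  by rewrite mulr_ge0// divr_ge0 ?(ltW ga2)// !mulr_ge0 ?powR_ge0// (le_trans _ (ltW r1)).
apply: le_trans (ler_wpM2l c0 lvl) _.
by rewrite le_eqVlt; apply/orP; left; apply/eqP; rewrite !mulrA.
Qed.

Lemma trunc_total n : (1 <= n <= P)%N ->
  `|\sum_(0 <= k < n) wgt n k / (t k.+1 - t k) * (nu (t k.+1) - nu (t k))
  - Int 0 (t n) (fun s => omega (1 - al) (t n - s) * nu' s)| <=
  A * (cfar + cnear + cfirst) * (t n `^ (- al) * N%:R `^ (- mu)) + \sum_(N <= k < n) wgt n k * O k.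
Proof.
move=> hn; have /andP[n1 nP] := hn; rewrite trunc_sum//.
have a0 : 0 < al by case/andP: hal.
have ga1 : 0 < Gamma al :> R by apply: Gamma_gt0; have := hal; lra.
have p0 : 0 <= t n `^ (- al) * N%:R `^ (- mu) by rewrite mulr_ge0 ?powR_ge0.
have T0 : 0 <= (tau / 2) `^ al + T `^ al by rewrite addr_ge0 ?powR_ge0.
have q0 : 0 <= 1 + al * r by rewrite addr_ge0 ?(ltW be0).
have r0 : 0 <= r by rewrite (le_trans _ (ltW r1)).
have f0 : 0 <= cfar by rewrite /cfar !mulr_ge0 ?powR_ge0 ?invr_ge0 ?(ltW a0) ?(ltW ga).
have k0 : 0 <= cnear by rewrite /cnear !mulr_ge0 ?powR_ge0 ?invr_ge0 ?(ltW ga2).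
have i0 : 0 <= cfirst.
  by rewrite /cfirst mulr_ge0// addr_ge0 ?(ltW ga1)// invr_ge0 mulr_ge0 ?(ltW a0) ?(ltW ga2).
(* For n = 1 the only cell starts at 0, where no oscillation bound is available. *)
have [n2|n2] := leqP 2 n; last first.
  have n1' : n = 1%N by apply/eqP; rewrite eqn_leq n1 -ltnS n2.
  rewrite n1' in nP hn p0 *; rewrite big_nat1 [X in _ + X]big_geq ?addr0; last exact: ltnW.
  have P0 : (0 < P)%N by exact: nP.
  apply: (le_trans (trunc_first P0)).
  have := inv_level (leqnn 1) nP; rewrite (minn_idPl _) ?invr1; last exact: ltnW.
  set z := t 1 `^ _ * _ in p0 *; move=> h.
  have c0 : 0 <= (al * Gamma (1 - al + 1))^-1 + Gamma al.
    by rewrite addr_ge0 ?(ltW ga1)// invr_ge0 mulr_ge0 ?(ltW a0) ?(ltW ga2).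
  apply: le_trans (_ : A * (cfirst * z) <= _).
    apply: ler_wpM2l => //; rewrite /cfirst -mulrA -[leLHS]mulr1; exact: ler_wpM2l.
  rewrite -[leRHS]mulrA ler_wpM2l// ler_wpM2r// lerDr addr_ge0//.
apply: (le_trans (ler_norm_sum _ _ _)).
have hn2 : (2 <= n <= P)%N by rewrite n2.
have [[_ _ _ mj _] _] := half_level n2 N2 erefl.
have jn : (minn n N <= n)%N by exact: geq_minl.
rewrite (big_cat_nat (n := minn n N))//= (big_cat_nat (n := (minn n N)./2))//=.
apply: le_trans (_ : A * (cfar + cnear) * (t n `^ (- al) * N%:R `^ (- mu)) + \sum_(N <= k < n) wgt n k * O k <= _); last first.
  by rewrite lerD2r ler_wpM2r// ler_wpM2l// lerDl.
apply: lerD.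
  by rewrite mulrDr mulrDl; apply: lerD; [exact: far_sum|exact: near_sum].
have [nN|Nn] := leqP n N; first by rewrite !big_geq.
apply: ler_sum_nat => k /andP[Nk kn]; apply: trunc_near => //.
by rewrite kn andbT (leq_trans _ Nk)// ltnW.
Qed.

End truncation.

Lemma sum_by_parts (R : realType) (c d : nat -> R) n :
  \sum_(0 <= k < n.+1) c k * (d k.+1 - d k) =
  c n * d n.+1 - c 0%N * d 0%N - \sum_(0 <= k < n) (c k.+1 - c k) * d k.+1.
Proof.
elim: n => [|n IH]; first by rewrite big_nat1 big_geq// subr0 mulrBr.
by rewrite big_nat_recr//= IH [in RHS]big_nat_recr//=; ring.
Qed.

(** Abel summation: with nonnegative nondecreasing weights, raising the earlier values while the
    last one is kept can only lower the weighted sum of increments. *)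
Lemma sum_by_parts_le (R : realType) (c d e : nat -> R) n :
  0 <= c 0%N -> (forall k, (k < n)%N -> c k <= c k.+1) ->
  (forall k, (k <= n)%N -> d k <= e k) -> d n.+1 = e n.+1 ->
  \sum_(0 <= k < n.+1) c k * (e k.+1 - e k) <= \sum_(0 <= k < n.+1) c k * (d k.+1 - d k).
Proof.
move=> c0 cm de den; rewrite !sum_by_parts den -!addrA lerD2l.
have h0 : c 0%N * d 0%N <= c 0%N * e 0%N by apply: ler_wpM2l => //; exact: de.
have h1 : \sum_(0 <= k < n) (c k.+1 - c k) * d k.+1 <= \sum_(0 <= k < n) (c k.+1 - c k) * e k.+1.
  apply: ler_sum_nat => k /andP[_ kn]; apply: ler_wpM2l; first by rewrite subr_ge0 cm.
  by apply: de.
lra.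
Qed.

(** * Stability of the L1 formula *)

Section stability.
Context {R : realType}.
Implicit Types (k n : nat) (d : nat -> R).
Context (al : R) (P : nat) (t : nat -> R).
Context (hal : 0 < al < 1) (t0 : t 0%N = 0) (tS : forall k, t k < t k.+1).

Let al1 : 0 < 1 - al <= 1. Proof. have := hal; lra. Qed.
Let al2 : 0 < 1 - al <= 2. Proof. have := hal; lra. Qed.
Let ga : 0 < Gamma (1 - al) :> R. Proof. exact: Gamma_gt0. Qed.
Let rho0 k : 0 < t k.+1 - t k. Proof. by rewrite subr_gt0. Qed.

(** The mean of the kernel over the cell number k, that is, the coefficient [L1coef] of index k +
    1. *)
Definition l1c n k : R := wgt al t n k / (t k.+1 - t k).

(** A mean lies between the values at the two ends, and the kernel increases towards t_n. Comparing
    neighbouring cells at their common node gives monotonicity in k on any mesh. *)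
Lemma l1c_low n k : (k < n)%N -> omega (1 - al) (t n - t k) <= l1c n k.
Proof.
move=> kn; have tk := tS k; have tkn : t k.+1 <= t n by exact: grid_mono.
rewrite /l1c ler_pdivlMr// wgtE// -(Int_cst _ (ltW (tS k))).
apply: Int_le; [exact: itgb_cst|exact: itgb_omega|].
move=> s hs; apply: omega_decr; [exact: al1|by lra|by lra].
Qed.

Lemma l1c_up n k : (k.+1 < n)%N -> l1c n k <= omega (1 - al) (t n - t k.+1).
Proof.
move=> kn; have tkn : t k.+1 < t n by apply: lt_le_trans (tS k.+1) _; exact: grid_mono.
rewrite /l1c ler_pdivrMr// wgtE//; last exact: ltnW.
rewrite -(Int_cst _ (ltW (tS k))).
apply: Int_le; [by apply: itgb_omega => //; exact: ltW|exact: itgb_cst|].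
move=> s hs; apply: omega_decr; [exact: al1|by rewrite subr_gt0|by lra].
Qed.

Lemma l1c_mono n k : (k.+1 < n)%N -> l1c n k <= l1c n k.+1.
Proof. by move=> kn; apply: le_trans (l1c_up kn) (l1c_low kn). Qed.

Lemma l1c_ge0 n k : (k < n)%N -> 0 <= l1c n k.
Proof. by move=> kn; apply: le_trans (l1c_low kn); exact: omega_ge0. Qed.

Lemma l1c_gt0 n k : (k < n)%N -> 0 < l1c n k.
Proof.
move=> kn; apply: lt_le_trans (l1c_low kn); apply: omega_gt0; [exact: al2|].
by rewrite subr_gt0; apply: lt_le_trans (tS k) _; exact: grid_mono.
Qed.

Context (z E : nat -> R) (F : R) (z0 : forall k, 0 <= z k) (E0 : forall k, 0 <= E k) (F0 : 0 <= F).

(** A discrete maximum principle. Subtracting [z 0] and the partial sums of E absorbs the residual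
    built from E exactly. After summation by parts the value at n is bounded through earlier values
    with nonnegative weights, and the weight [l1c n 0], at least t_n^(-al) / Gamma (1 - al), takes
    care of F. The alternative [z n = 0] anticipates a division by [z n]. *)
Lemma barrier : (forall n, (1 <= n <= P)%N -> z n = 0 \/
    \sum_(0 <= k < n) l1c n k * (z k.+1 - z k) <= \sum_(0 <= k < n) l1c n k * E k + F * t n `^ (- al)) ->
  forall n, (n <= P)%N -> z n <= z 0%N + \sum_(0 <= k < n) E k + Gamma (1 - al) * F.
Proof.
move=> H n; have G0 : 0 <= Gamma (1 - al) * F by rewrite mulr_ge0// ltW.
pose y k := z k - z 0%N - \sum_(0 <= j < k) E j.
suff : (n <= P)%N -> y n <= Gamma (1 - al) * F by move=> h /h; rewrite /y; lra.
elim/ltn_ind: n => -[|n] IH nP; first by rewrite /y big_geq// subr0 subrr.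
have [|zn|h] := H n.+1; first by rewrite nP.
  have s0 : 0 <= \sum_(0 <= j < n.+1) E j by exact: sumr_ge0.
  by have := z0 0%N; rewrite /y zn; lra.
have {}h : \sum_(0 <= k < n.+1) l1c n.+1 k * (y k.+1 - y k) <= F * t n.+1 `^ (- al).
  rewrite (_ : \sum_(0 <= k < n.+1) _ = \sum_(0 <= k < n.+1) l1c n.+1 k * (z k.+1 - z k) -
    \sum_(0 <= k < n.+1) l1c n.+1 k * E k); first by rewrite lerBlDl.
  rewrite -sumrB; apply: eq_big_nat => k _; rewrite /y big_nat_recr//=; ring.
rewrite sum_by_parts in h.
have y00 : y 0%N = 0 by rewrite /y big_geq// subr0 subrr.
rewrite y00 mulr0 subr0 in h.
have f0 : F * t n.+1 `^ (- al) <= l1c n.+1 0%N * (Gamma (1 - al) * F).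
  have := @l1c_low n.+1 0 isT; rewrite t0 subr0 /omega => h0.
  rewrite (_ : F * _ = t n.+1 `^ (1 - al - 1) / Gamma (1 - al) * (Gamma (1 - al) * F)).
    exact: ler_wpM2r h0.
  rewrite (_ : 1 - al - 1 = - al); last by ring.
  by field; rewrite gt_eqF.
have s1 : \sum_(0 <= k < n) (l1c n.+1 k.+1 - l1c n.+1 k) * y k.+1 <=
    (l1c n.+1 n - l1c n.+1 0%N) * (Gamma (1 - al) * F).
  rewrite -(@telescope_sumr _ 0 n (fun k => l1c n.+1 k))// big_distrl/=.
  apply: ler_sum_nat => k /andP[_ kn]; apply: ler_wpM2l; first by rewrite subr_ge0 l1c_mono.
  by apply: IH; rewrite ?ltnS// (leq_trans kn)// ltnW.
have c0 : 0 < l1c n.+1 n by exact: l1c_gt0.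
rewrite -(ler_pM2l c0); lra.
Qed.

(* [z k] stands for the norm of a vector v_k and [d k] for the inner product of v_k with v_n. *)
Lemma l1_stability : (forall n, (1 <= n <= P)%N -> exists d, [/\ d n = z n ^+ 2,
    forall k, (k < n)%N -> d k <= z k * z n &
    \sum_(0 <= k < n) l1c n k * (d k.+1 - d k) <=
    (\sum_(0 <= k < n) l1c n k * E k + F * t n `^ (- al)) * z n]) ->
  forall n, (n <= P)%N -> z n <= z 0%N + \sum_(0 <= k < n) E k + Gamma (1 - al) * F.
Proof.
move=> H; apply: barrier => n hn; have [d [dn dk h]] := H n hn.
have [zn|zn] := eqVneq (z n) 0; [by left|right].
have zn0 : 0 < z n by rewrite lt_neqAle eq_sym zn z0.
rewrite -(ler_pM2r zn0); apply: le_trans h; move: hn dn dk zn0.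
case: n zn => // n zn _ dn dk zn0; rewrite big_distrl/=.
(* Cauchy-Schwarz bounds the inner products from above, which is the right direction: the last one
   is the square [z n ^+ 2], and the earlier ones enter with a negative sign. *)
apply: le_trans (@sum_by_parts_le R (l1c n.+1) d (fun k => z k * z n.+1) n _ _ _ _).
- by rewrite le_eqVlt; apply/orP; left; apply/eqP; apply: eq_bigr => k _; ring.
- exact: l1c_ge0.
- by move=> k kn; apply: l1c_mono.
- by move=> k kn; apply: dk.
- by rewrite dn expr2.
Qed.

End stability.

(** * Pairings of the time derivative with a test function *)

Section pairing.
Context {R : realType}.
Local Notation TR := (measurableTypeR R).
Implicit Types (s t x : R).
Context (L T al cd : R) (u D : R -> R -> R) (v : R -> R).
Context (L0 : 0 < L) (al0 : 0 < al) (cd0 : 0 <= cd) (lv : L2on 0 L v).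
Context (mD : mfun2 (`]0, L[%classic : set TR) (`]0, T[%classic : set TR) D).
Context (bD : forall x t, 0 < x < L -> 0 < t <= T -> `|D x t| <= cd * t `^ (al - 1)).
Context (FTCD : forall x s t, 0 < x < L -> 0 <= s -> s <= t -> t <= T -> Int s t (D x) = u x t - u x s).
Context (lu : forall t, 0 <= t <= T -> L2on 0 L (u^~ t)).

Let V := Int 0 L (fun x => `|v x|).
Let iv : itgb 0 L (fun x => `|v x|). Proof. exact: itgb_norm (itgb_L2 lv). Qed.
Let I0L : measurable (`]0, L[%classic : set TR). Proof. exact: measurable_itv. Qed.
Let I0T : measurable (`]0, T[%classic : set TR). Proof. exact: measurable_itv. Qed.

Lemma L1_le_L2 : V <= Num.sqrt L * L2norm L v.
Proof.
have l1 : L2on 0 L (fun=> 1) by apply: L2on_bnd (_ : forall x, _ -> _ <= 1) => // x _; rewrite normr1.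
have la : L2on 0 L (fun x => `|v x|).
  have [m i] := lv; split; first exact: measurableT_comp.
  by apply: eq_itgb i => x _; rewrite real_normK ?num_real.
have h1 : L2norm L (fun=> 1) <= Num.sqrt L.
  have := @L2norm_bnd R L (fun=> 1) 1 L0 l1 ler01; rewrite mul1r; apply => x _; by rewrite normr1.
have -> : V = L2dot L (fun=> 1) (fun x => `|v x|) by rewrite L2dotE; apply: eq_Int => x _; rewrite mul1r.
have -> : L2norm L v = L2norm L (fun x => `|v x|).
  rewrite /L2norm !L2dotE; congr Num.sqrt; apply: eq_Int => x _.
  by rewrite -!expr2 real_normK ?num_real.
apply: (le_trans (ler_norm _)); apply: (le_trans (L2dot_le l1 la)).
by apply: ler_wpM2r; first exact: L2norm_ge0.
Qed.

Let mDs s : 0 < s < T -> measurable_fun (`]0, L[ : set R) (D^~ s).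
Proof. by move=> hs; apply: (mfun2_section I0T I0L (mfun2_swap I0L I0T mD)); exact/in_oo. Qed.

Let iDv s : 0 < s < T -> itgb 0 L (fun x => D x s * v x).
Proof.
move=> hs; apply: itgb_mulL2 lv; apply: (@L2on_bnd _ _ _ _ (cd * s `^ (al - 1))); first exact: mDs.
by move=> x hx; apply: bD => //; case/andP: hs => -> /ltW.
Qed.

Let absDv s : 0 < s < T -> Int 0 L (fun x => `|D x s * v x|) <= cd * V * s `^ (al - 1).
Proof.
move=> hs; rewrite mulrAC -IntZ//; apply: Int_le; [exact: itgb_norm (iDv hs)|exact: itgbZ|].
move=> x hx; rewrite normrM; apply: ler_wpM2r => //.
by apply: bD => //; case/andP: hs => -> /ltW.
Qed.

Lemma pair_bnd s : 0 < s < T -> `|Int 0 L (fun x => D x s * v x)| <= cd * V * s `^ (al - 1).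
Proof. move=> hs; apply: le_trans (absDv hs); apply: Int_abs; exact: iDv. Qed.

Let pow_itgb : 0 <= T -> itgb 0 T (fun s => cd * V * s `^ (al - 1)).
Proof. by move=> T0; have [h _] := @powint0 R al T al0 T0; exact: itgbZ. Qed.

(** Puts the pairing (u, v) in the position of [nu] in the truncation estimate. *)
Lemma pair_FTC s t : 0 <= s -> s <= t -> t <= T ->
  itgb s t (fun r => Int 0 L (fun x => D x r * v x)) /\
  Int s t (fun r => Int 0 L (fun x => D x r * v x)) = Int 0 L (fun x => u x t * v x) - Int 0 L (fun x => u x s * v x).
Proof.
move=> s0 st tT; have T0 := le_trans s0 (le_trans st tT).
have [|||_ _ i1 e] := @Ifubini R 0 L s t (fun x r => D x r * v x) (fun r => cd * V * r `^ (al - 1)).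
- have Ist : measurable (`]s, t[%classic : set TR) by exact: measurable_itv.
  apply: mf2M; last by apply: mf2_1 => //; exact: (proj1 lv).
  apply: mf2S mD => // r; rewrite /= !in_itv/= => /andP[sr rt].
  by rewrite (le_lt_trans s0 sr) (lt_le_trans rt tT).
- apply: aeW => r /andP[sr rt].
  have hr : 0 < r < T by rewrite (le_lt_trans s0 sr) (lt_le_trans rt tT).
  by split; [exact: iDv|exact: absDv].
- by apply: itgbS (pow_itgb T0).
split; first exact: i1.
have hs : 0 <= s <= T by rewrite s0 (le_trans st).
have ht : 0 <= t <= T by rewrite tT (le_trans s0).
rewrite -IntB; [|by apply: itgb_mulL2 lv; exact: lu|by apply: itgb_mulL2 lv; exact: lu].
rewrite -e; apply: eq_Int => x hx; rewrite -mulrBl -FTCD// IntZr//.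
apply: (itgb_le (g := fun r => cd * r `^ (al - 1))).
- apply: measurable_funS (mfun2_section I0L I0T mD ((in_oo 0 L x).2 hx)) => //.
  move=> r; rewrite /= !in_itv/= => /andP[sr rt].
  by rewrite (le_lt_trans s0 sr) (lt_le_trans rt tT).
- move=> r /andP[sr rt]; apply: bD => //.
  by rewrite (le_lt_trans s0 sr) (ltW (lt_le_trans rt tT)).
- have [h _] := @powint0 R al T al0 T0; apply: itgbS (itgbZ cd h) => //.
Qed.

Lemma pair_osc s t c : 0 < s < T -> 0 < t < T ->
  (forall x, 0 < x < L -> `|D x t - D x s| <= c) ->
  `|Int 0 L (fun x => D x t * v x) - Int 0 L (fun x => D x s * v x)| <= c * V.
Proof.
move=> hs ht h; rewrite -IntB; [|exact: iDv|exact: iDv].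
rewrite -IntZ//; apply: Int_abs_le; [by apply: itgbB; exact: iDv|exact: itgbZ|].
by move=> x hx; rewrite -mulrBl normrM; apply: ler_wpM2r => //; exact: h.
Qed.

End pairing.

(** The quadrature is exact for functions constant on each cell, so only the distance to the sampled
    values counts. *)
Lemma quadrature_error (R : realType) (al : R) (t : nat -> R) (g : R -> R) (w dl : nat -> R) n :
  0 < al < 1 -> t 0%N = 0 -> (forall k, t k < t k.+1) ->
  itgb 0 (t n) (fun s => omega (1 - al) (t n - s) * g s) ->
  (forall k, (k < n)%N -> forall s, t k < s < t k.+1 -> `|g s - w k| <= dl k) ->
  `|Int 0 (t n) (fun s => omega (1 - al) (t n - s) * g s) - \sum_(0 <= k < n) wgt al t n k * w k|
    <= \sum_(0 <= k < n) wgt al t n k * dl k.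
Proof.
move=> hal t0 tS ig hd; have hal' := hal.
have al1 : 0 < 1 - al <= 1 by lra.
have al2 : 0 < 1 - al <= 2 by lra.
have tm i j : (i <= j)%N -> t i <= t j by exact: grid_mono.
have t0' i : 0 <= t i by rewrite -t0 tm.
have -> : Int 0 (t n) (fun s => omega (1 - al) (t n - s) * g s) =
    \sum_(0 <= k < n) Int (t k) (t k.+1) (fun s => omega (1 - al) (t n - s) * g s).
  have H j : (j <= n)%N -> Int 0 (t j) (fun s => omega (1 - al) (t n - s) * g s) =
      \sum_(0 <= k < j) Int (t k) (t k.+1) (fun s => omega (1 - al) (t n - s) * g s).
    elim: j => [_|j IH jn]; first by rewrite t0 Int_nil// big_nil.
    rewrite big_nat_recr//= -IH ?(ltnW jn)//; apply: Int_split; first by rewrite t0' (ltW (tS j)).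
    by apply: itgbS ig; [exact: lexx|exact: tm].
  exact: H.
rewrite -sumrB; apply: (le_trans (ler_norm_sum _ _ _)); apply: ler_sum_nat => k /andP[_ kn].
have i1 : itgb (t k) (t k.+1) (fun s => omega (1 - al) (t n - s) * g s).
  by apply: itgbS ig; [exact: t0'|exact: tm].
have io : itgb (t k) (t k.+1) (fun s => omega (1 - al) (t n - s)) by apply: itgb_omega => //; exact: tm.
rewrite wgtE// -!IntZr// -IntB//; last exact: itgbZr.
apply: Int_abs_le; [by apply: itgbB => //; exact: itgbZr|exact: itgbZr|].
move=> s hs; rewrite -mulrBr normrM (ger0_norm (omega_ge0 _ al2)).
by apply: ler_wpM2l; [exact: omega_ge0|exact: hd].
Qed.

Lemma interpB (R : realType) M (X : nat -> R) (v w : R -> R) x :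
  interp M X v x - interp M X w x = interp M X (fun y => v y - w y) x.
Proof.
rewrite /interp opprD addrACA -sumrB; congr (_ + _); apply: eq_bigr => j _.
by rewrite -mulrBl -mulrBl; congr (_ / _ * _); ring.
Qed.

Lemma L2dot_sum (R : realType) (L : R) n (c : nat -> R) (w : nat -> R -> R) (v : R -> R) : (forall k, (k < n)%N -> L2on 0 L (w k)) -> L2on 0 L v ->
  L2on 0 L (fun x => \sum_(0 <= k < n) c k * w k x) /\
  L2dot L (fun x => \sum_(0 <= k < n) c k * w k x) v = \sum_(0 <= k < n) c k * L2dot L (w k) v.
Proof.
move=> + lv; elim: n => [_|n IH lw].
  split.
    apply: (@eq_L2on _ _ _ (fun=> 0)) => [x _|]; first by rewrite big_geq.
    by apply: L2on_bnd (_ : forall x, _ -> _ <= 0) => // x _; rewrite normr0.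
  rewrite big_geq// L2dotE -[RHS](@Int_zero _ 0 L (fun=> 0))//; apply: eq_Int => x _.
  by rewrite big_geq// mul0r.
have [|l1 e1] := IH; first by move=> k kn; apply: lw; exact: ltnW.
have ln : L2on 0 L (fun x => c n * w n x) by apply: L2onZ; exact: lw.
split; first by apply: eq_L2on (L2onD l1 ln) => x _; rewrite big_nat_recr.
rewrite big_nat_recr//= -e1 !L2dotE.
rewrite (@eq_Int _ _ _ _ (fun x => (\sum_(0 <= k < n) c k * w k x) * v x + c n * (w n x * v x))).
  rewrite IntD ?IntZ//; [by apply: itgb_mulL2 lv; exact: lw|exact: itgb_mulL2|].
  by apply: itgbZ; apply: itgb_mulL2 lv; exact: lw.
by move=> x _; rewrite big_nat_recr//=; ring.
Qed.

Lemma L2dotB (R : realType) (L : R) (w w' v : R -> R) : L2on 0 L w -> L2on 0 L w' -> L2on 0 L v ->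
  L2dot L (fun x => w x - w' x) v = L2dot L w v - L2dot L w' v.
Proof.
move=> l l' lv; rewrite !L2dotE -IntB; [|exact: itgb_mulL2|exact: itgb_mulL2].
by apply: eq_Int => x _; rewrite mulrBl.
Qed.

Lemma step_range (n J N : nat) : (n <= J)%N -> - (2 * N)%:Z <= n%:Z <= J%:Z.
Proof. move=> nJ; lia. Qed.

Lemma delay_range (n J N : nat) : (n < J)%N -> - (2 * N)%:Z <= n.+1%:Z - 2 * N%:Z <= J%:Z.
Proof. move=> nJ; lia. Qed.

Lemma delay_block (k n j N : nat) : (k < n)%N -> (n <= 2 * j.+1 * N)%N ->
  - (2 * N)%:Z <= k.+1%:Z - 2 * N%:Z <= (2 * j * N)%:Z.
Proof.
rewrite -[j.+1]addn1 mulnDr mulnDl muln1 => kn; have := leq_trans kn => /[apply].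
move: (2 * j * N)%N => J; lia.
Qed.

(** * Error of the scheme *)

Section scheme.
Context {R : realType}.
Local Notation TR := (measurableTypeR R).
Implicit Types (s t x : R) (k n : nat).
Context (al tau p a b L r cd co1 co2 M2 : R) (K : nat) (f u D : R -> R -> R) (S : R -> R -> R).
Local Notation T := (K%:R * tau).
Context (hal : 0 < al < 1) (htau : 0 < tau) (hp : 0 < p) (ha : a <= 0) (hL : 0 < L) (hr : 1 < r).
Context (cux : forall t, - tau <= t <= T -> {within `[0, L], continuous (u^~ t)}).
Context (ubd : forall t, - tau <= t <= T -> u 0 t = 0 /\ u L t = 0).
Context (S0 : forall s t, 0 <= S s t).
Context (SD : forall s q t, - tau <= s -> s <= q -> q <= t -> t <= T -> S s t = S s q + S q t).
Context (SL2 : forall s t, - tau <= s -> s <= t -> t <= T -> L2norm L (fun x => u x t - u x s) <= S s t).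
Context (Sweak : forall Z Q s t, ctest 0 L Z Q -> - tau <= s -> s <= t -> t <= T ->
  `|Int 0 L (fun x => (u x t - u x s) * Q x)| <= S s t * L2norm L Z).
Context (M20 : 0 <= M2) (uweak : forall Z Q t, ctest 0 L Z Q -> - tau <= t <= T ->
  `|Int 0 L (fun x => u x t * Q x)| <= M2 * L2norm L Z).
Context (cd0 : 0 <= cd) (co10 : 0 <= co1) (co20 : 0 <= co2).
Context (mD : mfun2 (`]0, L[%classic : set TR) (`]0, T[%classic : set TR) D).
Context (bD : forall x t, 0 < x < L -> 0 < t <= T -> `|D x t| <= cd * t `^ (al - 1)).
Context (FTCD : forall x s t, 0 < x < L -> 0 <= s -> s <= t -> t <= T -> Int s t (D x) = u x t - u x s).
Context (osc1 : forall x s t, 0 < x < L -> 0 < s -> s <= t -> t <= tau ->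
  `|D x t - D x s| <= co1 * s `^ (al - 2) * (t - s)).
Context (osc2 : forall k x s t, 0 < x < L -> (2 <= k <= K)%N -> (k%:R - 1) * tau < s -> s <= t -> t <= k%:R * tau ->
  `|D x t - D x s| <= co2 * (t - tau) `^ al - co2 * (s - tau) `^ al).
Context (pdew : forall M X v t, 0 < t <= T -> spatial_mesh L M X -> fe_space L M X v ->
  [/\ itgb 0 t (fun s => omega (1 - al) (t - s) * Int 0 L (fun x => D x s * v x)),
      itgb 0 t (fun s => omega (1 - al) (t - s) * Int 0 L (fun x => u x (s - tau) * v x)) &
  L2dot L (fun x => frac_int (1 - al) (f x) t) v =
    Int 0 t (fun s => omega (1 - al) (t - s) * Int 0 L (fun x => D x s * v x))
    - b * Int 0 t (fun s => omega (1 - al) (t - s) * Int 0 L (fun x => u x (s - tau) * v x))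
    - weak_form p a L u M X v t]).
Context (N M : nat) (X : nat -> R) (uh : int -> R -> R) (N2 : (2 <= N)%N) (hX : spatial_mesh L M X).
Local Notation h := (mesh_diam M X).
Local Notation gm := (graded_mesh tau r N).
Context (fuh : forall n : int, - (2 * N)%:Z <= n <= (2 * K * N)%:Z -> fe_space L M X (uh n)).
Context (sch : fe_scheme al K p a b L f gm N M X uh).

Let N0 : (0 < N)%N. Proof. exact: ltnW. Qed.

Definition tn k : R := gm k%:Z.

Let tn0 : tn 0 = 0. Proof. exact: mesh0. Qed.
Let tnS k : tn k < tn k.+1. Proof. by have /andP[] := mesh_step_bnd htau hr N0 k; rewrite subr_gt0. Qed.
Let tn_ge0 k : 0 <= tn k. Proof. by rewrite -tn0; exact: mesh_mono. Qed.
Let tn_le k : (k <= 2 * K * N)%N -> tn k <= T.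
Proof. by move=> kK; rewrite -(mesh_node htau hr N0 K); exact: mesh_mono. Qed.
Let tn_in k : (k <= 2 * K * N)%N -> - tau <= tn k <= T.
Proof. by move=> kK; rewrite tn_le// andbT (le_trans _ (tn_ge0 k))// oppr_le0 ltW. Qed.
Let tn_delay k : gm (k%:Z - 2 * N%:Z) = tn k - tau. Proof. exact: mesh_delay. Qed.

Definition eta t x : R := u x t - interp M X (u^~ t) x.

Let interp_L2 w : L2on 0 L (interp M X w).
Proof. by apply: L2on_continuous; apply: cont_within; exact: interp_cont hX. Qed.

Let u_L2 t : - tau <= t <= T -> L2on 0 L (u^~ t). Proof. by move=> /cux; exact: L2on_continuous. Qed.

Lemma eta_L2 t : - tau <= t <= T -> L2on 0 L (eta t).
Proof. by move=> ht; apply: L2onB; [exact: u_L2|exact: interp_L2]. Qed.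

Lemma eta_bnd t : - tau <= t <= T -> L2norm L (eta t) <= 2 * h ^+ 2 * M2.
Proof. by move=> ht; apply: interp_error => //; [exact: cux|move=> Z Q ZQ; exact: uweak]. Qed.

(** Interpolation is linear: the increment of [eta] is the interpolation error of the increment of
    u, whose pairings with Z'' are bounded by S. *)
Lemma eta_incr s t : - tau <= s -> s <= t -> t <= T -> L2norm L (fun x => eta t x - eta s x) <= 2 * h ^+ 2 * S s t.
Proof.
move=> ts st tT; pose w x := u x t - u x s.
have hs : - tau <= s <= T by rewrite ts (le_trans st).
have ht : - tau <= t <= T by rewrite tT (le_trans ts).
have -> : L2norm L (fun x => eta t x - eta s x) = L2norm L (fun x => w x - interp M X w x).
  by apply: eq_L2norm => x _; rewrite -interpB /eta /w; ring.
apply: interp_error => //; last by move=> Z Q ZQ; exact: Sweak.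
by move=> x; apply: cvgB; [exact: (cux ht)|exact: (cux hs)].
Qed.

Definition theta k x : R := interp M X (u^~ (tn k)) x - uh k%:Z x.

Let uhk k : (k <= 2 * K * N)%N -> fe_space L M X (uh k%:Z). Proof. by move=> kK; apply: fuh; exact: step_range. Qed.

Lemma theta_fe k : (k <= 2 * K * N)%N -> fe_space L M X (theta k).
Proof.
move=> kK; apply: fe_spaceB; last exact: uhk.
by have [h0 hl] := ubd (tn_in kK); exact: interp_fe.
Qed.

Let fe_L2 v : fe_space L M X v -> L2on 0 L v. Proof. by case=> cv _ _ _; exact: L2on_continuous. Qed.

(** Indexed by integers, since the delay term refers to the initial levels, of negative index. *)
Definition err (m : int) x : R := u x (gm m) - uh m x.

Let predZ k : k.+1%:Z - 1 = k%:Z. Proof. by rewrite -addn1 PoszD addrK. Qed.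

Lemma L1coefE n k : L1coef al gm n%:Z k.+1%:Z = l1c al tn n k.
Proof. by rewrite /L1coef predZ /l1c /wgt /tn (_ : 2 - al = 1 - al + 1)//; ring. Qed.

Lemma Dalpha_pair n v : (n <= 2 * K * N)%N -> L2on 0 L v -> L2dot L (Dalpha al gm uh n) v =
  \sum_(0 <= k < n) l1c al tn n k * (L2dot L (uh k.+1%:Z) v - L2dot L (uh k%:Z) v).
Proof.
move=> nK lv; have lu k : (k < n)%N -> L2on 0 L (uh k.+1%:Z) /\ L2on 0 L (uh k%:Z).
  by move=> kn; split; apply: fe_L2; apply: uhk; [exact: leq_trans nK|exact: leq_trans (ltnW kn) nK].
have [_ e] := @L2dot_sum R L n (l1c al tn n) (fun k x => uh k.+1%:Z x - uh k%:Z x) v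
   (fun k kn => L2onB (lu k kn).1 (lu k kn).2) lv.
rewrite -[RHS](@eq_big_nat _ _ _ _ _ (fun k => l1c al tn n k * L2dot L (fun x => uh k.+1%:Z x - uh k%:Z x) v)).
  rewrite -e; apply: eq_L2dot => x _ //; rewrite /Dalpha big_add1/=; apply: eq_bigr => k _.
  by rewrite L1coefE predZ.
by move=> k /andP[_ kn]; have [l1 l2] := lu k kn; rewrite L2dotB.
Qed.

Lemma Jdelay_pair n v : (n <= 2 * K * N)%N -> L2on 0 L v -> L2dot L (fun x => b * Jdelay al gm N uh n x) v =
  b * \sum_(0 <= k < n) wgt al tn n k * L2dot L (uh (k.+1%:Z - 2 * N%:Z)) v.
Proof.
move=> nK lv; have lu k : (k < n)%N -> L2on 0 L (uh (k.+1%:Z - 2 * N%:Z)).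
  by move=> kn; apply: fe_L2; apply: fuh; apply: delay_range; exact: leq_trans nK.
have [l e] := @L2dot_sum R L n (wgt al tn n) (fun k => uh (k.+1%:Z - 2 * N%:Z)) v lu lv.
rewrite -e !L2dotE -IntZ; last exact: itgb_mulL2.
apply: eq_Int => x _; rewrite -mulrA; congr (_ * (_ * _)).
rewrite /Jdelay big_add1/=; apply: eq_bigr => k _.
rewrite L1coefE predZ /l1c; congr (_ * _); rewrite mulrCA mulfV ?mulr1//.
by rewrite subr_eq0 gt_eqF//; exact: tnS.
Qed.

Lemma gform_interp w v : gform M X (interp M X w) v = gform M X w v.
Proof. by apply: eq_bigr => j _; rewrite (slope_interp w hL hX). Qed.

Let nu v t := Int 0 L (fun x => u x t * v x).

(** The scheme is subtracted from the equation tested with v = theta^n. The Dirichlet forms of u and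
    Pi u coincide, so that [eta] survives only in the time difference and in the reaction term. *)
Lemma error_identity n v : (1 <= n <= 2 * K * N)%N -> v = theta n ->
  \sum_(0 <= k < n) l1c al tn n k * (L2dot L (theta k.+1) v - L2dot L (theta k) v) =
  (\sum_(0 <= k < n) l1c al tn n k * (nu v (tn k.+1) - nu v (tn k))
    - Int 0 (tn n) (fun s => omega (1 - al) (tn n - s) * Int 0 L (fun x => D x s * v x)))
  - \sum_(0 <= k < n) l1c al tn n k * L2dot L (fun x => eta (tn k.+1) x - eta (tn k) x) v
  + b * (Int 0 (tn n) (fun s => omega (1 - al) (tn n - s) * nu v (s - tau))
    - \sum_(0 <= k < n) wgt al tn n k * L2dot L (uh (k.+1%:Z - 2 * N%:Z)) v)
  + a * L2dot L (eta (tn n)) v + a * L2norm L v ^+ 2 - p * gform M X v v.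
Proof.
move=> /andP[n1 nK] ev; have fv : fe_space L M X v by rewrite ev; exact: theta_fe.
have lv := fe_L2 fv.
have lth k : (k <= n)%N -> [/\ L2on 0 L (u^~ (tn k)), L2on 0 L (eta (tn k)) & L2on 0 L (uh k%:Z)].
  move=> kn; have kK := leq_trans kn nK.
  by split; [exact: u_L2 (tn_in kK)|exact: eta_L2 (tn_in kK)|exact: fe_L2 (uhk kK)].
have dth k : (k <= n)%N -> L2dot L (theta k) v = nu v (tn k) - L2dot L (eta (tn k)) v - L2dot L (uh k%:Z) v.
  move=> /lth[l1 l2 l3]; rewrite /nu -L2dotE -L2dotB// -L2dotB//; last exact: L2onB.
  by apply: eq_L2dot => x _ //; rewrite /theta /eta; ring.
have E1 : \sum_(0 <= k < n) l1c al tn n k * (L2dot L (theta k.+1) v - L2dot L (theta k) v) =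
   \sum_(0 <= k < n) l1c al tn n k * (nu v (tn k.+1) - nu v (tn k))
   - \sum_(0 <= k < n) l1c al tn n k * L2dot L (fun x => eta (tn k.+1) x - eta (tn k) x) v
   - \sum_(0 <= k < n) l1c al tn n k * (L2dot L (uh k.+1%:Z) v - L2dot L (uh k%:Z) v).
  rewrite -!sumrB; apply: eq_big_nat => k /andP[_ kn].
  have [_ le1 _] := lth k.+1 kn; have [_ le0 _] := lth k (ltnW kn).
  rewrite (dth k.+1 kn) (dth k (ltnW kn)) (L2dotB le1 le0 lv).
  move: (l1c _ _ _ _) (nu _ _) (nu _ _) (L2dot _ _ _) (L2dot _ _ _) (L2dot _ _ _) (L2dot _ _ _) => z1 z2 z3 z4 z5 z6 z7; ring.
have nn : (1 <= n <= 2 * K * N)%N by rewrite n1.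
have := sch nn fv; rewrite (Dalpha_pair nK lv) (Jdelay_pair nK lv) (Bform_fe _ _ hX (uhk nK) fv).
have tn1 : 0 < tn n <= T by rewrite tn_le// andbT; exact: mesh_pos.
have [_ _ ->] := pdew tn1 hX fv.
(* The form does not see Pi, and Pi u^n = theta^n + u_h^n with theta^n = v. *)
have G1 : gform M X (u^~ (tn n)) v = gform M X v v + gform M X (uh n%:Z) v.
  by rewrite {2}ev -(gform_interp (u^~ (tn n))) /theta gformB subrK.
have dn := dth n (leqnn n); rewrite -ev in dn.
have dvv : L2dot L v v = L2norm L v ^+ 2 by rewrite L2norm_sqr L2dotE; apply: eq_Int => x _; rewrite expr2.
rewrite /weak_form -/(nu v (tn n)) G1 E1 => E2; move: dn E2; rewrite dvv.
move: (\sum_(_ <= _ < _) _) (\sum_(_ <= _ < _) _) (\sum_(_ <= _ < _) _) (\sum_(_ <= _ < _) _) => z1 z2 z3 z4.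
rewrite /nu; move: (gform _ _ _ _) (gform _ _ _ _) (L2dot _ _ _) (L2dot _ _ _) (L2norm _ _) => z5 z6 z7 z8 z9.
move: (Int 0 (tn n) _) (Int 0 (tn n) _) (Int 0 L _) => z10 z11 z12 dn E2.
rewrite -[z4](addrK (p * z6 - a * z7)) E2 dn; ring.
Qed.

(** Before tau, that is for k < 2 N, the singularity is at 0; afterwards it is at tau, and the bound
    is kept as an increment for telescoping. *)
Definition osc k : R := if (k < 2 * N)%N then co1 * tn k `^ (al - 2) * (tn k.+1 - tn k)
  else co2 * (tn k.+1 - tau) `^ al - co2 * (tn k - tau) `^ al.

Let tn_gt0 k : (0 < k)%N -> 0 < tn k. Proof. exact: mesh_pos. Qed.
Let tn_mono k n : (k <= n)%N -> tn k <= tn n. Proof. exact: mesh_mono. Qed.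
Let tn_tau : tn (2 * N) = tau.
Proof. by have := mesh_node htau hr N0 1; rewrite mul1r muln1. Qed.
Let a0 : 0 < al. Proof. by case/andP: hal. Qed.

Let tau_tn k : (2 * N <= k)%N -> 0 <= tn k - tau.
Proof. by move=> kN; rewrite subr_ge0 -tn_tau; exact: tn_mono. Qed.

Lemma osc_ge0 k : 0 <= osc k.
Proof.
rewrite /osc; case: ltnP => kN; first by rewrite !mulr_ge0 ?powR_ge0// subr_ge0 ltW.
have h0 := tau_tn kN; have h1 := tnS k.
rewrite -mulrBr mulr_ge0// subr_ge0; apply: ge0_ler_powR; rewrite ?(ltW a0) ?nnegrE//; lra.
Qed.

Let osc_pt k x s t : (1 <= k < 2 * K * N)%N -> 0 < x < L -> tn k < s -> s <= t -> t < tn k.+1 ->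
  `|D x t - D x s| <= osc k.
Proof.
move=> /andP[k1 kK] hx ks st tk; have s0 : 0 < s by apply: le_lt_trans ks.
have tk0 := tn_gt0 k1; rewrite /osc; case: ltnP => kN.
  have tt : t <= tau by rewrite (le_trans (ltW tk))// -tn_tau; exact: tn_mono.
  apply: (le_trans (osc1 hx s0 st tt)); rewrite -!mulrA; apply: ler_wpM2l => //.
  apply: ler_pM; [exact: powR_ge0|by rewrite subr_ge0| |lra].
  rewrite -[al - 2]opprB !powRN lef_pV2 ?posrE ?powR_gt0//.
  apply: ge0_ler_powR; rewrite ?nnegrE ?(ltW ks) ?(ltW s0) ?(ltW tk0)//; have ha' := hal; lra.
have [j [j1 jk kj jJ j2]] := mesh_block htau hr N0 k.
have hj : (2 <= j <= K)%N by rewrite j2// jJ.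
have js : (j%:R - 1) * tau < s by exact: le_lt_trans jk ks.
have tj : t <= j%:R * tau by exact: le_trans (ltW tk) kj.
apply: (le_trans (osc2 hx hj js st tj)); have h0 := tau_tn kN; apply: lerB; apply: ler_wpM2l => //;
  apply: ge0_ler_powR; rewrite ?(ltW a0) ?nnegrE//; lra.
Qed.

Let c3 := cfar al r tau + cnear al r tau T + cfirst al tau T.

Lemma c3_ge0 : 0 <= (cd + co1) * c3.
Proof.
apply: mulr_ge0; first exact: addr_ge0.
have ga : 0 < Gamma (1 - al) :> R by apply: Gamma_gt0; have := hal; lra.
have ga2 : 0 < Gamma (1 - al + 1) :> R by apply: Gamma_gt0; have := hal; lra.
have ga1 : 0 < Gamma al :> R by apply: Gamma_gt0; have := hal; lra.
have r0 : 0 <= r by rewrite (le_trans _ (ltW hr)).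
rewrite /c3; apply: addr_ge0; first apply: addr_ge0.
- by rewrite /cfar !mulr_ge0 ?powR_ge0 ?invr_ge0 ?(ltW a0) ?(ltW ga)// addr_ge0// mulr_ge0// ltW.
- by rewrite /cnear !mulr_ge0 ?powR_ge0 ?invr_ge0 ?(ltW ga2)// addr_ge0 ?powR_ge0.
rewrite /cfirst mulr_ge0// addr_ge0 ?powR_ge0 ?(ltW ga1)//.
by rewrite invr_ge0 mulr_ge0 ?(ltW a0) ?(ltW ga2).
Qed.

(** [trunc_total] with A = (cd + co1) V, where V is the L1 norm of v; cd bounds the derivative and
    co1 its oscillation. *)
Lemma mesh_truncation n v : (1 <= n <= 2 * K * N)%N -> fe_space L M X v ->
  `|\sum_(0 <= k < n) l1c al tn n k * (nu v (tn k.+1) - nu v (tn k))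
    - Int 0 (tn n) (fun s => omega (1 - al) (tn n - s) * Int 0 L (fun x => D x s * v x))|
  <= ((cd + co1) * c3 * (tn n `^ (- al) * N%:R `^ (- Num.min 1 (al * r))) +
     \sum_(N <= k < n) wgt al tn n k * osc k) * Int 0 L (fun x => `|v x|).
Proof.
move=> hn fv; have lv := fe_L2 fv; set V := Int 0 L _.
have V0 : 0 <= V by apply: Int_ge0 => x _; exact: normr_ge0.
have lu t : 0 <= t <= T -> L2on 0 L (u^~ t).
  by move=> /andP[t0 tT]; apply: u_L2; rewrite tT (le_trans _ t0)// oppr_le0 ltW.
have T0 : 0 <= T by rewrite -(mesh_node htau hr N0 K); exact: tn_ge0.
have cV : cd <= cd + co1 /\ co1 <= cd + co1 by rewrite lerDl lerDr.
have A0 : 0 <= (cd + co1) * V by rewrite mulr_ge0// addr_ge0.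
have P1 := @pair_FTC R L T al cd u D v a0 lv mD bD FTCD lu.
have inu : itgb 0 T (fun s => Int 0 L (fun x => D x s * v x)) by have [] := P1 0 T (lexx 0) T0 (lexx T).
have FT s x : 0 <= s -> s <= x -> x <= T ->
    Int s x (fun r => Int 0 L (fun y => D y r * v y)) = nu v x - nu v s.
  by move=> s0 sx xT; have [] := P1 s x s0 sx xT.
have oN k : (1 <= k < N)%N -> osc k * V <= (cd + co1) * V * tn k `^ (al - 2) * (tn k.+1 - tn k).
  move=> /andP[k1 kN]; rewrite /osc ifT; last by rewrite (leq_trans kN)// leq_pmull.
  rewrite mulrAC; apply: ler_wpM2r; first by rewrite subr_ge0 ltW.
  rewrite mulrAC; apply: ler_wpM2r; first exact: powR_ge0.
  by apply: ler_wpM2r => //; case: cV.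
have onu k : (1 <= k < 2 * K * N)%N -> forall s x, tn k < s < tn k.+1 -> tn k < x < tn k.+1 ->
    `|Int 0 L (fun y => D y x * v y) - Int 0 L (fun y => D y s * v y)| <= osc k * V.
  move=> hk s x /andP[ks sk] /andP[kx xk].
  have tT : tn k.+1 <= T by apply: tn_le; case/andP: hk.
  have hs : 0 < s < T by rewrite (le_lt_trans (tn_ge0 k) ks) (lt_le_trans sk tT).
  have hx : 0 < x < T by rewrite (le_lt_trans (tn_ge0 k) kx) (lt_le_trans xk tT).
  apply: (@pair_osc R L T al cd D v lv mD bD s x (osc k) hs hx) => y hy.
  have [sx|xs] := leP s x; first exact: osc_pt.
  by rewrite distrC; apply: osc_pt => //; exact: ltW.
have bnu s : 0 < s < T -> `|Int 0 L (fun y => D y s * v y)| <= (cd + co1) * V * s `^ (al - 1).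
  move=> hs; apply: (le_trans (@pair_bnd R L T al cd D v lv mD bD s hs)).
  by apply: ler_wpM2r; [exact: powR_ge0|apply: ler_wpM2r => //; case: cV].
have := @trunc_total R al r tau T ((cd + co1) * V) N (2 * K * N) tn (nu v) _ (fun k => osc k * V) hal htau hr N2 A0
  tn0 tnS (tn_le (leqnn _)) (fun k kN => mesh_first htau hr N0 kN) (fun k kN => mesh_step_rel htau hr N0 kN)
  inu FT bnu onu oN n hn.
move=> hh; apply: (le_trans hh).
rewrite -/c3 [leRHS]mulrDl big_distrl/= le_eqVlt; apply/orP; left; apply/eqP; congr (_ + _); first by ring.
by apply: eq_bigr => k _; rewrite mulrA.
Qed.

(** On a cell (u(s - tau), v) is compared with the sample at the right end. The shift by tau maps
    mesh cells to mesh cells, so that the variation of u costs S over an earlier cell, and what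
    remains is the error at an earlier level. *)
Lemma delay_consistency n v : (1 <= n <= 2 * K * N)%N -> fe_space L M X v ->
  `|Int 0 (tn n) (fun s => omega (1 - al) (tn n - s) * nu v (s - tau))
    - \sum_(0 <= k < n) wgt al tn n k * L2dot L (uh (k.+1%:Z - 2 * N%:Z)) v| <=
  (\sum_(0 <= k < n) wgt al tn n k *
     (S (tn k - tau) (tn k.+1 - tau) + L2norm L (err (k.+1%:Z - 2 * N%:Z)))) * L2norm L v.
Proof.
move=> /andP[n1 nK] fv; have lv := fe_L2 fv.
have tn1 : 0 < tn n <= T by rewrite tn_le// andbT; exact: mesh_pos.
have [_ ig _] := pdew tn1 hX fv.
rewrite big_distrl/=; under [leRHS]eq_bigr do rewrite -mulrA.
apply: (@quadrature_error R al tn (fun s => nu v (s - tau)) (fun k => L2dot L (uh (k.+1%:Z - 2 * N%:Z)) v)) => //.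
move=> k kn s /andP[ks sk].
have kK : (k < 2 * K * N)%N by exact: leq_trans nK.
have tT := tn_le kK; have tk0 := tn_ge0 k; have t0 := htau.
have hk1 : - tau <= tn k.+1 - tau <= T by lra.
have hs : - tau <= s - tau <= T by lra.
have lh : L2on 0 L (uh (k.+1%:Z - 2 * N%:Z)) by apply: fe_L2; apply: fuh; exact: delay_range.
have lu1 := u_L2 hk1; have lus := u_L2 hs.
have -> : nu v (s - tau) - L2dot L (uh (k.+1%:Z - 2 * N%:Z)) v =
   L2dot L (fun x => u x (tn k.+1 - tau) - uh (k.+1%:Z - 2 * N%:Z) x) v
   - L2dot L (fun x => u x (tn k.+1 - tau) - u x (s - tau)) v.
  by rewrite (L2dotB lu1 lh lv) (L2dotB lu1 lus lv) /nu -L2dotE; ring.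
apply: (le_trans (ler_normB _ _)); rewrite [leLHS]addrC [leRHS]mulrDl; apply: lerD.
  apply: (le_trans (L2dot_le (L2onB lu1 lus) lv)); apply: ler_wpM2r; first exact: L2norm_ge0.
  have sk' : s - tau <= tn k.+1 - tau by lra.
  have h1 : - tau <= s - tau by lra.
  have h2 : tn k.+1 - tau <= T by lra.
  apply: (le_trans (SL2 h1 sk' h2)).
  have h3 : - tau <= tn k - tau by lra.
  have h4 : tn k - tau <= s - tau by lra.
  by rewrite [leRHS](SD h3 h4 sk' h2) lerDr.
apply: (le_trans (L2dot_le (L2onB lu1 lh) lv)); apply: ler_wpM2r; first exact: L2norm_ge0.
by rewrite le_eqVlt; apply/orP; left; apply/eqP; apply: eq_L2norm => x _; rewrite /err tn_delay.
Qed.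

(** The factors [tn k.+1 - tn k] turn [wgt] into [l1c], the form that [l1_stability] requires. The
    truncation error of the cells below N is accounted for in [Fstep]. *)
Definition Estep k : R := (tn k.+1 - tn k) * (if (N <= k)%N then osc k * Num.sqrt L else 0)
  + 2 * h ^+ 2 * S (tn k) (tn k.+1)
  + `|b| * ((tn k.+1 - tn k) * (S (tn k - tau) (tn k.+1 - tau) + L2norm L (err (k.+1%:Z - 2 * N%:Z)))).

(** The reaction term carries no factor t_n^(-al); it acquires one through 1 <= T^al t_n^(-al). *)
Definition Fstep : R := (cd + co1) * c3 * N%:R `^ (- Num.min 1 (al * r)) * Num.sqrt L
  + `|a| * (2 * h ^+ 2 * M2) * T `^ al.

(** The terms a |v|^2 and - p [gform] are nonpositive and dropped; the four others of the identity
    are bounded separately. *)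
Lemma error_step n : (1 <= n <= 2 * K * N)%N ->
  \sum_(0 <= k < n) l1c al tn n k * (L2dot L (theta k.+1) (theta n) - L2dot L (theta k) (theta n)) <=
  (\sum_(0 <= k < n) l1c al tn n k * Estep k + Fstep * tn n `^ (- al)) * L2norm L (theta n).
Proof.
move=> hn; have /andP[n1 nK] := hn; set v := theta n.
have fv : fe_space L M X v by exact: theta_fe.
have lv := fe_L2 fv; rewrite (error_identity hn (erefl v)).
have h1 := mesh_truncation hn fv; have h2 := delay_consistency hn fv.
have V := @L1_le_L2 R L v hL lv; have v0 := L2norm_ge0 L v.
have tnn := tn_gt0 n1; have tT := tn_le nK.
have h3 : `|\sum_(0 <= k < n) l1c al tn n k * L2dot L (fun x => eta (tn k.+1) x - eta (tn k) x) v| <=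
    (\sum_(0 <= k < n) l1c al tn n k * (2 * h ^+ 2 * S (tn k) (tn k.+1))) * L2norm L v.
  apply: (le_trans (ler_norm_sum _ _ _)); rewrite big_distrl/=; apply: ler_sum_nat => k /andP[_ kn].
  have l0 : 0 <= l1c al tn n k by exact: l1c_ge0.
  have kK : (k < 2 * K * N)%N by exact: leq_trans nK.
  have h4 : - tau <= tn k by case/andP: (tn_in (ltnW kK)).
  rewrite normrM (ger0_norm l0) -mulrA; apply: ler_wpM2l => //.
  apply: le_trans (L2dot_le (L2onB (eta_L2 (tn_in kK)) (eta_L2 (tn_in (ltnW kK)))) lv) _.
  apply: ler_wpM2r => //; apply: eta_incr => //; [exact: ltW|exact: tn_le].
have h4 : `|L2dot L (eta (tn n)) v| <= 2 * h ^+ 2 * M2 * L2norm L v.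
  apply: le_trans (L2dot_le (eta_L2 (tn_in nK)) lv) _.
  by apply: ler_wpM2r => //; apply: eta_bnd; exact: tn_in.
have pow1 : 1 <= T `^ al * tn n `^ (- al).
  rewrite powRN ler_pdivlMr ?powR_gt0// mul1r; apply: ge0_ler_powR; rewrite ?(ltW a0) ?nnegrE ?(ltW tnn)//.
  exact: le_trans (ltW tnn) tT.
have g0 := gform_ge0 v hX.
have c30 := c3_ge0.
set Z1 := \sum_(0 <= k < n) l1c al tn n k * (nu v (tn k.+1) - nu v (tn k)) - _ in h1 *.
set Z2 := \sum_(0 <= k < n) _ in h3 *.
set Z3 := Int 0 (tn n) _ - _ in h2 *.
have h1' : Z1 <= ((cd + co1) * c3 * N%:R `^ (- Num.min 1 (al * r)) * Num.sqrt L * tn n `^ (- al) +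
     \sum_(0 <= k < n) l1c al tn n k * ((tn k.+1 - tn k) * (if (N <= k)%N then osc k * Num.sqrt L else 0))) * L2norm L v.
  apply: le_trans (ler_norm _) _; apply: (le_trans h1).
  set W := _ + _; have W0 : 0 <= W.
    apply: addr_ge0; first by apply: mulr_ge0; [exact: c30|rewrite mulr_ge0 ?powR_ge0].
    rewrite big_seq; apply: sumr_ge0 => k; rewrite mem_index_iota => /andP[_ kn].
    by rewrite mulr_ge0 ?osc_ge0// wgt_ge0.
  apply: (le_trans (ler_wpM2l W0 V)); rewrite mulrA; apply: ler_wpM2r => //.
  rewrite /W mulrDl; apply: lerD; first by rewrite le_eqVlt; apply/orP; left; apply/eqP; ring.
  rewrite (@big_nat_widenl _ _ _ _ 0)// [X in X * _]big_mkcond/= big_distrl/=.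
  rewrite le_eqVlt; apply/orP; left; apply/eqP; apply: eq_bigr => k _.
  case: (N <= k)%N; last by rewrite mul0r !mulr0.
  by rewrite /l1c [in RHS]mulrA divfK ?mulrA// subr_eq0 gt_eqF.
have h2' : b * Z3 <= (\sum_(0 <= k < n) l1c al tn n k *
   (`|b| * ((tn k.+1 - tn k) * (S (tn k - tau) (tn k.+1 - tau) + L2norm L (err (k.+1%:Z - 2 * N%:Z)))))) * L2norm L v.
  apply: le_trans (ler_norm _) _; rewrite normrM.
  apply: le_trans (ler_wpM2l (normr_ge0 b) h2) _; rewrite mulrA big_distrr/=.
  rewrite le_eqVlt; apply/orP; left; apply/eqP; congr (_ * _); apply: eq_bigr => k _.
  rewrite /l1c [in RHS]mulrCA [X in _ = _ * X]mulrA divfK// subr_eq0 gt_eqF//.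
have h4' : a * L2dot L (eta (tn n)) v <= `|a| * (2 * h ^+ 2 * M2) * (T `^ al * tn n `^ (- al)) * L2norm L v.
  apply: le_trans (ler_norm _) _; rewrite normrM.
  apply: le_trans (ler_wpM2l (normr_ge0 a) h4) _; rewrite mulrA; apply: ler_wpM2r => //.
  have k0 : 0 <= `|a| * (2 * h ^+ 2 * M2).
    apply: mulr_ge0; [exact: normr_ge0|apply: mulr_ge0 M20; apply: mulr_ge0; [exact: ler0n|exact: sqr_ge0]].
  by rewrite ler_peMr.
have h5 : a * L2norm L v ^+ 2 <= 0 by rewrite mulr_le0_ge0 ?sqr_ge0.
have h6 : 0 <= p * gform M X v v by rewrite mulr_ge0// ltW.
have h3' : - Z2 <= (\sum_(0 <= k < n) l1c al tn n k * (2 * h ^+ 2 * S (tn k) (tn k.+1))) * L2norm L v.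
  by apply: le_trans h3; rewrite -normrN; exact: ler_norm.
have -> : \sum_(0 <= k < n) l1c al tn n k * Estep k =
  \sum_(0 <= k < n) l1c al tn n k * ((tn k.+1 - tn k) * (if (N <= k)%N then osc k * Num.sqrt L else 0))
  + \sum_(0 <= k < n) l1c al tn n k * (2 * h ^+ 2 * S (tn k) (tn k.+1))
  + \sum_(0 <= k < n) l1c al tn n k *
   (`|b| * ((tn k.+1 - tn k) * (S (tn k - tau) (tn k.+1 - tau) + L2norm L (err (k.+1%:Z - 2 * N%:Z))))).
  by rewrite -!big_split/=; apply: eq_bigr => k _; rewrite /Estep -!mulrDr.
move: h1' h2' h3' h4' h5 h6; rewrite /Fstep.
move: (a * L2norm L v ^+ 2) (p * _) (a * _) (b * _) => y1 y2 y3 y4.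
move: (\sum_(_ <= _ < _) _) (\sum_(_ <= _ < _) _) (\sum_(_ <= _ < _) _) => y5 y6 y7.
move: (Z1) (- Z2) (`|a| * _) (T `^ al) (tn n `^ _) (_ * _ * Num.sqrt L) (L2norm L v) => y8 y9 y10 y11 y12 y13 y14.
move=> k1 k2 k3 k4 k5 k6.
have -> : (y7 + y5 + y6 + (y13 + y10 * y11) * y12) * y14 =
  (y13 * y12 + y7) * y14 + y6 * y14 + y5 * y14 + y10 * (y11 * y12) * y14 by ring.
lra.
Qed.

Let rho_ge0 k : 0 <= tn k.+1 - tn k. Proof. by rewrite subr_ge0 ltW. Qed.
Let sqL0 : 0 <= Num.sqrt L. Proof. exact: sqrtr_ge0. Qed.
Let mu := Num.min 1 (al * r).
Local Notation dlt := (h ^+ 2 + N%:R `^ (- mu)).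

Lemma Estep_ge0 k : 0 <= Estep k.
Proof.
rewrite /Estep; apply: addr_ge0; first apply: addr_ge0.
- by apply: mulr_ge0 => //; case: ifP => // _; apply: mulr_ge0 => //; exact: osc_ge0.
- by apply: mulr_ge0 => //; apply: mulr_ge0; [exact: ler0n|exact: sqr_ge0].
apply: mulr_ge0; [exact: normr_ge0|apply: mulr_ge0 => //; apply: addr_ge0 => //; exact: L2norm_ge0].
Qed.

Definition cF : R := (cd + co1) * c3 * Num.sqrt L + `|a| * (2 * M2) * T `^ al.

Let cF2 : 0 <= `|a| * (2 * M2) * T `^ al.
Proof. by apply: mulr_ge0; [apply: mulr_ge0 => //; apply: mulr_ge0|exact: powR_ge0]. Qed.

Lemma cF_ge0 : 0 <= cF.
Proof. by apply: addr_ge0 cF2; apply: mulr_ge0; [exact: c3_ge0|]. Qed.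

Lemma Fstep_ge0 : 0 <= Fstep.
Proof.
apply: addr_ge0; first by apply: mulr_ge0 => //; apply: mulr_ge0; [exact: c3_ge0|exact: powR_ge0].
apply: mulr_ge0; [apply: mulr_ge0; first exact: normr_ge0|exact: powR_ge0].
by apply: mulr_ge0 => //; apply: mulr_ge0; [exact: ler0n|exact: sqr_ge0].
Qed.

Lemma Fstep_le : Fstep <= cF * dlt.
Proof.
have h2 : 0 <= h ^+ 2 by exact: sqr_ge0.
have N3 : 0 <= N%:R `^ (- mu) by exact: powR_ge0.
have k1 : 0 <= (cd + co1) * c3 * Num.sqrt L by apply: mulr_ge0; [exact: c3_ge0|].
have k2 := cF2; rewrite /Fstep /cF -/mu; move: h2 N3 k1 k2.
move: (h ^+ 2) (N%:R `^ _) ((cd + co1) * c3) (T `^ al) (`|a|) => y1 y2 y3 y4 y5 h2 N3 k1 k2.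
have -> : y3 * y2 * Num.sqrt L + y5 * (2 * y1 * M2) * y4 = y3 * Num.sqrt L * y2 + y5 * (2 * M2) * y4 * y1 by ring.
move: (y3 * _) (y5 * _ * _) k1 k2 => z1 z2 k1 k2.
by rewrite mulrDl; apply: lerD; apply: ler_wpM2l => //; rewrite ?lerDl ?lerDr.
Qed.

Lemma theta_stability n : (n <= 2 * K * N)%N ->
  L2norm L (theta n) <= L2norm L (theta 0) + \sum_(0 <= k < n) Estep k + Gamma (1 - al) * Fstep.
Proof.
apply: (@l1_stability R al (2 * K * N) tn hal tn0 tnS (fun k => L2norm L (theta k)) Estep Fstep).
- by move=> k; exact: L2norm_ge0.
- exact: Estep_ge0.
- exact: Fstep_ge0.
move=> m hm; have /andP[m1 mK] := hm; exists (fun k => L2dot L (theta k) (theta m)); split.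
- by rewrite L2norm_sqr L2dotE; apply: eq_Int => x _; rewrite expr2.
- move=> k km; apply: le_trans (ler_norm _) _; apply: L2dot_le; apply: fe_L2; apply: theta_fe => //.
  exact: leq_trans (ltnW km) mK.
exact: error_step.
Qed.

Let Sinf := S (- tau) T.

Let Ssub s t : - tau <= s -> s <= t -> t <= T -> S s t <= Sinf.
Proof.
move=> ts st tT; have h1 : - tau <= t := le_trans ts st.
rewrite /Sinf (SD (lexx _) h1 tT (lexx _)) (SD (lexx _) ts st tT).
have := S0 (- tau) s; have := S0 t T; lra.
Qed.

(** Additivity of S over consecutive cells; c = 0 serves the increments of [eta] and c = tau the
    delay term. *)
Lemma S_sum c n : (n <= 2 * K * N)%N -> c <= tau -> 0 <= c -> \sum_(0 <= k < n) S (tn k - c) (tn k.+1 - c) <= Sinf.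
Proof.
move=> nK ct c0.
have H m : (m <= n)%N -> \sum_(0 <= k < m) S (tn k - c) (tn k.+1 - c) <= S (tn 0 - c) (tn m - c).
  elim: m => [|m IH mn]; first by rewrite big_geq.
  rewrite big_nat_recr//=; apply: le_trans (lerD (IH (ltnW mn)) (lexx _)) _.
  have mT : tn m.+1 <= T by apply: tn_le; exact: leq_trans nK.
  have t0 := htau; have := tn_ge0 m; have := tnS m; rewrite tn0 => q1 q2.
  by rewrite -SD//; lra.
have tT := tn_le nK; have t1 := tn_ge0 n; have := H n (leqnn n); rewrite tn0 => /le_trans; apply.
by apply: Ssub; lra.
Qed.

Let cQ := co1 * (tau / 2) `^ (al - 2) * T + co2 * T `^ al.

Lemma osc_sum n : (n <= 2 * K * N)%N -> \sum_(0 <= k < n) (if (N <= k)%N then osc k else 0) <= cQ.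
Proof.
move=> nK; have t20 : 0 < tau / 2 by rewrite divr_gt0.
(* [osc] is dominated by increments of q. The linear part takes the bound at tau / 2, beyond which
   the cells k >= N lie; [q2] starts at k = 2 N, where t_k = tau and its formula is 0. *)
pose q2 k := if (k < 2 * N)%N then 0 else co2 * (tn k - tau) `^ al.
pose q k := co1 * (tau / 2) `^ (al - 2) * tn k + q2 k.
have q2_mono k : q2 k <= q2 k.+1.
  rewrite /q2; case: (ltnP k) => k1; case: (ltnP k.+1) => k2 //.
  - by rewrite mulr_ge0 ?powR_ge0.
  - by move: k2; rewrite ltnNge (leq_trans k1).
  have := tau_tn k1; have := tnS k => z1 z2; apply: ler_wpM2l => //.
  apply: ge0_ler_powR; rewrite ?(ltW a0) ?nnegrE//; lra.
have c1 : 0 <= co1 * (tau / 2) `^ (al - 2) by rewrite mulr_ge0 ?powR_ge0.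
apply: le_trans (_ : \sum_(0 <= k < n) (q k.+1 - q k) <= _).
  apply: ler_sum_nat => k _.
  have -> : q k.+1 - q k = co1 * (tau / 2) `^ (al - 2) * (tn k.+1 - tn k) + (q2 k.+1 - q2 k) by rewrite /q; ring.
  have r1 : 0 <= co1 * (tau / 2) `^ (al - 2) * (tn k.+1 - tn k) by exact: mulr_ge0.
  have r2 : 0 <= q2 k.+1 - q2 k by rewrite subr_ge0.
  case: (leqP N k) => kN; last exact: addr_ge0.
  rewrite /osc; case: (ltnP k (2 * N)) => k2.
    apply: ler_wpDr => //; apply: ler_wpM2r => //; apply: ler_wpM2l => //.
    have tk : tau / 2 <= tn k.
      have := mesh_first htau hr N0 (leqnn N); rewrite divff ?pnatr_eq0 -?lt0n// powR1 mulr1 => <-.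
      exact: tn_mono.
    rewrite -[al - 2]opprB !powRN lef_pV2 ?posrE ?powR_gt0//; last exact: lt_le_trans tk.
    by apply: ge0_ler_powR; rewrite ?nnegrE ?(ltW t20) ?(le_trans (ltW t20) tk)//; have := hal; lra.
  apply: ler_wpDl => //; rewrite /q2 !ifF//; first by apply/negbTE; rewrite -leqNgt.
  by apply/negbTE; rewrite -leqNgt (leq_trans k2).
rewrite telescope_sumr//.
have q0 : q 0%N = 0 by rewrite /q tn0 mulr0 add0r /q2 ifT// muln_gt0.
rewrite q0 subr0 /q /cQ; have tT := tn_le nK; apply: lerD; first exact: ler_wpM2l.
rewrite /q2; case: (ltnP n) => n2; first by rewrite mulr_ge0 ?powR_ge0.
have := tau_tn n2 => z1; apply: ler_wpM2l => //; apply: ge0_ler_powR; rewrite ?(ltW a0) ?nnegrE//; have := htau; lra.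
Qed.

(** Sums weighted by the steps gain the factor rho_max / N, the increments of [eta] come with h^2,
    and the earlier errors are weighted by steps of total length at most T. *)
Definition cE B : R := rho_max tau r * (cQ * Num.sqrt L) + 2 * Sinf + `|b| * (rho_max tau r * Sinf + T * B).

Let rm0 : 0 <= rho_max tau r / N%:R.
Proof. by have /andP[q1 q2] := mesh_step_bnd htau hr N0 0; exact: le_trans (ltW q1) q2. Qed.

Let Ninv : N%:R^-1 <= dlt.
Proof.
have i0 : 0 < N%:R :> R by rewrite ltr0n.
apply: le_trans (_ : N%:R `^ (- mu) <= _); last by rewrite lerDr sqr_ge0.
rewrite -powR_inv1 ?(ltW i0)//; apply: ler_powR; first by rewrite ler1n.
by rewrite lerN2 /mu ge_min lexx.
Qed.

Lemma Estep_sum n B : (n <= 2 * K * N)%N -> 0 <= B ->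
  (forall k, (k < n)%N -> L2norm L (err (k.+1%:Z - 2 * N%:Z)) <= B * dlt) ->
  \sum_(0 <= k < n) Estep k <= cE B * dlt.
Proof.
move=> nK B0 hB; have Sinf0 : 0 <= Sinf by exact: S0.
have N3 : 0 <= N%:R `^ (- mu) by exact: powR_ge0.
have h20 : 0 <= h ^+ 2 by exact: sqr_ge0.
have d0 : 0 <= dlt by exact: addr_ge0.
have rb k : tn k.+1 - tn k <= rho_max tau r / N%:R by have /andP[] := mesh_step_bnd htau hr N0 k.
have cQ0 : 0 <= cQ by apply: le_trans (osc_sum (leq0n _)); rewrite big_geq.
have rmx : 0 <= rho_max tau r.
  by have := rm0; rewrite pmulr_lge0// invr_gt0 ltr0n.
have e1 : \sum_(0 <= k < n) (tn k.+1 - tn k) * (if (N <= k)%N then osc k * Num.sqrt L else 0) <=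
    rho_max tau r * (cQ * Num.sqrt L) * dlt.
  apply: le_trans (_ : rho_max tau r / N%:R * (\sum_(0 <= k < n) (if (N <= k)%N then osc k else 0) * Num.sqrt L) <= _).
    rewrite big_distrr/=; apply: ler_sum_nat => k _.
    case: (leqP N k) => kN; last by rewrite !mul0r !mulr0.
    by apply: ler_wpM2r; [apply: mulr_ge0 => //; exact: osc_ge0|exact: rb].
  apply: le_trans (_ : rho_max tau r / N%:R * (cQ * Num.sqrt L) <= _).
    by apply: ler_wpM2l => //; rewrite -big_distrl/=; apply: ler_wpM2r => //; exact: osc_sum.
  rewrite mulrAC; apply: ler_wpM2l Ninv; by apply: mulr_ge0 => //; exact: mulr_ge0.
have e2 : \sum_(0 <= k < n) 2 * h ^+ 2 * S (tn k) (tn k.+1) <= 2 * Sinf * dlt.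
  rewrite -big_distrr/= mulrAC; apply: ler_pM => //.
  - by apply: mulr_ge0 => //; apply: sumr_ge0 => k _.
  - apply: ler_wpM2l => //; apply: le_trans (@S_sum 0 n nK (ltW htau) (lexx 0)).
    by rewrite le_eqVlt; apply/orP; left; apply/eqP; apply: eq_bigr => k _; rewrite !subr0.
  - by rewrite lerDl.
have e3 : \sum_(0 <= k < n) (tn k.+1 - tn k) * S (tn k - tau) (tn k.+1 - tau) <= rho_max tau r * Sinf * dlt.
  apply: le_trans (_ : rho_max tau r / N%:R * Sinf <= _).
    apply: le_trans (_ : rho_max tau r / N%:R * (\sum_(0 <= k < n) S (tn k - tau) (tn k.+1 - tau)) <= _).
      by rewrite big_distrr/=; apply: ler_sum_nat => k _; apply: ler_wpM2r.
    by apply: ler_wpM2l => //; apply: S_sum => //; exact: ltW.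
  rewrite mulrAC; apply: ler_wpM2l Ninv; exact: mulr_ge0.
have e4 : \sum_(0 <= k < n) (tn k.+1 - tn k) * L2norm L (err (k.+1%:Z - 2 * N%:Z)) <= T * B * dlt.
  apply: le_trans (_ : \sum_(0 <= k < n) (tn k.+1 - tn k) * (B * dlt) <= _).
    by apply: ler_sum_nat => k /andP[_ kn]; apply: ler_wpM2l => //; exact: hB.
  rewrite -big_distrl/= telescope_sumr// tn0 subr0 mulrA; apply: ler_wpM2r => //; apply: ler_wpM2r => //; exact: tn_le.
have -> : \sum_(0 <= k < n) Estep k =
  \sum_(0 <= k < n) (tn k.+1 - tn k) * (if (N <= k)%N then osc k * Num.sqrt L else 0)
  + \sum_(0 <= k < n) 2 * h ^+ 2 * S (tn k) (tn k.+1)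
  + `|b| * (\sum_(0 <= k < n) (tn k.+1 - tn k) * S (tn k - tau) (tn k.+1 - tau)
     + \sum_(0 <= k < n) (tn k.+1 - tn k) * L2norm L (err (k.+1%:Z - 2 * N%:Z))).
  rewrite -!big_split/= big_distrr/= -big_split/=; apply: eq_bigr => k _.
  by rewrite /Estep; congr (_ + `|b| * _); rewrite mulrDr.
have -> : cE B * dlt = rho_max tau r * (cQ * Num.sqrt L) * dlt + 2 * Sinf * dlt
    + `|b| * (rho_max tau r * Sinf * dlt + T * B * dlt).
  by rewrite /cE; move: (rho_max _ _) (cQ) (Sinf) (h ^+ 2) (N%:R `^ _) => y1 y2 y3 y4 y5; ring.
apply: lerD; first exact: lerD.
by apply: ler_wpM2l; [exact: normr_ge0|exact: lerD].
Qed.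

Context (C0 : R) (start : forall n : int, - (2 * N)%:Z <= n <= 0 -> L2norm L (err n) <= C0 * h ^+ 2).

(** The two terms 2 M2 are the interpolation errors at time 0, within theta^0, and at the current
    time. *)
Definition cstep B : R := 2 * M2 + `|C0| + cE B + Gamma (1 - al) * cF + 2 * M2.

(** One recursion step per delay interval; adding [cB i] keeps the bound valid on the earlier
    ones. *)
Fixpoint cB (j : nat) : R := if j is i.+1 then cB i + cstep (cB i) else `|C0|.

Lemma cstep_ge0 B : 0 <= B -> 0 <= cstep B.
Proof.
move=> B0.
have Sinf0 : 0 <= Sinf by exact: S0.
have T0 : 0 <= T by rewrite -(mesh_node htau hr N0 K); exact: tn_ge0.
have rmx : 0 <= rho_max tau r.
  by have := rm0; rewrite pmulr_lge0// invr_gt0 ltr0n.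
have cQ0 : 0 <= cQ by apply: le_trans (osc_sum (leq0n _)); rewrite big_geq.
have ga : 0 < Gamma (1 - al) :> R by apply: Gamma_gt0; have := hal; lra.
have k1 : 0 <= 2 * M2 by exact: mulr_ge0.
apply: addr_ge0 => //; apply: addr_ge0; last by apply: mulr_ge0; [exact: ltW|exact: cF_ge0].
apply: addr_ge0; first exact: addr_ge0.
rewrite /cE; apply: addr_ge0; first by apply: addr_ge0; apply: mulr_ge0 => //; exact: mulr_ge0.
by apply: mulr_ge0 => //; apply: addr_ge0; exact: mulr_ge0.
Qed.

Lemma cB_ge0 j : 0 <= cB j.
Proof.
elim: j => [|j IH]; first exact: normr_ge0.
by apply: addr_ge0 => //; exact: cstep_ge0.
Qed.

(** Induction over the delay intervals. By [delay_block] the delay term at a level of the next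
    interval refers to levels already estimated, while the stability estimate always starts from
    time 0. *)
Lemma err_block j : (j <= K)%N -> forall m : int, - (2 * N)%:Z <= m <= (2 * j * N)%:Z -> L2norm L (err m) <= cB j * dlt.
Proof.
have N3 : 0 <= N%:R `^ (- mu) by exact: powR_ge0.
have h20 : 0 <= h ^+ 2 by exact: sqr_ge0.
have hd : h ^+ 2 <= dlt by rewrite lerDl.
have d0 : 0 <= dlt by exact: addr_ge0.
have start' (m : int) : - (2 * N)%:Z <= m <= 0 -> L2norm L (err m) <= `|C0| * h ^+ 2.
  by move=> /start /le_trans; apply; apply: ler_wpM2r => //; exact: ler_norm.
elim: j => [_ m hm|j IH jK m /andP[m1 m2]].
  apply: (le_trans (start' m _)); first by move: hm; rewrite muln0 mul0n.
  exact: ler_wpM2l.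
have step0 := cstep_ge0 (cB_ge0 j).
have [mj|jm] := leP m (2 * j * N)%:Z.
  apply: (le_trans (IH (ltnW jK) m _)); first by rewrite m1.
  by apply: ler_wpM2r => //=; rewrite lerDl.
have [n en] : exists n, m = n%:Z by case: m jm {m1 m2} => // n _; exists n.
rewrite en in m2 jm *; rewrite lez_nat in m2; rewrite ltz_nat in jm.
have nK : (n <= 2 * K * N)%N by apply: (leq_trans m2); rewrite leq_mul// leq_mul.
have hE : forall k, (k < n)%N -> L2norm L (err (k.+1%:Z - 2 * N%:Z)) <= cB j * dlt.
  move=> k kn; apply: IH; first exact: ltnW.
  exact: (@delay_block k n j N).
have e1 := Estep_sum nK (cB_ge0 j) hE.
have e2 := theta_stability nK.
have zn := tn_in nK; have z0 := tn_in (leq0n (2 * K * N)).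
have lth k : (k <= 2 * K * N)%N -> L2on 0 L (theta k) by move=> kK; apply: fe_L2; exact: theta_fe.
have e3 : L2norm L (err n%:Z) <= L2norm L (theta n) + 2 * M2 * h ^+ 2.
  have -> : L2norm L (err n%:Z) = L2norm L (fun x => theta n x + eta (tn n) x).
    by apply: eq_L2norm => x _; rewrite /err /theta /eta /tn; ring.
  apply: (le_trans (L2norm_triangle (lth n nK) (eta_L2 zn))); apply: lerD => //.
  by rewrite mulrAC; exact: eta_bnd.
have e4 : L2norm L (theta 0) <= 2 * M2 * h ^+ 2 + `|C0| * h ^+ 2.
  have -> : L2norm L (theta 0) = L2norm L (fun x => err 0 x - eta (tn 0) x).
    by apply: eq_L2norm => x _; rewrite /err /theta /eta /tn; ring.
  have l0 : L2on 0 L (err 0) by apply: L2onB; [exact: u_L2 z0|exact: fe_L2 (uhk (leq0n _))].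
  apply: (le_trans (L2norm_sub l0 (eta_L2 z0))); rewrite addrC; apply: lerD.
    by rewrite mulrAC; exact: eta_bnd.
  by apply: start'; rewrite lexx andbT oppr_le0.
have ga : 0 <= Gamma (1 - al) :> R by apply: ltW; apply: Gamma_gt0; have := hal; lra.
have e5 : Gamma (1 - al) * Fstep <= Gamma (1 - al) * cF * dlt.
  by rewrite -mulrA; apply: ler_wpM2l => //; exact: Fstep_le.
have e6 : 2 * M2 * h ^+ 2 <= 2 * M2 * dlt by apply: ler_wpM2l => //; exact: mulr_ge0.
have e7 : `|C0| * h ^+ 2 <= `|C0| * dlt by apply: ler_wpM2l.
have e8 : 0 <= cB j * dlt by apply: mulr_ge0 => //; exact: cB_ge0.
have -> : cB j.+1 * dlt = cB j * dlt +
    (2 * M2 * dlt + `|C0| * dlt + cE (cB j) * dlt + Gamma (1 - al) * cF * dlt + 2 * M2 * dlt).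
  have -> : cB j.+1 = cB j + cstep (cB j) by [].
  rewrite /cstep; move: (Gamma (1 - al) * cF) (cE (cB j)) (cB j) => y1 y2 y3; ring.
move: e1 e2 e3 e4 e5 e6 e7 e8; move: (cE _ * _) (Gamma _ * Fstep) => y1 y2.
move: (Gamma _ * _ * _) (2 * M2 * _) (2 * M2 * _) (`|C0| * _) (`|C0| * _) (cB j * _) => y3 y4 y5 y6 y7 y8.
move: (L2norm L (theta n)) (L2norm L (theta 0)) (L2norm L _) (\sum_(_ <= _ < _) _) => y9 y10 y11 y12.
lra.
Qed.

Lemma scheme_error n : (1 <= n <= 2 * K * N)%N ->
  L2norm L (fun x => u x (gm n%:Z) - uh n%:Z x) <= cB K * dlt.
Proof. by move=> /andP[_ nK]; apply: err_block => //; exact: step_range. Qed.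

End scheme.

(** * The error estimate with a uniform constant *)

Lemma neg_range (N : nat) (m : int) : - (2 * N)%:Z <= m <= 0 ->
  exists2 j : nat, (j <= 2 * N)%N & m = j%:Z - 2 * N%:Z.
Proof.
move=> hm; exists (absz (m + (2 * N)%:Z)); lia.
Qed.

Theorem theorem4p2 (R : realType) (alpha tau : R) (K : nat) (p a b L : R)
    (f phi u : R -> R -> R) (r kappa C0 : R)
    (halpha : 0 < alpha < 1) (htau : 0 < tau) (hK : (0 < K)%N)
    (hp : 0 < p) (ha : a <= 0) (hb : b != 0) (hL : 0 < L) (hr : 1 < r)
    (hf : {within (`]0, L[ : set R) `*` (`[0, K%:R * tau] : set R),
             continuous (fun z : R * R => f z.1 z.2)})
    (hphi : {within (`]0, L[ : set R) `*` (`[- tau, 0] : set R),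
               continuous (fun z : R * R => phi z.1 z.2)})
    (hu : is_solution alpha tau K p a b L f phi u)
    (hdt : dt_bounds alpha tau K L u)
    (hH2 : in_Linfty_H2 L (- tau) (K%:R * tau) u)
    (hdtH2 : dt_in_L1_H2 L (- tau) (K%:R * tau) u) :
  exists C : R, 0 < C /\
    forall (N M : nat) (X : nat -> R) (uh : int -> R -> R),
      (2 <= N)%N ->
      spatial_mesh L M X ->
      quasi_uniform kappa M X ->
      let h := mesh_diam M X in
      let t := graded_mesh tau r N in
      (forall n : int, - (2 * N)%:Z <= n <= (2 * K * N)%:Z ->
         fe_space L M X (uh n)) ->
      (forall n : int, - (2 * N)%:Z <= n <= 0 ->
         L2norm L (fun x => uh n x - phi x (t n)) <= C0 * h ^+ 2) ->
      fe_scheme alpha K p a b L f t N M X uh ->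
      forall n : nat, (1 <= n <= 2 * K * N)%N ->
        L2norm L (fun x => u x (t n%:Z) - uh n%:Z x)
          <= C * (h ^+ 2 + N%:R `^ (- Num.min 1 (alpha * r))).
Proof.
have [cu0 cux0 uphi ubd0 pde] := hu; have [C hC] := hdt.
have [_ [u1 [u2 [Mm hu2]]]] := hH2.
have [g [[mg [g1 [g2 [hg ig]]]] wg]] := hdtH2.
set T := K%:R * tau in hf hu hdt hH2 hdtH2 cu0 cux0 ubd0 hu2 mg hg ig wg *.
have T0 : 0 < T by rewrite mulr_gt0// ltr0n.
have tT : - tau < T by rewrite (lt_trans _ T0)// oppr_lt0.
have cu x : 0 <= x <= L -> {within `[- tau, T], continuous (u x)} by move=> hx; apply: cu0; rewrite in_itv.
have cux t : - tau <= t <= T -> {within `[0, L], continuous (u^~ t)} by move=> ht; apply: cux0; rewrite in_itv.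
have ubd t : - tau <= t <= T -> u 0 t = 0 /\ u L t = 0 by move=> ht; apply: ubd0; rewrite in_itv.
pose S := incr L g g1 g2.
have S0 s t : 0 <= S s t by exact: incr_ge0.
have SD s q t : - tau <= s -> s <= q -> q <= t -> t <= T -> S s t = S s q + S q t by exact: (incrD ig).
have SL2 s t : - tau <= s -> s <= t -> t <= T -> L2norm L (fun x => u x t - u x s) <= S s t.
  exact: (incr_L2 tT cu cux mg hg ig wg).
have Sweak Z Q s t : ctest 0 L Z Q -> - tau <= s -> s <= t -> t <= T ->
    `|Int 0 L (fun x => (u x t - u x s) * Q x)| <= S s t * L2norm L Z.
  exact: (incr_weak tT cu cux mg hg ig wg).
have Sle s t : - tau <= s -> s <= t -> t <= T -> S s t <= S (- tau) T.
  move=> ts st tt; exact: (incr_le ig (lexx _) ts st tt (lexx _)).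
have lu t : - tau <= t <= T -> L2on 0 L (u^~ t) by move=> /cux; exact: L2on_continuous.
(* u is continuous in x and in t separately; on [- tau, 0] it is bounded through phi, which is
   jointly continuous. *)
have hub0 dl : 0 < dl -> exists2 B : R, 0 <= B & forall x t, dl <= x <= L - dl -> - tau <= t <= 0 -> `|u x t| <= B.
  move=> dl0; have [B B0 hB] := rect_bnd hphi dl0; exists B => // x t hx ht.
  rewrite uphi ?in_itv//=; first exact: hB.
  by have /andP[x1 x2] := hx; rewrite (lt_le_trans dl0 x1) (le_lt_trans x2)// gtrBl.
have in0 : - tau <= 0 <= T by rewrite oppr_le0 (ltW htau) (ltW T0).
have hMu t : - tau <= t <= T -> L2norm L (u^~ t) <= L2norm L (u^~ 0) + S (- tau) T.
  move=> ht; have /andP[t1 t2] := ht; have [t0|t0] := leP 0 t.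
    have -> : L2norm L (u^~ t) = L2norm L (fun x => u x 0 + (u x t - u x 0)).
      by apply: eq_L2norm => x _; ring.
    apply: (le_trans (L2norm_triangle (lu _ in0) (L2onB (lu _ ht) (lu _ in0)))); apply: lerD => //.
    by apply: le_trans (SL2 _ _ _ t0 t2) (Sle _ _ _ t0 t2); case/andP: in0.
  have -> : L2norm L (u^~ t) = L2norm L (fun x => u x 0 - (u x 0 - u x t)).
    by apply: eq_L2norm => x _; ring.
  apply: (le_trans (L2norm_sub (lu _ in0) (L2onB (lu _ in0) (lu _ ht)))); apply: lerD => //.
  by apply: le_trans (SL2 _ _ t1 (ltW t0) (ltW T0)) (Sle _ _ t1 (ltW t0) (ltW T0)).
(* The bound [Mm] holds at almost every time; any other time is reached from such a time by an
   increment, at a cost of at most S (- tau) T. *)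
pose M2 := `|Mm| + S (- tau) T.
have M20 : 0 <= M2 by rewrite addr_ge0.
have uweak Z Q t : ctest 0 L Z Q -> - tau <= t <= T -> `|Int 0 L (fun x => u x t * Q x)| <= M2 * L2norm L Z.
  move=> ZQ ht; have z0 := L2norm_ge0 L Z.
  have [q hq [H hM]] : exists2 q, - tau < q < T & in_H2 L (u^~ q) (u1^~ q) (u2^~ q) /\ H2norm L (u^~ q) (u1^~ q) (u2^~ q) <= Mm.
    by apply: ae_exists => //; apply: aeS hu2 => q h hq; apply: h; rewrite in_itv.
  have [q1 q2] : - tau <= q /\ q <= T by case/andP: hq => /ltW ? /ltW.
  have hq' : - tau <= q <= T by rewrite q1.
  have cQ : continuous Q by have [? []] := ctest_ends ZQ.
  have lQ : L2on 0 L Q by apply: L2on_continuous; exact: cont_within.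
  have h1 : `|Int 0 L (fun x => u x q * Q x)| <= `|Mm| * L2norm L Z.
    apply: (le_trans (H2_weak_bound H ZQ)); apply: ler_wpM2r => //.
    exact: le_trans hM (ler_norm _).
  have h2 : `|Int 0 L (fun x => u x t * Q x) - Int 0 L (fun x => u x q * Q x)| <= S (- tau) T * L2norm L Z.
    have e s : - tau <= s <= T -> itgb 0 L (fun x => u x s * Q x) by move=> /lu h; exact: itgb_mulL2.
    have /andP[t1 t2] := ht; have [qt|tq] := leP q t.
      rewrite -IntB; [|exact: e|exact: e].
      rewrite (@eq_Int _ _ _ _ (fun x => (u x t - u x q) * Q x)); last by move=> x _; rewrite mulrBl.
      by apply: (le_trans (Sweak _ _ _ _ ZQ q1 qt t2)); apply: ler_wpM2r => //; exact: Sle.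
    rewrite distrC -IntB; [|exact: e|exact: e].
    rewrite (@eq_Int _ _ _ _ (fun x => (u x q - u x t) * Q x)); last by move=> x _; rewrite mulrBl.
    by apply: (le_trans (Sweak _ _ _ _ ZQ t1 (ltW tq) q2)); apply: ler_wpM2r => //; apply: Sle => //; exact: ltW.
  rewrite -[X in `|X|](subrK (Int 0 L (fun x => u x q * Q x))) (le_trans (ler_normD _ _))// addrC mulrDl.
  exact: lerD.
(* No argument depends on N, M, X or uh; the absolute value and the added 1 secure positivity. *)
exists (`|cB alpha tau a b L r (cD alpha tau K C) (cO1 alpha tau K C) (cO2 alpha tau K C) M2 K S C0 K| + 1).
split; first by rewrite ltr_wpDl.
move=> N M X uh N2 hX _ h t fuh start sch n hn.
have N0 : (0 < N)%N by exact: ltnW.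
(* Levels up to 0 lie in [- tau, 0], where u is phi; the sign of the difference disappears in the
   norm. *)
have start' (m : int) : - (2 * N)%:Z <= m <= 0 -> L2norm L (err tau r u N uh m) <= C0 * h ^+ 2.
  move=> hm; apply: le_trans (start m hm).
  have [j jN mj] := neg_range hm.
  have tm : - tau <= t m <= 0.
    rewrite mj /t mesh_delay// lerBrDr addNr subr_le0.
    have t1 : 0 <= graded_mesh tau r N j%:Z by rewrite -(mesh0 htau hr N0) mesh_mono.
    apply/andP; split; first exact: t1.
    have := mesh_node htau hr N0 1; rewrite mul1r muln1 => e.
    by apply: le_trans (mesh_mono htau hr N0 jN) _; rewrite e.
  rewrite le_eqVlt; apply/orP; left; apply/eqP; rewrite /L2norm; congr Num.sqrt.
  rewrite !L2dotE; apply: eq_Int => x hx; rewrite /err -/t uphi ?in_itv//; ring.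
have cD0 := cD_ge0 alpha tau K C.
have cO10 : 0 <= cO1 alpha tau K C by rewrite /cO1 mulr_ge0// addr_ge0 ?powR_ge0.
have cO20 : 0 <= cO2 alpha tau K C.
  by rewrite /cO2 !mulr_ge0 ?addr_ge0 ?powR_ge0// invr_ge0; case/andP: halpha => /ltW.
have := @scheme_error R alpha tau p a b L r (cD alpha tau K C) (cO1 alpha tau K C) (cO2 alpha tau K C) M2 K f u (Du tau K u) S
  halpha htau hp ha hL hr cux ubd S0 SD SL2 Sweak M20 uweak cD0 cO10 cO20 (Du_mfun2 htau cu cux hC)
  (fun x t => @Du_bnd R alpha tau K L u C halpha htau hC x t)
  (fun x s t => @Du_FTC R alpha tau K L u C halpha htau cu cux hC x s t)
  (fun x s t hx => @Du_osc1 R alpha tau K L u C halpha htau hC x s t hx hK)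
  (fun k x s t => @Du_osc2 R alpha tau K L u C halpha htau hC k x s t)
  (fun M X v t => @pde_weak R alpha tau K p a b L f u C halpha htau hL hf cu cux pde hC Mm u1 u2 hu2 hub0 _ hMu M X v t)
  N M X uh N2 hX fuh sch C0 start' n hn.
move/le_trans; apply; apply: ler_wpM2r; first by rewrite addr_ge0 ?sqr_ge0 ?powR_ge0.
by apply: le_trans (ler_norm _) _; rewrite lerDl.
Qed.
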